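(* Let $(M^{n+1},g)$ be $C^2$ conformally compact asymptotically locally hyperbolic. For every closed set $S\subseteq\partial M$ there exists a closed totally convex set $\mathcal{H}(S)\subseteq M$ such that $$\partial_\infty\mathcal{H}(S)=S,$$ and such that, whenever $1\le p\le n$ and $V$ is a stationary rectifiable $p$-varifold in $M$ with $\partial_\infty\operatorname{spt}V\subseteq S$, one has $$\operatorname{spt}V\subseteq\mathcal{H}(S).$$
   Context: Conformally compact setting: $M$ is the interior of a compact smooth manifold with boundary $\overline{M}$ of dimension $n+1$, with boundary $\partial M$, and $g$ is a smooth Riemannian metric on $M$. $(M,g)$ is $C^2$ conformally compact if there is a smooth defining function $\rho$ on $\overline M$ ($\rho>0$ on $M$, $\rho=0$ and $d\rho\ne0$ on $\partial M$) such that $\rho^2g$ extends to a nondegenerate $C^2$ metric on $\overline{M}$. It is asymptotically locally hyperbolic if $|d\rho|_{\rho^2g}=1$ on $\partial M$ (this does not depend on the choice of $\rho$). No global curvature assumption is made. For $E\subset M$, its asymptotic boundary is $\partial_\infty E:=\overline{E}^{\,\overline{M}}\cap\partial M$, where $\overline{E}^{\,\overline{M}}$ is the closure in $\overline{M}$. A subset of $M$ is totally convex if it contains every $g$-geodesic segment of $M$ whose endpoints lie in the subset. For a rectifiable $p$-varifold $V$ in $M$ with weight measure $\mu_V$ and approximate tangent planes $T_xV$, $\operatorname{spt}V:=\operatorname{spt}\mu_V$, and the first variation is $\delta V(X)=\int\operatorname{div}_{T_xV}X\,d\mu_V(x)$, where $\operatorname{div}_PX=\sum_i\langle\nabla_{e_i}X,e_i\rangle$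 for an orthonormal basis $(e_i)$ of the plane $P$. $V$ is stationary in an open set $U$ if $\delta V(X)=0$ for all $C^1$ vector fields $X$ with compact support in $U$; stationary means stationary in $M$. *)

(* Defs.v *)
From HB Require Import structures.
From mathcomp Require Import all_boot all_order all_algebra.
From mathcomp Require Import all_classical all_reals all_analysis.

Set Implicit Arguments.
Unset Strict Implicit.
Unset Printing Implicit Defensive.

Import Order.TTheory GRing.Theory Num.Theory.
Import numFieldNormedType.Exports.

Local Open Scope classical_set_scope.
Local Open Scope ring_scope.

(* Vectors are rows, so the Jacobian of a
   map acts on the right of a vector, and a metric with matrix G is
   (v, w) |-> v *m G *m w^T. *)

Section Differentiability.
Context {R : realType} {m : nat}.
Implicit Types (W A : set 'rV[R]_m) (f : 'rV[R]_m -> R).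

Definition partial (a : 'I_m) f : 'rV[R]_m -> R := 'D_(delta_mx 0 a) f.

(* Meaningful for open W only. *)
Fixpoint Ck (k : nat) W f : Prop :=
  (forall u, W u -> {for u, continuous f}) /\
  if k is k'.+1 then
    forall a, (forall u, W u -> derivable f u (delta_mx 0 a)) /\
              Ck k' W (partial a f)
  else True.

(* On a set A which need not be open (here: relatively open in a half-space),
   regularity means local extendability to a regular function on an open set. *)
Definition Ck_on (k : nat) A f : Prop :=
  forall u, A u -> exists W F,
    [/\ open W, W u, Ck k W F & forall v, W v -> A v -> F v = f v].

Definition smooth_on A f : Prop :=
  forall u, A u -> exists W F,
    [/\ open W, W u, forall k, Ck k W F & forall v, W v -> A v -> F v = f v].

End Differentiability.

Definition halfspace (R : realType) (n : nat) : set 'rV[R]_n.+1 :=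
  [set u | 0 <= u 0 0].

(* Compact smooth manifolds with boundary of dimension n+1, given by a smooth
   atlas (not required to be maximal).  Second countability follows from
   compactness; the base point only records nonemptiness. *)
Record bmanifold (R : realType) (n : nat) := BManifold {
  space :> ptopologicalType;
  index : Type;
  dom : index -> set space;
  chart : index -> space -> 'rV[R]_n.+1;
  chart_inv : index -> 'rV[R]_n.+1 -> space;
  space_hausdorff : hausdorff_space space;
  space_compact : compact [set: space];
  dom_cover : forall x, exists i, dom i x;
  dom_open : forall i, open (dom i);
  chart_image : forall i, exists2 W, open W &
    chart i @` dom i = W `&` @halfspace R n;
  chartK : forall i x, dom i x -> chart_inv i (chart i x) = x;
  chart_continuous : forall i x, dom i x -> {for x, continuous (chart i)};
  chart_inv_continuous : forall i,
    {within chart i @` dom i, continuous (chart_inv i)};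
  transition_smooth : forall i j l,
    smooth_on (chart i @` (dom i `&` dom j))
              (fun u => chart j (chart_inv i u) 0 l)
}.

Section ConformallyCompact.
Context {R : realType} {n : nat} (N : bmanifold R n).

Definition boundary : set N := [set x | exists2 i, dom i x & chart i x 0 0 = 0].

Definition inner : set N := ~` boundary.

Definition local (T : Type) (i : index N) (f : N -> T) : 'rV[R]_n.+1 -> T :=
  fun u => f (chart_inv i u).

(* Only used at points of [inner]: there the image of the chart is a
   neighbourhood of [chart i x]. *)
Definition transition_jacobian (i j : index N) (x : N) : 'M[R]_n.+1 :=
  jacobian (local i (chart j)) (chart i x).

(* Tensor fields are given by their components in every chart of the atlas. *)
Definition metric_components := index N -> N -> 'M[R]_n.+1.
Definition vector_components := index N -> N -> 'rV[R]_n.+1.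

Definition inner_product (G : 'M[R]_n.+1) (v w : 'rV[R]_n.+1) : R :=
  (v *m G *m w^T) 0 0.

Definition positive_definite (G : 'M[R]_n.+1) : Prop :=
  G^T = G /\ forall v, v != 0 -> 0 < inner_product G v v.

Definition riemannian_metric (g : metric_components) : Prop :=
  [/\ forall i x, inner x -> dom i x -> positive_definite (g i x),
      forall i j x, inner x -> dom i x -> dom j x ->
        g i x = transition_jacobian i j x *m g j x *m
                (transition_jacobian i j x)^T
    & forall i a b, smooth_on (chart i @` (dom i `&` inner))
        (local i (fun x => g i x a b))].

(* [w] is the row of components in the chart [i] of the differential of [f]
   at [x]; at a boundary point it does not depend on the extension [F]. *)
Definition is_differential (i : index N) (f : N -> R) (x : N)
    (w : 'rV[R]_n.+1) : Prop :=
  exists W F,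
    [/\ open W, W (chart i x), Ck 1 W F,
        forall u, W u -> (chart i @` dom i) u -> F u = local i f u
      & w = \row_a partial a F (chart i x)].

Definition defining_function (rho : N -> R) : Prop :=
  [/\ forall i, smooth_on (chart i @` dom i) (local i rho),
      forall x, inner x -> 0 < rho x,
      forall x, boundary x -> rho x = 0
    & forall i x w, boundary x -> dom i x -> is_differential i rho x w ->
        w != 0].

(* [h] is the C^2 extension to [N] of rho^2 g; its tensorial behaviour on the
   boundary follows by continuity. *)
Definition C2_compactification (g : metric_components) (rho : N -> R)
    (h : metric_components) : Prop :=
  [/\ defining_function rho,
      forall i x, inner x -> dom i x -> h i x = rho x ^+ 2 *: g i x,
      forall i x, dom i x -> positive_definite (h i x)
    & forall i a b, Ck_on 2 (chart i @` dom i)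
        (local i (fun x => h i x a b))].

Definition C2_conformally_compact (g : metric_components) : Prop :=
  exists rho h, C2_compactification g rho h.

Definition covector_norm (G : 'M[R]_n.+1) (w : 'rV[R]_n.+1) : R :=
  Num.sqrt (inner_product (invmx G) w w).

Definition asymptotically_locally_hyperbolic (g : metric_components) : Prop :=
  exists rho h, C2_compactification g rho h /\
    forall i x w, boundary x -> dom i x -> is_differential i rho x w ->
      covector_norm (h i x) w = 1.

Definition asymptotic_boundary (E : set N) : set N := closure E `&` boundary.

Definition closed_in_inner (E : set N) : Prop :=
  E `<=` inner /\ closure E `&` inner `<=` E.

Definition christoffel (g : metric_components) (i : index N) (x : N)
    (c a b : 'I_n.+1) : R :=
  let G a b := local i (fun y => g i y a b) in
  2^-1 * \sum_l invmx (g i x) c l *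
    (partial a (G b l) (chart i x) + partial b (G a l) (chart i x)
     - partial l (G a b) (chart i x)).

Definition geodesic_at (g : metric_components) (gamma : R -> N) (t : R) :
    Prop :=
  [/\ inner (gamma t), {for t, continuous gamma}
    & forall i, dom i (gamma t) ->
        let c := chart i \o gamma in
        [/\ \forall s \near t, derivable c s 1,
            derivable (derive1 c) t 1
          & forall k, derive1 (derive1 c) t 0 k +
              \sum_a \sum_b christoffel g i (gamma t) k a b *
                            (derive1 c t 0 a * derive1 c t 0 b) = 0]].

(* A geodesic parametrized by [`[a, b]] extends to a slightly larger open
   interval because [inner] has no boundary. *)
Definition geodesic_segment (g : metric_components) (gamma : R -> N)
    (a b : R) : Prop :=
  a <= b /\ exists2 e, 0 < e &
    forall t, a - e < t < b + e -> geodesic_at g gamma t.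

Definition totally_convex (g : metric_components) (E : set N) : Prop :=
  forall gamma a b, geodesic_segment g gamma a b ->
    E (gamma a) -> E (gamma b) -> gamma @` `[a, b] `<=` E.

End ConformallyCompact.

Definition borel (T : ptopologicalType) := g_sigma_algebraType (@open T).


Section Hausdorff.
Context {R : realType} {T : Type} (d : T -> T -> \bar R).

(* Volume of the unit ball of R^p. *)
Fixpoint ball_volume (p : nat) : R :=
  match p with
  | 0 => 1
  | 1 => 2
  | q.+2 => 2 * pi / q.+2%:R * ball_volume q
  end.

(* 0 is added so that the empty set has diameter 0. *)
Definition diameter (A : set T) : \bar R :=
  ereal_sup (0%E |` [set d z.1 z.2 | z in A `*` A]).

Definition hausdorff_pre (p : nat) (delta : R) (A : set T) : \bar R :=
  ereal_inf
    [set (\sum_(0 <= k <oo) (ball_volume p / 2 ^+ p)%:E * diameter (U k) ^+ p)%E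
    | U in [set U : nat -> set T |
             A `<=` \bigcup_k U k /\
             forall k, (diameter (U k) <= delta%:E)%E]].

Definition hausdorff_measure (p : nat) (A : set T) : \bar R :=
  ereal_sup [set hausdorff_pre p delta A | delta in [set delta | 0 < delta]].

End Hausdorff.

Definition euclidean_distance (R : realType) (m : nat) (u v : 'rV[R]_m) :
    \bar R :=
  (Num.sqrt (\sum_k (u 0 k - v 0 k) ^+ 2))%:E.

Section Varifolds.
Context {R : realType} {n : nat} (N : bmanifold R n).
Variable g : metric_components N.

Definition C1_curve (gamma : R -> N) : Prop :=
  forall t, [/\ inner (gamma t), {for t, continuous gamma}
    & forall i, dom i (gamma t) ->
        (\forall s \near t, derivable (chart i \o gamma) s 1) /\
        {for t, continuous (derive1 (chart i \o gamma))}].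

Definition speed (gamma : R -> N) (t : R) : R :=
  xget 0 [set s | exists2 i, dom i (gamma t) &
    let v := (derive1 (chart i \o gamma)) t in
    s = Num.sqrt (inner_product (g i (gamma t)) v v)].

Definition curve_length (gamma : R -> N) : \bar R :=
  (\int[lebesgue_measure]_(t in `[0%R, 1%R]) (speed gamma t)%:E)%E.

(* +oo between different components of [inner]. *)
Definition riemannian_distance (x y : N) : \bar R :=
  ereal_inf [set curve_length gamma
    | gamma in [set gamma | [/\ C1_curve gamma, gamma 0 = x & gamma 1 = y]]].

Definition countably_rectifiable (p : nat) (E : set N) : Prop :=
  exists (Z : set N) (A : nat -> set 'rV[R]_p) (F : nat -> 'rV[R]_p -> N)
      (L : nat -> R),
    [/\ hausdorff_measure riemannian_distance p Z = 0%E,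
        forall k u v, A k u -> A k v ->
          (riemannian_distance (F k u) (F k v)
             <= (L k)%:E * euclidean_distance u v)%E
      & E `<=` Z `|` \bigcup_k (F k @` A k)].

(* A rectifiable varifold is given by its weight measure, the Radon measure
   theta H^p restricted to E on [inner], regarded as a Borel measure on [N];
   [nu] is H^p restricted to E. *)
Definition rectifiable_varifold (p : nat)
    (mu : {measure set (borel N) -> \bar R}) : Prop :=
  (forall K : set N, compact K -> K `<=` @inner _ _ N -> (mu K < +oo)%E) /\
  exists (E : set (borel N)) (theta : borel N -> R)
      (nu : {measure set (borel N) -> \bar R}),
    [/\ measurable E, E `<=` @inner _ _ N & countably_rectifiable p E] /\
    [/\ measurable_fun E theta,
        forall x, E x -> 0 < theta x,
        forall A : set (borel N), measurable A ->
          nu A = hausdorff_measure riemannian_distance p (A `&` E)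
      & forall A : set (borel N), measurable A ->
          mu A = (\int[nu]_(x in A `&` E) (theta x)%:E)%E].

Definition spt (mu : {measure set (borel N) -> \bar R}) : set N :=
  [set x | inner x /\
    forall U : set N, open U -> U x -> (0 < mu U)%E].

(* The span of the rows of [P] is, in the chart [i], the approximate tangent
   plane of [mu] at [x], i.e. the dilations of [mu] about [x] converge weakly
   to a positive multiple of H^p restricted to that plane ([nu]).  This does
   not depend on the chart. *)
Definition approximate_tangent (p : nat)
    (mu : {measure set (borel N) -> \bar R}) (i : index N) (x : N)
    (P : 'M[R]_(p, n.+1)) : Prop :=
  \rank P = p /\
  exists (theta0 : R) (nu : {measure set (borel 'rV[R]_n.+1) -> \bar R}),
    [/\ 0 < theta0,
        forall A : set (borel 'rV[R]_n.+1), measurable A ->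
          nu A = hausdorff_measure (@euclidean_distance R n.+1) p
                   (A `&` [set v | (v <= P)%MS])
      & forall phi : 'rV[R]_n.+1 -> R, continuous phi ->
          (exists2 K, compact K & forall v, ~ K v -> phi v = 0) ->
          (fun lambda : R => lambda ^- p *
             Rintegral mu (dom i)
               (fun y => phi (lambda^-1 *: (chart i y - chart i x))))
            @ 0^'+ --> theta0 * Rintegral nu setT phi].

Definition C1_vector_field (X : vector_components N) : Prop :=
  (forall i j x, inner x -> dom i x -> dom j x ->
     X j x = X i x *m transition_jacobian i j x) /\
  (forall i l, Ck_on 1 (chart i @` (dom i `&` @inner _ _ N))
     (local i (fun x => X i x 0 l))).

Definition compactly_supported (U : set N) (X : vector_components N) : Prop :=
  exists2 K : set N, compact K /\ K `<=` U &
    forall i x, inner x -> dom i x -> ~ K x -> X i x = 0.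

Definition covariant_derivative (X : vector_components N) (i : index N)
    (x : N) (v : 'rV[R]_n.+1) : 'rV[R]_n.+1 :=
  \row_k \sum_a v 0 a *
    (partial a (local i (fun y => X i y 0 k)) (chart i x) +
     \sum_b christoffel g i x k a b * X i x 0 b).

(* div_{T_x V} X, with the g-orthonormal basis of T_x V given by the rows of
   [e]; the value depends neither on the chart nor on the basis. *)
Definition tangential_divergence (p : nat)
    (mu : {measure set (borel N) -> \bar R}) (X : vector_components N)
    (x : N) : R :=
  xget 0 [set s | exists (i : index N) (e : 'M[R]_(p, n.+1)),
    [/\ dom i x, approximate_tangent mu i x e,
        forall a b, inner_product (g i x) (row a e) (row b e) = (a == b)%:R
      & s = \sum_a inner_product (g i x)
                     (covariant_derivative X i x (row a e)) (row a e)]].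

Definition first_variation (p : nat)
    (mu : {measure set (borel N) -> \bar R}) (X : vector_components N) :
    \bar R :=
  (\int[mu]_(x in @inner _ _ N) (tangential_divergence p mu X x)%:E)%E.

Definition stationary_in (p : nat)
    (mu : {measure set (borel N) -> \bar R}) (U : set N) : Prop :=
  forall X, C1_vector_field X -> compactly_supported U X ->
    first_variation p mu X = 0%E.

Definition stationary (p : nat)
    (mu : {measure set (borel N) -> \bar R}) : Prop :=
  stationary_in p mu (@inner _ _ N).

End Varifolds.

(* Main.v *)
Require Import Defs.
From HB Require Import structures.
From mathcomp Require Import all_boot all_order all_algebra.
From mathcomp Require Import all_classical all_reals all_analysis.
From mathcomp Require Import measurable_realfun ring lra zify.

Set Implicit Arguments.
Unset Strict Implicit.
Unset Printing Implicit Defensive.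

Import Order.TTheory GRing.Theory Num.Theory.
Import numFieldNormedType.Exports.

Local Open Scope classical_set_scope.
Local Open Scope ring_scope.

(** Convexity at infinity comes from vector fields that expand lengths.

    Let [q] be a boundary point outside [S].  In a chart around [q] put
    [eta u = r ^ 2 - |u - q| ^ 2 - rho u]; for small [r] the region [0 < eta] is
    a small cap at [q].  Let [h = rho ^ 2 g] be the compactified metric and [Y]
    its gradient of [eta], up to a positive factor.  The differential of [eta] at
    [q] is that of [- rho], so [Y rho < 0] near [q].  In the Lie derivative of
    [g = rho ^ -2 h] along [Y] the term where [rho ^ -2] is differentiated has
    order [rho ^ -3] and is positive definite, while the other one has order
    [rho ^ -2]; hence this Lie derivative is at least a multiple of
    [rho ^ -1 g].  The field [X = relu eta ^ 2 Y] extends by zero outside the cap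
    and has the same property with the weight [relu eta ^ 2], since the
    differential of the weight only contributes the square of that of [eta]
    ([barrier_exists]).

    Along a geodesic the derivative of the product of [X] with the velocity is
    half the Lie derivative of [g], evaluated on the velocity, hence nonnegative
    ([geodesic_product_derive]).  For a segment with end points outside the cap
    this product vanishes at both ends, hence everywhere, and then the positive
    part of [eta] is constant along the segment: the segment avoids the cap
    ([barrier_geodesic]).

    The divergence of [X] along a plane is the trace of the same quadratic form
    on that plane, so it is nonnegative, and positive in the cap.  If the
    asymptotic boundary of a stationary varifold lies in [S], the support stays
    away from the boundary in the closed cap, and [X] may be multiplied by a
    function of [rho] that is 1 near the support and makes it compactly supported
    ([cut_field_divergence]).  The first variation along the resulting field
    would be positive if the cap met the support.

    The hull is what remains after removing every cap whose closure avoids a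
    closed set [C] made of [S] and of interior points accumulating exactly on [S]
    ([accumulating_set]).  The points of [C] keep [S] in the asymptotic boundary,
    and the caps remove everything else ([hull_boundary]).

    The divergence along the varifold is defined through approximate tangent
    planes, so the last argument needs them on a set of positive mass
    ([varifold_tangents]).  An interior chart is bi-Lipschitz for the Riemannian
    distance ([chart_bilipschitz]); it turns the mass into a finite measure that
    is carried by countably many Lipschitz images of Euclidean space and vanishes
    on sets without p-dimensional content.  By Rademacher's theorem
    ([rademacher]) such images are bi-Lipschitz up to sets without content
    ([bilip_pieces]); on a piece the measure is the image of a density, and its
    dilations at a Lebesgue point of the density, where the rest of the mass has
    density zero, converge to Lebesgue measure on the image of the differential
    ([tangent_planes]).  Finally Hausdorff measure on a plane is a multiple of
    Lebesgue measure ([plane_hausdorff]). *)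

(** * Dyadic cubes and Lebesgue measure on row vectors *)

Section RowNorm.
Context {R : realType} {m : nat}.
Implicit Types u v : 'rV[R]_m.

Lemma le_coord_norm v j : `|v 0 j| <= `|v|.
Proof.
rewrite [leRHS]/Num.norm/= mx_normrE.
by apply/bigmax_geP; right; exists (0, j).
Qed.

Lemma norm_rV_le v r : 0 <= r -> (forall j, `|v 0 j| <= r) -> `|v| <= r.
Proof.
move=> r0 h; rewrite [leLHS]/Num.norm/= mx_normrE.
by apply/bigmax_leP; split => // -[i j] _ /=; rewrite ord1.
Qed.

Lemma norm_rV_lt v r : 0 < r -> (forall j, `|v 0 j| < r) -> `|v| < r.
Proof.
move=> r0 h; rewrite [ltLHS]/Num.norm/= mx_normrE.
by apply/bigmax_ltP; split => // -[i j] _ /=; rewrite ord1.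
Qed.

Lemma ball_rVP u r v : 0 < r -> ball u r v <-> forall j, `|u 0 j - v 0 j| < r.
Proof.
move=> r0; rewrite -ball_normE /=; split=> [h j|h].
  by have := le_coord_norm (u - v) j; rewrite !mxE => /le_lt_trans; apply.
by apply: norm_rV_lt => // j; rewrite !mxE; exact: h.
Qed.

End RowNorm.

Section DyadicCubes.
Context {R : realType} {m : nat}.
Implicit Types (u v : 'rV[R]_m) (k : nat) (z : 'rV[int]_m).

Definition dcube k z : set 'rV[R]_m :=
  [set v | forall j, Num.floor (2 ^+ k * v 0 j) = z 0 j].

Definition dindex k v : 'rV[int]_m := \row_j Num.floor (2 ^+ k * v 0 j).

Lemma dcube_dindex k v : dcube k (dindex k v) v.
Proof. by move=> j; rewrite mxE. Qed.

Lemma floor_half (x y : R) : Num.floor (2 * x) = Num.floor (2 * y) ->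
  Num.floor x = Num.floor y.
Proof.
move=> xy; have hx := floor_itv x; have hy := floor_itv y.
have h2x := floor_itv (2 * x); have h2y := floor_itv (2 * y).
move: h2x h2y; rewrite xy => /andP[a1 a2] /andP[b1 b2].
case/andP: hx => c1 c2; case/andP: hy => d1 d2.
rewrite !intrD1 in a2 b2 c2 d2 *.
move: xy a1 a2 b1 b2 c1 c2 d1 d2.
set X := Num.floor x; set Y := Num.floor y; set W := Num.floor (2 * y).
move=> xy a1 a2 b1 b2 c1 c2 d1 d2.
have e1 : X *+ 2 < W + 1.
  by rewrite -(ltr_int R) rmorphMn rmorphD/= mulr2n; lra.
have e2 : W < X *+ 2 + 2.
  by rewrite -(ltr_int R) rmorphD/= rmorphMn/= mulr2n; lra.
have e3 : Y *+ 2 < W + 1.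
  by rewrite -(ltr_int R) rmorphMn rmorphD/= mulr2n; lra.
have e4 : W < Y *+ 2 + 2.
  by rewrite -(ltr_int R) rmorphD/= rmorphMn/= mulr2n; lra.
lia.
Qed.

Lemma dindex_le k k' u v : (k <= k')%N -> dindex k' u = dindex k' v ->
  dindex k u = dindex k v.
Proof.
move=> /subnK <-; elim: (k' - k)%N => [//|d IH] h; apply: IH.
apply/rowP => j; move/rowP: h => /(_ j); rewrite !mxE addSn exprS -!mulrA.
exact: floor_half.
Qed.

Lemma dcubeP k z v : dcube k z v <-> dindex k v = z.
Proof.
split=> [h|<-]; last exact: dcube_dindex.
by apply/rowP => j; rewrite mxE h.
Qed.

Lemma dcube_nested k k' z z' : (k <= k')%N ->
  dcube k z `&` dcube k' z' !=set0 -> dcube k' z' `<=` dcube k z.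
Proof.
move=> kk' [v [/dcubeP <- /dcubeP <-]] w /dcubeP h.
by apply/dcubeP; exact: dindex_le h.
Qed.

Lemma dcube_close k z u v : dcube k z u -> dcube k z v ->
  `|u - v| < 2 ^- k.
Proof.
move=> hu hv; apply: norm_rV_lt => [|j]; first by rewrite invr_gt0 exprn_gt0.
rewrite !mxE; have p2 : 0 < 2 ^+ k :> R by rewrite exprn_gt0.
rewrite -(ltr_pM2l p2) mulfV ?gt_eqF// -[X in X * `|_|]ger0_norm ?ltW//.
rewrite -normrM mulrBr.
have := floor_itv (2 ^+ k * u 0 j); have := floor_itv (2 ^+ k * v 0 j).
rewrite hu hv !intrD1 => /andP[a1 a2] /andP[b1 b2].
by rewrite ltr_norml; apply/andP; split; lra.
Qed.

(* Enumeration of all dyadic cubes; indices that do not encode a cube give the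
   empty set. *)
Definition dcubes (i : nat) : set 'rV[R]_m :=
  if unpickle i is Some kz then dcube (kz : nat * 'rV[int]_m).1 kz.2 else set0.

Definition dlevel (i : nat) : nat :=
  if unpickle i is Some kz then (kz : nat * 'rV[int]_m).1 else 0%N.

Lemma dcubesE k z : dcubes (pickle (k, z)) = dcube k z.
Proof. by rewrite /dcubes pickleK. Qed.

Lemma dlevelE k z : dlevel (pickle (k, z)) = k.
Proof. by rewrite /dlevel pickleK. Qed.

Lemma dcubesP i v : dcubes i v -> dcubes i = dcube (dlevel i) (dindex (dlevel i) v).
Proof.
rewrite /dcubes /dlevel; case: unpickle => [[k z]|//] /= h.
by move/dcubeP: (h) => ->.
Qed.

(** The union over small cubes: each point lies in cubes of every fine enough
    level. *)
Lemma open_dcubes (V : set 'rV[R]_m) (k0 : nat) : open V ->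
  V = \bigcup_(i in [set i | (k0 <= dlevel i)%N /\ dcubes i `<=` V]) dcubes i.
Proof.
move=> oV; apply/seteqP; split => [v Vv|v [i [_ iV] /iV]//].
have /nbhs_ballP[e /= e0 eV] : nbhs v V by apply: open_nbhs_nbhs.
have [k ke] : exists k, 2 ^- k < e.
  have h2 : `|2^-1 : R| < 1 by rewrite ger0_norm ?invf_lt1 ?ltr1n// invr_ge0.
  have /cvgrPdist_lt/(_ _ e0) := @cvg_geometric R 1 2^-1 h2.
  move=> [k _ /(_ k (leqnn _))] /=; rewrite sub0r normrN mul1r exprVn.
  by move=> /(le_lt_trans (ler_norm _)) ?; exists k.
pose K := maxn k k0.
exists (pickle (K, dindex K v)); last by rewrite dcubesE; exact: dcube_dindex.
split; first by rewrite dlevelE leq_maxr.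
rewrite dcubesE => w hw; apply: eV; rewrite -ball_normE /=.
apply: lt_le_trans (dcube_close (dcube_dindex K v) hw) _.
apply: le_trans (ltW ke); rewrite lef_pV2 ?posrE ?exprn_gt0//.
by rewrite ler_weXn2l ?ler1n// leq_maxl.
Qed.

(** Two dyadic cubes are nested or disjoint, so the maximal members of any
    family of dyadic cubes are pairwise disjoint and still cover its union. *)
Lemma dcubes_select (P : set nat) : exists M : set nat,
  [/\ M `<=` P, trivIset M dcubes &
      forall i, P i -> dcubes i !=set0 -> exists2 j, M j &
        dcubes i `<=` dcubes j /\ (dlevel j <= dlevel i)%N].
Proof.
pose M := [set i | P i /\
  (forall j, P j -> (dlevel j < dlevel i)%N -> ~ dcubes i `<=` dcubes j) /\
  (forall j, P j -> dcubes j = dcubes i -> dlevel j = dlevel i -> (i <= j)%N)].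
exists M; split.
- by move=> i [].
- move=> i j [Pi [mi mi']] [Pj [mj mj']] [v [iv jv]].
  have Ej := dcubesP jv; have Ei := dcubesP iv.
  have [lt|lt|eq] := ltngtP (dlevel i) (dlevel j).
  + exfalso; apply: (mj i Pi lt); rewrite Ei Ej.
    apply: dcube_nested; first exact: ltnW.
    by exists v; split; exact: dcube_dindex.
  + exfalso; apply: (mi j Pj lt); rewrite Ei Ej.
    apply: dcube_nested; first exact: ltnW.
    by exists v; split; exact: dcube_dindex.
  + have E : dcubes i = dcubes j by rewrite Ei Ej eq.
    by apply/eqP; rewrite eqn_leq mi'// mj'.
- move=> i Pi [v iv].
  pose Q := [pred l | `[< exists j, [/\ P j, dlevel j = l &
    dcubes i `<=` dcubes j] >]].
  have exQ : exists l, Q l by exists (dlevel i); apply/asboolP; exists i; split.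
  case: (ex_minnP exQ) => l /asboolP[j [Pj jl ij]] minl.
  pose Q' := [pred j' | `[< [/\ P j', dlevel j' = l & dcubes j' = dcubes j] >]].
  have exQ' : exists j', Q' j' by exists j; apply/asboolP; split.
  case: (ex_minnP exQ') => j' /asboolP[Pj' j'l j'j] minj'.
  exists j'; last first.
    split; first by rewrite j'j.
    by rewrite j'l; apply: minl; apply/asboolP; exists i; split.
  split=> //; split=> [j2 Pj2 j2l j'j2|j2 Pj2 j2j' j2l].
    have : (l <= dlevel j2)%N.
      apply: minl; apply/asboolP; exists j2; split=> //.
      by apply: subset_trans j'j2; rewrite j'j.
    by rewrite -j'l leqNgt j2l.
  by apply: minj'; apply/asboolP; split => //; rewrite ?j2l ?j2j'.
Qed.

End DyadicCubes.

Section BorelSets.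
Context {R : realType}.

Lemma open_borel (T : ptopologicalType) (V : set T) :
  open V -> measurable (V : set (borel T)).
Proof. by move=> oV; apply: sub_sigma_algebra. Qed.

Lemma closed_borel (T : ptopologicalType) (V : set T) :
  closed V -> measurable (V : set (borel T)).
Proof.
by move=> cV; rewrite -(setCK V); apply: measurableC; apply: open_borel; exact: closed_openC.
Qed.

Lemma continuous_borel (T U : ptopologicalType) (f : T -> U) :
  continuous f -> measurable_fun setT (f : borel T -> borel U).
Proof.
move=> cf; apply: measurability => // _ [V oV <-].
by rewrite setTI; apply: open_borel; move/continuousP : cf; exact.
Qed.

Lemma continuous_borel_real (T : ptopologicalType) (f : T -> R) :
  continuous f -> measurable_fun setT (f : borel T -> R).
Proof.
move=> cf; apply: (measurability _ (RGenOpens.measurableE R)).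
move=> _ [_ [a [b ->] <-]].
rewrite setTI; apply: open_borel; move/continuousP : cf; apply.
exact: interval_open.
Qed.

Context {m : nat}.
Implicit Types (a b : 'rV[R]_m).

Lemma measurable_coord j :
  measurable_fun setT (fun v : borel 'rV[R]_m => v 0 j).
Proof. by apply: continuous_borel_real; exact: coord_continuous. Qed.

Definition box a b : set 'rV[R]_m :=
  [set v | forall j, a 0 j <= v 0 j < b 0 j].

Lemma measurable_box a b : measurable (box a b : set (borel 'rV[R]_m)).
Proof.
rewrite (_ : box a b =
   \bigcap_(j in [set: 'I_m]) ((fun v : borel 'rV[R]_m => v 0 j) @^-1` `[a 0 j, b 0 j[)).
  apply: fin_bigcap_measurable; first exact: finite_finset.
  by move=> j _; rewrite -[X in measurable X]setTI; exact: measurable_coord.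
apply/seteqP; split => [v h j _|v h j]; first by rewrite /= in_itv/= h.
by have := h j Logic.I; rewrite /= in_itv.
Qed.

Lemma dcube_box k (z : 'rV[int]_m) : dcube k z =
  box (\row_j (2 ^- k * (z 0 j)%:~R)) (\row_j (2 ^- k * (z 0 j + 1)%:~R)) :> set 'rV[R]_m.
Proof.
have p2 : 0 < 2 ^+ k :> R by rewrite exprn_gt0.
apply/seteqP; split => v h j.
  have := floor_itv (2 ^+ k * v 0 j); rewrite h !mxE => /andP[h1 h2].
  by rewrite -(ler_pM2l p2) -[X in _ && X](ltr_pM2l p2) !mulrA !mulfV ?gt_eqF// !mul1r h1.
have := h j; rewrite !mxE => /andP[h1 h2].
apply/floor_def; rewrite -(ler_pM2l (x := 2 ^- k)) ?invr_gt0//.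
rewrite -[X in _ && X](ltr_pM2l (x := 2 ^- k)) ?invr_gt0//.
by rewrite !mulrA !mulVf ?gt_eqF// !mul1r h1 h2.
Qed.

Lemma measurable_dcube k (z : 'rV[int]_m) :
  measurable (dcube k z : set (borel 'rV[R]_m)).
Proof. by rewrite dcube_box; exact: measurable_box. Qed.

Lemma measurable_dcubes i : measurable (dcubes i : set (borel 'rV[R]_m)).
Proof. by rewrite /dcubes; case: unpickle => // ?; exact: measurable_dcube. Qed.

Definition boxes : set (set 'rV[R]_m) :=
  [set A | exists a b, A = box a b].

Lemma borel_boxes : @measurable _ (borel 'rV[R]_m) = <<s boxes >>.
Proof.
apply/seteqP; split.
  apply: smallest_sub; first exact: smallest_sigma_algebra.
  move=> V oV; rewrite (open_dcubes 0 oV) bigcup_mkcond.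
  have sb := @sigma_algebra_bigcup _ setT boxes; apply: sb => i.
  case: ifPn => _; last exact: sigma_algebra0.
  rewrite /dcubes; case: unpickle => [kz|]; last exact: sigma_algebra0.
  by apply: sub_sigma_algebra; rewrite dcube_box; eexists; eexists.
apply: smallest_sub; first exact: sigma_algebra_measurable.
by move=> _ [a [b ->]]; exact: measurable_box.
Qed.

Lemma measurable_rV d (T : measurableType d) (f : T -> borel 'rV[R]_m) :
  (forall j, measurable_fun setT (fun x => f x 0 j)) -> measurable_fun setT f.
Proof.
move=> mf; apply: (measurability _ borel_boxes) => _ [_ [a [b ->] <-]].
rewrite setTI.
rewrite (_ : f @^-1` box a b =
   \bigcap_(j in [set: 'I_m]) ((fun x => f x 0 j) @^-1` `[a 0 j, b 0 j[)).
  apply: fin_bigcap_measurable; first exact: finite_finset.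
  by move=> j _; rewrite -[X in measurable X]setTI; exact: mf.
apply/seteqP; split => [v h j _|v h j]; first by rewrite /= in_itv/= h.
by have := h j Logic.I; rewrite /= in_itv.
Qed.

Lemma boxI : setI_closed boxes.
Proof.
move=> _ _ [a [b ->]] [a' [b' ->]].
exists (\row_j Num.max (a 0 j) (a' 0 j)), (\row_j Num.min (b 0 j) (b' 0 j)).
apply/seteqP; split => [v [h h'] j|v h].
  by rewrite !mxE ge_max lt_min; have /andP[-> ->] := h j; have /andP[-> ->] := h' j.
split=> j; have := h j; rewrite !mxE ge_max lt_min => /andP[/andP[? ?] /andP[? ?]];
  exact/andP.
Qed.

Definition bigbox (k : nat) : set 'rV[R]_m :=
  box (const_mx (- k%:R)) (const_mx k%:R).

Lemma bigbox_cover : \bigcup_k bigbox k = setT.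
Proof.
apply/seteqP; split => // v _.
have [k vk] : exists k : nat, `|v| < k%:R.
  by exists (Num.bound `|v|); rewrite archi_boundP.
exists k => // j; rewrite !mxE.
by have := le_coord_norm v j; move/le_lt_trans => /(_ _ vk); rewrite ltr_norml => /andP[/ltW -> ->].
Qed.

(** Boxes are stable under intersection and generate the Borel sets. *)
Lemma borel_measure_unique (m1 m2 : {measure set (borel 'rV[R]_m) -> \bar R}) :
  (forall a b, (forall j, a 0 j <= b 0 j) -> m1 (box a b) = m2 (box a b)) ->
  (forall k, (m1 (bigbox k) < +oo)%E) ->
  forall A, measurable A -> m1 A = m2 A.
Proof.
move=> m12 m1oo A mA; apply: (@measure_unique _ R (borel 'rV[R]_m) boxes bigbox) => //.
- exact: borel_boxes.
- exact: boxI.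
- by move=> k; eexists; eexists.
- exact: bigbox_cover.
- move=> _ [a [b ->]].
  have [h|h] := pselect (forall j, a 0 j <= b 0 j); first exact: m12.
  rewrite (_ : box a b = set0) ?measure0//; apply/seteqP; split => // v hv.
  by apply: h => j; have /andP[/le_trans h /ltW/h] := hv j.
Qed.

End BorelSets.

Section SigmaFiniteMeasure.
Context {R : realType} d (T : measurableType d).
Variables (mu : {measure set T -> \bar R}) (h : sigma_finite setT mu).

Definition sigma_finite_of : set T -> \bar R := let _ := h in mu.

HB.instance Definition _ := Measure.on sigma_finite_of.
HB.instance Definition _ := Measure_isSigmaFinite.Build _ _ _ sigma_finite_of h.

Lemma sigma_finite_measure_of :
  exists L : {sigma_finite_measure set T -> \bar R},
    L = mu :> (set T -> \bar R).
Proof. by exists sigma_finite_of. Qed.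

End SigmaFiniteMeasure.

Lemma pushforward_measure {R : realType} d d' (T : measurableType d)
    (U : measurableType d') (mu : {measure set T -> \bar R}) (f : T -> U) :
  measurable_fun setT f ->
  exists nu : {measure set U -> \bar R}, forall A, nu A = mu (f @^-1` A).
Proof.
by move=> mf; exists (measure_function_pushforward__canonical__measure_function_Measure mu mf).
Qed.

Section LebesgueExists.
Context {R : realType}.

Definition consv m (x : R) (v : 'rV[R]_m) : 'rV[R]_m.+1 :=
  \row_j (if unlift 0 j is Some i then v 0 i else x).

Definition tailv m (a : 'rV[R]_m.+1) : 'rV[R]_m := \row_i a 0 (lift 0 i).

Lemma consv_box m (a b : 'rV[R]_m.+1) (x : R) (v : 'rV[R]_m) :
  box a b (consv x v) <->
  (a 0 0 <= x < b 0 0) /\ box (tailv a) (tailv b) v.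
Proof.
split=> [h|[h1 h2] j].
  split; first by have := h 0; rewrite mxE unlift_none.
  by move=> j; rewrite !mxE; have := h (lift 0 j); rewrite mxE liftK.
rewrite mxE; case: unliftP => [i ->|->//].
by have := h2 i; rewrite !mxE.
Qed.

(** Induction on the dimension: the image of a product with one-dimensional
    Lebesgue measure. *)
Lemma lebesgue_rV_exists m :
  exists L : {sigma_finite_measure set (borel 'rV[R]_m) -> \bar R},
    forall a b : 'rV[R]_m, (forall j, a 0 j <= b 0 j) ->
      L (box a b) = (\prod_j (b 0 j - a 0 j))%:E.
Proof.
have sf (k : nat) (mu : {measure set (borel 'rV[R]_k) -> \bar R}) :
    (forall a b : 'rV[R]_k, (forall j, a 0 j <= b 0 j) ->
      mu (box a b) = (\prod_j (b 0 j - a 0 j))%:E) -> sigma_finite setT mu.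
  move=> h; exists bigbox; first by rewrite bigbox_cover.
  move=> i; split; first exact: measurable_box.
  by rewrite h ?ltry// => j; rewrite !mxE lerNl (le_trans _ (ler0n _ _))// oppr_le0.
elim: m => [|m [L LE]].
  pose L := dirac (0 : borel 'rV[R]_0) : {measure set (borel 'rV[R]_0) -> \bar R}.
  have LE (a b : 'rV[R]_0) : (forall j, a 0 j <= b 0 j) ->
      L (box a b) = (\prod_j (b 0 j - a 0 j))%:E.
    move=> _; rewrite big_ord0 /L/= diracE mem_set// => -[].
    by [].
  have [L' L'E] := sigma_finite_measure_of (sf _ _ LE).
  by exists L'; rewrite L'E.
pose phi (z : measurableTypeR R * borel 'rV[R]_m) : borel 'rV[R]_m.+1 :=
  consv z.1 z.2.
have mphi : measurable_fun setT phi.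
  apply: measurable_rV => j; case: (unliftP 0 j) => [i ->|->].
    rewrite (_ : (fun _ => _) = (fun v : borel 'rV[R]_m => v 0 i) \o snd).
      apply: measurableT_comp => //; exact: measurable_coord.
    by apply/funext => z; rewrite mxE liftK.
  rewrite (_ : (fun _ => _) = fst)//; apply/funext => z.
  by rewrite mxE unlift_none.
have [L' L'phi] := pushforward_measure (@lebesgue_measure R \x L)%E mphi.
have L'E (a b : 'rV[R]_m.+1) : (forall j, a 0 j <= b 0 j) ->
    L' (box a b) = (\prod_j (b 0 j - a 0 j))%:E.
  move=> ab; rewrite L'phi.
  rewrite (_ : phi @^-1` _ = `[a 0 0, b 0 0[ `*`
     box (tailv a) (tailv b)); last first.
    apply/seteqP; split => [[x v] /consv_box[h1 h2]|[x v] [h1 h2]].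
      by split => //; rewrite /= in_itv.
    by apply/consv_box; split => //; move: h1; rewrite /= in_itv.
  pose I : set R := `[a 0 0, b 0 0[%classic; pose B := box (tailv a) (tailv b).
  transitivity (lebesgue_measure I * L B)%E.
    by apply: product_measure1E; [exact: measurable_itv|exact: measurable_box].
  rewrite /B LE; last by move=> j; rewrite !mxE.
  rewrite lebesgue_measure_itv/= lte_fin big_ord_recl/= EFinM.
  have [ab0|ba0] := ltP (a 0 0) (b 0 0).
    rewrite -EFinD; congr (_ * _)%E; congr EFin; apply: eq_bigr => i _.
    by rewrite !mxE.
  have -> : a 0 0 = b 0 0 by apply/eqP; rewrite eq_le ba0 ab.
  by rewrite subrr !mul0e.
have [L2 L2E] := sigma_finite_measure_of (sf _ _ L'E).
by exists L2; rewrite L2E.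
Qed.

End LebesgueExists.

Section LebesgueRows.
Context {R : realType} {m : nat}.
Implicit Types (a b : 'rV[R]_m) (A : set (borel 'rV[R]_m)).

Definition lebn : {sigma_finite_measure set (borel 'rV[R]_m) -> \bar R} :=
  sval (cid (@lebesgue_rV_exists R m)).

Lemma lebn_box a b : (forall j, a 0 j <= b 0 j) ->
  lebn (box a b) = (\prod_j (b 0 j - a 0 j))%:E.
Proof. by rewrite /lebn; case: cid => L /=; apply. Qed.

Lemma lebn_dcube k (z : 'rV[int]_m) :
  lebn (dcube k z) = ((2 ^- k) ^+ m)%:E.
Proof.
rewrite dcube_box lebn_box.
  congr EFin; rewrite (eq_bigr (fun=> 2 ^- k)).
    by rewrite prodr_const card_ord.
  by move=> j _; rewrite !mxE rmorphD/= mulrDr mulr1 addrC addKr.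
move=> j; rewrite !mxE ler_pM2l ?invr_gt0 ?exprn_gt0//.
by rewrite ler_int lerDl.
Qed.

Definition affine_rV a (l : R) (v : 'rV[R]_m) : 'rV[R]_m := a + l *: v.

Lemma measurable_affine_rV a l :
  measurable_fun setT (affine_rV a l : borel 'rV[R]_m -> borel 'rV[R]_m).
Proof.
apply: continuous_borel => v.
exact: (cvgD (cvg_cst a) (cvgZ (cvg_cst l) cvg_id)).
Qed.

Lemma affine_rV_box a l c d : 0 < l ->
  affine_rV a l @^-1` box c d = box (l^-1 *: (c - a)) (l^-1 *: (d - a)).
Proof.
by move=> l0; apply/seteqP; split => v h j; have := h j; rewrite !mxE;
  rewrite ![l^-1 * _]mulrC ler_pdivrMr// ltr_pdivlMr// lerBlDl ltrBrDl [v 0 j * l]mulrC.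
Qed.

Lemma lebn_box_fin a b : (lebn (box a b) < +oo)%E.
Proof.
have [h|h] := pselect (forall j, a 0 j <= b 0 j); first by rewrite lebn_box ?ltry.
rewrite (_ : box a b = set0) ?measure0//; apply/seteqP; split => // v hv.
by apply: h => j; have /andP[/le_trans h /ltW/h] := hv j.
Qed.

Lemma lebn_affine a l A : 0 < l -> measurable A ->
  lebn (affine_rV a l @^-1` A) = ((l^-1 ^+ m)%:E * lebn A)%E.
Proof.
move=> l0 mA.
have lm0 : 0 <= l^-1 ^+ m by rewrite exprn_ge0// invr_ge0 ltW.
have [nu nuE] := pushforward_measure lebn (measurable_affine_rV a l).
rewrite -nuE.
pose mu : {measure set (borel 'rV[R]_m) -> \bar R} := mscale (NngNum lm0) lebn.
rewrite -[RHS]/(mu A).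
apply: borel_measure_unique => // [c d cd|k]; last first.
  by rewrite nuE affine_rV_box//; exact: lebn_box_fin.
rewrite nuE /mu/= /mscale/= lebn_box// affine_rV_box// lebn_box; last first.
  by move=> j; rewrite !mxE ler_pM2l ?invr_gt0// lerD2r.
rewrite -EFinM; congr EFin; rewrite (eq_bigr (fun j => l^-1 * (d 0 j - c 0 j))).
  by rewrite big_split/= prodr_const card_ord.
by move=> j _; rewrite !mxE -mulrBr opprB addrA subrK.
Qed.

Lemma ball_borel a (r : R) : measurable (ball a r : set (borel 'rV[R]_m)).
Proof. by apply: open_borel; exact: ball_open. Qed.

Lemma lebn_ball a r : 0 < r -> (lebn (ball a r) <= ((2 * r) ^+ m)%:E)%E.
Proof.
move=> r0; apply: (@le_trans _ _ (lebn (box (a - const_mx r) (a + const_mx r)))).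
  apply: le_measure; rewrite ?inE; [exact: ball_borel|exact: measurable_box|].
  move=> v /(ball_rVP _ _ r0) h j; rewrite !mxE.
  by have := h j; rewrite ltr_norml => /andP[h1 h2]; apply/andP; split; lra.
rewrite lebn_box; last by move=> j; rewrite !mxE lerD2l; lra.
rewrite lee_fin (eq_bigr (fun=> 2 * r)); first by rewrite prodr_const card_ord.
by move=> j _; rewrite !mxE; lra.
Qed.

Lemma lebn_ball_ge a r : 0 < r -> ((r ^+ m)%:E <= lebn (ball a r))%E.
Proof.
move=> r0; apply: (@le_trans _ _ (lebn (box (a - const_mx (r / 2)) (a + const_mx (r / 2))))).
  rewrite lebn_box; last by move=> j; rewrite !mxE lerD2l; lra.
  rewrite lee_fin (eq_bigr (fun=> r)); first by rewrite prodr_const card_ord.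
  by move=> j _; rewrite !mxE; lra.
apply: le_measure; rewrite ?inE; [exact: measurable_box|exact: ball_borel|].
move=> v h; apply/(ball_rVP _ _ r0) => j; have := h j; rewrite !mxE => /andP[h1 h2].
by rewrite ltr_norml; apply/andP; split; lra.
Qed.

End LebesgueRows.

Arguments lebn : clear implicits.
Arguments lebn {R} m.

Lemma measure_bigsetU_le {R : realType} d (T : measurableType d)
    (nu : {measure set T -> \bar R}) (I : finType) (F : I -> set T) :
  (forall i, measurable (F i)) ->
  (nu (\big[setU/set0]_i F i) <= \sum_i nu (F i))%E.
Proof.
move=> mF; suff [] : measurable (\big[setU/set0]_i F i) /\
    (nu (\big[setU/set0]_i F i) <= \sum_i nu (F i))%E by [].
elim/big_ind2 : _ => [|A x B y [mA Ax] [mB By]|i _]; rewrite ?measure0//.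
split; first exact: measurableU.
by apply: le_trans (measureU2 _ mA mB) _; exact: leeD.
Qed.

Section MaximalInequality.
Context {R : realType} {m : nat}.
Notation L := (lebn m : set (borel 'rV[R]_m) -> \bar R).

Definition tricube k (z : 'rV[int]_m) : set 'rV[R]_m :=
  box (\row_j (2 ^- k * (z 0 j - 1)%:~R)) (\row_j (2 ^- k * (z 0 j + 2)%:~R)).

Lemma lebn_tricube k z : L (tricube k z) = ((3 * 2 ^- k) ^+ m)%:E.
Proof.
rewrite /tricube lebn_box.
  congr EFin; rewrite (eq_bigr (fun=> 3 * 2 ^- k)).
    by rewrite prodr_const card_ord.
  by move=> j _; rewrite !mxE !rmorphD/=; ring.
move=> j; rewrite !mxE ler_pM2l ?invr_gt0 ?exprn_gt0//.
by rewrite ler_int; lia.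
Qed.

Lemma int_close3 (w z : int) : z < w + 2 -> w < z + 2 ->
  exists e : 'I_3, w = z + (e : nat)%:Z - 1.
Proof.
move=> h1 h2; have [w0|[w0|w0]] : w = z - 1 \/ w = z \/ w = z + 1 by lia.
- by exists (@Ordinal 3 0 isT); rewrite w0 /=; lia.
- by exists (@Ordinal 3 1 isT); rewrite w0 /=; lia.
- by exists (@Ordinal 3 2 isT); rewrite w0 /=; lia.
Qed.

Lemma ord3_dist (z : int) (e : 'I_3) : `|z + (e : nat)%:Z - 1 - z| <= 1.
Proof. by have := ltn_ord e; lia. Qed.

Lemma tricube_close k z u v : dcube k z u -> `|u - v| <= 2 ^- k -> tricube k z v.
Proof.
rewrite dcube_box => hu uv j; have := hu j; rewrite !mxE => /andP[h1 h2].
have := le_coord_norm (u - v) j; rewrite !mxE => /le_trans/(_ uv).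
rewrite ler_norml => /andP[h3 h4].
move: h1 h2; rewrite !rmorphD/= !mulrDr rmorphN/= mulrN !mulr1 => h1 h2.
by apply/andP; split; lra.
Qed.

Lemma dyadic_scale (r : R) : 0 < r <= 1 -> exists k, r <= 2 ^- k < 2 * r.
Proof.
case/andP=> r0 r1.
have exk : exists k, (2 : R) ^- k < 2 * r.
  have h2 : `|2^-1 : R| < 1 by rewrite ger0_norm ?invf_lt1 ?ltr1n// invr_ge0.
  have /cvgrPdist_lt/(_ _ r0) := @cvg_geometric R 1 2^-1 h2.
  move=> [k _ /(_ k (leqnn _))] /=; rewrite sub0r normrN mul1r exprVn.
  by move=> /(le_lt_trans (ler_norm _)) ?; exists k; lra.
case: (ex_minnP exk) => -[|k] kr mink.
  by exists 0%N; rewrite kr expr0 invr1 r1.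
exists k.+1; rewrite kr andbT.
have : ~~ (2 ^- k < 2 * r).
  by apply/negP => /mink; rewrite ltnn.
by rewrite -leNgt exprS invfM => ?; lra.
Qed.

(** A ball meets only the neighbours of the dyadic cube of its centre at its own
    scale, so a ball of large mass forces a dyadic cube of large mass nearby;
    the maximal such cubes are disjoint, hence few. *)
Lemma maximal_inequality (nu : {measure set (borel 'rV[R]_m) -> \bar R}) (t : R) :
  (nu setT < +oo)%E -> 0 < t ->
  exists A : set (borel 'rV[R]_m), [/\ measurable A,
    (L A <= (18 ^+ m / t)%:E * nu setT)%E &
    forall a, ~ A a -> forall r, 0 < r <= 1 -> (nu (ball a r) <= (t * r ^+ m)%:E)%E].
Proof.
move=> nufin t0.
pose P := [set i | (dcubes i : set 'rV[R]_m) !=set0 /\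
  ((t * 6^-1 ^+ m * (2 ^- @dlevel m i) ^+ m)%:E <
     nu (dcubes i : set (borel 'rV[R]_m)))%E].
have [M [MP trivM coverM]] := @dcubes_select R m P.
pose T i : set (borel 'rV[R]_m) := if unpickle i is Some kz
  then tricube (kz : nat * 'rV[int]_m).1 kz.2 else set0.
pose T' i := if i \in M then T i else set0.
have mT i : measurable (T i).
  by rewrite /T; case: unpickle => // ?; exact: measurable_box.
have mT' i : measurable (T' i) by rewrite /T'; case: ifP.
pose D' i : set (borel 'rV[R]_m) := if i \in M then dcubes i else set0.
have mD' i : measurable (D' i).
  by rewrite /D'; case: ifP => // _; exact: measurable_dcubes.
exists (\bigcup_i T' i); split.
- exact: bigcup_measurable.
- apply: le_trans (measure_sigma_subadditive _ mT' _ (@subset_refl _ _)) _.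
    exact: bigcup_measurable.
  have trivD' : trivIset setT D'.
    move=> i j _ _ [v]; rewrite /D'; case: ifP => [/set_mem Mi|_ [] //].
    by case: ifP => [/set_mem Mj [iv jv]|_ [] //]; apply: trivM => //; exists v.
  apply: (@le_trans _ _ (\sum_(0 <= i <oo) (18 ^+ m / t)%:E * nu (D' i))%E).
    apply: lee_nneseries => // i _.
    rewrite /T' /D'; case: ifP => [/set_mem Mi|_]; last by rewrite !measure0 mule0.
    have [[v iv] nui] := MP _ Mi.
    move: iv nui; rewrite /T /dcubes /dlevel; case: unpickle => // -[k z] /= _ nui.
    rewrite lebn_tricube.
    apply: (@le_trans _ _ ((18 ^+ m / t)%:E * (t * 6^-1 ^+ m * (2 ^- k) ^+ m)%:E)%E).
      rewrite -EFinM lee_fin.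
      have -> : (3 / 2 ^+ k : R) ^+ m = (18 * 6^-1 * 2 ^- k) ^+ m.
        by congr (_ ^+ m); field; rewrite expf_neq0.
      rewrite !exprMn_comm; [|exact: mulrC..].
      by rewrite !mulrA divfK// gt_eqF.
    by apply: lee_wpmul2l; [rewrite lee_fin divr_ge0 ?exprn_ge0 ?ltW|exact: ltW].
  rewrite nneseriesZl//.
  apply: lee_wpmul2l; first by rewrite lee_fin divr_ge0 ?exprn_ge0 ?ltW.
  have mU : measurable (\bigcup_i D' i) by exact: bigcup_measurable.
  have /cvg_lim -> // := @measure_semi_sigma_additive _ _ _ nu D' mD' trivD' mU.
  by apply: le_measure; rewrite ?inE.
- move=> a Aa r r01; rewrite leNgt; apply/negP => big; apply: Aa.
  have [k /andP[rk kr]] := dyadic_scale r01.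
  case/andP: r01 => r0 r1.
  pose z := dindex k a.
  pose nb (e : {ffun 'I_m -> 'I_3}) : 'rV[int]_m := \row_j (z 0 j + (e j : nat)%:Z - 1).
  have cover : ball a r `<=` \big[setU/set0]_(e : {ffun 'I_m -> 'I_3}) dcube k (nb e).
    move=> v /(ball_rVP _ _ r0) av.
    have ee j : exists e : 'I_3, Num.floor (2 ^+ k * v 0 j) = z 0 j + (e : nat)%:Z - 1.
      have p2 : 0 < 2 ^+ k :> R by rewrite exprn_gt0.
      have := floor_itv (2 ^+ k * v 0 j); have := floor_itv (2 ^+ k * a 0 j).
      rewrite {1 2}(_ : Num.floor (2 ^+ k * a 0 j) = z 0 j); last by rewrite mxE.
      set w := Num.floor _; rewrite !intrD1 => /andP[z1 z2] /andP[w1 w2].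
      have dist : `|2 ^+ k * a 0 j - 2 ^+ k * v 0 j| < 1.
        rewrite -mulrBr normrM ger0_norm ?ltW//.
        have := lt_le_trans (av j) rk.
        by rewrite -(ltr_pM2l p2) mulfV ?lt0r_neq0.
      move: dist; rewrite ltr_norml => /andP[d1 d2].
      have c1 : z 0 j < w + 2 by rewrite -(ltr_int R) rmorphD/=; lra.
      have c2 : w < z 0 j + 2 by rewrite -(ltr_int R) rmorphD/=; lra.
      exact: int_close3.
    rewrite (bigD1 (finfun (fun j => sval (cid (ee j)))))//=; left.
    by move=> j; rewrite mxE ffunE; case: cid.
  have [e he] : exists e, ((t * 3^-1 ^+ m * r ^+ m)%:E < nu (dcube k (nb e) : set (borel 'rV[R]_m)))%E.
    apply: contrapT => /forallNP none.
    move: big; rewrite ltNge => /negP; apply.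
    apply: (@le_trans _ _ (\sum_(e : {ffun 'I_m -> 'I_3}) nu (dcube k (nb e) : set (borel 'rV[R]_m)))%E).
      have mU := bigsetU_measurable.
      apply: (@le_trans _ _ (nu (\big[setU/set0]_(e : {ffun 'I_m -> 'I_3}) (dcube k (nb e) : set (borel 'rV[R]_m))))).
        apply: le_measure; rewrite ?inE//; first exact: ball_borel.
        by apply: mU => *; exact: measurable_dcube.
      apply: (@measure_bigsetU_le R _ _ nu _ (fun e => dcube k (nb e) : set (borel 'rV[R]_m))) => e; exact: measurable_dcube.
    apply: (@le_trans _ _ (\sum_(e : {ffun 'I_m -> 'I_3}) (t * 3^-1 ^+ m * r ^+ m)%:E)%E).
      by apply: lee_sum => e _; rewrite leNgt; apply/negP; exact: none.
    rewrite sumEFin lee_fin sumr_const card_ffun !card_ord -[leLHS]mulr_natl natrX.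
    have h3 : (3 : R) ^+ m != 0 by rewrite expf_neq0.
    by rewrite exprVn [t * _]mulrC -mulrA mulVKf.
  have Pe : P (pickle (k, nb e)).
    split; rewrite dcubesE.
      exists (\row_j (2 ^- k * (nb e 0 j)%:~R)) => j; rewrite mxE mulrA mulfV ?mul1r ?expf_neq0//.
      by rewrite intrKfloor.
    apply: le_lt_trans he; rewrite dlevelE lee_fin -!mulrA ler_pM2l//.
    rewrite -!exprMn lerXn2r ?nnegrE ?mulr_ge0 ?invr_ge0 ?exprn_ge0//; first exact: ltW.
    lra.
  have [j Mj [ij lj]] := coverM _ Pe Pe.1.
  exists j => //; rewrite /T' mem_set//.
  pose w : 'rV[R]_m := \row_j (a 0 j + 2 ^- k * ((nb e 0 j)%:~R - (z 0 j)%:~R)).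
  have wj : dcubes j w.
    apply: ij; rewrite dcubesE => i; rewrite !mxE mulrDr mulrA mulfV ?mul1r ?expf_neq0//.
    rewrite -rmorphB/= floorDrz ?intr_int// intrKfloor addrC subrK//.
  have aw : `|w - a| <= 2 ^- k.
    apply: norm_rV_le => [|i]; first by rewrite invr_ge0 exprn_ge0.
    rewrite !mxE addrAC subrr add0r normrM ger0_norm ?invr_ge0 ?exprn_ge0//.
    rewrite ler_piMr ?invr_ge0 ?exprn_ge0// -rmorphB/= -intr_norm.
    by rewrite -[1]/(1%:~R) ler_int; exact: ord3_dist.
  move: wj lj; rewrite dlevelE /T /dcubes /dlevel; case: unpickle => // -[l zl] /= wj lj.
  apply: tricube_close wj _; apply: le_trans aw _.
  by rewrite lef_pV2 ?posrE ?exprn_gt0// ler_weXn2l// ler1n.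
Qed.

End MaximalInequality.

Section OuterRegularity.
Context {R : realType} {m : nat}.
Notation T := (borel 'rV[R]_m).

Lemma open_Fsigma (V : set 'rV[R]_m) : open V ->
  exists F : nat -> set 'rV[R]_m, [/\ forall k, closed (F k),
    nondecreasing_seq F & V = \bigcup_k F k].
Proof.
move=> oV.
pose F k := ~` (\bigcup_(y in ~` V) ball y k.+1%:R^-1) : set 'rV[R]_m.
exists F; split.
- by move=> k; apply: open_closedC; apply: bigcup_open => y _; exact: ball_open.
- move=> i j ij; apply/subsetPset; apply: subsetC; apply: subset_bigcup => y _.
  by apply: le_ball; rewrite lef_pV2 ?posrE// ler_nat.
- apply/seteqP; split => [v Vv|v [k _ Fv]]; last first.
    by apply: contrapT => Vv; apply: Fv; exists v => //; exact: ballxx.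
  have /nbhs_ballP[e /= e0 eV] : nbhs v V by apply: open_nbhs_nbhs.
  have [k ke] : exists k : nat, k.+1%:R^-1 < e.
    by exists (Num.bound e^-1); rewrite invf_plt ?posrE// (lt_trans (archi_boundP _))// ?invr_ge0 ?ltW// ltr_nat.
  exists k => // -[y Vy]; rewrite -ball_normE /= distrC => yv; apply: Vy; apply: eV.
  by rewrite -ball_normE /=; exact: lt_trans ke.
Qed.

Lemma finite_measure_tail (nu : {measure set T -> \bar R}) (F : nat -> set T) e :
  (nu setT < +oo)%E -> (forall k, measurable (F k)) -> nondecreasing_seq F ->
  0 < e -> exists k, (nu (\bigcup_i F i `\` F k) <= e%:E)%E.
Proof.
move=> nufin mF ndF e0.
have mU : measurable (\bigcup_i F i) by exact: bigcup_measurable.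
have fin A : measurable A -> nu A \is a fin_num.
  move=> mA; rewrite ge0_fin_numE// (le_lt_trans _ nufin)//.
  by apply: le_measure; rewrite ?inE.
have cv := @nondecreasing_cvg_mu _ _ _ nu F mF mU ndF.
have {}cv : fine \o (nu \o F) @ \oo --> fine (nu (\bigcup_i F i)).
  by apply: fine_cvg; rewrite fineK ?fin.
have /cvgrPdist_le/(_ _ e0)[k _ /(_ k (leqnn _)) /=] := cv.
move=> h; exists k; rewrite measureD//; last by rewrite (le_lt_trans _ nufin)//; apply: le_measure; rewrite ?inE.
rewrite setIidr; last exact: bigcup_sup.
rewrite -[X in (X - _)%E]fineK ?fin// -[X in (_ - X)%E]fineK ?fin// -EFinB lee_fin.
exact: le_trans (ler_norm _) h.
Qed.

(** The sets with this property contain the open sets, which are unions of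
    countably many closed sets, and form a sigma-algebra. *)
Lemma finite_regular (nu : {measure set T -> \bar R}) (A : set T) :
  (nu setT < +oo)%E -> measurable A -> forall e, 0 < e ->
  exists V F : set 'rV[R]_m, [/\ open V, closed F, F `<=` A, A `<=` V &
    (nu ((V `\` F) : set T) <= e%:E)%E].
Proof.
move=> nufin; pose P A := forall e, 0 < e ->
  exists V F : set 'rV[R]_m, [/\ open V, closed F, F `<=` A, A `<=` V &
    (nu ((V `\` F) : set T) <= e%:E)%E].
move: A; apply: (@smallest_sub _ _ _ P); last first.
  move=> V oV e e0; have [F [cF ndF VF]] := open_Fsigma oV.
  have [k hk] := finite_measure_tail nufin (fun k => closed_borel (cF k)) ndF e0.
  exists V, (F k); split => //; first by rewrite VF; exact: bigcup_sup.
  by rewrite VF.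
split.
- move=> e e0; exists set0, set0; split; [exact: open0|exact: closed0|by []|by []|].
  by rewrite setD0 measure0 lee_fin ltW.
- move=> A PA e e0; have [V [F [oV cF FA AV VF]]] := PA _ e0.
  exists (~` F), (~` V); split; [exact: closed_openC|exact: open_closedC| | |].
  + by rewrite setTD; exact: subsetC.
  + by rewrite setTD; exact: subsetC.
  + by rewrite setDE setCK setIC -setDE.
- move=> A PA e e0.
  have e2 : 0 < e / 2 by rewrite divr_gt0.
  have ek k : 0 < e / 2 / (2 ^ k.+1)%:R.
    by rewrite divr_gt0// ltr0n expn_gt0.
  have /choice[V VP] : forall k, exists V, exists F : set 'rV[R]_m,
     [/\ open V, closed F, F `<=` A k, A k `<=` V &
      (nu ((V `\` F) : set T) <= (e / 2 / (2 ^ k.+1)%:R)%:E)%E].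
    by move=> k; exact: PA.
  have /choice[F FP] := VP.
  pose G k : set 'rV[R]_m := \big[setU/set0]_(i < k) F i.
  have cG k : closed (G k).
    rewrite /G; elim/big_ind : _ => //; first exact: closed0.
    by move=> X Y; exact: closedU.
    by move=> i _; have [] := FP i.
  have ndG : nondecreasing_seq G by move=> i j ij; apply/subsetPset; exact: subset_bigsetU.
  have GF : \bigcup_k G k = \bigcup_k F k.
    apply/seteqP; split => v [k _].
      by rewrite /G -bigcup_mkord => -[i _ Fi]; exists i.
    by move=> Fk; exists k.+1 => //; rewrite /G -bigcup_mkord; exists k => /=.
  have [k hk] := finite_measure_tail nufin (fun k => closed_borel (cG k)) ndG e2.
  have mV i : measurable (V i : set T) by apply: open_borel; have [] := FP i.
  have mF i : measurable (F i : set T) by apply: closed_borel; have [] := FP i.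
  exists (\bigcup_k V k), (G k); split => //.
  + by apply: bigcup_open => i _; have [] := FP i.
  + rewrite /G -bigcup_mkord => v [i _ Fv]; exists i => //.
    by have [_ _ + _ _] := FP i; exact.
  + by move=> v [i _ Av]; exists i => //; have [_ _ _ + _] := FP i; exact.
  + have mUV : measurable (\bigcup_k V k : set T) by exact: bigcup_measurable.
    have mGk : measurable (G k : set T) by apply: closed_borel.
    have mUF : measurable (\bigcup_k F k : set T) by exact: bigcup_measurable.
    have mVF : measurable (\bigcup_k (V k `\` F k) : set T).
      by apply: bigcup_measurable => i _; exact: measurableD.
    apply: (@le_trans _ _ (nu ((\bigcup_i (V i `\` F i)) `|` (\bigcup_i F i `\` G k) : set T))).
      apply: le_measure; rewrite ?inE.
      * exact: measurableD.
      * by apply: measurableU => //; exact: measurableD.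
      * move=> v [[i _ Vi] Gv].
        have [|nF] := pselect ((\bigcup_i F i) v); first by right.
        by left; exists i => //; split => // Fi; apply: nF; exists i.
    apply: le_trans (measureU2 _ _ _) _ => //; first exact: measurableD.
    rewrite [e]splitr EFinD; apply: leeD; last by rewrite -GF.
    apply: le_trans (measure_sigma_subadditive _ _ mVF (@subset_refl _ _)) _.
      by move=> i; exact: measurableD.
    apply: (@le_trans _ _ (\sum_(0 <= i <oo) (0 + (e / 2 / (2 ^ i.+1)%:R)%:E))%E).
      apply: lee_nneseries => // i _; rewrite add0e.
      by have [] := FP i.
    apply: le_trans (epsilon_trick xpredT _ (ltW e2)) _ => //.
    by rewrite eseries0// add0e.
Qed.

(** Outer regularity extends to sigma-finite measures by exhausting with balls;
    for null sets this says that they have open neighbourhoods of small measure. *)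
Lemma lebn_null_open (A : set T) e : measurable A -> lebn m A = 0%E -> 0 < e ->
  exists V : set 'rV[R]_m, [/\ open V, A `<=` V & (lebn m (V : set T) <= e%:E)%E].
Proof.
move=> mA A0 e0.
have ek k : 0 < e / (2 ^ k.+1)%:R by rewrite divr_gt0// ltr0n expn_gt0.
pose B k : set T := ball (0 : 'rV[R]_m) k.+1%:R.
have mB k : measurable (B k) by exact: ball_borel.
have /choice[V VP] : forall k, exists V : set 'rV[R]_m, [/\ open V, A `<=` V &
    (lebn m (V `&` B k : set T) <= (e / (2 ^ k.+1)%:R)%:E)%E].
  move=> k.
  pose nu : {measure set T -> \bar R} := mrestr (lebn m) (mB k).
  have nufin : (nu setT < +oo)%E.
    by rewrite /nu/= /mrestr setTI (le_lt_trans (lebn_ball _ _))// ltry.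
  have [V [F [oV cF FA AV VF]]] := finite_regular nufin mA (ek k).
  exists V; split => //; move: VF; rewrite /nu/= /mrestr => VF.
  have mV : measurable (V : set T) by exact: open_borel.
  have mF : measurable (F : set T) by exact: closed_borel.
  apply: (@le_trans _ _ (lebn m (((V `\` F) `&` B k) `|` A : set T))).
    apply: le_measure; rewrite ?inE.
    - exact: measurableI.
    - by apply: measurableU => //; apply: measurableI => //; exact: measurableD.
    - move=> v [Vv Bv]; have [Fv|nFv] := pselect (F v); first by right; exact: FA.
      by left.
  apply: le_trans (measureU2 _ _ _) _ => //.
    by apply: measurableI => //; exact: measurableD.
  by rewrite /= [X in (_ + X)%E]A0 adde0.
exists (\bigcup_k (V k `&` B k)); split.
- by apply: bigcup_open => i _; apply: openI; [have [] := VP i|exact: ball_open].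
- move=> v Av; exists (Num.bound `|v|) => //; split; first by have [_ + _] := VP (Num.bound `|v|); exact.
  rewrite /B -ball_normE /= sub0r normrN.
  by apply: lt_trans (archi_boundP _) _ => //; rewrite ltr_nat.
- have mVB k : measurable (V k `&` B k : set T).
    by apply: measurableI => //; apply: open_borel; have [] := VP k.
  apply: le_trans (measure_sigma_subadditive _ mVB _ (@subset_refl _ _)) _.
    exact: bigcup_measurable.
  apply: (@le_trans _ _ (\sum_(0 <= i <oo) (0 + (e / (2 ^ i.+1)%:R)%:E))%E).
    by apply: lee_nneseries => // i _; rewrite add0e; have [] := VP i.
  apply: le_trans (epsilon_trick xpredT _ (ltW e0)) _ => //.
  by rewrite eseries0// add0e.
Qed.

End OuterRegularity.

Section Density.
Context {R : realType} {m : nat}.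
Notation T := (borel 'rV[R]_m).
Notation L := (lebn m).

(** If measures [nu i] have arbitrarily small total mass, then almost every point
    has small upper density for some of them. *)
Lemma small_mass_density (nu : nat -> {measure set T -> \bar R}) :
  (forall i, nu i setT < +oo)%E ->
  (forall e, 0 < e -> exists i, (nu i setT <= e%:E)%E) ->
  L.-negligible [set a | ~ (forall t, 0 < t -> exists i,
     forall r, 0 < r <= 1 -> (nu i (ball (a : 'rV[R]_m) r : set T) <= (t * r ^+ m)%:E)%E)].
Proof.
move=> nufin nu0.
have ex (ki : nat * nat) : exists A : set T, [/\ measurable A,
    (L A <= (18 ^+ m / ki.1.+1%:R^-1)%:E * nu ki.2 setT)%E &
    forall a : 'rV[R]_m, ~ A a -> forall r, 0 < r <= 1 ->
      (nu ki.2 (ball a r : set T) <= (ki.1.+1%:R^-1 * r ^+ m)%:E)%E].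
  by apply: maximal_inequality => //; rewrite invr_gt0.
have /choice[A AP] := ex.
pose B k := \bigcap_i A (k, i).
have mB k : measurable (B k).
  by apply: bigcapT_measurable => i; have [] := AP (k, i).
have B0 k : L (B k) = 0%E.
  apply/eqP; rewrite eq_le measure_ge0 andbT; apply/lee_addgt0Pr => e e0.
  rewrite add0e; pose c : R := 18 ^+ m / k.+1%:R^-1.
  have c0 : 0 < c by rewrite divr_gt0 ?exprn_gt0 ?invr_gt0.
  have [i hi] := nu0 (e / c) (divr_gt0 e0 c0).
  have [mA hA _] := AP (k, i).
  apply: (@le_trans _ _ (L (A (k, i)))).
    by apply: le_measure; rewrite ?inE//; exact: bigcap_inf.
  apply: le_trans hA _; rewrite -/c.
  apply: (@le_trans _ _ (c%:E * (e / c)%:E)%E).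
    by apply: lee_wpmul2l => //; rewrite lee_fin ltW.
  by rewrite -EFinM lee_fin mulrCA divff ?mulr1// gt_eqF.
exists (\bigcup_k B k); split.
- exact: bigcup_measurable.
- apply/eqP; rewrite eq_le measure_ge0 andbT.
  apply: le_trans (measure_sigma_subadditive _ mB _ (@subset_refl _ _)) _.
    exact: bigcup_measurable.
  by rewrite eseries0// => i _ _; rewrite -[RHS](B0 i).
- move=> a /existsNP[t /not_implyP[t0 /forallNP h]].
  exists (Num.bound t^-1) => // i _; apply: contrapT => Aa.
  apply: (h i) => r r01; have [_ _ /(_ a Aa r r01)] := AP (Num.bound t^-1, i).
  move=> /le_trans; apply; rewrite lee_fin ler_wpM2r//.
    by case/andP: r01 => /ltW r0 _; rewrite exprn_ge0.
  rewrite invf_ple ?posrE//= ltW//; apply: (lt_trans (archi_boundP _)).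
    by rewrite invr_ge0 ltW.
  by rewrite ltr_nat.
Qed.

(** A measure that does not charge [B] has density zero at almost every point of
    [B]: inside a small open neighbourhood of [B] it has small total mass. *)
Lemma null_density (nu : {measure set T -> \bar R}) (B : set T) :
  (nu setT < +oo)%E -> measurable B -> nu B = 0%E ->
  L.-negligible [set a | B a /\ ~ (forall t, 0 < t -> exists d, 0 < d /\
     forall r, 0 < r < d -> (nu (ball (a : 'rV[R]_m) r : set T) <= (t * r ^+ m)%:E)%E)].
Proof.
move=> nufin mB nuB.
have /choice[V VP] : forall k : nat, exists V : set 'rV[R]_m, [/\ open V, B `<=` V &
    (nu (V : set T) <= (k.+1%:R^-1)%:E)%E].
  move=> k; have k0 : (0 : R) < k.+1%:R^-1 by rewrite invr_gt0.
  have [V [F [oV cF FB BV VF]]] := finite_regular nufin mB k0.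
  exists V; split => //.
  have mV : measurable (V : set T) by exact: open_borel.
  have mF : measurable (F : set T) by exact: closed_borel.
  apply: (@le_trans _ _ (nu ((V `\` F) `|` B : set T))).
    apply: le_measure; rewrite ?inE//.
    - by apply: measurableU => //; exact: measurableD.
    - move=> v Vv; have [Fv|nFv] := pselect (F v); first by right; exact: FB.
      by left.
  apply: le_trans (measureU2 _ _ _) _ => //; first exact: measurableD.
  by rewrite /= [X in (_ + X)%E]nuB adde0.
have mV k : measurable (V k : set T) by apply: open_borel; have [] := VP k.
pose mu k : {measure set T -> \bar R} := mrestr nu (mV k).
have muT k : mu k setT = nu (V k) by rewrite /mu/= /mrestr setTI.
have mufin k : (mu k setT < +oo)%E.
  by rewrite muT (le_lt_trans _ nufin)//; apply: le_measure; rewrite ?inE.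
have mu0 e : 0 < e -> exists i, (mu i setT <= e%:E)%E.
  move=> e0; exists (Num.bound e^-1); rewrite muT.
  have [_ _ /le_trans] := VP (Num.bound e^-1); apply; rewrite lee_fin.
  rewrite invf_ple ?posrE//= ltW//; apply: (lt_trans (archi_boundP _)).
    by rewrite invr_ge0 ltW.
  by rewrite ltr_nat.
apply: negligibleS (small_mass_density mufin mu0) => a [Ba h1] h2.
apply: h1 => t t0; have [i hi] := h2 t t0.
have [oV BV _] := VP i.
have /nbhs_ballP[e /= e0 eV] : nbhs (a : 'rV[R]_m) (V i).
  by apply: open_nbhs_nbhs; split => //; exact: BV.
exists (Num.min e 1); split; first by rewrite lt_min e0 ltr01.
move=> r /andP[r0]; rewrite lt_min => /andP[re r1].
have := hi r; rewrite r0 ltW//= => /(_ isT); rewrite /mu/= /mrestr setIidl//.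
by move=> y hy; apply: eV; apply: le_ball hy; exact: ltW.
Qed.

End Density.

(** * Lebesgue points and Rademacher's theorem *)

Section DensityMeasure.
Context d (T : measurableType d) {R : realType} (mu : {measure set T -> \bar R}).
Variable f : T -> \bar R.
Hypotheses (mf : measurable_fun setT f) (f0 : forall x, (0 <= f x)%E).

Definition density_measure : set T -> \bar R :=
  let _ := mf in let _ := f0 in fun A => (\int[mu]_(x in A) f x)%E.

Let dm0 : density_measure set0 = 0%E.
Proof. by rewrite /density_measure integral_set0. Qed.

Let dm_ge0 A : (0 <= density_measure A)%E.
Proof. exact: integral_ge0. Qed.

Let dm_sigma : semi_sigma_additive density_measure.
Proof. exact: semi_sigma_additive_nng_induced. Qed.

HB.instance Definition _ := isMeasure.Build _ _ _ density_measure
  dm0 dm_ge0 dm_sigma.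

Lemma measure_of_density : exists nu : {measure set T -> \bar R},
  forall A, nu A = (\int[mu]_(x in A) f x)%E.
Proof. by exists density_measure. Qed.

End DensityMeasure.

Lemma itv_close {R : realType} (q e x y : R) :
  q <= x -> x < q + e -> q <= y -> y < q + e -> `|x - y| <= e.
Proof. by move=> *; rewrite ler_norml; apply/andP; split; lra. Qed.

Section LebesguePoints.
Context {R : realType} {m : nat}.
Notation T := (borel 'rV[R]_m).
Notation L := (lebn m).

(** Split the values of [w] into short intervals: near a density point of a level
    set, the other values of [w] carry little mass. *)
Lemma lebesgue_points (w : T -> R) : measurable_fun setT w ->
  (forall k : nat, (\int[L]_(x in (ball (0%R : 'rV[R]_m) k%:R : set T)) `|w x|%:E < +oo)%E) ->
  L.-negligible [set a | ~ (forall t, 0 < t -> exists d, 0 < d /\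
     forall r, 0 < r < d ->
       (\int[L]_(x in (ball (a : 'rV[R]_m) r : set T)) `|w x - w a|%:E <= (t * r ^+ m)%:E)%E)].
Proof.
move=> mw wfin.
pose C (c : int * nat * nat) : set T := ball (0 : 'rV[R]_m) c.2%:R.
have mC c : measurable (C c) by exact: ball_borel.
pose B (c : int * nat * nat) : set T :=
  C c `&` w @^-1` `[c.1.1%:~R / c.1.2.+1%:R, (c.1.1 + 1)%:~R / c.1.2.+1%:R[.
have mB c : measurable (B c).
  by apply: measurableI => //; rewrite -[X in measurable X]setTI; exact: mw.
have Bclose c x y : B c x -> B c y -> `|w x - w y| <= c.1.2.+1%:R^-1.
  case: c => [[z n] k] [_ +] [_]; rewrite /B /= !in_itv/= => /andP[].
  rewrite rmorphD/= mulrDl mul1r => x1 x2 /andP[y1 y2].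
  exact: itv_close x1 x2 y1 y2.
pose f c := (fun x : T => (`|w x| + 1)%:E) \_ (C c `\` B c).
have f0 c x : (0 <= f c x)%E by rewrite /f patchE; case: ifP => // _; rewrite lee_fin addr_ge0.
have mw1 : measurable_fun setT (fun x : T => (`|w x| + 1)%:E).
  apply/measurable_EFinP; apply: measurable_funD => //.
  exact: measurableT_comp.
have mf c : measurable_fun setT (f c).
  by apply/(measurable_restrictT _ _).1; [exact: measurableD|exact: measurable_funS mw1].
have /choice[nu nuE] : forall c, exists nu : {measure set T -> \bar R},
    forall A, nu A = (\int[L]_(x in A) f c x)%E.
  by move=> c; exact: measure_of_density.
have nufin c : (nu c setT < +oo)%E.
  rewrite nuE /f -integral_mkcond.
  apply: (@le_lt_trans _ _ (\int[L]_(x in C c) (`|w x| + 1)%:E)%E).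
    by apply: ge0_subset_integral => //; [exact: measurableD|exact: measurable_funS mw1].
  under eq_integral do rewrite EFinD.
  rewrite ge0_integralD//; last first.
    by apply/measurable_EFinP; apply: measurableT_comp => //; exact: measurable_funS mw.
  rewrite lte_add_pinfty//; first exact: wfin.
  rewrite integral_cst// mul1e.
  have [c0|c0] := ltP 0 (c.2%:R : R).
    by rewrite (le_lt_trans (lebn_ball _ c0))// ltry.
  by rewrite /C le0_ball0// measure0.
have nuB c : nu c (B c) = 0%E.
  rewrite nuE integral0_eq// => x Bx; rewrite /f patchE ifF//.
  by apply/negbTE/negP; rewrite inE => -[].
have N c := null_density (nufin c) (mB c) (nuB c).
pose NN i := if unpickle i is Some c then
  [set a | B c a /\ ~ (forall t, 0 < t -> exists d, 0 < d /\
     forall r, 0 < r < d -> (nu c (ball (a : 'rV[R]_m) r : set T) <= (t * r ^+ m)%:E)%E)]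
  else set0.
have NNn : L.-negligible (\bigcup_i NN i).
  apply: negligible_bigcup => i; rewrite /NN; case: unpickle => [c|]; first exact: N.
  exact: negligible_set0.
apply: negligibleS NNn => a; apply: contra_notP => notN t t0.
pose n := Num.bound (2 * 2 ^+ m / t).
pose k := (Num.bound `|a : 'rV[R]_m|).+1.
pose c := (Num.floor (n.+1%:R * w a), n, k).
have n1 : (0 : R) < n.+1%:R by [].
have Ba : B c a.
  split.
    rewrite /C -ball_normE /= sub0r normrN; apply: lt_trans (archi_boundP _) _ => //.
    by rewrite ltr_nat.
  rewrite /= in_itv/=; have := floor_itv (n.+1%:R * w a) => /andP[h1 h2].
  by rewrite ler_pdivrMr// ltr_pdivlMr// [w a * _]mulrC h1 h2.
have good : forall t, 0 < t -> exists d, 0 < d /\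
     forall r, 0 < r < d -> (nu c (ball (a : 'rV[R]_m) r : set T) <= (t * r ^+ m)%:E)%E.
  apply: contrapT => bad; apply: notN.
  by exists (pickle c); [exact: Logic.I|rewrite /NN pickleK; split].
have wa0 : 0 < 1 + `|w a| by rewrite ltr_pwDl.
have [d [d0 hd]] := good (t / 2 / (1 + `|w a|)) (divr_gt0 (divr_gt0 t0 (ltr0Sn _ 1)) wa0).
exists (Num.min d 1); split; first by rewrite lt_min d0 ltr01.
move=> r /andP[r0]; rewrite lt_min => /andP[rd r1].
have rm0 : 0 <= r ^+ m by rewrite exprn_ge0// ltW.
pose Q : set T := ball (a : 'rV[R]_m) r.
have mQ : measurable Q by exact: ball_borel.
have QC : Q `<=` C c.
  move=> x; rewrite /Q /C -!ball_normE /= sub0r normrN => ax.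
  rewrite -[x](subrK a) -addrC; apply: le_lt_trans (ler_normD _ _) _.
  rewrite /k -natr1 ltrD//; first exact: archi_boundP.
  by rewrite distrC (lt_trans ax).
have mdist : measurable_fun setT (fun x : T => `|w x - w a|%:E).
  apply/measurable_EFinP; apply: measurableT_comp => //.
  exact: measurable_funB.
rewrite -/Q -(setDUK (@subIsetl _ Q (B c))) ge0_integral_setU//; last 4 first.
- exact: measurableI.
- by apply: measurableD => //; exact: measurableI.
- exact: measurable_funS mdist.
- by apply/disj_setPS => x [[] ? ? [_]]; exact.
rewrite (_ : t * r ^+ m = t / 2 * r ^+ m + t / 2 * r ^+ m); last by field.
rewrite EFinD; apply: leeD.
  apply: (@le_trans _ _ (\int[L]_(x in Q `&` B c) (n.+1%:R^-1)%:E)%E).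
    apply: ge0_le_integral => //; first exact: measurableI.
    - exact: measurable_funS mdist.
    - by move=> x [_ Bx]; rewrite lee_fin; exact: (Bclose c).
  rewrite integral_cst//; last exact: measurableI.
  apply: (@le_trans _ _ ((n.+1%:R^-1)%:E * ((2 * r) ^+ m)%:E)%E).
    apply: lee_wpmul2l; first by rewrite lee_fin invr_ge0.
    apply: le_trans (lebn_ball (a : 'rV[R]_m) r0); apply: le_measure; rewrite ?inE//.
      exact: measurableI.
  rewrite -EFinM lee_fin exprMn mulrA ler_wpM2r//.
  rewrite ler_pdivrMl// mulrA ler_pdivlMr// mulrC -ler_pdivrMr//.
  apply: ltW; apply: lt_trans (archi_boundP _) _; last by rewrite /n ltr_nat.
  by rewrite divr_ge0 ?mulr_ge0 ?exprn_ge0// ltW.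
have -> : Q `\` (Q `&` B c) = Q `\` B c by rewrite setDIr setDv set0U.
apply: (@le_trans _ _ ((1 + `|w a|)%:E * nu c Q)%E); last first.
  apply: (@le_trans _ _ ((1 + `|w a|)%:E * (t / 2 / (1 + `|w a|) * r ^+ m)%:E)%E).
    by apply: lee_wpmul2l; [rewrite lee_fin ltW|apply: hd; rewrite r0 rd].
  rewrite -EFinM lee_fin mulrA ler_wpM2r// mulrC divfK// gt_eqF.
rewrite nuE -ge0_integralZl//; [|exact: measurable_funS (mf c)].
rewrite (_ : Q `\` B c = Q `&` (C c `\` B c)); last first.
  by rewrite setDE setDE setIA (setIidl QC).
rewrite integral_mkcondr; apply: ge0_le_integral => //.
- by move=> x _; rewrite patchE; case: ifP.
- apply: measurable_funS (_ : measurable_fun setT _) => //.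
  by apply/(measurable_restrictT _ _).1; [exact: measurableD|exact: measurable_funS mdist].
- apply: emeasurable_funM; first exact: measurable_cst.
  exact: measurable_funS (mf c).
- move=> x _; rewrite /f !patchE; case: ifP => _; last by rewrite mule0.
  rewrite -EFinM lee_fin mulrDl mul1r; apply: le_trans (ler_normB _ _) _.
  have : 0 <= `|w a| * `|w x| by rewrite mulr_ge0.
  have := normr_ge0 (w a); have := normr_ge0 (w x); lra.
Qed.

End LebesguePoints.

Section LipschitzLine.
Context {R : realType}.
Notation mu := (@lebesgue_measure R).
Variables (u : R -> R) (K : R).
Hypothesis uK : forall x y, `|u x - u y| <= K * `|x - y|.

Definition tilt (e : R) (s : R) : R := let _ := uK in K * s + e * u s.

Lemma tilt_nd e : `|e| = 1 -> nondecreasing (tilt e).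
Proof.
move=> e1 x y xy; rewrite /tilt -subr_ge0 opprD addrACA -!mulrBr.
have : `|e * (u y - u x)| <= K * (y - x).
  by rewrite normrM e1 mul1r (le_trans (uK _ _))// ger0_norm// subr_ge0.
by rewrite ler_norml => /andP[h _]; lra.
Qed.

Lemma lip_real_continuous : continuous u.
Proof.
move=> x; apply/cvgrPdist_le => e e0; near=> y.
apply: le_trans (uK _ _) _.
have K1 : 0 < `|K| + 1 by rewrite ltr_wpDl.
apply: (@le_trans _ _ ((`|K| + 1) * `|x - y|)).
  by rewrite ler_wpM2r// (le_trans (ler_norm _))// lerDl.
rewrite -ler_pdivlMl//; near: y.
by apply: cvgr_dist_le => //; rewrite mulr_gt0// invr_gt0.
Unshelve. all: by end_near. Qed.

Lemma tilt_continuous e : continuous (tilt e).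
Proof.
move=> x; apply: cvgD; apply: cvgM; [exact: cvg_cst|exact: cvg_id|exact: cvg_cst|exact: lip_real_continuous].
Qed.

Lemma tilt_rc e : right_continuous (tilt e).
Proof. by move=> x; apply: cvg_at_right_filter; exact: tilt_continuous. Qed.

Let up := tilt 1.
Let dn := tilt (-1).
Let up_nd : nondecreasing up. Proof. by apply: tilt_nd; rewrite normr1. Qed.
Let dn_nd : nondecreasing dn. Proof. by apply: tilt_nd; rewrite normrN1. Qed.
HB.instance Definition _ := isCumulative.Build R _ R up up_nd (@tilt_rc 1).
HB.instance Definition _ := isCumulative.Build R _ R dn dn_nd (@tilt_rc (-1)).

Lemma lebesgue_stieltjes_itvoc (f : cumulative R R) (a b : R) : a <= b ->
  lebesgue_stieltjes_measure f `]a, b]%classic = (f b - f a)%:E.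
Proof.
move=> ab; transitivity (wlength f (`]a, b]%classic : set (ocitv_type R))).
  exact: (measurable_mu_extE _ (is_ocitv a b)).
by rewrite wlength_itv_bnd.
Qed.

Let mup : {measure set (measurableTypeR R) -> \bar R} := lebesgue_stieltjes_measure up.
Let mdn : {measure set (measurableTypeR R) -> \bar R} := lebesgue_stieltjes_measure dn.

Lemma lip_K_ge0 : 0 <= K.
Proof. by have := le_trans (normr_ge0 _) (uK 1 0); rewrite subr0 normr1 mulr1. Qed.

(** [K s + u s] and [K s - u s] are both nondecreasing and add up to [2 K s], so
    each of their Stieltjes measures is dominated by Lebesgue measure. *)
Lemma stieltjes_dominated (A : set (measurableTypeR R)) : measurable A ->
  (mup A <= (2 * K)%:E * mu A)%E.
Proof.
move=> mA.
have K2 : 0 <= 2 * K by rewrite mulr_ge0// lip_K_ge0.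
pose m1 : {measure set (measurableTypeR R) -> \bar R} := measure_add mup mdn.
pose m2 : {measure set (measurableTypeR R) -> \bar R} := mscale (NngNum K2) mu.
have E (B : set (measurableTypeR R)) : measurable B -> m1 B = m2 B.
  have key (a b : R) : a <= b -> m1 `]a, b]%classic = m2 `]a, b]%classic.
    move=> ab; transitivity (mup `]a, b]%classic + mdn `]a, b]%classic)%E.
      exact: measure_addE.
    rewrite [mup _]lebesgue_stieltjes_itvoc// [mdn _]lebesgue_stieltjes_itvoc//.
    rewrite /m2/= /mscale/= lebesgue_measure_itv/= lte_fin.
    move: ab; rewrite le_eqVlt => /predU1P[->|ab].
      by rewrite ltxx mule0 !subrr add0e.
    by rewrite ab -!EFinD -EFinM; congr EFin; rewrite /up /dn /tilt; ring.
  apply: (@measure_unique _ R (measurableTypeR R) (@ocitv R) (fun k => `]- k%:R, k%:R]%classic)) => //.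
  - exact: ocitvI.
  - by move=> i; exact: is_ocitv.
  - apply/seteqP; split => // x _; exists (Num.bound `|x|).+1 => //=.
    have := archi_boundP (normr_ge0 x); rewrite in_itv/= ltr_norml => /andP[h1 h2].
    rewrite -natr1; apply/andP; split; lra.
  - move=> X /= [[a b] _ <-]/=; have [ab|ba] := leP a b; first exact: key.
    by rewrite set_itv_ge ?measure0// -leNgt /= bnd_simp ltW.
  - move=> k; rewrite key.
      rewrite /m2/= /mscale/= lebesgue_measure_itv/= lte_fin; case: ifP => _.
        by rewrite -EFinD -EFinM ltry.
      by rewrite mule0 ltry.
    by rewrite (@le_trans _ _ 0)// oppr_le0.
rewrite -[leRHS]/(m2 A) -(E A mA).
rewrite (_ : m1 A = (mup A + mdn A)%E); last exact: measure_addE.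
exact: leeDl.
Qed.

(** An everywhere defined measurable version of the derivative. *)
Definition quotient_limsup (s : R) : R :=
  limn_sup (fun k => (u (s + k.+1%:R^-1) - u s) * k.+1%:R).

(** The measures of [stieltjes_dominated] have densities by the Radon-Nikodym
    theorem, and the differentiation theorem applies to these. *)
Lemma lipschitz_derivable_ae (M : R) : 0 < M ->
  exists g : R -> R, [/\ mu.-integrable setT (EFin \o g),
    (forall a b, - M < a -> a <= b -> b <= M ->
      (\int[mu]_(s in `]a, b]) (g s)%:E = (up b - up a)%:E)%E) &
    mu.-negligible [set s | - M < s < M /\
      ~ ((fun k => (up (s + k.+1%:R^-1) - up s) * k.+1%:R) @ \oo --> g s)]].
Proof.
move=> M0.
pose I : set (measurableTypeR R) := `]- M, M]%classic.
have mI : measurable I by exact: measurable_itv.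
have MM : - M <= M by rewrite (@le_trans _ _ 0)// ?oppr_le0 ltW.
have Ioo : (mup I < +oo)%E by rewrite [mup _]lebesgue_stieltjes_itvoc ?ltry.
pose nu : {finite_measure set (measurableTypeR R) -> \bar R} := mfrestr mI Ioo.
have numu : nu `<< mu.
  apply/null_content_dominatesP => A mA A0.
  apply/eqP; rewrite eq_le measure_ge0 andbT /nu /= /mfrestr /mrestr.
  apply: (@le_trans _ _ (mup A)).
    by apply: le_measure; rewrite ?inE//; exact: measurableI.
  by apply: le_trans (stieltjes_dominated mA) _; rewrite [X in (_ * X)%E]A0 mule0.
have [gE [g0 gfin gint nug]] := radon_nikodym_sigma_finite numu.
pose g := fine \o gE.
have gEE : EFin \o g = gE by apply/funext => x; rewrite /g /= fineK.
have gi : mu.-integrable setT (EFin \o g) by rewrite gEE.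
exists g; split => //.
  move=> a b Ma ab bM; transitivity (nu `]a, b]%classic).
    rewrite nug; last exact: measurable_itv.
    by apply: eq_integral => x _; rewrite -gEE.
  rewrite /nu /= /mfrestr /mrestr setIidl.
    exact: (@lebesgue_stieltjes_itvoc up).
  move=> x /=; rewrite !in_itv/= => /andP[h1 h2].
  by apply/andP; split; [exact: lt_trans h1|exact: le_trans bM].
have intNy y : mu.-integrable `]-oo, y] (EFin \o g).
  by apply: integrableS gi => //; exact: measurable_itv.
have locg : locally_integrable setT g by apply: open_integrable_locally => //; exact: openT.
have [N [mN N0 NP]] := FTC1Ny intNy locg.
exists N; split => // s [/andP[Ms sM] hs]; apply: NP => /= -[ds dsE]; apply: hs.
have FE x : - M < x < M ->
    (\int[mu]_(t in [set` `]-oo, x]]) (g t))%R = up x - up (- M).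
  move=> /andP[Mx xM]; rewrite /Rintegral.
  have -> : (\int[mu]_(t in [set` `]-oo, x]%R]) (g t)%:E)%E = nu `]-oo, x]%classic.
    rewrite nug; last exact: measurable_itv.
    by apply: eq_integral => y _; rewrite -gEE.
  rewrite /nu /= /mfrestr /mrestr (_ : _ `&` _ = `]- M, x]%classic).
    by rewrite [X in fine X = _](@lebesgue_stieltjes_itvoc up)// ltW.
  apply/seteqP; split => y; rewrite /I /= !in_itv/=; first by move=> [-> /andP[-> _]].
  by move=> /andP[-> yx]; rewrite yx (le_trans yx (ltW xM)).
pose F x := (\int[mu]_(t in [set` `]-oo, x]]) (g t))%R.
have cvF : h^-1 *: (F (h *: 1 + s) - F s) @[h --> (0 : R)^'] --> g s.
  by move: ds => /cvg_ex[l hl]; have := dsE; rewrite derive1E /derive => <-; apply: cvgP hl.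
have cvk : (fun k => k.+1%:R^-1 : R) @ \oo --> (0 : R)^'.
  move=> A [e /= e0 eA]; have := @cvg_harmonic R => /cvgrPdist_lt/(_ _ e0).
  apply: filterS => k; rewrite sub0r normrN => hk; apply: eA => /=.
    by rewrite sub0r normrN.
  by rewrite invr_neq0.
apply: cvg_trans (cvg_comp _ _ cvk cvF); apply: near_eq_cvg.
have [e e0 eM] : exists2 e : R, 0 < e & s + e < M.
  by exists ((M - s) / 2); [rewrite divr_gt0// subr_gt0|lra].
have := @cvg_harmonic R => /cvgrPdist_lt/(_ _ e0); apply: filterS => k.
rewrite sub0r normrN ger0_norm ?invr_ge0// /harmonic => hk /=.
rewrite /F invrK [_ *: 1]mulr1 [_^-1 + s]addrC !FE ?Ms ?sM//.
  by rewrite [LHS]mulrC; congr (_ * _); ring.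
apply/andP; split; first by rewrite (lt_trans Ms)// ltrDl invr_gt0.
by apply: lt_trans eM; rewrite ltrD2l.
Qed.

Lemma quotient_bound s k : `|(u (s + k.+1%:R^-1) - u s) * k.+1%:R| <= K.
Proof.
rewrite normrM; apply: (@le_trans _ _ (K * k.+1%:R^-1 * k.+1%:R)).
  rewrite [X in _ * X]ger0_norm// ler_wpM2r//; apply: le_trans (uK _ _) _.
  by rewrite addrAC subrr add0r ger0_norm// invr_ge0.
by rewrite mulfVK.
Qed.

Lemma quotient_limsup_bound s : `|quotient_limsup s| <= K.
Proof.
pose q k := (u (s + k.+1%:R^-1) - u s) * k.+1%:R.
have bq : bounded_fun q.
  exists K; split; first exact: num_real.
  by move=> x Kx k _; exact: le_trans (quotient_bound s k) (ltW Kx).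
have hK k : - K <= q k <= K by rewrite -ler_norml; exact: quotient_bound.
rewrite /quotient_limsup -/q limn_supE//.
have sK n : - K <= sups q n <= K.
  rewrite /sups; apply/andP; split.
    apply: (@le_trans _ _ (q n)); first by case/andP: (hK n).
    apply: ub_le_sup; last by exists n => /=.
    by exists K => _ [k _ <-]; case/andP: (hK k).
  apply: ge_sup; first by exists (q n); exists n => /=.
  by move=> _ [k _ <-]; case/andP: (hK k).
rewrite ler_norml; apply/andP; split.
  apply: lb_le_inf; first by exists (sups q 0%N); exists 0%N.
  by move=> _ [n _ <-]; case/andP: (sK n).
apply: (@le_trans _ _ (sups q 0%N)); last by case/andP: (sK 0%N).
apply: ge_inf; last by exists 0%N.
by exists (- K) => _ [n _ <-]; case/andP: (sK n).
Qed.

Lemma measurable_quotient_limsup : measurable_fun setT quotient_limsup.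
Proof.
apply: measurable_fun_limn_sup.
- move=> t _; exists K => _ [k _ <-].
  by have := quotient_bound t k; rewrite ler_norml => /andP[].
- move=> t _; exists (- K) => _ [k _ <-].
  by have := quotient_bound t k; rewrite ler_norml => /andP[].
- move=> k; apply: measurable_funM; last exact: measurable_cst.
  apply: measurable_funB; apply: continuous_measurable_fun => x.
    apply: continuous_comp; last exact: lip_real_continuous.
    by apply: cvgD; [exact: cvg_id|exact: cvg_cst].
  exact: lip_real_continuous.
Qed.

Lemma lipschitz_integral (t : R) : 0 <= t ->
  (\int[mu]_(s in `]0%R, t]) (quotient_limsup s)%:E = (u t - u 0)%:E)%E.
Proof.
move=> t0; have M0 : 0 < t + 1 by rewrite ltr_wpDl.
have [g [gi gE gae]] := lipschitz_derivable_ae M0.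
have mt : measurable (`]0%R, t] : set (measurableTypeR R)) by exact: measurable_itv.
transitivity (\int[mu]_(s in `]0%R, t]) ((g s)%:E - K%:E))%E.
  apply: ae_eq_integral => //.
  - by apply/measurable_EFinP; apply: measurable_funS measurable_quotient_limsup.
  - apply: emeasurable_funB; last exact: measurable_cst.
    by case/integrableP: gi => h _; exact: measurable_funS h.
  apply: negligibleS gae => s /= /not_implyP[]; rewrite in_itv/= => /andP[s0 st] ne.
  split; first by apply/andP; split; lra.
  move=> cv; apply: ne; rewrite -EFinB; congr EFin.
  have : (fun k => (u (s + k.+1%:R^-1) - u s) * k.+1%:R) @ \oo --> g s - K.
    apply: cvg_trans (cvgB cv (cvg_cst K)); apply: near_eq_cvg; near=> k.
    rewrite /= /up /tilt !fctE/=.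
    have : k.+1%:R != 0 :> R by [].
    by move: (k.+1%:R : R) => x x0; field.
  by move=> /cvg_limn_inf_sup[].
rewrite integralB//; last 2 first.
- exact: integrableS gi.
- apply/integrableP; split; first exact: measurable_cst.
  by rewrite integral_cst//= lebesgue_measure_itv/=; case: ifP => _; rewrite -?EFinB -?EFinM ?mule0 ltry.
rewrite gE; [|lra|lra|lra].
rewrite integral_cst//= lebesgue_measure_itv/= lte_fin.
move: t0; rewrite le_eqVlt => /predU1P[<-|->].
  by rewrite ltxx mule0 sube0 !subrr.
by rewrite oppr0 adde0 -EFinM -EFinB /up /tilt; congr EFin; ring.
Unshelve. all: by end_near. Qed.

End LipschitzLine.

Section LebesgueAffine.
Context {R : realType} {m : nat}.
Notation T := (borel 'rV[R]_m).
Notation L := (lebn m).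

Lemma lebn_integral_affine (a : 'rV[R]_m) (l : R) (f : T -> \bar R) : 0 < l ->
  measurable_fun setT f -> (forall x, (0 <= f x)%E) ->
  (\int[L]_x f (affine_rV a l x) = (l^-1 ^+ m)%:E * \int[L]_x f x)%E.
Proof.
move=> l0 mf f0.
have lm0 : 0 <= l^-1 ^+ m by rewrite exprn_ge0// invr_ge0 ltW.
have mA := measurable_affine_rV a l.
transitivity (\int[pushforward L (affine_rV a l : T -> T)]_x f x)%E.
  by rewrite ge0_integral_pushforward.
transitivity (\int[mscale (NngNum lm0) L]_x f x)%E; last first.
  by rewrite ge0_integral_mscale.
by apply: eq_measure_integral => A mA' _; exact: lebn_affine.
Qed.

End LebesgueAffine.

Lemma finite_pos_lb {R : realType} (I : finType) (d : I -> R) :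
  (forall i, 0 < d i) -> exists D, 0 < D /\ forall i, D <= d i.
Proof.
move=> d0; exists (\big[Num.min/1]_i d i); split; last by move=> i; exact: bigmin_le.
by elim/big_ind : _ => // x y x0 y0; rewrite lt_min x0 y0.
Qed.

Section Rademacher.
Context {R : realType} {m : nat}.
Notation T := (borel 'rV[R]_m).
Notation L := (lebn m).
Variables (f : 'rV[R]_m -> R) (K : R).
Hypothesis fK : forall x y, `|f x - f y| <= K * `|x - y|.

Notation ev := (delta_mx 0 : 'I_m -> 'rV[R]_m).

Lemma norm_ev (j : 'I_m) : `|ev j : 'rV[R]_m| = 1.
Proof.
apply/eqP; rewrite eq_le; apply/andP; split.
  apply: norm_rV_le => // i; rewrite mxE eqxx /=.
  by case: (i == j); rewrite ?normr1 ?normr0.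
by have := le_coord_norm (ev j) j; rewrite mxE !eqxx normr1.
Qed.

Definition line_fun (y : 'rV[R]_m) (j : 'I_m) (s : R) : R := f (y + s *: ev j).

Lemma line_lip y j s t : `|line_fun y j s - line_fun y j t| <= K * `|s - t|.
Proof.
apply: le_trans (fK _ _) _.
by rewrite opprD addrACA subrr add0r -scalerBl normrZ norm_ev mulr1.
Qed.

Definition partial_limsup (j : 'I_m) (y : T) : R :=
  quotient_limsup (line_fun y j) 0.

Lemma partial_limsup_line j y s :
  partial_limsup j (y + s *: ev j) = quotient_limsup (line_fun y j) s.
Proof.
rewrite /partial_limsup /quotient_limsup; congr limn_sup; apply/funext => k.
by rewrite /line_fun add0r scale0r addr0 -addrA -scalerDl.
Qed.

Lemma lip_rV_continuous : continuous f.
Proof.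
move=> x; apply/(@cvgrPdist_le _ _ _ (nbhs x)) => e e0; near=> y.
apply: le_trans (fK _ _) _.
have K1 : 0 < `|K| + 1 by rewrite ltr_wpDl.
apply: (@le_trans _ _ ((`|K| + 1) * `|x - y|)).
  by rewrite ler_wpM2r// (le_trans (ler_norm _))// lerDl.
rewrite -ler_pdivlMl//; near: y.
by apply: cvgr_dist_le => //; rewrite mulr_gt0// invr_gt0.
Unshelve. all: by end_near. Qed.

Lemma measurable_partial_limsup j : measurable_fun setT (partial_limsup j).
Proof.
apply: measurable_fun_limn_sup.
- move=> t _; exists K => _ [k _ <-].
  by have := quotient_bound (line_lip t j) 0 k; rewrite ler_norml => /andP[].
- move=> t _; exists (- K) => _ [k _ <-].
  by have := quotient_bound (line_lip t j) 0 k; rewrite ler_norml => /andP[].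
- move=> k; apply: measurable_funM; last exact: measurable_cst.
  apply: measurable_funB; apply: continuous_borel_real => x;
    (apply: continuous_comp; last exact: lip_rV_continuous);
    exact: (cvgD cvg_id (cvg_cst _)).
Qed.

Lemma partial_limsup_bound j y : `|partial_limsup j y| <= K.
Proof. exact: (quotient_limsup_bound (line_lip y j)). Qed.

(** At a Lebesgue point of the partial derivative in direction [j], increments in
    that direction are nearly linear: by Tonelli, some segment close to the given
    one carries little deviation of the partial derivative. *)
Lemma segment_increment (a : 'rV[R]_m) (j : 'I_m) :
  (forall t, 0 < t -> exists d, 0 < d /\ forall r, 0 < r < d ->
    (\int[L]_(x in (ball a r : set T)) `|partial_limsup j x - partial_limsup j a|%:E
       <= (t * r ^+ m)%:E)%E) ->
  forall e, 0 < e -> exists d, 0 < d /\ forall r, 0 < r < d ->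
    forall (z : 'rV[R]_m) t, `|z| <= 2 * r -> 0 <= t <= r ->
    `|f (a + z + t *: ev j) - f (a + z) - t * partial_limsup j a| <= e * r.
Proof.
set G := partial_limsup j => lebpt e e0.
have K0 : 0 <= K.
  have := fK (ev j) 0; rewrite subr0 norm_ev mulr1.
  exact: le_trans.
pose del := Num.min 1 (e / (4 * K + 1)).
have K41 : 0 < 4 * K + 1 by rewrite ltr_wpDl// mulr_ge0.
have del0 : 0 < del by rewrite lt_min ltr01 divr_gt0.
have del1 : del <= 1 by rewrite ge_min lexx.
have Kdel : 2 * K * del <= e / 2.
  apply: (@le_trans _ _ (2 * K * (e / (4 * K + 1)))).
    by rewrite ler_wpM2l ?mulr_ge0// ge_min lexx orbT.
  by rewrite mulrA ler_pdivrMr//; nra.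
pose eps := e / 2 * del ^+ m / 4 ^+ m / 2.
have dm : 0 < del ^+ m by rewrite exprn_gt0.
have p4 : 0 < 4 ^+ m :> R by rewrite exprn_gt0.
have eps0 : 0 < eps by rewrite !divr_gt0// mulr_gt0// divr_gt0.
have [d [d0 hd]] := lebpt _ eps0.
exists (d / 4); split; first by rewrite divr_gt0.
move=> r /andP[r0 rd] z t zr /andP[t0 tr].
have r4 : 0 < 4 * r < d by rewrite mulr_gt0//= mulrC -ltr_pdivlMr.
pose h := ((fun x : T => `|G x - G a|%:E) \_ (ball a (4 * r) : set T)).
have mGa : measurable_fun setT (fun x : T => `|G x - G a|%:E).
  apply/measurable_EFinP; apply: measurableT_comp => //.
  by apply: measurable_funB; [exact: measurable_partial_limsup|exact: measurable_cst].
have mh : measurable_fun setT h.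
  by apply/(measurable_restrictT _ _).1; [exact: ball_borel|exact: measurable_funS mGa].
have h0 x : (0 <= h x)%E by rewrite /h patchE; case: ifP => // _; rewrite lee_fin.
have hint : (\int[L]_x h x <= (eps * (4 * r) ^+ m)%:E)%E.
  by rewrite /h -integral_mkcond; exact: hd.
pose H (ys : T * measurableTypeR R) : \bar R :=
  if ys.2 \in `]0, t] then h (affine_rV (a + z + ys.2 *: ev j) 1 ys.1) else 0%E.
have mH : measurable_fun setT H.
  apply: measurable_fun_if => //.
  - apply: (measurable_fun_bool true).
    rewrite setTI (_ : _ @^-1` _ = setT `*` `]0, t]%classic).
      by apply: measurableX => //; exact: measurable_itv.
    by apply/seteqP; split => -[y s] /=; [split|case].
  - apply: measurable_funS (_ : measurable_fun setT _) => //.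
    apply: (measurableT_comp mh); apply: measurable_rV => i.
    rewrite (_ : (fun _ => _) = (fun ys : T * measurableTypeR R =>
       (a + z) 0 i + ys.2 * ev j 0 i + ys.1 0 i)).
      apply: measurable_funD.
        apply: measurable_funD; first exact: measurable_cst.
        by apply: measurable_funM; [exact: measurable_snd|exact: measurable_cst].
      by apply: (measurableT_comp (measurable_coord i)); exact: measurable_fst.
    by apply/funext => -[y s] /=; rewrite /affine_rV scale1r !mxE.
have H0 ys : (0 <= H ys)%E by rewrite /H; case: ifP.
have tonelli : (\int[L]_y \int[lebesgue_measure]_s H (y, s) <= (t * (eps * (4 * r) ^+ m))%:E)%E.
  have -> := fubini_tonelli (m1 := L) (m2 := lebesgue_measure) H mH H0.
  apply: (@le_trans _ _ (\int[lebesgue_measure]_(s in `]0%R, t]) (eps * (4 * r) ^+ m)%:E)%E).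
    rewrite [leRHS]integral_mkcond; apply: ge0_le_integral => //.
    - by move=> s _; apply: integral_ge0.
    - exact: measurable_fun_fubini_tonelli_G.
    - by apply/(measurable_restrictT _ _).1; [exact: measurable_itv|exact: measurable_cst].
    - move=> s _; rewrite /H patchE mem_setE /=; case: ifP => _; last by rewrite integral0.
      by rewrite lebn_integral_affine// invr1 expr1n mul1e.
  rewrite integral_cst//=.
  rewrite lebesgue_measure_itv/= lte_fin; case: ifP => _.
    by rewrite oppr0 adde0 -EFinM mulrC.
  rewrite mule0 lee_fin; apply: mulr_ge0 => //; apply: mulr_ge0; first exact: ltW.
  by apply: exprn_ge0; apply: ltW; case/andP: r4.
have dr0 : 0 < del * r by rewrite mulr_gt0.
have [y [yQ hy]] : exists y : 'rV[R]_m, `|y| < del * r /\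
    (\int[lebesgue_measure]_s H (y, s) <= (e / 2 * r)%:E)%E.
  apply: contrapT => /forallNP none.
  have : ((e / 2 * r)%:E * L (ball (0%R : 'rV[R]_m) (del * r) : set T) <=
      (t * (eps * (4 * r) ^+ m))%:E)%E.
    rewrite -integral_cst; last exact: ball_borel.
    apply: le_trans tonelli; rewrite integral_mkcond; apply: ge0_le_integral => //.
    - by move=> y _; rewrite patchE; case: ifP => // _; rewrite lee_fin mulr_ge0 ?divr_ge0 ?ltW.
    - by apply/(measurable_restrictT _ _).1; [exact: ball_borel|exact: measurable_cst].
    - exact: measurable_fun_fubini_tonelli_F.
    - move=> y _; rewrite patchE; case: ifPn => [|_]; last exact: integral_ge0.
      rewrite inE -ball_normE /= sub0r normrN => yd.
      rewrite leNgt; apply/negP => bad; apply: (none y); split => //; exact: ltW.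
  apply/negP; rewrite -ltNge.
  apply: (@lt_le_trans _ _ ((e / 2 * r)%:E * ((del * r) ^+ m)%:E)%E).
    rewrite -EFinM lte_fin /eps !exprMn.
    have rm : 0 < r ^+ m by rewrite exprn_gt0.
    rewrite [ltLHS](_ : _ = t * (e / 2 / 2 * del ^+ m * r ^+ m)); last first.
      by field; rewrite gt_eqF.
    rewrite [ltRHS](_ : _ = r * (e / 2 * del ^+ m * r ^+ m)); last by ring.
    apply: (@le_lt_trans _ _ (r * (e / 2 / 2 * del ^+ m * r ^+ m))).
      by rewrite ler_wpM2r// !mulr_ge0 ?divr_ge0 ?ltW.
    by rewrite ltr_pM2l// ltr_pM2r// ltr_pM2r//; lra.
  by apply: lee_wpmul2l; [rewrite lee_fin mulr_ge0 ?divr_ge0 ?ltW|exact: lebn_ball_ge].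
have inc : `|f (a + z + y + t *: ev j) - f (a + z + y) - t * G a| <= e / 2 * r.
  rewrite -lee_fin; apply: le_trans hy.
  have uL := line_lip (a + z + y) j.
  have := lipschitz_integral uL t0; rewrite /line_fun scale0r addr0 => E.
  have mq : measurable_fun setT (quotient_limsup (line_fun (a + z + y) j) : measurableTypeR R -> R).
    exact: measurable_quotient_limsup uL.
  have mt : measurable (`]0%R, t] : set (measurableTypeR R)) by exact: measurable_itv.
  have tfin : (lebesgue_measure (`]0%R, t] : set (measurableTypeR R)) < +oo)%E.
    by rewrite lebesgue_measure_itv/= lte_fin; case: ifP => _; rewrite ?ltry// -EFinD ltry.
  have iq : lebesgue_measure.-integrable (`]0%R, t] : set (measurableTypeR R))
      (EFin \o quotient_limsup (line_fun (a + z + y) j)).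
    apply: measurable_bounded_integrable => //; first exact: measurable_funS mq.
    exists K; split; first exact: num_real.
    by move=> x Kx s _; exact: le_trans (quotient_limsup_bound uL s) (ltW Kx).
  have ic : lebesgue_measure.-integrable (`]0%R, t] : set (measurableTypeR R)) (EFin \o cst (G a)).
    apply: measurable_bounded_integrable => //.
    exists `|G a|; split; first exact: num_real.
    by move=> x Kx s _; exact: ltW.
  have -> : (`|f (a + z + y + t *: ev j) - f (a + z + y) - t * G a|%:E =
     `|\int[lebesgue_measure]_(s in `]0%R, t]) ((quotient_limsup (line_fun (a + z + y) j) s)%:E - (G a)%:E)|)%E.
    rewrite integralB// E integral_cst//= lebesgue_measure_itv/= lte_fin.
    move: t0; rewrite le_eqVlt => /predU1P[<-|->].
      by rewrite ltxx mule0 mul0r.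
    by rewrite oppr0 adde0 -EFinM [G a * t]mulrC.
  apply: le_trans (le_abse_integral _ _ _) _ => //.
    by apply: emeasurable_funB; [case/integrableP: iq|exact: measurable_cst].
  rewrite integral_mkcond le_eqVlt; apply/orP; left; apply/eqP.
  apply: eq_integral => s _; rewrite patchE /H mem_setE /=; case: ifP => // st.
  rewrite /h patchE mem_set; last first.
    rewrite -ball_normE /= /affine_rV scale1r distrC.
    have -> : a + z + s *: ev j + y - a = z + (s *: ev j + y).
      by rewrite -!addrA [LHS]addrC -!addrA addNr addr0.
    apply: le_lt_trans (ler_normD _ _) _; apply: le_lt_trans (lerD (lexx _) (ler_normD _ _)) _.
    rewrite normrZ norm_ev mulr1.
    move: st; rewrite in_itv/= => /andP[s0 st]; rewrite (ger0_norm (ltW s0)).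
    have : del * r <= r by rewrite ler_piMl// ltW.
    lra.
  rewrite /affine_rV scale1r /=; congr (`| _ - _|%:E).
  by rewrite /G -partial_limsup_line; congr partial_limsup; rewrite -!addrA; congr (_ + (_ + _)); rewrite addrC.
have c1 := fK (a + z + t *: ev j) (a + z + y + t *: ev j).
have c2 := fK (a + z + y) (a + z).
have n1 : `|a + z + t *: ev j - (a + z + y + t *: ev j)| = `|y|.
  by rewrite opprD addrACA subrr addr0 opprD addrA subrr sub0r normrN.
have n2 : `|a + z + y - (a + z)| = `|y| by rewrite addrAC subrr add0r.
rewrite n1 in c1; rewrite n2 in c2.
have Ky : K * `|y| <= K * (del * r) by rewrite ler_wpM2l// ltW.
have Kd : 2 * (K * (del * r)) <= e / 2 * r.
  have -> : 2 * (K * (del * r)) = 2 * K * del * r by ring.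
  by rewrite ler_wpM2r// ltW.
move: inc c1 c2; rewrite !ler_norml => /andP[i1 i2] /andP[j1 j2] /andP[k1 k2].
by apply/andP; split; lra.
Qed.

Definition partial_path (z : 'rV[R]_m) (k : nat) : 'rV[R]_m :=
  \row_i (if (i < k)%N then z 0 i else 0).

Lemma partial_path_norm z k : `|partial_path z k| <= `|z|.
Proof.
apply: norm_rV_le => // j; rewrite mxE; case: ifP => _; last by rewrite normr0.
exact: le_coord_norm.
Qed.

Lemma partial_pathS z (j : 'I_m) :
  partial_path z j.+1 = partial_path z j + z 0 j *: ev j.
Proof.
apply/rowP => i; rewrite !mxE eqxx /= ltnS leq_eqVlt.
have [->|ij] := eqVneq i j; first by rewrite eqxx ltnn add0r mulr1.
by rewrite (inj_eq val_inj) (negbTE ij) mulr0 addr0.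
Qed.

(** Going from [a] to [a + z] one coordinate at a time, [segment_increment]
    bounds each increment. *)
Lemma rademacher_scalar : L.-negligible [set a | ~ (exists G : 'I_m -> R,
  forall e, 0 < e -> exists d, 0 < d /\ forall z : 'rV[R]_m, `|z| < d ->
    `|f (a + z) - f a - \sum_j z 0 j * G j| <= e * `|z|)].
Proof.
pose bad (j : 'I_m) := [set a : T | ~ (forall t, 0 < t -> exists d, 0 < d /\
  forall r, 0 < r < d ->
    (\int[L]_(x in (ball (a : 'rV[R]_m) r : set T)) `|partial_limsup j x - partial_limsup j a|%:E
       <= (t * r ^+ m)%:E)%E)].
have nbad j : L.-negligible (bad j).
  apply: lebesgue_points; first exact: measurable_partial_limsup.
  move=> k; apply: (@le_lt_trans _ _ (\int[L]_(x in (ball (0%R : 'rV[R]_m) k%:R : set T)) K%:E)%E).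
    apply: ge0_le_integral => //; first exact: ball_borel.
    - apply/measurable_EFinP; apply: measurableT_comp => //.
      exact: measurable_funS (measurable_partial_limsup j).
    - by move=> x _; rewrite lee_fin; exact: partial_limsup_bound.
  rewrite integral_cst; last exact: ball_borel.
  have [k0|k0] := ltP 0 (k%:R : R); last by rewrite le0_ball0// measure0 mule0 ltry.
  have := lebn_ball (0 : 'rV[R]_m) k0.
  rewrite -ge0_fin_numE ?mule_ge0//; last first.
    by rewrite lee_fin (le_trans _ (partial_limsup_bound j 0)).
  move=> h; apply: fin_numM => //; rewrite ge0_fin_numE//; exact: le_lt_trans h (ltry _).
pose B i : set T := if insub i is Some j then bad j else set0.
have nB : L.-negligible (\bigcup_i B i).
  apply: negligible_bigcup => i; rewrite /B; case: insub => [j|]; first exact: nbad.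
  exact: negligible_set0.
apply: negligibleS nB => a; apply: contra_notP => nb.
have good j : forall t, 0 < t -> exists d, 0 < d /\ forall r, 0 < r < d ->
    (\int[L]_(x in (ball (a : 'rV[R]_m) r : set T)) `|partial_limsup j x - partial_limsup j a|%:E
       <= (t * r ^+ m)%:E)%E.
  apply: contrapT => bj; apply: nb; exists (j : nat) => //.
  by rewrite /B valK.
exists (fun j => partial_limsup j a) => e e0.
have m1 : (0 : R) < m.+1%:R by [].
have em : 0 < e / m.+1%:R by rewrite divr_gt0.
have /choice[d dP] j := segment_increment (good j) em.
have [D [D0 Dd]] := finite_pos_lb (fun j => (dP j).1).
exists D; split => // z zD.
have [->|z0] := eqVneq z 0.
  rewrite addr0 subrr sub0r normrN normr0 mulr0 big1 ?normr0// => j _.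
  by rewrite mxE mul0r.
have nz : 0 < `|z| by rewrite normr_gt0.
have step (j : 'I_m) : `|f (a + partial_path z j.+1) - f (a + partial_path z j) -
    z 0 j * partial_limsup j a| <= e / m.+1%:R * `|z|.
  have [_ hd] := dP j; have zr : 0 < `|z| < d j by rewrite nz (lt_le_trans zD).
  have zj := le_coord_norm z j.
  have pn := partial_path_norm z j.
  rewrite partial_pathS addrA; have [z0j|z0j] := leP 0 (z 0 j).
    apply: hd => //; first by rewrite mulr_natl mulr2n ler_wpDl.
    by rewrite z0j (le_trans (ler_norm _)).
  have h1 : `|partial_path z j.+1| <= 2 * `|z|.
    by rewrite (le_trans (partial_path_norm _ _))// mulr_natl mulr2n ler_wpDl.
  have h2 : 0 <= - z 0 j <= `|z|.
    by rewrite oppr_ge0 ltW//= (le_trans (ler_norm _))// normrN.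
  have := hd _ zr _ _ h1 h2; rewrite partial_pathS addrA scaleNr addrK => h.
  apply: le_trans h; rewrite -[leRHS]normrN le_eqVlt; apply/orP; left; apply/eqP.
  by congr `|_|; ring.
have tele : f (a + z) - f a = \sum_(j < m) (f (a + partial_path z j.+1) - f (a + partial_path z j)).
  rewrite -(big_mkord xpredT (fun j => f (a + partial_path z j.+1) - f (a + partial_path z j))).
  rewrite (telescope_sumr (fun k => f (a + partial_path z k)))//.
  congr (f _ - f _).
    by congr (_ + _); apply/rowP => i; rewrite mxE ltn_ord.
  by rewrite -[LHS]addr0; congr (_ + _); apply/rowP => i; rewrite !mxE.
rewrite tele -sumrB; apply: le_trans (ler_norm_sum _ _ _) _.
apply: (@le_trans _ _ (\sum_(j < m) e / m.+1%:R * `|z|)).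
  by apply: ler_sum => j _; exact: step.
rewrite sumr_const card_ord -[leLHS]mulr_natr mulrAC ler_wpM2r//.
by rewrite mulrAC ler_pdivrMr// ler_wpM2l ?ler_nat// ltW.
Qed.

End Rademacher.

(** Only finitely many coordinates have to be treated, so the exceptional sets
    add up to a null set. *)
Lemma rademacher {R : realType} {p m : nat} (f : 'rV[R]_p -> 'rV[R]_m) (K : R) :
  (forall x y, `|f x - f y| <= K * `|x - y|) ->
  (lebn p).-negligible [set a : borel 'rV[R]_p | ~ (exists A : 'M[R]_(p, m),
    forall e, 0 < e -> exists d, 0 < d /\ forall z : 'rV[R]_p, `|z| < d ->
      `|f (a + z) - f a - z *m A| <= e * `|z|)].
Proof.
move=> fK.
have fiK i x y : `|f x 0 i - f y 0 i| <= K * `|x - y|.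
  by apply: le_trans (fK x y); have := le_coord_norm (f x - f y) i; rewrite !mxE.
pose bad (i : 'I_m) := [set a : borel 'rV[R]_p | ~ (exists G : 'I_p -> R,
  forall e, 0 < e -> exists d, 0 < d /\ forall z : 'rV[R]_p, `|z| < d ->
    `|f (a + z) 0 i - f a 0 i - \sum_j z 0 j * G j| <= e * `|z|)].
have nbad i : (lebn p).-negligible (bad i) by exact: rademacher_scalar (fiK i).
pose B k : set (borel 'rV[R]_p) := if insub k is Some i then bad i else set0.
have nB : (lebn p).-negligible (\bigcup_k B k).
  apply: negligible_bigcup => k; rewrite /B; case: insub => [i|]; first exact: nbad.
  exact: negligible_set0.
apply: negligibleS nB => a; apply: contra_notP => nb.
have good (i : 'I_m) : exists G : 'I_p -> R,
  forall e, 0 < e -> exists d, 0 < d /\ forall z : 'rV[R]_p, `|z| < d ->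
    `|f (a + z) 0 i - f a 0 i - \sum_j z 0 j * G j| <= e * `|z|.
  apply: contrapT => bi; apply: nb; exists (i : nat) => //.
  by rewrite /B valK.
have [G GP] := choice good.
exists (\matrix_(j, i) G i j) => e e0.
have /choice[d dP] i := GP i e e0.
have [D [D0 Dd]] := finite_pos_lb (fun i => (dP i).1).
exists D; split => // z zD; apply: norm_rV_le => [|i].
  by rewrite mulr_ge0// ltW.
have [_ /(_ z (lt_le_trans zD (Dd i)))] := dP i.
rewrite !mxE; congr (`|_ - _| <= _); apply: eq_bigr => j _.
by rewrite mxE.
Qed.

(** * Sets of vanishing p-dimensional content *)

(** Sums over a countable type, as series along its enumeration. *)
Lemma esum_enum {R : realType} (I : countType) (w : I -> \bar R) :
  (forall i, (0 <= w i)%E) ->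
  (\sum_(k <oo) (if (pickle_inv k : option I) is Some i then w i else 0) =
   \esum_(i in [set: I]) w i)%E.
Proof.
move=> w0; pose t k : \bar R := if (pickle_inv k : option I) is Some i then w i else 0%E.
have t0 k : (0 <= t k)%E by rewrite /t; case: pickle_inv.
rewrite nneseries_esumT//.
have bij : set_bij [set: I] (range (@pickle I)) pickle.
  split; [by move=> i _; exists i | by move=> x y _ _; exact: (pcan_inj pickleK) | by []].
transitivity (\esum_(k in range (@pickle I)) t k)%E.
  rewrite [RHS]esum_mkcond; apply: eq_esum => k _; rewrite -/(t k).
  case: ifPn => // /negP; rewrite inE => nk.
  rewrite /t; case E : ((pickle_inv k : option I)) => [i|//]; exfalso; apply: nk.
  by exists i => //; have := @pickle_invK I k; rewrite E.
rewrite (reindex_esum [set: I] (range (@pickle I)) pickle t bij).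
by apply: eq_esum => i _; rewrite /t pickleK_inv.
Qed.

Section BallCover.
Context {R : realType} {m : nat}.
Variable p : nat.
Implicit Types A : set 'rV[R]_m.

Definition ball_cover A (e : \bar R) : Prop :=
  exists (c : nat -> 'rV[R]_m) (r : nat -> R), [/\ forall k, 0 <= r k,
    A `<=` \bigcup_k ball (c k) (r k) &
    (\sum_(k <oo) (r k ^+ p)%:E <= e)%E].

Definition pnull A : Prop := forall e, 0 < e -> ball_cover A e%:E.

Lemma ball_coverS A B e : A `<=` B -> ball_cover B e -> ball_cover A e.
Proof.
by move=> AB [c [r [r0 Bc re]]]; exists c, r; split=> //; exact: subset_trans Bc.
Qed.

Lemma ball_coverW A e e' : (e <= e')%E -> ball_cover A e -> ball_cover A e'.
Proof.
by move=> ee' [c [r [r0 Bc re]]]; exists c, r; split=> //; exact: le_trans re ee'.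
Qed.

Lemma pnullS A B : A `<=` B -> pnull B -> pnull A.
Proof. by move=> AB B0 e e0; apply: ball_coverS AB _; exact: B0. Qed.

Hypothesis p0 : (0 < p)%N.

Lemma ball_cover_count (I : countType) A (c : I -> 'rV[R]_m) (r : I -> R) e :
  (forall i, 0 <= r i) -> A `<=` \bigcup_i ball (c i) (r i) ->
  (\esum_(i in [set: I]) (r i ^+ p)%:E <= e)%E -> ball_cover A e.
Proof.
move=> r0 Ac re.
exists (fun k => if (pickle_inv k : option I) is Some i then c i else 0).
exists (fun k => if (pickle_inv k : option I) is Some i then r i else 0); split.
- by move=> k; case: pickle_inv.
- by move=> x /Ac[i _ xi]; exists (pickle i) => //; rewrite pickleK_inv.
- apply: le_trans re; rewrite -esum_enum; last by move=> i; rewrite lee_fin exprn_ge0.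
  apply: lee_nneseries => [k _ _|k _]; case: pickle_inv => [i|].
  + by rewrite lee_fin exprn_ge0.
  + by rewrite lee_fin exprn_ge0.
  + by [].
  + by rewrite expr0n eqn0Ngt p0.
Qed.

Lemma ball_cover_set0 e : (0 <= e)%E -> ball_cover set0 e.
Proof.
move=> e0; exists (fun=> 0), (fun=> 0); split => //.
by rewrite eseries0// => k _ _; rewrite expr0n eqn0Ngt p0.
Qed.

Lemma ball_cover_fin (I : finType) A (c : I -> 'rV[R]_m) (r : R) :
  0 <= r -> A `<=` \bigcup_i ball (c i) r ->
  ball_cover A (#|I|%:R * r ^+ p)%:E.
Proof.
move=> r0 Ac; apply: (@ball_cover_count I A c (fun=> r)) => //.
rewrite esum_fset; [|exact: finite_finset|by move=> i _; rewrite lee_fin exprn_ge0].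
rewrite fsbig_finite; last exact: finite_finset.
rewrite (perm_big (index_enum I))/=; last first.
  apply: uniq_perm; [exact: finmap.fset_uniq|exact: index_enum_uniq|move=> i].
  by rewrite mem_index_enum in_fset_set ?in_setT//; exact: finite_finset.
by rewrite sumEFin lee_fin sumr_const -[leLHS]mulr_natl.
Qed.

Lemma ball_cover_bigcup (A : nat -> set 'rV[R]_m) (x : nat -> \bar R) :
  (forall i, ball_cover (A i) (x i)) ->
  ball_cover (\bigcup_i A i) (\sum_(i <oo) x i)%E.
Proof.
move=> /choice[c /choice[r cr]].
have r0 i k : 0 <= r i k by have [] := cr i.
apply: (@ball_cover_count (nat * nat)%type _ (fun ij => c ij.1 ij.2) (fun ij => r ij.1 ij.2)) => //.
  move=> v [i _ Av]; have [_ + _] := cr i => /(_ v Av)[k _ vk].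
  by exists (i, k).
rewrite -[X in (\esum_(_ in X) _ <= _)%E]setXTT.
have := @esum_esum R nat nat setT (fun=> setT) (fun i j => (r i j ^+ p)%:E).
move=> <-; last by move=> i j _ _; rewrite lee_fin exprn_ge0.
rewrite -nneseries_esumT; last by move=> i; apply: esum_ge0 => j _; rewrite lee_fin exprn_ge0.
apply: lee_nneseries => [i _ _|i _]; first by apply: esum_ge0 => j _; rewrite lee_fin exprn_ge0.
rewrite -nneseries_esumT; last by move=> j; rewrite lee_fin exprn_ge0.
by have [] := cr i.
Qed.

Lemma pnull_bigcup (A : nat -> set 'rV[R]_m) :
  (forall i, pnull (A i)) -> pnull (\bigcup_i A i).
Proof.
move=> A0 e e0.
have ek k : 0 < e / (2 ^ k.+1)%:R by rewrite divr_gt0// ltr0n expn_gt0.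
have := ball_cover_bigcup (fun i => A0 i _ (ek i)).
apply: ball_coverW.
apply: (@le_trans _ _ (\sum_(i <oo) (0 + (e / (2 ^ i.+1)%:R)%:E))%E).
  by apply: lee_nneseries => [i _ _|i _]; rewrite ?add0e// lee_fin ltW.
apply: le_trans (epsilon_trick xpredT _ (ltW e0)) _ => //.
by rewrite eseries0// add0e.
Qed.

(** Intersect the open sets given by the covers of small content. *)
Lemma pnull_negligible (mu : {measure set (borel 'rV[R]_m) -> \bar R}) :
  (forall B : set (borel 'rV[R]_m), measurable B -> pnull B -> mu B = 0%E) ->
  forall A, pnull A -> mu.-negligible (A : set (borel 'rV[R]_m)).
Proof.
move=> mu0 A A0.
have k0 (k : nat) : (0 : R) < k.+1%:R^-1 by rewrite invr_gt0.
have /choice[c cP] := fun k => A0 _ (k0 k).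
have {cP} [r cP] := choice cP.
pose O k : set (borel 'rV[R]_m) := \bigcup_j ball (c k j) (r k j).
have mO k : measurable (O k).
  by apply: open_borel; apply: bigcup_open => j _; exact: ball_open.
have mB : measurable (\bigcap_k O k) by exact: bigcapT_measurable.
exists (\bigcap_k O k); split => //.
  apply: mu0 => // e e0.
  exists (c (Num.bound e^-1)), (r (Num.bound e^-1)).
  have [h1 h2 h3] := cP (Num.bound e^-1); split => //.
    by move=> v /(_ (Num.bound e^-1) Logic.I).
  apply: le_trans h3 _; rewrite lee_fin invf_ple ?posrE//= ltW//.
  by apply: (lt_trans (archi_boundP _)); rewrite ?invr_ge0 ?ltW// ltr_nat.
by move=> v Av k _; have [_ + _] := cP k; exact.
Qed.

End BallCover.

(** * Lipschitz images *)

Section LipschitzImages.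
Context {R : realType} {p m : nat}.
Hypothesis p0 : (0 < p)%N.
Variables (f : 'rV[R]_p -> 'rV[R]_m) (K : R).
Hypothesis fK : forall x y, `|f x - f y| <= K * `|x - y|.
Notation L := (lebn p).
Notation T := (borel 'rV[R]_p).

Let K0 : 0 <= `|K| + 1. Proof. by rewrite addr_ge0. Qed.

Lemma lip_dcube i v x : dcubes i v -> dcubes i x ->
  `|f v - f x| < (`|K| + 1) * 2 ^- @dlevel p i.
Proof.
move=> hv hx; move: (hv) (hx); rewrite (dcubesP hv) => h1 h2.
have vx := dcube_close h1 h2.
apply: le_lt_trans (fK _ _) _.
apply: (@le_lt_trans _ _ (`|K| * `|v - x|)); first by rewrite ler_wpM2r// ler_norm.
apply: le_lt_trans (ler_wpM2l (normr_ge0 K) (ltW vx)) _.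
by rewrite ltr_pM2r ?ltrDl// invr_gt0 exprn_gt0.
Qed.

Lemma lebn_dcubes i : (dcubes i : set 'rV[R]_p) !=set0 ->
  L (dcubes i : set T) = ((2 ^- @dlevel p i) ^+ p)%:E.
Proof.
by rewrite /dcubes /dlevel; case: unpickle => [kz _|[]//]; exact: lebn_dcube.
Qed.

(** The content is subadditive and the measure is additive over disjoint
    dyadic cubes. *)
Lemma ball_cover_dcubes (P : set nat) (V : set 'rV[R]_p) (C : R) : 0 <= C -> measurable (V : set T) ->
  (forall i, P i -> (dcubes i : set 'rV[R]_p) !=set0 -> dcubes i `<=` V) ->
  (forall i, P i -> (dcubes i : set 'rV[R]_p) !=set0 ->
    ball_cover p (f @` dcubes i) (C%:E * L (dcubes i : set T))%E) ->
  ball_cover p (f @` (\bigcup_(i in P) dcubes i)) (C%:E * L V)%E.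
Proof.
move=> C0 mV PV Pf; have [M [MP trivM coverM]] := @dcubes_select R p P.
pose D i : set T := if i \in M then dcubes i else set0.
have mD i : measurable (D i) by rewrite /D; case: ifP => // _; exact: measurable_dcubes.
have trivD : trivIset setT D.
  move=> i j _ _ [v]; rewrite /D; case: ifP => [/set_mem Mi|_ [] //].
  by case: ifP => [/set_mem Mj [iv jv]|_ [] //]; apply: trivM => //; exists v.
have cov i : ball_cover p (f @` D i) (C%:E * L (D i))%E.
  rewrite /D; case: ifPn => [/set_mem Mi|_].
    have [->|/set0P ne] := eqVneq (dcubes i : set 'rV[R]_p) set0.
      by rewrite image_set0 measure0 mule0; exact: ball_cover_set0.
    by apply: Pf => //; exact: MP.
  by rewrite image_set0 measure0 mule0; exact: ball_cover_set0.
have := ball_cover_bigcup p0 cov.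
rewrite nneseriesZl//.
have mU : measurable (\bigcup_i D i) by exact: bigcup_measurable.
have /cvg_lim E := @measure_semi_sigma_additive _ _ _ L D mD trivD mU.
rewrite E// => h; apply: ball_coverW (ball_coverS _ h).
  apply: lee_wpmul2l; first by rewrite lee_fin.
  apply: le_measure; rewrite ?inE// => v [i _]; rewrite /D; case: ifPn => // /set_mem Mi vi.
  by apply: (PV i) => //; [exact: MP|exists v].
move=> _ [v [i Pi vi] <-]; have [j Mj [ij _]] := coverM i Pi (ex_intro _ v vi).
by exists j => //; exists v => //; rewrite /D mem_set//; exact: ij.
Qed.

(** Dyadic cubes of an open neighbourhood of small measure have images of
    comparably small content. *)
Lemma lip_image_null (A : set T) : L.-negligible A -> pnull p (f @` A).
Proof.
move=> [B [mB B0 AB]] e e0.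
have c0 : 0 < (`|K| + 1) ^+ p + 1 by rewrite ltr_wpDl// exprn_ge0.
have [V [oV BV LV]] := lebn_null_open mB B0 (divr_gt0 e0 c0).
pose P := [set i | (0 <= @dlevel p i)%N /\ (dcubes i : set 'rV[R]_p) `<=` V].
have VE : V = \bigcup_(i in P) dcubes i := open_dcubes 0 oV.
apply: (@ball_coverS _ _ _ _ (f @` V)).
  by apply: image_subset; exact: subset_trans BV.
have := @ball_cover_dcubes P V ((`|K| + 1) ^+ p).
rewrite -VE => h.
apply: ball_coverW (h _ _ _ _).
- apply: (@le_trans _ _ (((`|K| + 1) ^+ p)%:E * (e / ((`|K| + 1) ^+ p + 1))%:E)%E).
    by apply: lee_wpmul2l => //; rewrite lee_fin exprn_ge0.
  by rewrite -EFinM lee_fin mulrA ler_pdivrMr// [leLHS]mulrC ler_pM2l// lerDl.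
- exact: exprn_ge0.
- exact: open_borel.
- by move=> i [].
- move=> i [_ iV] [v iv]; rewrite lebn_dcubes; last by exists v.
  rewrite -EFinM -exprMn_comm; last exact: mulrC.
  have := @ball_cover_fin R m p p0 unit (f @` dcubes i) (fun=> f v) ((`|K| + 1) * 2 ^- @dlevel p i).
  rewrite card_unit mul1r; apply.
    by rewrite mulr_ge0// invr_ge0 exprn_ge0.
  move=> _ [x ix <-]; exists tt => //.
  by rewrite -ball_normE /=; exact: lip_dcube.
Qed.

End LipschitzImages.

Lemma pow2_small {R : realType} (k0 : nat) (e : R) : 0 < e ->
  exists2 k, (k0 <= k)%N & 2 ^- k < e.
Proof.
move=> e0; have r01 : 0 < Num.min (e / 2) 1 <= 1 by rewrite lt_min divr_gt0//= ltr01 ge_min lexx orbT.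
have [k /andP[_ ke]] := dyadic_scale r01.
exists (maxn k0 k); first exact: leq_maxl.
apply: (@le_lt_trans _ _ (2 ^- k)).
  by rewrite lef_pV2 ?posrE ?exprn_gt0// ler_weXn2l ?ler1n// leq_maxr.
by apply: (lt_le_trans ke); rewrite -ler_pdivlMl// mulrC ge_min lexx.
Qed.

Lemma grid_close {R : realType} (N : nat) (r y : R) : (0 < N)%N -> 0 < r ->
  `|y| <= 2 * r ->
  exists i : 'I_(4 * N).+1, `|y - (i%:R * (r / N%:R) - 2 * r)| <= r / N%:R.
Proof.
move=> N0 r0; rewrite ler_norml => /andP[y1 y2].
have N0' : 0 < N%:R :> R by rewrite ltr0n.
have s0 : 0 < r / N%:R by rewrite divr_gt0.
pose t := (y + 2 * r) / (r / N%:R).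
have t0 : 0 <= t by rewrite divr_ge0// ?(ltW s0)//; lra.
have yt : y = t * (r / N%:R) - 2 * r by rewrite /t divfK ?gt_eqF// addrK.
have /andP[h1 h2] := truncn_itv t0.
have t4 : t <= (4 * N)%:R.
  rewrite /t ler_pdivrMr// natrM -mulrA (mulrC _ (r / _)) divfK ?gt_eqF//; lra.
have i4 : (Num.truncn t < (4 * N).+1)%N.
  by rewrite ltnS -(ler_nat R); exact: le_trans t4.
exists (Ordinal i4) => /=; rewrite {1}yt.
rewrite (_ : _ - _ = (t - (Num.truncn t)%:R) * (r / N%:R)); last by ring.
rewrite ger0_norm; last by rewrite mulr_ge0 ?subr_ge0// ltW.
rewrite ler_piMl ?(ltW s0)//; move: h2; rewrite -natr1; lra.
Qed.

(** The image lies near a piece of hyperplane: the grid of mesh [r / N] needs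
    one power of [N] less than in full dimension. *)
Lemma slab_cover {R : realType} (q m N : nat) (f : 'rV[R]_q.+1 -> 'rV[R]_m)
    (Q : set 'rV[R]_q.+1) (a v : 'rV[R]_q.+1) (T : 'M[R]_(q.+1, m)) (K r : R) :
  (0 < N)%N -> 0 < r -> 0 <= K -> v != 0 -> v *m T = 0 ->
  (forall z : 'rV[R]_q.+1, `|z *m T| <= K * `|z|) ->
  (forall x, Q x -> `|x - a| < r /\ `|f x - f a - (x - a) *m T| <= r / N%:R) ->
  ball_cover q.+1 (f @` Q) (5 ^+ q * (K + 2) ^+ q.+1 / N%:R * r ^+ q.+1)%:E.
Proof.
move=> N0 r0 K0 v0 vT TK Qf.
have N0' : 0 < N%:R :> R by rewrite ltr0n.
have s0 : 0 < r / N%:R by rewrite divr_gt0.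
have [j vj] : exists j, `|v| = `|v 0 j|.
  have : `|v| != 0 by rewrite normr_eq0.
  by move=> /mx_norm_neq0[[i j]]; rewrite (ord1 i) => h; exists j.
have vj0 : v 0 j != 0 by rewrite -normr_eq0 -vj normr_eq0.
pose c (e : {ffun 'I_q -> 'I_(4 * N).+1}) : 'rV[R]_q.+1 :=
  \row_k if unlift j k is Some k' then (e k')%:R * (r / N%:R) - 2 * r else 0.
have key := @ball_cover_fin R m q.+1 isT {ffun 'I_q -> 'I_(4 * N).+1} (f @` Q)
  (fun e => f a + c e *m T) ((K + 2) * (r / N%:R)).
apply: ball_coverW (key _ _).
- rewrite lee_fin card_ffun !card_ord natrX exprMn.
  have h : (4 * N).+1%:R <= 5 * N%:R :> R by rewrite -natrM ler_nat; lia.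
  have h1 : (4 * N).+1%:R ^+ q <= (5 * N%:R) ^+ q :> R by rewrite lerXn2r// ?nnegrE ?mulr_ge0.
  apply: (le_trans (ler_wpM2r _ h1)).
    by rewrite mulr_ge0 ?exprn_ge0 ?addr_ge0// ltW.
  rewrite exprMn exprMn exprVn [N%:R ^+ q.+1]exprS.
  have := gt_eqF N0'; set x := N%:R => x0.
  have xq : x ^+ q != 0 by rewrite expf_neq0// x0.
  rewrite le_eqVlt; apply/orP; left; apply/eqP; field.
  by rewrite x0 xq.
- by rewrite mulr_ge0 ?addr_ge0// ltW.
- move=> _ [x Qx <-]; have [xa fx] := Qf x Qx.
  pose z : 'rV[R]_q.+1 := x - a; pose t := z 0 j / v 0 j; pose z' : 'rV[R]_q.+1 := z - t *: v.
  have zT : z *m T = z' *m T by rewrite /z' [RHS]mulmxBl -scalemxAl vT scaler0 subr0.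
  have z'r : `|z'| <= 2 * r.
    apply: (le_trans (ler_normB _ _)); rewrite normrZ /t normrM normfV -vj.
    rewrite divfK ?normr_eq0//; have := le_coord_norm z j; move: xa; rewrite -/z; lra.
  have z'j : z' 0 j = 0 by rewrite !mxE /t divfK// /z !mxE subrr.
  have /choice[e he] : forall k', exists i : 'I_(4 * N).+1,
      `|z' 0 (lift j k') - (i%:R * (r / N%:R) - 2 * r)| <= r / N%:R.
    by move=> k'; apply: grid_close => //; apply: le_trans (le_coord_norm _ _) z'r.
  exists [ffun k' => e k'] => //.
  rewrite -ball_normE /=.
  have zc : `|z' - c [ffun k' => e k']| <= r / N%:R.
    apply: norm_rV_le => [|k]; first exact: ltW.
    rewrite (_ : _ 0 k = z' 0 k - c [ffun k' => e k'] 0 k); last by rewrite !mxE.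
    rewrite [c _ 0 k]mxE.
    case: unliftP => [k' ->|->]; first by rewrite ffunE.
    by rewrite z'j subr0 normr0 ltW.
  rewrite -normrN opprB.
  rewrite (_ : f x - _ = (f x - f a - z *m T) + (z' - c [ffun k' => e k']) *m T); last first.
    by rewrite [(z' - _) *m T]mulmxBl -zT opprD !addrA subrK.
  apply: (le_lt_trans (ler_normD _ _)).
  apply: (le_lt_trans (lerD fx (le_trans (TK _) (ler_wpM2l K0 zc)))).
  rewrite -[X in X + _]mul1r -mulrDl ltr_pM2r//; lra.
Qed.

Lemma diff_norm_le {R : realType} (p m : nat) (f : 'rV[R]_p -> 'rV[R]_m)
    (K : R) (a : 'rV[R]_p) (T : 'M[R]_(p, m)) :
  (forall x y, `|f x - f y| <= K * `|x - y|) ->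
  (forall e, 0 < e -> exists2 d, 0 < d & forall z : 'rV[R]_p, `|z| < d ->
     `|f (a + z) - f a - z *m T| <= e * `|z|) ->
  forall z : 'rV[R]_p, `|z *m T| <= (`|K| + 1) * `|z|.
Proof.
move=> fK /(_ 1 ltr01)[d d0 fT] z.
have [->|z0] := eqVneq z 0; first by rewrite mul0mx !normr0 mulr0.
have nz : 0 < `|z| by rewrite normr_gt0.
pose t := d / 2 / `|z|; have t0 : 0 < t by rewrite !divr_gt0.
have tz : `|t *: z| = d / 2 by rewrite normrZ (gtr0_norm t0) /t divfK// gt_eqF.
have h : `|t *: z *m T| <= (`|K| + 1) * `|t *: z|.
  have tzd : `|t *: z| < d by rewrite tz; lra.
  have := fT (t *: z) tzd; rewrite tz => h1.
  have h2 : `|f (a + t *: z) - f a| <= `|K| * `|t *: z|.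
    apply: le_trans (fK _ _) _; rewrite addrAC subrr add0r.
    by rewrite ler_wpM2r// ler_norm.
  rewrite (_ : _ *m T = (f (a + t *: z) - f a) - (f (a + t *: z) - f a - t *: z *m T)).
    by apply: (le_trans (ler_normB _ _)); rewrite mulrDl -tz lerD// tz.
  by rewrite opprB addrC subrK.
clear - t0 h; clearbody t; move: h.
by rewrite -scalemxAl !normrZ (gtr0_norm t0) mulrCA ler_pM2l.
Qed.

(** Near such a point [slab_cover] gains an arbitrary factor over the volume
    of small dyadic cubes. *)
Lemma rankdef_null {R : realType} (q m : nat) (f : 'rV[R]_q.+1 -> 'rV[R]_m) (K : R) :
  (forall x y, `|f x - f y| <= K * `|x - y|) ->
  pnull q.+1 (f @` [set a | exists (v : 'rV[R]_q.+1) (T : 'M[R]_(q.+1, m)),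
    [/\ v != 0, v *m T = 0 &
      forall e, 0 < e -> exists2 d, 0 < d & forall z : 'rV[R]_q.+1, `|z| < d ->
       `|f (a + z) - f a - z *m T| <= e * `|z|]]).
Proof.
move=> fK; set A := [set a | _].
apply: (@pnullS _ _ _ _ (\bigcup_i (f @` (A `&` dcubes i)))).
  move=> _ [a Aa <-]; have : (setT : set 'rV[R]_q.+1) a by [].
  rewrite (open_dcubes 0 openT) => -[i _ ai]; exists i => //; exists a => //.
apply: pnull_bigcup => // i e e0.
have [[w wi]|ne] := pselect ((dcubes i : set 'rV[R]_q.+1) !=set0); last first.
  apply: (@ball_coverS _ _ _ _ set0); first by move=> x [a [_ ai] _]; case: ne; exists a.
  by apply: ball_cover_set0 => //; rewrite lee_fin ltW.
pose C : R := 5 ^+ q * (`|K| + 1 + 2) ^+ q.+1.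
have C0 : 0 <= C by rewrite mulr_ge0 ?exprn_ge0// !addr_ge0.
pose N := (Num.truncn (C / e)).+1.
have N0 : 0 < N%:R :> R by rewrite ltr0n.
have CN : C / N%:R <= e.
  rewrite ler_pdivrMr// mulrC -ler_pdivrMr// ltW//.
  by have /andP[] := truncn_itv (divr_ge0 C0 (ltW e0)).
pose P := [set k | (dcubes k : set 'rV[R]_q.+1) `<=` dcubes i /\
  exists a (v : 'rV[R]_q.+1) (T : 'M[R]_(q.+1, m)),
   [/\ dcubes k a, v != 0, v *m T = 0,
      forall z : 'rV[R]_q.+1, `|z *m T| <= (`|K| + 1) * `|z| &
      forall z : 'rV[R]_q.+1, `|z| < 2 ^- @dlevel q.+1 k ->
       `|f (a + z) - f a - z *m T| <= N%:R^-1 * `|z|]].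
apply: (@ball_coverS _ _ _ _ (f @` (\bigcup_(k in P) dcubes k))).
  apply: image_subset => a [[v [T [v0 vT fT]]] ai].
  have [d d0 dT] := fT N%:R^-1 (eqbRL (invr_gt0 _) N0).
  have [k ik kd] : exists2 k, (@dlevel q.+1 i <= k)%N & 2 ^- k < d.
    exact: pow2_small.
  exists (pickle (k, dindex k a)).
    rewrite /P /= dcubesE dlevelE; split.
      rewrite (dcubesP ai); apply: dcube_nested => //; exists a; split; exact: dcube_dindex.
    exists a, v, T; split => //; [exact: dcube_dindex|exact: diff_norm_le fK fT|].
    by move=> z zk; apply: dT; exact: lt_trans kd.
  by rewrite dcubesE; exact: dcube_dindex.
have h : ball_cover q.+1 (f @` \bigcup_(k in P) dcubes k)
    ((C / N%:R)%:E * lebn q.+1 (dcubes i : set (borel 'rV[R]_q.+1)))%E.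
  apply: ball_cover_dcubes => //.
  - by rewrite divr_ge0.
  - exact: measurable_dcubes.
  - by move=> k [].
  move=> k [_ [a [v [T [ka v0 vT TK fT]]]]] _.
  rewrite lebn_dcubes; last by exists a.
  have r0 : 0 < 2 ^- @dlevel q.+1 k :> R by rewrite invr_gt0 exprn_gt0.
  rewrite -EFinM.
  apply: (@slab_cover _ _ _ _ _ _ a v T _ _ _ r0 _ v0 vT TK) => //.
  move=> x xk.
  have xa : `|x - a| < 2 ^- @dlevel q.+1 k.
    by move: (xk) (ka); rewrite (dcubesP ka) => h1 h2; exact: dcube_close h1 h2.
  split=> //; have := fT _ xa; rewrite [a + _]addrC subrK => /le_trans; apply.
  by rewrite mulrC ler_pM2r ?invr_gt0// ltW.
apply: ball_coverW h; rewrite lebn_dcubes; last by exists w.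
rewrite -EFinM lee_fin -[leRHS]mulr1; apply: ler_pM => //; first by rewrite divr_ge0.

by rewrite exprn_ile1// ?invr_ge0 ?exprn_ge0// invf_le1 ?exprn_gt0// exprn_ege1// ler1n.
Qed.

(** * Densities, Lipschitz extensions and bi-Lipschitz pieces *)

Section FiniteMeasureOf.
Context {R : realType} {d} {T : measurableType d} (mu : {measure set T -> \bar R}).
Hypothesis mufin : (mu setT < +oo)%E.

Definition finite_of := mu : set T -> \bar R.

HB.instance Definition _ := Measure.on finite_of.

Let finite_of_fin : fin_num_fun finite_of.
Proof.
move=> A mA; rewrite ge0_fin_numE// (le_lt_trans _ mufin)//.
by apply: le_measure; rewrite ?inE.
Qed.

HB.instance Definition _ := @Measure_isFinite.Build _ T R finite_of finite_of_fin.

Lemma finite_measure_of : exists nu : {finite_measure set T -> \bar R},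
  nu = mu :> (set T -> \bar R).
Proof. by exists finite_of. Qed.

End FiniteMeasureOf.

Lemma eq_measure_integralT {R : realType} {d} {T : measurableType d}
    (mu nu : {measure set T -> \bar R}) (D : set T) (f : T -> \bar R) :
  mu = nu :> (set T -> \bar R) -> (\int[mu]_(x in D) f x = \int[nu]_(x in D) f x)%E.
Proof. by move=> E; apply: eq_measure_integral => A mA AD; rewrite E. Qed.

(** Radon-Nikodym, in the form used for test functions; monotone convergence
    extends it from indicators. *)
Lemma density_exists {R : realType} {d} {T : measurableType d}
    (nu : {measure set T -> \bar R}) (L : {sigma_finite_measure set T -> \bar R}) :
  (nu setT < +oo)%E -> (forall A, measurable A -> L A = 0%E -> nu A = 0%E) ->
  exists w : T -> R, [/\ measurable_fun setT w, forall x, 0 <= w x,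
    (\int[L]_x (w x)%:E < +oo)%E &
    forall (f : T -> \bar R), (forall x, 0 <= f x)%E -> measurable_fun setT f ->
      (\int[nu]_x f x = \int[L]_x (f x * (w x)%:E))%E].
Proof.
move=> nufin nuL; have [nu' nuE] := finite_measure_of nufin.
have numu : nu' `<< L by apply/null_content_dominatesP => A mA; rewrite nuE; exact: nuL.
pose g := Radon_Nikodym_SigmaFinite.f nu' L.
have g0 x : (0 <= g x)%E by exact: Radon_Nikodym_SigmaFinite.f_ge0.
have gfin x : g x \is a fin_num by exact: Radon_Nikodym_SigmaFinite.f_fin_num.
have gint : L.-integrable setT g by exact: Radon_Nikodym_SigmaFinite.f_integrable.
exists (fun x => fine (g x)); split.
- by apply: measurableT_comp => //; exact: measurable_int gint.
- by move=> x; exact: fine_ge0.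
- have /integrableP[_] := gint; congr (_ < _)%E; apply: eq_integral => x _.
  by rewrite gee0_abs// fineK.
- move=> f f0 mf; rewrite -(eq_measure_integralT _ _ nuE).
  rewrite -(Radon_Nikodym_SigmaFinite.change_of_variables numu)//.
  by apply: eq_integral => x _; rewrite fineK.
Qed.

(** McShane's formula: the infimum over the set of [u a + K |x - a|]. *)
Lemma mcshane_real {R : realType} (m : nat) (A : set 'rV[R]_m) (u : 'rV[R]_m -> R)
    (K : R) : 0 <= K -> A !=set0 ->
  (forall x y, A x -> A y -> `|u x - u y| <= K * `|x - y|) ->
  exists U : 'rV[R]_m -> R, (forall x y, `|U x - U y| <= K * `|x - y|) /\
    forall x, A x -> U x = u x.
Proof.
move=> K0 [a0 Aa0] uK.
pose I x := [set u a + K * `|x - a| | a in A].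
have lb x a : A a -> u a0 - K * `|x - a0| <= u a + K * `|x - a|.
  move=> Aa; have := uK _ _ Aa0 Aa => /(le_trans (ler_norm _)) h.
  have : K * `|a0 - a| <= K * `|x - a0| + K * `|x - a|.
    rewrite -mulrDr ler_wpM2l// (_ : a0 - a = (x - a) - (x - a0)).
      by rewrite [leRHS]addrC; exact: ler_normB.
    by rewrite opprB [RHS]addrC addrA subrK.
  lra.
have hI x : has_inf (I x).
  split; first by exists (u a0 + K * `|x - a0|), a0.
  by exists (u a0 - K * `|x - a0|) => _ [a Aa <-]; exact: lb.
have key x y : inf (I x) <= inf (I y) + K * `|x - y|.
  rewrite -lerBlDr; apply: lb_le_inf; first by case: (hI y).
  move=> _ [a Aa <-]; rewrite lerBlDr.
  apply: (@le_trans _ _ (u a + K * `|x - a|)).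
    by apply: ge_inf; [case: (hI x)|exists a].
  rewrite -addrA lerD2l -mulrDr ler_wpM2l//.
  by rewrite [leRHS]addrC -[x - a](subrKA y) ler_normD.
exists (fun x => inf (I x)); split.
  move=> x y; rewrite ler_norml; apply/andP; split.
    by have := key y x; rewrite distrC; lra.
  by have := key x y; lra.
move=> x Ax; apply/eqP; rewrite eq_le; apply/andP; split.
  apply: ge_inf; first by case: (hI x).
  by exists x => //; rewrite subrr normr0 mulr0 addr0.
apply: lb_le_inf; first by case: (hI x).
move=> _ [a Aa <-]; have := uK _ _ Ax Aa => /(le_trans (ler_norm _)); lra.
Qed.

Lemma mcshane {R : realType} (m p : nat) (A : set 'rV[R]_m) (u : 'rV[R]_m -> 'rV[R]_p)
    (K : R) : 0 <= K -> A !=set0 ->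
  (forall x y, A x -> A y -> `|u x - u y| <= K * `|x - y|) ->
  exists U : 'rV[R]_m -> 'rV[R]_p, (forall x y, `|U x - U y| <= K * `|x - y|) /\
    forall x, A x -> U x = u x.
Proof.
move=> K0 A0 uK.
have /choice[U UP] : forall i, exists U : 'rV[R]_m -> R,
    (forall x y, `|U x - U y| <= K * `|x - y|) /\ forall x, A x -> U x = u x 0 i.
  move=> i; apply: mcshane_real => // x y Ax Ay; apply: le_trans (uK x y Ax Ay).
  by have := le_coord_norm (u x - u y) i; rewrite !mxE.
exists (fun x => \row_i U i x); split => [x y|x Ax].
  apply: norm_rV_le => [|i]; first by rewrite mulr_ge0.
  by rewrite !mxE; have [+ _] := UP i; exact.
by apply/rowP => i; rewrite mxE; have [_ ->] := UP i.
Qed.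

(** An injective matrix has a left inverse, which is bounded. *)
Lemma inj_norm_ge {R : realType} (p m : nat) (T : 'M[R]_(p, m)) :
  (forall v : 'rV[R]_p, v *m T = 0 -> v = 0) ->
  exists2 c, 0 < c & forall z : 'rV[R]_p, c * `|z| <= `|z *m T|.
Proof.
move=> Tinj.
have Tf : row_free T.
  apply/row_freeP; exists (pinvmx T); apply/row_matrixP => i.
  rewrite row_mul; apply/eqP; rewrite -subr_eq0; apply/eqP/Tinj.
  rewrite mulmxBl mulmxKpV ?row_sub//.
  by rewrite row1 -rowE subrr.
have [T' TT'] := row_freeP Tf.
pose M := \sum_i \sum_j `|T' i j|.
have M0 : 0 <= M by apply: sumr_ge0 => i _; apply: sumr_ge0.
exists (M + 1)^-1; first by rewrite invr_gt0 ltr_wpDl.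
move=> z; rewrite ler_pdivrMl ?ltr_wpDl//.
rewrite -{1}[z]mulmx1 -TT' mulmxA; set y := z *m T.
apply: norm_rV_le => [|j]; first by rewrite mulr_ge0// addr_ge0.
rewrite mxE; apply: (le_trans (ler_norm_sum _ _ _)).
apply: (@le_trans _ _ (\sum_i `|T' i j| * `|y|)).
  by apply: ler_sum => i _; rewrite normrM mulrC ler_wpM2l// le_coord_norm.
rewrite -mulr_suml ler_wpM2r// (@le_trans _ _ M) ?lerDl//.
apply: ler_sum => i _; rewrite (bigD1 j)//= lerDl.
by apply: sumr_ge0.
Qed.

Lemma lip_continuous {R : realType} (p m : nat) (f : 'rV[R]_p -> 'rV[R]_m) (K : R) :
  (forall x y, `|f x - f y| <= K * `|x - y|) -> continuous f.
Proof.
move=> fK x; apply/(@cvgrPdist_le _ _ _ (nbhs x)) => e e0; near=> y.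
apply: le_trans (fK _ _) _.
have K1 : 0 < `|K| + 1 by rewrite ltr_wpDl.
apply: (@le_trans _ _ ((`|K| + 1) * `|x - y|)).
  by rewrite ler_wpM2r// (le_trans (ler_norm _))// lerDl.
rewrite -ler_pdivlMl//; near: y.
by apply: cvgr_dist_le => //; rewrite mulr_gt0// invr_gt0.
Unshelve. all: by end_near. Qed.

Lemma dist_continuous {R : realType} (p : nat) (b : 'rV[R]_p) :
  continuous (fun a : 'rV[R]_p => `|b - a|).
Proof.
move=> x; apply/(@cvgrPdist_le _ _ _ (nbhs x)) => e e0; near=> y.
apply: le_trans (ler_dist_dist _ _) _.
rewrite opprB addrC addrA subrK distrC; near: y.
exact: cvgr_dist_le.
Unshelve. all: by end_near. Qed.

(** Rademacher's theorem and [rankdef_null]: at the remaining points the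
    differential is injective, which gives a lower bound on some scale, and
    the points with a given scale form a closed set. *)
Lemma bilip_pieces {R : realType} (q m : nat) (f : 'rV[R]_q.+1 -> 'rV[R]_m) (K : R) :
  (forall x y, `|f x - f y| <= K * `|x - y|) ->
  exists (C : nat -> set 'rV[R]_q.+1) (c : nat -> R),
  [/\ forall i, compact (C i), forall i, 0 < c i,
    forall i a b, C i a -> `|b - a| <= c i -> c i * `|b - a| <= `|f b - f a|,
    forall i a b, C i a -> C i b -> `|b - a| <= c i &
    pnull q.+1 (f @` (~` \bigcup_i C i))].
Proof.
move=> fK; have fc := lip_continuous fK.
pose e (j : nat) : R := j.+1%:R^-1.
have e0 j : 0 < e j by rewrite invr_gt0.
pose A j : set 'rV[R]_q.+1 :=
  [set a | forall b : 'rV[R]_q.+1, `|b - a| < e j -> e j * `|b - a| <= `|f b - f a|].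
pose x0 i : 'rV[R]_q.+1 := xget 0 (dcubes i).
pose C (ij : nat * nat) := A ij.2 `&` [set a : 'rV[R]_q.+1 | `|x0 ij.1 - a| <= e ij.2 / 2 / 2].
have cA j : closed (A j).
  rewrite (_ : A j = \bigcap_b ((fun a : 'rV[R]_q.+1 => `|b - a|) @^-1` [set t | e j <= t] `|`
      (fun a : 'rV[R]_q.+1 => `|f b - f a| - e j * `|b - a|) @^-1` [set t | 0 <= t])); last first.
    apply/seteqP; split => [a Aa b _|a h b ba].
      have [ba|ba] := ltP `|b - a| (e j); last by left.
      by right; rewrite /= subr_ge0; exact: Aa.
    have [|/=] := h b Logic.I; first by rewrite /= leNgt ba.
    by rewrite subr_ge0.
  apply: closed_bigI => b _; apply: closedU; apply: preimage_closed.
  - by move=> a _; exact: dist_continuous.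
  - exact: closed_ge.
  - move=> a _; have h1 := continuous_comp (fc a) (@dist_continuous R m (f b) (f a)).
    have h2 := cvgM (cvg_cst (e j)) (@dist_continuous R q.+1 b a).
    by apply: (cvgB h1); exact: h2.
  - exact: closed_ge.
pose C' k := C (odflt (0, 0)%N (unpickle k)).
pose e' k := e (odflt (0, 0)%N (unpickle k : option (nat * nat))).2 / 2.
exists C', e'; split.
- move=> i; rewrite /C' /C; set ij := odflt _ _.
  apply: bounded_closed_compact.
    exists (`|x0 ij.1| + e ij.2 / 2 / 2); split; first by rewrite num_real.
    move=> M hM a [_ /= h]; rewrite -(subrK (x0 ij.1) a).
    apply: (le_trans (ler_normD _ _)); apply: le_trans (ltW hM).
    by rewrite addrC lerD2l distrC.
  apply: closedI => //; apply: (@preimage_closed _ _ (fun a : 'rV[R]_q.+1 => `|x0 ij.1 - a|) [set t | t <= e ij.2 / 2 / 2]).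
    by move=> a _; exact: dist_continuous.
  exact: closed_le.
- by move=> i; rewrite divr_gt0.
- move=> i a b [h _] ba; have e1 := e0 (odflt (0, 0)%N (unpickle i : option (nat * nat))).2.
  apply: (@le_trans _ _ (e (odflt (0, 0)%N (unpickle i : option (nat * nat))).2 * `|b - a|)).
    by rewrite ler_wpM2r// /e'; lra.
  by apply: h; apply: le_lt_trans ba _; rewrite /e'; lra.
- move=> i a b [_ /= h1] [_ /= h2]; rewrite -(subrK (x0 (odflt (0, 0)%N (unpickle i)).1) b) -addrA.
  apply: (le_trans (ler_normD _ _)); rewrite [e' i]splitr lerD//.
  by rewrite distrC.
pose D (a : 'rV[R]_q.+1) (T : 'M[R]_(q.+1, m)) := 
  forall e, 0 < e -> exists2 d, 0 < d & forall z : 'rV[R]_q.+1, `|z| < d ->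
       `|f (a + z) - f a - z *m T| <= e * `|z|.
pose N1 := [set a : 'rV[R]_q.+1 | ~ exists T, D a T].
pose N2 := [set a : 'rV[R]_q.+1 | exists (v : 'rV[R]_q.+1) (T : 'M[R]_(q.+1, m)),
    [/\ v != 0, v *m T = 0 & D a T]].
have n1 : pnull q.+1 (f @` N1).
  apply: (@lip_image_null R q.+1 m isT f K fK N1); apply: negligibleS (rademacher fK).
  move=> a /= h [T DT]; apply: h; exists T => t /DT[d [d0 dP]]; by exists d.
have n2 : pnull q.+1 (f @` N2) by exact: rankdef_null fK.
pose NN k := if k is 0%N then N1 else N2.
apply: (@pnullS _ _ _ _ (\bigcup_k (f @` NN k))); last first.
  by apply: pnull_bigcup => // -[|k].
move=> _ [a na <-].
have [[T DT]|nT] := pselect (exists T, D a T); last by exists 0%N => //; exists a.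
have [[v [v0 vT]]|nv] := pselect (exists v : 'rV[R]_q.+1, v != 0 /\ v *m T = 0).
  by exists 1%N => //; exists a => //; exists v, T.
exfalso; apply: na.
have [c c0 cT] : exists2 c, 0 < c & forall z : 'rV[R]_q.+1, c * `|z| <= `|z *m T|.
  apply: inj_norm_ge => v vT; apply/eqP; apply/negPn/negP => v0.
  by apply: nv; exists v.
have c20 : 0 < c / 2 by rewrite divr_gt0.
have [d d0 dP] := DT _ c20.
have m0 : 0 < Num.min (c / 2) d by rewrite lt_min c20.
have [j _ je] := @pow2_small R 0 _ m0.
have ej : e (2 ^ j)%N < Num.min (c / 2) d.
  apply: lt_trans je; rewrite /e -natrX ltf_pV2 ?posrE ?ltr0n ?expn_gt0//.
  by rewrite ltr_nat.
move: ej; rewrite lt_min => /andP[ejc ejd].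
set l := (2 ^ j)%N in ejc ejd.
have [k _ ke] := @pow2_small R 0 _ (divr_gt0 (divr_gt0 (e0 l) (@ltr0n R 2)) (@ltr0n R 2)).
have Aa : A l a.
  move=> b ba; have := dP (b - a) (lt_trans ba ejd).
  have := cT (b - a); rewrite [a + _]addrC subrK.
  set z := b - a => h1 h2.
  have h3 : `|z *m T| <= `|f b - f a| + `|f b - f a - z *m T|.
    rewrite -[X in `|X| <= _](subKr (f b - f a)).
    by apply: (le_trans (ler_normB _ _)).
  have h4 : e l * `|z| <= c / 2 * `|z| by rewrite ler_wpM2r// ltW.
  have : c * `|z| = c / 2 * `|z| + c / 2 * `|z| by rewrite -mulrDl -splitr.
  lra.
exists (pickle (pickle (k, dindex k a), l)) => //.
rewrite /C' pickleK; split => //=.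
have h : dcubes (pickle (k, dindex k a)) a by rewrite dcubesE; exact: dcube_dindex.
have h' : dcubes (pickle (k, dindex k a)) (x0 (pickle (k, dindex k a))).
  by apply: (xgetPex 0); exists a.
rewrite dcubesE in h h'.
by apply: le_trans (ltW (dcube_close h' h)) (ltW ke).
Qed.

(** * Blow-up of a measure carried by a Lipschitz image *)

Lemma compact_support_bounds {R : realType} (m : nat) (phi : 'rV[R]_m -> R) :
  continuous phi -> (exists2 K, compact K & forall v, ~ K v -> phi v = 0) ->
  exists M Phi : R, [/\ 0 < M, 0 <= Phi, forall v, M <= `|v| -> phi v = 0,
    forall v, `|phi v| <= Phi &
    forall e, 0 < e -> exists2 d, 0 < d &
      forall u v, `|u - v| < d -> `|phi u - phi v| <= e].
Proof.
move=> cphi [K cK K0].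
have [M [Mr hM]] := compact_bounded cK.
have cpK : compact (phi @` K).
  by apply: continuous_compact => //; apply: continuous_subspaceT.
have [P [Pr hP]] := compact_bounded cpK.
exists (`|M| + 2), (`|P| + 1); split; [by rewrite ltr_wpDl|by rewrite addr_ge0| | |].
- move=> v Mv; apply: K0 => Kv.
  have : `|v| <= `|M| + 1 by apply: hM => //; rewrite ltr_pwDr// ler_norm.
  lra.
- move=> v; have [Kv|nKv] := pselect (K v); last by rewrite K0// normr0 addr_ge0.
  by apply: (hP (`|P| + 1)); [rewrite ltr_pwDr// ler_norm|exists v].
move=> e e0; have e20 : 0 < e / 2 by rewrite divr_gt0.
have /compact_near_coveringP/(_ R (0 : R)^'+
  (fun d u => forall v : 'rV[R]_m, `|u - v| < d -> `|phi u - phi v| <= e) _) := cK.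
have h x : K x -> \forall x' \near x & d \near (0 : R)^'+,
    forall v : 'rV[R]_m, `|x' - v| < d -> `|phi x' - phi v| <= e.
  move=> Kx; have := cphi x; move=> /(@cvgrPdist_le _ _ _ (nbhs x))/(_ _ e20).
  move=> /nbhs_ballP[r /= r0 hr]; have r20 : 0 < r / 2 by rewrite divr_gt0.
  exists (ball x (r / 2), [set d | d < r / 2]) => /=; first split.
  - exact: nbhsx_ballx.
  - exact: nbhs_right_lt.
  move=> [y d] /= []; rewrite -ball_normE /= => xy dr v yv.
  rewrite -(subrKA (phi x)) (le_trans (ler_normD _ _))// (splitr e) lerD//.
    rewrite distrC; apply: hr; rewrite -ball_normE /=; lra.
  apply: hr; rewrite -ball_normE /= -(subrKA y) (le_lt_trans (ler_normD _ _))//; lra.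
move=> /(_ h) hK.
have [d [d0 dK]] : exists d : R, 0 < d /\ K `<=` [set u | forall v : 'rV[R]_m, `|u - v| < d -> `|phi u - phi v| <= e].
  have hK0 : \forall d \near (0 : R)^'+, (0 < d) /\ K `<=` [set u | forall v : 'rV[R]_m, `|u - v| < d -> `|phi u - phi v| <= e].
    by apply: filterS2 hK (nbhs_right_gt (0 : R)) => d h1 h2; split.
  exact: filter_ex hK0.
exists d => // u v uv; have [Ku|nKu] := pselect (K u); first exact: dK.
have [Kv|nKv] := pselect (K v); first by rewrite distrC; apply: dK => //; rewrite distrC.
by rewrite !K0// subrr normr0 ltW.
Qed.

Lemma small_factor {R : realType} (A t : R) : 0 <= A -> 0 < t ->
  exists2 s, 0 < s & A * s <= t.
Proof.
move=> A0 t0; exists (t / (A + 1)); first by rewrite divr_gt0// ltr_wpDl.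
by rewrite mulrA ler_pdivrMr ?ltr_wpDl// mulrDr mulr1 mulrC lerDl ltW.
Qed.

Lemma mulmxr_continuous {R : realType} (k l : nat) (B : 'M[R]_(k, l)) :
  continuous (fun v : 'rV[R]_k => v *m B).
Proof.
pose K := \sum_i \sum_j `|B i j|.
apply: (@lip_continuous _ _ _ _ K) => x y; rewrite -mulmxBl; set z := x - y.
have K0 : 0 <= K by apply: sumr_ge0 => i _; apply: sumr_ge0.
apply: norm_rV_le => [|j]; first by rewrite mulr_ge0.
rewrite mxE; apply: (le_trans (ler_norm_sum _ _ _)).
apply: (@le_trans _ _ (\sum_i `|B i j| * `|z|)).
  by apply: ler_sum => i _; rewrite normrM mulrC ler_wpM2l// le_coord_norm.
rewrite -mulr_suml ler_wpM2r//.
apply: ler_sum => i _; rewrite (bigD1 j)//= lerDl.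
by apply: sumr_ge0.
Qed.

Lemma rescale_continuous {R : realType} (k : nat) (l : R) (x : 'rV[R]_k) :
  continuous (fun y : 'rV[R]_k => l *: (y - x)).
Proof.
apply: (@lip_continuous _ _ _ _ `|l|) => y z.
by rewrite -scalerBr normrZ opprB addrA subrK.
Qed.

Lemma continuous_comp_rV {R : realType} (k l : nat) (U : topologicalType)
    (f : 'rV[R]_k -> 'rV[R]_l) (g : 'rV[R]_l -> U) :
  continuous f -> continuous g -> continuous (fun v => g (f v)).
Proof. by move=> fc gc v; apply: continuous_comp; [exact: fc|exact: gc]. Qed.

Lemma measurable_comp_rV {R : realType} (k l : nat)
    (f : 'rV[R]_k -> 'rV[R]_l) (phi : 'rV[R]_l -> R) :
  continuous f -> continuous phi ->
  measurable_fun setT (fun v : borel 'rV[R]_k => phi (f v)).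
Proof.
by move=> fc gc; apply: continuous_borel_real; exact: continuous_comp_rV gc.
Qed.

Lemma Rintegral_posneg {R : realType} d (T : measurableType d)
    (mu : {measure set T -> \bar R}) (D : set T) (g : T -> R) :
  (\int[mu]_(x in D) (Num.max (g x) 0)%:E < +oo)%E ->
  (\int[mu]_(x in D) (Num.max (- g x) 0)%:E < +oo)%E ->
  Rintegral mu D g =
  Rintegral mu D (fun x => Num.max (g x) 0) - Rintegral mu D (fun x => Num.max (- g x) 0).
Proof.
move=> f1 f2; rewrite /Rintegral integralE.
rewrite [X in fine (X - _)%E](_ : _ = \int[mu]_(x in D) (Num.max (g x) 0)%:E)%E; last first.
  by apply: eq_integral => x _; rewrite funeposE EFin_max.
rewrite [X in fine (_ - X)%E](_ : _ = \int[mu]_(x in D) (Num.max (- g x) 0)%:E)%E; last first.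
  by apply: eq_integral => x _; rewrite funenegE EFin_max.
by rewrite fineB// ge0_fin_numE//; apply: integral_ge0 => x _; rewrite lee_fin le_max lexx orbT.
Qed.

Lemma continuous_maxr0 {R : realType} (T : topologicalType) (f : T -> R) :
  continuous f -> continuous (fun x => Num.max (f x) 0).
Proof.
move=> cf x; apply/(@cvgrPdist_le _ _ _ (nbhs x)) => e e0.
have := cf x; move=> /(@cvgrPdist_le _ _ _ (nbhs x))/(_ e e0); apply: filterS => y.
rewrite !ler_norml => /andP[h1 h2]; apply/andP.
by case: (leP (f x) 0) => ?; case: (leP (f y) 0) => ?; split; lra.
Qed.

Section Blowup.
Context {R : realType} {p m : nat}.
Notation L := (lebn p).
Notation T1 := (borel 'rV[R]_p).
Notation T2 := (borel 'rV[R]_m).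
Variables (mu : {measure set T2 -> \bar R}) (E : set T2).
Variables (f : 'rV[R]_p -> 'rV[R]_m) (w : T1 -> R) (a : 'rV[R]_p)
  (T : 'M[R]_(p, m)) (c : R).
Hypothesis mufin : (mu setT < +oo)%E.
Hypothesis mE : measurable E.
Hypothesis fc : continuous f.
Hypothesis mw : measurable_fun setT w.
Hypothesis w0 : forall b, 0 <= w b.
Hypothesis c0 : 0 < c.
Hypothesis muE : forall psi : T2 -> \bar R, (forall y, 0 <= psi y)%E ->
  measurable_fun setT psi ->
  (\int[mu]_(y in E) psi y = \int[L]_b (psi (f b) * (w b)%:E))%E.
Hypothesis fge : forall b, w b != 0 -> c * `|b - a| <= `|f b - f a|.
Hypothesis Tge : forall z : 'rV[R]_p, c * `|z| <= `|z *m T|.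
Hypothesis fT : forall e, 0 < e -> exists2 d, 0 < d & forall z : 'rV[R]_p, `|z| < d ->
  `|f (a + z) - f a - z *m T| <= e * `|z|.
Hypothesis wleb : forall t, 0 < t -> exists d, 0 < d /\ forall r, 0 < r < d ->
  (\int[L]_(x in (ball a r : set T1)) `|w x - w a|%:E <= (t * r ^+ p)%:E)%E.
Hypothesis mudens : forall t, 0 < t -> exists d, 0 < d /\ forall r, 0 < r < d ->
  (mu ((ball (f a) r : set T2) `\` E) <= (t * r ^+ p)%:E)%E.

Section TestFunction.
Variable phi : 'rV[R]_m -> R.
Hypothesis phic : continuous phi.
Hypothesis phi0 : forall v, 0 <= phi v.
Hypothesis phiK : exists2 K, compact K & forall v, ~ K v -> phi v = 0.

Let X l := (\int[mu]_y (phi (l^-1 *: ((y : 'rV[R]_m) - f a)))%:E)%E.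
Let Y l := (\int[L]_b (w a * phi ((l^-1 *: ((b : 'rV[R]_p) - a)) *m T))%:E)%E.

Let mphi1 l : measurable_fun setT (fun y : T2 => phi (l^-1 *: ((y : 'rV[R]_m) - f a))).
Proof. exact: (measurable_comp_rV (@rescale_continuous _ _ l^-1 (f a)) phic). Qed.

Let mphi2 l : measurable_fun setT (fun b : T1 => phi (l^-1 *: (f b - f a))).
Proof.
have h := continuous_comp_rV fc (@rescale_continuous _ _ l^-1 (f a)).
exact: (measurable_comp_rV h phic).
Qed.

Let mphi3 l : measurable_fun setT (fun b : T1 => phi (l^-1 *: ((b : 'rV[R]_p) - a) *m T)).
Proof.
have h := continuous_comp_rV (@rescale_continuous _ _ l^-1 a) (@mulmxr_continuous _ _ _ T).
exact: (measurable_comp_rV h phic).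
Qed.

(** On the support of the test function the points are at distance at most a
    multiple of [l], so the error comes from the mass outside the piece, the
    oscillation of the density and the nonlinearity of [f], each small at
    scale [l]. *)
Lemma blowup_estimate t : 0 < t -> exists2 d, 0 < d & forall l, 0 < l < d ->
  (X l <= Y l + (t * l ^+ p)%:E)%E /\ (Y l <= X l + (t * l ^+ p)%:E)%E.
Proof.
move=> t0; have [M [Phi [M0 Phi0 phiM phiP phiU]]] := compact_support_bounds phic phiK.
pose M' := M / c; have M'0 : 0 < M' by rewrite divr_gt0.
have M'E : M' = M / c by []; clearbody M'.
have t30 : 0 < t / 3 by rewrite divr_gt0.
have [s1 s10 hs1] := small_factor (mulr_ge0 Phi0 (exprn_ge0 p (ltW M0))) t30.
have [s2 s20 hs2] := small_factor (mulr_ge0 Phi0 (exprn_ge0 p (ltW M'0))) t30.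
have M20 : 0 <= 2 * M' by lra.
have [s3 s30 hs3] := small_factor (mulr_ge0 (w0 a) (exprn_ge0 p M20)) t30.
have [d1 [d10 hd1]] := mudens s10.
have [d2 [d20 hd2]] := wleb s20.
have [d3 d30 hd3] := phiU _ s30.
have e40 : 0 < d3 / (2 * M') by rewrite divr_gt0// mulr_gt0.
have [d4 d40 hd4] := fT e40.
exists (Num.min (d1 / M) (Num.min (d2 / M') (d4 / M'))).
  by rewrite !lt_min !divr_gt0.
move=> l /andP[l0]; rewrite !lt_min !ltr_pdivlMr// => /and3P[ld1 ld2 ld4].
have il : 0 < l^-1 by rewrite invr_gt0.
pose rho := l * M'; have rho0 : 0 < rho by rewrite mulr_gt0.
pose g1 b := phi (l^-1 *: (f b - f a)) * w b.
pose g2 b := w a * phi ((l^-1 *: (b - a)) *m T).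
pose err (b : T1) := (Phi * `|w b - w a| + w a * s3) * \1_(ball a rho) b.
have g1_0 b : rho <= `|b - a| -> g1 b = 0.
  rewrite /g1 => h; have [->|wb] := eqVneq (w b) 0; first by rewrite mulr0.
  rewrite phiM ?mul0r// normrZ gtr0_norm// ler_pdivlMl//.
  apply: le_trans (fge wb); rewrite -ler_pdivrMl//; apply: le_trans h.
  by rewrite /rho M'E mulrC -mulrA.
have g2_0 b : rho <= `|b - a| -> g2 b = 0.
  rewrite /g2 => h; rewrite phiM ?mulr0// (le_trans _ (Tge _))//.
  rewrite normrZ gtr0_norm// mulrCA ler_pdivlMl// -ler_pdivrMl//.
  by apply: le_trans h; rewrite /rho M'E mulrC -mulrA.
have Phw b : 0 <= Phi * `|w b - w a| + w a * s3.
  by rewrite addr_ge0// mulr_ge0 ?(ltW s30).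
have err0 b : 0 <= err b by rewrite mulr_ge0// indicE.
have g12 b : `|g1 b - g2 b| <= err b.
  have [bin|bout] := ltP `|b - a| rho; last first.
    by rewrite g1_0// g2_0// subrr normr0.
  rewrite /err indicE mem_set ?mulr1; last by rewrite /= -ball_normE /= distrC.
  set u := phi (l^-1 *: (f b - f a)); set v := phi (l^-1 *: (b - a) *m T).
  have uv : `|u - v| <= s3.
    apply: hd3; rewrite -scalemxAl -scalerBr normrZ gtr0_norm//.
    have := hd4 (b - a) (lt_trans bin ld4); rewrite [a + _]addrC subrK => h.
    rewrite ltr_pdivrMl//; apply: (le_lt_trans h).
    apply: (@le_lt_trans _ _ (d3 / (2 * M') * rho)).
      by rewrite ler_wpM2l// ltW.
    rewrite /rho (_ : _ * _ = l * d3 / 2); last by field; rewrite gt_eqF.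
    by have := mulr_gt0 l0 d30; lra.
  rewrite /g1 /g2 -/u -/v (_ : u * w b - w a * v = u * (w b - w a) + w a * (u - v)); last by ring.
  apply: (le_trans (ler_normD _ _)); rewrite !normrM lerD//.
    by rewrite ler_wpM2r// /u.
  by rewrite (ger0_norm (w0 a)) ler_wpM2l.
have mg1 : measurable_fun setT (fun b : T1 => (g1 b)%:E).
  by apply/measurable_EFinP; exact: measurable_funM.
have mg2 : measurable_fun setT (fun b : T1 => (g2 b)%:E).
  by apply/measurable_EFinP; exact: measurable_funM.
have mB : measurable (ball a rho : set T1) by exact: ball_borel.
have merr : measurable_fun setT (fun b : T1 => (err b)%:E).
  apply/measurable_EFinP; apply: measurable_funM; last exact: measurable_indic.
  apply: measurable_funD => //; apply: measurable_funM => //.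
  by apply: measurableT_comp => //; exact: measurable_funB.
have g10 b : 0 <= g1 b by rewrite mulr_ge0.
have g20 b : 0 <= g2 b by rewrite mulr_ge0.
have Ierr : (\int[L]_b (err b)%:E <= ((t / 3 + t / 3) * l ^+ p)%:E)%E.
  have -> : (\int[L]_b (err b)%:E =
      \int[L]_(b in (ball a rho : set T1)) ((Phi * `|w b - w a|)%:E + (w a * s3)%:E))%E.
    rewrite [RHS]integral_mkcond; apply: eq_integral => b _.
    by rewrite patchE /err indicE; case: (b \in _); rewrite ?mulr1 ?mulr0// EFinD.
  have mPw : measurable_fun (ball a rho : set T1) (fun b : T1 => `|w b - w a|%:E).
    apply: measurable_funTS; apply/measurable_EFinP.
    by apply: measurableT_comp => //; exact: measurable_funB.
  rewrite ge0_integralD//; last 3 first.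
  - by move=> b _; rewrite lee_fin mulr_ge0.
  - by under eq_fun do rewrite EFinM; exact: measurable_funeM.
  - by move=> b _; rewrite lee_fin mulr_ge0// ltW.
  rewrite integral_cst// mulrDl EFinD; apply: leeD.
    under eq_integral do rewrite EFinM.
    rewrite ge0_integralZl_EFin//.
    apply: (@le_trans _ _ (Phi%:E * (s2 * rho ^+ p)%:E)%E).
      by apply: lee_wpmul2l => //; apply: hd2; rewrite rho0.
    rewrite -EFinM lee_fin /rho exprMn.
    rewrite (_ : Phi * _ = Phi * M' ^+ p * s2 * l ^+ p); last by ring.
    by rewrite ler_wpM2r// exprn_ge0// ltW.
  apply: (@le_trans _ _ ((w a * s3)%:E * ((2 * rho) ^+ p)%:E)%E).
    apply: lee_wpmul2l; last exact: lebn_ball.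
    by rewrite lee_fin mulr_ge0// ltW.
  rewrite -EFinM lee_fin (_ : _ * (2 * rho) ^+ p = w a * (2 * M') ^+ p * s3 * l ^+ p).
    by rewrite ler_wpM2r// exprn_ge0// ltW.
  by rewrite /rho !exprMn; ring.
have Iout : (\int[mu]_(y in ~` E) (phi (l^-1 *: ((y : 'rV[R]_m) - f a)))%:E <= (t / 3 * l ^+ p)%:E)%E.
  have mC : measurable (~` E) by exact: measurableC.
  have mBf : measurable (ball (f a) (l * M) : set T2) by exact: ball_borel.
  apply: (@le_trans _ _ (\int[mu]_(y in ~` E) (Phi%:E * (\1_(ball (f a) (l * M) : set T2) y)%:E))%E).
    apply: ge0_le_integral => //.
    - by move=> y _; rewrite lee_fin.
    - by apply/measurable_EFinP; exact: measurable_funTS.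
    - apply: measurable_funTS; apply: measurable_funeM; apply/measurable_EFinP.
      exact: measurable_indic.
    - move=> y _; rewrite -EFinM lee_fin indicE.
      case: (boolP (y \in _)) => [_|].
        by rewrite mulr1; apply: le_trans (ler_norm _) (phiP _).
      rewrite notin_setE -ball_normE /= => /negP; rewrite -leNgt => h.
      rewrite phiM ?mulr0// normrZ gtr0_norm// ler_pdivlMl// distrC.
      exact: h.
  rewrite ge0_integralZl_EFin//; last first.
    by apply: measurable_funTS; apply/measurable_EFinP; exact: measurable_indic.
  rewrite integral_indic//.
  apply: (@le_trans _ _ (Phi%:E * (s1 * (l * M) ^+ p)%:E)%E).
    apply: lee_wpmul2l => //; rewrite -setDE; apply: hd1.
    by rewrite mulr_gt0.
  rewrite -EFinM lee_fin exprMn.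
  rewrite (_ : Phi * _ = Phi * M ^+ p * s1 * l ^+ p); last by ring.
  by rewrite ler_wpM2r// exprn_ge0// ltW.
have XE : X l = (\int[L]_b (g1 b)%:E + \int[mu]_(y in ~` E) (phi (l^-1 *: ((y : 'rV[R]_m) - f a)))%:E)%E.
  rewrite /X -(setUv E) ge0_integral_setU//; last 4 first.
  - exact: measurableC.
  - by rewrite setUv; apply/measurable_EFinP; exact: mphi1.
  - by move=> y _; rewrite lee_fin.
  - by apply/disj_setPCl.
  congr (_ + _)%E.
  rewrite muE; [|by move=> y; rewrite lee_fin|by apply/measurable_EFinP; exact: mphi1].
  by apply: eq_integral => b _; rewrite -EFinM.
have le12 : (\int[L]_b (g1 b)%:E <= Y l + \int[L]_b (err b)%:E)%E.
  rewrite -ge0_integralD//; last 2 first.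
  - by move=> b _; rewrite lee_fin; first [exact: g10|exact: g20|exact: err0].
  - by move=> b _; rewrite lee_fin; first [exact: g10|exact: g20|exact: err0].
  apply: ge0_le_integral => //.
  - by move=> b _; rewrite lee_fin; first [exact: g10|exact: g20|exact: err0].
  - exact: emeasurable_funD.
  - move=> b _; rewrite -EFinD lee_fin -lerBlDl.
    exact: (le_trans (ler_norm _) (g12 b)).
have le21 : (Y l <= \int[L]_b (g1 b)%:E + \int[L]_b (err b)%:E)%E.
  rewrite -ge0_integralD//; last 2 first.
  - by move=> b _; rewrite lee_fin; first [exact: g10|exact: g20|exact: err0].
  - by move=> b _; rewrite lee_fin; first [exact: g10|exact: g20|exact: err0].
  apply: ge0_le_integral => //.
  - by move=> b _; rewrite lee_fin; first [exact: g10|exact: g20|exact: err0].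
  - exact: emeasurable_funD.
  - move=> b _; rewrite -EFinD lee_fin -lerBlDl -/(g2 b).
    by have := g12 b; rewrite distrC; apply: le_trans; exact: ler_norm.
have t3 : ((t * l ^+ p)%:E = ((t / 3 + t / 3) * l ^+ p)%:E + (t / 3 * l ^+ p)%:E)%E.
  by rewrite -EFinD; congr EFin; field.
split.
  rewrite XE t3 [leRHS]addeA; apply: (leeD _ Iout).
  by apply: (le_trans le12); exact: leeD2l.
rewrite XE; apply: (le_trans le21); rewrite -addeA; apply: leeD2l.
apply: (le_trans Ierr); rewrite t3.
apply: (@le_trans _ _ ((t / 3 + t / 3) * l ^+ p)%:E) => //.
rewrite addeCA leeDl// adde_ge0//.
  by apply: integral_ge0 => y _; rewrite lee_fin.
by rewrite lee_fin mulr_ge0 ?exprn_ge0 ?(ltW t30)// ltW.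
Qed.

Let J := (\int[L]_z (phi ((z : 'rV[R]_p) *m T))%:E)%E.

Let YE l : 0 < l -> Y l = ((w a * l ^+ p)%:E * J)%E.
Proof.
move=> l0; rewrite /Y; under eq_integral do rewrite EFinM.
rewrite ge0_integralZl_EFin//; [|by move=> b _; rewrite lee_fin|by apply/measurable_EFinP; exact: mphi3].
rewrite EFinM -muleA; congr (_ * _)%E.
pose F (b : T1) := (phi ((l^-1 *: ((b : 'rV[R]_p) - a)) *m T))%:E.
have <- : (\int[L]_z F (affine_rV a l z) = J)%E.
  apply: eq_integral => z _; rewrite /F /affine_rV [a + _]addrC addrK.
  by rewrite scalerA mulVf ?gt_eqF// scale1r.
rewrite lebn_integral_affine//;
  [|by apply/measurable_EFinP; exact: mphi3|by move=> x; rewrite lee_fin].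
by rewrite muleA -EFinM -exprMn mulfV ?gt_eqF// expr1n mul1e.
Qed.

Lemma plane_integral_fin : (J < +oo)%E.
Proof.
have [M [Phi [M0 Phi0 phiM phiP phiU]]] := compact_support_bounds phic phiK.
have Mc : 0 < M / c by rewrite divr_gt0.
have mB : measurable (ball 0 (M / c) : set T1) by exact: ball_borel.
apply: (@le_lt_trans _ _ (\int[L]_z (Phi%:E * (\1_(ball 0 (M / c) : set T1) z)%:E))%E).
  apply: ge0_le_integral => //.
  - by move=> y _; rewrite lee_fin.
  - apply/measurable_EFinP; exact: (measurable_comp_rV (@mulmxr_continuous _ _ _ T) phic).
  - by apply: measurable_funeM; apply/measurable_EFinP; exact: measurable_indic.
  - move=> y _; rewrite -EFinM lee_fin indicE.
    case: (boolP (y \in _)) => [_|].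
      by rewrite mulr1; apply: le_trans (ler_norm _) (phiP _).
    rewrite notin_setE -ball_normE /= sub0r normrN => /negP; rewrite -leNgt => h.
    rewrite phiM ?mulr0//; apply: le_trans (Tge _).
    by rewrite -ler_pdivrMl// mulrC.
rewrite ge0_integralZl_EFin//; last first.
  by apply/measurable_EFinP; exact: measurable_indic.
rewrite integral_indic// setIT lte_mul_pinfty//.
exact: le_lt_trans (lebn_ball _ Mc) (ltry _).
Qed.

Lemma blowup_integral_fin l : (X l < +oo)%E.
Proof.
have [M [Phi [M0 Phi0 phiM phiP phiU]]] := compact_support_bounds phic phiK.
apply: (@le_lt_trans _ _ (\int[mu]_y (cst Phi%:E y))%E).
  apply: ge0_le_integral => //.
  - by move=> y _; rewrite lee_fin.
  - by apply/measurable_EFinP; exact: mphi1.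
  - by move=> y _; rewrite lee_fin; apply: le_trans (ler_norm _) (phiP _).
by rewrite integral_cst// lte_mul_pinfty.
Qed.

Lemma blowup_cvg_ge0 :
  l ^- p * Rintegral mu setT (fun y => phi (l^-1 *: ((y : 'rV[R]_m) - f a))) @[l --> 0^'+] -->
  w a * Rintegral L setT (fun z => phi ((z : 'rV[R]_p) *m T)).
Proof.
apply/cvgrPdist_le => t t0; have [d d0 dP] := blowup_estimate t0.
near=> l.
have l0 : 0 < l by near: l; exact: nbhs_right_gt.
have ld : l < d by near: l; exact: nbhs_right_lt.
have [] := dP l; first by rewrite l0.
rewrite YE//.
have J0 : (0 <= J)%E by apply: integral_ge0 => y _; rewrite lee_fin.
have X0 : (0 <= X l)%E by apply: integral_ge0 => y _; rewrite lee_fin.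
rewrite /Rintegral -/J -/(X l).
rewrite -(@fineK _ J) ?ge0_fin_numE ?plane_integral_fin//.
rewrite -(@fineK _ (X l)) ?ge0_fin_numE ?blowup_integral_fin//.
rewrite -!EFinM -!EFinD !lee_fin /=.
set x := fine (X l); set j := fine J => h1 h2.
have lp : 0 < l ^+ p by rewrite exprn_gt0.
rewrite -(ler_pM2r lp) -[X in _ * X](gtr0_norm lp) -normrM mulrBl.
rewrite (_ : l ^- p * x * l ^+ p = x); last by field; rewrite gt_eqF.
rewrite ler_norml; apply/andP; split; lra.
Unshelve. all: by end_near. Qed.

End TestFunction.

(** Positive and negative parts converge separately. *)
Lemma blowup_cvg (phi : 'rV[R]_m -> R) : continuous phi ->
  (exists2 K, compact K & forall v, ~ K v -> phi v = 0) ->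
  l ^- p * Rintegral mu setT (fun y => phi (l^-1 *: ((y : 'rV[R]_m) - f a))) @[l --> 0^'+] -->
  w a * Rintegral L setT (fun z => phi ((z : 'rV[R]_p) *m T)).
Proof.
move=> phic phiK.
have nphic : continuous (fun v => - phi v) by move=> v; exact: (cvgN (phic v)).
have c1 := continuous_maxr0 phic; have c2 := continuous_maxr0 nphic.
have k1 : exists2 K, compact K & forall v, ~ K v -> Num.max (phi v) 0 = 0.
  by have [K cK K0] := phiK; exists K => // v /K0 ->; exact: maxxx.
have k2 : exists2 K, compact K & forall v, ~ K v -> Num.max (- phi v) 0 = 0.
  by have [K cK K0] := phiK; exists K => // v /K0 ->; rewrite oppr0; exact: maxxx.
have p1 v : 0 <= Num.max (phi v) 0 by rewrite le_max lexx orbT.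
have p2 v : 0 <= Num.max (- phi v) 0 by rewrite le_max lexx orbT.
rewrite Rintegral_posneg; [|exact: plane_integral_fin c1 p1 k1|exact: plane_integral_fin c2 p2 k2].
have E1 l : l ^- p * Rintegral mu setT (fun y => phi (l^-1 *: ((y : 'rV[R]_m) - f a))) =
    l ^- p * Rintegral mu setT (fun y => Num.max (phi (l^-1 *: ((y : 'rV[R]_m) - f a))) 0) -
    l ^- p * Rintegral mu setT (fun y => Num.max (- phi (l^-1 *: ((y : 'rV[R]_m) - f a))) 0).
  rewrite Rintegral_posneg ?mulrBr//; first exact: blowup_integral_fin c1 p1 k1 l.
  exact: blowup_integral_fin c2 p2 k2 l.
rewrite (funext E1) mulrBr.
by apply: cvgB; [exact: blowup_cvg_ge0 c1 p1 k1|exact: blowup_cvg_ge0 c2 p2 k2].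
Qed.

End Blowup.

(** * Tangent planes of measures carried by Lipschitz images *)

Lemma integral_mrestrE {R : realType} d (T : measurableType d)
    (mu : {measure set T -> \bar R}) (E : set T) (mE : measurable E) (g : T -> \bar R) :
  measurable_fun setT g -> (forall x, 0 <= g x)%E ->
  (\int[mrestr mu mE]_x g x = \int[mu]_(x in E) g x)%E.
Proof.
move=> mg g0; have mC : measurable (~` E) by exact: measurableC.
rewrite -(setUv E) ge0_integral_setU//; last 2 first.
- by rewrite setUv.
- by apply/disj_setPCl.
rewrite [X in (_ + X)%E](_ : _ = 0%E) ?adde0; last first.
  apply: null_set_integral => //; first exact: measurable_funTS.
  by rewrite /= /mrestr setICl measure0.
by apply: eq_measure_integral => A mA AE; rewrite /= /mrestr setIidl.
Qed.

Lemma restricted_pushforward {R : realType} d d' (T : measurableType d)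
    (U : measurableType d') (mu : {measure set T -> \bar R}) (E : set T) (s : T -> U) :
  measurable E -> measurable_fun setT s ->
  exists nu : {measure set U -> \bar R},
    (forall A, nu A = mu (s @^-1` A `&` E)) /\
    forall g : U -> \bar R, measurable_fun setT g -> (forall x, 0 <= g x)%E ->
      (\int[nu]_x g x = \int[mu]_(y in E) g (s y))%E.
Proof.
move=> mE ms; have [nu nuE] := pushforward_measure (mrestr mu mE) ms.
exists nu; split => // g mg g0.
rewrite -(integral_mrestrE mu mE (measurableT_comp mg ms) (fun x => g0 (s x))).
rewrite (@eq_measure_integralT _ _ _ nu (pushforward (mrestr mu mE) s)); last first.
  by apply/funext => A; rewrite nuE.
by rewrite ge0_integral_pushforward.
Qed.

(** Otherwise all the pieces, and the sets without content left by
    [bilip_pieces], would be null. *)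
Lemma charged_piece {R : realType} (q m : nat)
    (mu : {measure set (borel 'rV[R]_m) -> \bar R})
    (f : nat -> 'rV[R]_q.+1 -> 'rV[R]_m) (K : nat -> R) :
  (forall k x y, `|f k x - f k y| <= K k * `|x - y|) ->
  (forall B : set (borel 'rV[R]_m), measurable B -> pnull q.+1 B -> mu B = 0%E) ->
  mu.-negligible ((~` \bigcup_k range (f k)) : set (borel 'rV[R]_m)) ->
  (0 < mu setT)%E ->
  exists k (C : set 'rV[R]_q.+1) (c : R), [/\ compact C, 0 < c,
    forall a b, C a -> `|b - a| <= c -> c * `|b - a| <= `|f k b - f k a|,
    forall a b, C a -> C b -> `|b - a| <= c &
    (0 < mu (f k @` C : set (borel 'rV[R]_m)))%E].
Proof.
move=> fK mu0 munull mupos.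
have /choice[C /choice[c Cc]] := fun k => bilip_pieces (fK k).
apply: contrapT => hno.
have mC k i : measurable (f k @` C k i : set (borel 'rV[R]_m)).
  have [cC _ _ _ _] := Cc k.
  apply: closed_borel; apply: compact_closed; first exact: norm_hausdorff.
  apply: continuous_compact => //; apply: continuous_subspaceT.
  exact: lip_continuous (fK k).
have nC k i : mu.-negligible (f k @` C k i : set (borel 'rV[R]_m)).
  apply/negligibleP => //; apply/eqP; rewrite eq_le measure_ge0 andbT leNgt.
  apply/negP => h; apply: hno; exists k, (C k i), (c k i).
  by have [h1 h2 h3 h4 _] := Cc k; split => //; [exact: h3|exact: h4].
have nT : mu.-negligible [set: borel 'rV[R]_m].
  apply: (@negligibleS _ _ _ mu (~` (\bigcup_k range (f k)) `|`
    \bigcup_k ((f k @` (~` \bigcup_i C k i)) `|` \bigcup_i (f k @` C k i)))).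
    move=> y _; have [[k _ [a _ fa]]|h] := pselect ((\bigcup_k range (f k)) y); last by left.
    right; exists k => //; have [[i _ Ci]|h] := pselect ((\bigcup_i C k i) a).
      by right; exists i => //; exists a.
    by left; exists a.
  apply: negligibleU => //; apply: negligible_bigcup => k; apply: negligibleU.
    by have [_ _ _ _] := Cc k; exact: (pnull_negligible mu0).
  by apply: negligible_bigcup => i.
by have /negligibleP := nT => /(_ measurableT) h; move: mupos; rewrite h ltxx.
Qed.

Lemma diff_norm_ge {R : realType} (p m : nat) (f : 'rV[R]_p -> 'rV[R]_m)
    (a : 'rV[R]_p) (T : 'M[R]_(p, m)) (c r : R) : 0 < r ->
  (forall b, `|b - a| <= r -> c * `|b - a| <= `|f b - f a|) ->
  (forall e, 0 < e -> exists2 d, 0 < d & forall z : 'rV[R]_p, `|z| < d ->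
     `|f (a + z) - f a - z *m T| <= e * `|z|) ->
  forall z : 'rV[R]_p, c * `|z| <= `|z *m T|.
Proof.
move=> r0 fc fT z; have [->|z0] := eqVneq z 0; first by rewrite mul0mx !normr0 mulr0.
have nz : 0 < `|z| by rewrite normr_gt0.
apply/ler_addgt0Pr => e e0.
have [d d0 dP] := fT (e / `|z|) (divr_gt0 e0 nz).
have dr : 0 < Num.min d r by rewrite lt_min d0.
pose t := Num.min d r / 2 / `|z|; have t0 : 0 < t by rewrite !divr_gt0.
have tz : `|t *: z| = Num.min d r / 2.
  by rewrite normrZ (gtr0_norm t0) /t divfK// gt_eqF.
have tzlt : `|t *: z| < Num.min d r by rewrite tz; lra.
move: (tzlt); rewrite lt_min => /andP[tzd tzr].
have h1 := dP _ tzd.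
have := fc (a + t *: z); rewrite addrAC subrr add0r => /(_ (ltW tzr)) h2.
have h3 : `|f (a + t *: z) - f a| <= `|t *: z *m T| + `|f (a + t *: z) - f a - t *: z *m T|.
  by rewrite -{1}(subrK (t *: z *m T) (f (a + t *: z) - f a)) addrC ler_normD.
have h4 : c * `|t *: z| <= `|t *: z *m T| + e / `|z| * `|t *: z| by lra.
clear -t0 h4 nz; clearbody t; move: h4.
rewrite -scalemxAl !normrZ (gtr0_norm t0) => h.
have h5 : e / `|z| * (t * `|z|) = t * e by field; rewrite gt_eqF.
by rewrite h5 mulrCA -mulrDr ler_pM2l// in h.
Qed.

Lemma norm_ge_row_free {R : realType} (p m : nat) (T : 'M[R]_(p, m)) (c : R) : 0 < c ->
  (forall z : 'rV[R]_p, c * `|z| <= `|z *m T|) -> \rank T = p.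
Proof.
move=> c0 Tc; apply/eqP; rewrite -[_ == _]/(row_free T) -kermx_eq0.
apply/eqP/row_matrixP => i; rewrite row0; apply/eqP; rewrite -normr_eq0 eq_le normr_ge0 andbT.
have := Tc (row i (kermx T)); rewrite -row_mul mulmx_ker row0 normr0.
by rewrite pmulr_rle0.
Qed.

(** Choose a piece of positive mass; a Lipschitz left inverse carries its mass
    to a measure with a density, and almost every point satisfies the
    hypotheses of [blowup_cvg]. *)
Theorem tangent_planes {R : realType} (q m : nat)
    (mu : {measure set (borel 'rV[R]_m) -> \bar R})
    (f : nat -> 'rV[R]_q.+1 -> 'rV[R]_m) (K : nat -> R) :
  (mu setT < +oo)%E ->
  (forall k x y, `|f k x - f k y| <= K k * `|x - y|) ->
  (forall B : set (borel 'rV[R]_m), measurable B -> pnull q.+1 B -> mu B = 0%E) ->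
  mu.-negligible ((~` \bigcup_k range (f k)) : set (borel 'rV[R]_m)) ->
  (0 < mu setT)%E ->
  exists B : set (borel 'rV[R]_m), [/\ measurable B, (0 < mu B)%E &
    forall x : 'rV[R]_m, B x -> exists (T : 'M[R]_(q.+1, m)) (theta : R),
    [/\ \rank T = q.+1, 0 < theta &
      forall phi : 'rV[R]_m -> R, continuous phi ->
        (exists2 K, compact K & forall v, ~ K v -> phi v = 0) ->
        l ^- q.+1 * Rintegral mu setT (fun y => phi (l^-1 *: ((y : 'rV[R]_m) - x)))
          @[l --> 0^'+] -->
        theta * Rintegral (lebn q.+1) setT (fun z => phi ((z : 'rV[R]_q.+1) *m T))]].
Proof.
move=> mufin fK' mu0 munull mupos.
have [k [C [c [cC c0 Cloc Cdiam muC]]]] := charged_piece fK' mu0 munull mupos.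
have {fK'} fK := fK' k; move: fK muC Cloc; move: (f k) (K k) => {munull} {}f {}K {k} fK muC Cloc.
have Cge a b : C a -> C b -> c * `|b - a| <= `|f b - f a|.
  by move=> Ca Cb; apply: Cloc => //; exact: Cdiam.
pose T1 := borel 'rV[R]_q.+1; pose T2 := borel 'rV[R]_m; pose L := @lebn R q.+1.
pose E : set 'rV[R]_m := f @` C.
have fc : continuous f by exact: lip_continuous fK.
have cE : compact E by apply: continuous_compact => //; apply: continuous_subspaceT.
have clE : closed E by apply: compact_closed cE; exact: norm_hausdorff.
have mE : measurable (E : set T2) by exact: closed_borel.
have clC : closed C by apply: compact_closed cC; exact: norm_hausdorff.
have mC : measurable (C : set T1) by exact: closed_borel.
have E0 : E !=set0.
  by apply/set0P; apply/eqP => E0; move: muC; rewrite -/E E0 measure0 ltxx.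
(* A Lipschitz left inverse of [f] on [C]. *)
pose s0 y := xget 0 [set a | C a /\ f a = y].
have s0P y : E y -> C (s0 y) /\ f (s0 y) = y.
  by move=> [a Ca <-]; apply: (@xgetPex _ 0 [set b | C b /\ f b = f a]); exists a.
have ci0 : 0 <= c^-1 by rewrite invr_ge0 ltW.
have [s [sK sE]] : exists s : 'rV[R]_m -> 'rV[R]_q.+1,
    (forall x y, `|s x - s y| <= c^-1 * `|x - y|) /\ forall x, E x -> s x = s0 x.
  apply: mcshane => // x y /s0P[Cx fx] /s0P[Cy fy].
  by rewrite ler_pdivlMl// -{2}fx -{2}fy; exact: Cge.
have sC y : E y -> C (s y) by move=> Ey; rewrite sE//; have [] := s0P y Ey.
have fs y : E y -> f (s y) = y by move=> Ey; rewrite sE//; have [] := s0P y Ey.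
have ms : measurable_fun setT (s : T2 -> T1).
  by apply: continuous_borel; exact: lip_continuous sK.
have [nu [nuE nuI]] := restricted_pushforward mu (mE : measurable (E : set T2)) ms.
have nufin : (nu setT < +oo)%E.
  rewrite nuE; apply: le_lt_trans mufin; apply: le_measure; rewrite ?inE//.
  by apply: measurableI => //; rewrite preimage_setT.
have nuL (A : set T1) : measurable A -> L A = 0%E -> nu A = 0%E.
  move=> mA LA; rewrite nuE; apply: mu0.
    by apply: measurableI => //; rewrite -[X in measurable X]setTI; exact: ms.
  apply: (@pnullS _ _ _ _ (f @` A)); first by move=> y [sy Ey]; exists (s y) => //; exact: fs.
  by apply: (@lip_image_null R q.+1 m isT f K fK); apply/negligibleP.
have [w [mw w0 wfin nuw]] := density_exists nufin nuL.
pose w' (b : T1) := w b * \1_C b.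
have mw' : measurable_fun setT w' by apply: measurable_funM => //; exact: measurable_indic.
have w'0 b : 0 <= w' b by rewrite mulr_ge0// indicE.
have w'C b : w' b != 0 -> C b.
  rewrite /w' indicE; case: (boolP (b \in C)) => [/set_mem//|_]; by rewrite mulr0 eqxx.
have muE psi : (forall y, 0 <= psi y)%E -> measurable_fun setT psi ->
    (\int[mu]_(y in E) psi y = \int[L]_b (psi (f b) * (w' b)%:E))%E.
  move=> psi0 mpsi; pose g b := (psi (f b) * (\1_C b)%:E)%E.
  have mg : measurable_fun setT (g : T1 -> \bar R).
    apply: emeasurable_funM; last by apply/measurable_EFinP; exact: measurable_indic.
    by apply: measurableT_comp mpsi _; exact: continuous_borel.
  have g0 b : (0 <= g b)%E by rewrite mule_ge0// lee_fin indicE.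
  transitivity (\int[nu]_b g b)%E.
    rewrite nuI//; apply: eq_integral => y /set_mem Ey.
    by rewrite /g fs// indicE mem_set ?mule1//; exact: sC.
  rewrite nuw//; apply: eq_integral => b _.
  by rewrite /g /w' EFinM [((w b)%:E * _)%E]muleC muleA.
pose V (i : nat) : set 'rV[R]_m := \bigcup_(e in E) ball e i.+1%:R^-1.
have oV i : open (V i) by apply: bigcup_open => e _; exact: ball_open.
have mVE i : measurable (V i `\` E : set T2).
  by apply: measurableD => //; exact: open_borel.
have /choice[nui nuiE] := fun i => restricted_pushforward mu (mVE i) ms.
have nuifin i : (nui i setT < +oo)%E.
  have [-> _] := nuiE i; apply: le_lt_trans mufin; apply: le_measure; rewrite ?inE//.
  by apply: measurableI => //; rewrite preimage_setT.
have nui0 e : 0 < e -> exists i, (nui i setT <= e%:E)%E.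
  move=> e0; pose F i : set T2 := ~` V i.
  have mF i : measurable (F i) by apply: measurableC; exact: open_borel.
  have ndF : nondecreasing_seq F.
    move=> i j ij; apply/subsetPset; apply: subsetC => y [z Ez zy]; exists z => //.
    by apply: le_ball zy; rewrite lef_pV2 ?posrE// ler_nat.
  have [i hi] := finite_measure_tail mufin mF ndF e0.
  exists i; have [-> _] := nuiE i; apply: le_trans hi; rewrite preimage_setT setTI.
  apply: le_measure; rewrite ?inE//.
    by apply: measurableD => //; exact: bigcup_measurable.
  move=> y [Vy nEy]; split; last by move=> h; exact: h.
  have /nbhs_ballP[r /= r0 rE] : nbhs y (~` E).
    by apply: open_nbhs_nbhs; split => //; exact: closed_openC.
  exists (Num.bound r^-1) => // -[z Ez zy]; apply: (rE z) => //.
  apply: ball_sym; apply: le_ball zy; rewrite invf_ple ?posrE//= ltW//.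
  by apply: (lt_trans (archi_boundP _)); rewrite ?invr_ge0 ?ltW// ltr_nat.
have N1 := lebesgue_points mw'.
have {}N1 : L.-negligible [set a | ~ (forall t, 0 < t -> exists d, 0 < d /\
     forall r, 0 < r < d ->
       (\int[L]_(x in (ball (a : 'rV[R]_q.+1) r : set T1)) `|w' x - w' a|%:E <= (t * r ^+ q.+1)%:E)%E)].
  apply: N1 => k.
  apply: le_lt_trans wfin; apply: (@le_trans _ _ (\int[L]_(x in (ball (0%R : 'rV[R]_q.+1) k%:R : set T1)) (w x)%:E)%E).
    apply: ge0_le_integral => //.
    - exact: ball_borel.
    - apply: measurable_funTS; apply/measurable_EFinP.
      exact: measurableT_comp.
    - by apply: measurable_funTS; apply/measurable_EFinP.
    - move=> b _; rewrite lee_fin ger0_norm// /w' indicE.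
      by case: (b \in C); rewrite ?mulr1 ?mulr0.
  apply: ge0_subset_integral => //; first exact: ball_borel.
    by apply/measurable_EFinP.
  by move=> b _; rewrite lee_fin.
have N2 := rademacher fK.
have N3 := small_mass_density nuifin nui0.
have := negligibleU (negligibleU N1 N2) N3 => -[N [mN LN sN]].
pose B : set T2 := E `&` s @^-1` (~` N `&` [set b | w b != 0]).
have mw0 : measurable [set b : T1 | w b != 0].
  rewrite (_ : [set b : T1 | w b != 0] = setT `&` w @^-1` (~` [set 0])).
    by apply: mw => //; apply: measurableC; exact: measurable_set1.
  by apply/seteqP; split => [b /eqP h|b [_ /eqP h]].
exists B; split.
- apply: measurableI => //; rewrite -[X in measurable X]setTI; apply: ms => //.
  by apply: measurableI => //; exact: measurableC.
- rewrite lt_neqAle measure_ge0 andbT eq_sym; apply/negP => /eqP B0.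
  have mG : measurable (~` N `&` [set b : T1 | w b != 0]).
    by apply: measurableI => //; exact: measurableC.
  have nG : nu.-negligible (~` N `&` [set b : T1 | w b != 0]).
    by apply/(negligibleP nu mG); apply: (etrans (nuE _)); rewrite setIC.
  have nN : nu.-negligible N by apply/negligibleP => //; exact: nuL.
  have nW : nu.-negligible (~` [set b : T1 | w b != 0]).
    have mW : measurable (~` [set b : T1 | w b != 0]) by exact: measurableC.
    apply/(negligibleP nu mW).
    have : nu (~` [set b : T1 | w b != 0]) = 0%E; last by [].
    rewrite -[X in nu X]setIT -integral_indic// nuw//; last by apply/measurable_EFinP; exact: measurable_indic.
    apply: integral0_eq => b _; rewrite indicE.
    case: (boolP (b \in _)) => [/set_mem/negP|_]; last by rewrite mul0e.
    by rewrite negbK => /eqP ->; rewrite mule0.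
  have nT : nu.-negligible [set: T1].
    apply: negligibleS (negligibleU (negligibleU nG nN) nW) => b _.
    have [Nb|Nb] := pselect (N b); first by left; right.
    have [wb|wb] := boolP (w b != 0); first by left; left.
    by right; exact/negP.
  have h : mu (E : set T2) = 0%E.
    have := nuE setT; rewrite preimage_setT setTI => <-.
    exact: (negligibleP nu measurableT).1 nT.
  by move: muC; rewrite lt_neqAle measure_ge0 andbT eq_sym => /eqP; apply; exact: h.
move=> x [Ex [sN' /= wx]]; pose a := s x.
have Ca : C a by exact: sC.
have fa : f a = x by exact: fs.
have w'a : 0 < w' a.
  rewrite /w' indicE mem_set// mulr1 lt_neqAle eq_sym; apply/andP; split => //.
have wleb : forall t, 0 < t -> exists d, 0 < d /\
     forall r, 0 < r < d ->
       (\int[L]_(x in (ball (a : 'rV[R]_q.+1) r : set T1)) `|w' x - w' a|%:E <= (t * r ^+ q.+1)%:E)%E.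
  by apply: contrapT => h; apply: sN'; apply: sN; left; left.
have [T fT] : exists T : 'M[R]_(q.+1, m), forall e, 0 < e -> exists2 d, 0 < d &
    forall z : 'rV[R]_q.+1, `|z| < d -> `|f (a + z) - f a - z *m T| <= e * `|z|.
  apply: contrapT => h; apply: sN'; apply: sN; left; right => -[T hT]; apply: h.
  by exists T => e /hT[d [d0 dP]]; exists d.
have dens : forall t, 0 < t -> exists i, forall r, 0 < r <= 1 ->
    (nui i (ball (a : 'rV[R]_q.+1) r : set T1) <= (t * r ^+ q.+1)%:E)%E.
  by apply: contrapT => h; apply: sN'; apply: sN; right.
have Tge := diff_norm_ge c0 (Cloc a ^~ Ca) fT.
exists T, (w' a); split => //; first exact: norm_ge_row_free c0 Tge.
move=> phi phic phiK; rewrite -fa.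
apply: (blowup_cvg mufin mE fc mw' w'0 c0 muE _ Tge fT wleb _ phic phiK).
  by move=> b /w'C Cb; exact: Cge.
move=> t t0; have tc : 0 < t * c ^+ q.+1 by rewrite mulr_gt0// exprn_gt0.
have [i hi] := dens _ tc.
exists (Num.min c i.+1%:R^-1); split; first by rewrite lt_min c0 /= invr_gt0 ltr0Sn.
move=> r /andP[r0]; rewrite lt_min => /andP[rc ri].
have rc01 : 0 < r / c <= 1 by rewrite divr_gt0//= ler_pdivrMr// mul1r ltW.
have := hi _ rc01; have [-> _] := nuiE i.
rewrite -mulrA -exprMn [c * _]mulrC divfK ?gt_eqF//.
apply: le_trans; apply: le_measure; rewrite ?inE.
- by apply: measurableD => //; exact: ball_borel.
- apply: measurableI => //; rewrite -[X in measurable X]setTI; apply: ms => //.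
  exact: ball_borel.
- move=> y; rewrite fa => -[]; rewrite -ball_normE /= => xy nEy; split.
    rewrite /= -ball_normE /= /a; apply: (le_lt_trans (sK _ _)).
    by rewrite mulrC ltr_pM2r// invr_gt0.
  split => //; exists x => //; rewrite -ball_normE /=; exact: lt_trans ri.
Qed.

(** * Hausdorff measures *)

Lemma ball_volume_gt0 (R : realType) (p : nat) : 0 < ball_volume p :> R.
Proof.
have [k] := ubnP p; elim: k p => // k IH [|[|p]] //= pk.
by rewrite mulr_gt0 ?divr_gt0 ?mulr_gt0 ?pi_gt0 ?ltr0n//; apply: IH; lia.
Qed.

Section HausdorffCovers.
Context {R : realType} {T : Type} (d : T -> T -> \bar R) (q : nat).
Notation p := q.+1.
Implicit Types A : set T.

Let om : R := ball_volume p / 2 ^+ p.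

Let om_gt0 : 0 < om.
Proof. by rewrite divr_gt0 ?exprn_gt0//; exact: ball_volume_gt0. Qed.

Lemma diameter_ge0 A : (0 <= diameter d A)%E.
Proof. by apply: ereal_sup_ubound; left. Qed.

Lemma diameter_le A M : 0 <= M -> (forall x y, A x -> A y -> (d x y <= M%:E)%E) ->
  (diameter d A <= M%:E)%E.
Proof.
move=> M0 h; apply: ge_ereal_sup => _ [->|[[x y] [/= Ax Ay] <-]]; first by rewrite lee_fin.
exact: h.
Qed.

Lemma le_diameter A x y : A x -> A y -> (d x y <= diameter d A)%E.
Proof. by move=> Ax Ay; apply: ereal_sup_ubound; right; exists (x, y). Qed.

Lemma hausdorff_pre_le dl A (U : nat -> set T) (D : nat -> R) :
  A `<=` \bigcup_k U k -> (forall k, 0 <= D k <= dl) ->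
  (forall k x y, U k x -> U k y -> (d x y <= (D k)%:E)%E) ->
  (hausdorff_pre d p dl A <= om%:E * \sum_(k <oo) (D k ^+ p)%:E)%E.
Proof.
move=> AU D0 UD.
have dD k : (diameter d (U k) <= (D k)%:E)%E.
  by apply: diameter_le; [have /andP[] := D0 k|exact: UD].
have dE k : exists2 x : R, diameter d (U k) = x%:E & 0 <= x <= D k.
  have := dD k; have := diameter_ge0 (U k); case: (diameter d (U k)) => // x.
  by rewrite !lee_fin => h1 h2; exists x; rewrite ?h1.
apply: (@le_trans _ _ (\sum_(0 <= k <oo) (om%:E * diameter d (U k) ^+ p))%E).
  apply: ereal_inf_lbound; exists U => //; split => // k.
  by apply: le_trans (dD k) _; rewrite lee_fin; have /andP[] := D0 k.
rewrite -nneseriesZl; last by move=> k _; rewrite lee_fin exprn_ge0//; have /andP[] := D0 k.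
apply: lee_nneseries => [k _ _|k _].
  by rewrite mule_ge0 ?lee_fin ?(ltW om_gt0)// expe_ge0// diameter_ge0.
have [x -> /andP[x0 xD]] := dE k.
rewrite -EFin_expe -!EFinM lee_fin ler_wpM2l ?(ltW om_gt0)//.
by rewrite lerXn2r ?nnegrE// (le_trans x0).
Qed.

Lemma hausdorff_pre_lt dl A (x : \bar R) : (hausdorff_pre d p dl A < x)%E ->
  exists (U : nat -> set T) (D : nat -> R),
  [/\ A `<=` \bigcup_k U k, forall k, 0 <= D k <= dl,
    forall k u v, U k u -> U k v -> (d u v <= (D k)%:E)%E &
    (om%:E * \sum_(k <oo) (D k ^+ p)%:E < x)%E].
Proof.
move=> /ereal_inf_lt[_ [U [AU dU] <-] Ux].
have dE k : exists2 D : R, diameter d (U k) = D%:E & 0 <= D <= dl.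
  have := dU k; have := diameter_ge0 (U k); case: (diameter d (U k)) => // D.
  by rewrite !lee_fin => h1 h2; exists D; rewrite ?h1.
have /choice[D DP] : forall k, exists D : R, diameter d (U k) = D%:E /\ 0 <= D <= dl.
  by move=> k; have [D h1 h2] := dE k; exists D.
exists U, D; split => //.
- by move=> k; have [] := DP k.
- by move=> k u v Uu Uv; have [<- _] := DP k; exact: le_diameter.
- apply: le_lt_trans Ux; rewrite -nneseriesZl; last first.
    by move=> k _; rewrite lee_fin exprn_ge0//; have [_ /andP[]] := DP k.
  apply: lee_nneseries => [k _ _|k _].
    by rewrite mule_ge0// lee_fin ?(ltW om_gt0)// exprn_ge0//; have [_ /andP[]] := DP k.
  by have [-> _] := DP k; rewrite -EFin_expe.
Qed.

Lemma hausdorff_pre_le_count (I : countType) dl A (U : I -> set T) (D : I -> R) :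
  0 <= dl ->
  A `<=` \bigcup_i U i -> (forall i, 0 <= D i <= dl) ->
  (forall i x y, U i x -> U i y -> (d x y <= (D i)%:E)%E) ->
  (hausdorff_pre d p dl A <= om%:E * \esum_(i in [set: I]) (D i ^+ p)%:E)%E.
Proof.
move=> dl0 AU D0 UD.
pose U' k := if (pickle_inv k : option I) is Some i then U i else set0.
pose D' k := if (pickle_inv k : option I) is Some i then D i else 0.
apply: le_trans (@hausdorff_pre_le dl A U' D' _ _ _) _.
- by move=> x /AU[i _ xi]; exists (pickle i) => //; rewrite /U' pickleK_inv.
- by move=> k; rewrite /D'; case: pickle_inv => [i|]; rewrite ?D0 ?lexx.
- by move=> k x y; rewrite /U' /D'; case: pickle_inv => [i|//]; exact: UD.
apply: lee_wpmul2l; first by rewrite lee_fin ltW.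
have D00 i : 0 <= D i by have /andP[] := D0 i.
rewrite -esum_enum; last by move=> i; rewrite lee_fin exprn_ge0.
apply: lee_nneseries => [k _ _|k _]; rewrite /D'; case: pickle_inv => [i|];
  by rewrite ?lee_fin ?expr0n ?exprn_ge0.
Qed.

Lemma hausdorff_pre_ge0 dl A : (0 <= hausdorff_pre d p dl A)%E.
Proof.
apply: le_ereal_inf_tmp => _ [U _ <-]; apply: nneseries_ge0 => k _ _.
by rewrite mule_ge0 ?lee_fin ?(ltW om_gt0)// expe_ge0// diameter_ge0.
Qed.

Lemma hausdorff_pre_measure dl A : 0 < dl ->
  (hausdorff_pre d p dl A <= hausdorff_measure d p A)%E.
Proof. by move=> dl0; apply: ereal_sup_ubound; exists dl. Qed.

Lemma hausdorff_ge0 A : (0 <= hausdorff_measure d p A)%E.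
Proof. exact: le_trans (hausdorff_pre_ge0 1 A) (hausdorff_pre_measure _ _). Qed.

Lemma le_hausdorff A B : A `<=` B ->
  (hausdorff_measure d p A <= hausdorff_measure d p B)%E.
Proof.
move=> AB; apply: ge_ereal_sup => _ [dl dl0 <-].
apply: le_trans (hausdorff_pre_measure _ dl0).
apply: le_ereal_inf_tmp => x [U [BU dU] <-]; apply: ereal_inf_lbound.
by exists U => //; split => //; exact: subset_trans BU.
Qed.

Lemma hausdorff_bigcup (A : nat -> set T) :
  (hausdorff_measure d p (\bigcup_i A i) <= \sum_(i <oo) hausdorff_measure d p (A i))%E.
Proof.
apply: ge_ereal_sup => _ [dl dl0 <-].
apply: (@le_trans _ _ (\sum_(i <oo) hausdorff_pre d p dl (A i))%E); last first.
  apply: lee_nneseries => [i _ _|i _]; first exact: hausdorff_pre_ge0.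
  exact: hausdorff_pre_measure.
have [[i hi]|fin] := pselect (exists i, hausdorff_pre d p dl (A i) = +oo%E).
  by rewrite (@nneseries_pinfty _ _ xpredT i) ?leey// => k _; exact: hausdorff_pre_ge0.
apply/lee_addgt0Pr => e e0.
have ei i : 0 < e / (2 ^ i.+1)%:R by rewrite divr_gt0// ltr0n expn_gt0.
have /choice[U /choice[D UD]] : forall i, exists (U : nat -> set T) (D : nat -> R),
  [/\ A i `<=` \bigcup_k U k, forall k, 0 <= D k <= dl,
    forall k u v, U k u -> U k v -> (d u v <= (D k)%:E)%E &
    (om%:E * \sum_(k <oo) (D k ^+ p)%:E < hausdorff_pre d p dl (A i) + (e / (2 ^ i.+1)%:R)%:E)%E].
  move=> i; apply: hausdorff_pre_lt; rewrite -[ltLHS]adde0 lteD2lE ?lte_fin//.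
  rewrite ge0_fin_numE ?hausdorff_pre_ge0// ltey; apply/eqP => h; apply: fin; by exists i.
apply: le_trans (epsilon_trick _ (fun i => hausdorff_pre_ge0 dl (A i)) (ltW e0)).
have D0 i k : 0 <= D i k by have [_ /(_ k)/andP[]] := UD i.
apply: (le_trans (@hausdorff_pre_le_count (nat * nat)%type dl _
  (fun ij => U ij.1 ij.2) (fun ij => D ij.1 ij.2) (ltW dl0) _ _ _)).
- by move=> x [i _ Ax]; have [+ _ _ _] := UD i => /(_ x Ax)[k _ Ux]; exists (i, k).
- by move=> [i k]; have [_ + _ _] := UD i; exact.
- by move=> [i k]; have [_ _ + _] := UD i; exact.
rewrite -(_ : setT `*` setT = [set: nat * nat]); last exact: setXTT.
have := @esum_esum R nat nat setT (fun=> setT) (fun i j => (D i j ^+ p)%:E).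
move=> <-; last by move=> i j _ _; rewrite lee_fin exprn_ge0.
rewrite -nneseries_esumT; last by move=> i; apply: esum_ge0 => j _; rewrite lee_fin exprn_ge0.
rewrite -nneseriesZl; last by move=> i _; apply: esum_ge0 => j _; rewrite lee_fin exprn_ge0.
apply: lee_nneseries => [i _ _|i _].
  by rewrite mule_ge0 ?lee_fin ?(ltW om_gt0)//; apply: esum_ge0 => j _; rewrite lee_fin exprn_ge0.
rewrite -nneseries_esumT; last by move=> j; rewrite lee_fin exprn_ge0.
by have [_ _ _ /ltW] := UD i.
Qed.

Lemma hausdorff0 : hausdorff_measure d p set0 = 0%E.
Proof.
apply/eqP; rewrite eq_le hausdorff_ge0 andbT; apply: ge_ereal_sup => _ [dl dl0 <-].
apply: le_trans (@hausdorff_pre_le dl set0 (fun=> set0) (fun=> 0) _ _ _) _ => //.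
  by move=> k; rewrite lexx ltW.
by rewrite eseries0 ?mule0// => k _ _; rewrite expr0n.
Qed.

Lemma hausdorffU A B : (hausdorff_measure d p (A `|` B) <=
  hausdorff_measure d p A + hausdorff_measure d p B)%E.
Proof.
rewrite -bigcup2E; apply: le_trans (hausdorff_bigcup _) _.
rewrite (nneseries_split 0 2); last by move=> k _; exact: hausdorff_ge0.
rewrite add0n eseries0 ?adde0; last first.
  by move=> k k2 _; rewrite /bigcup2; case: k k2 => [|[|k]]//= _; exact: hausdorff0.
by rewrite big_nat_recl//= big_nat1.
Qed.

End HausdorffCovers.

(** Covers are transported by the map; finer covers have small enough sets for
    the Lipschitz bound to apply. *)
Lemma hausdorff_lip {R : realType} (T T' : Type) (d : T -> T -> \bar R)
    (d' : T' -> T' -> \bar R) (q : nat) (f : T -> T') (A : set T) (K r : R) :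
  0 < K -> 0 < r ->
  (forall x y, A x -> A y -> (d x y <= r%:E)%E -> (d' (f x) (f y) <= K%:E * d x y)%E) ->
  (hausdorff_measure d' q.+1 (f @` A) <= (K ^+ q.+1)%:E * hausdorff_measure d q.+1 A)%E.
Proof.
move=> K0 r0 fK; apply: ge_ereal_sup => _ [dl dl0 <-].
pose e := Num.min (dl / K) r.
have e0 : 0 < e by rewrite lt_min divr_gt0.
apply: (@le_trans _ _ ((K ^+ q.+1)%:E * hausdorff_pre d q.+1 e A)%E); last first.
  by apply: lee_wpmul2l; [rewrite lee_fin exprn_ge0// ltW|exact: hausdorff_pre_measure].
rewrite -lee_pdivrMl ?exprn_gt0//.
rewrite leNgt; apply/negP => /hausdorff_pre_lt[U [D [AU De UD]]].
apply/negP; rewrite -leNgt lee_pdivrMl ?exprn_gt0//.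
apply: le_trans (@hausdorff_pre_le R T' d' q dl _ (fun k => f @` (U k `&` A)) (fun k => K * D k) _ _ _) _.
- by move=> _ [x Ax <-]; have [k _ Ux] := AU x Ax; exists k => //; exists x.
- move=> k; have /andP[D0 ] := De k; rewrite le_min => /andP[h _].
  by rewrite mulr_ge0 ?(ltW K0)//= mulrC -ler_pdivlMr.
- move=> k _ _ [x [Ux Ax] <-] [y [Uy Ay] <-].
  have xy := UD k x y Ux Uy.
  apply: (@le_trans _ _ (K%:E * d x y)%E).
    apply: fK => //; apply: le_trans xy _; rewrite lee_fin.
    by have /andP[_] := De k; rewrite le_min => /andP[].
  by rewrite EFinM; apply: lee_wpmul2l => //; rewrite lee_fin ltW.
rewrite muleCA; apply: lee_wpmul2l.
  by rewrite lee_fin divr_ge0 ?exprn_ge0// ltW// ball_volume_gt0.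
have D0 k : 0 <= D k by have /andP[] := De k.
rewrite -nneseriesZl; last by move=> k _; rewrite lee_fin exprn_ge0.
apply: lee_nneseries => [k _ _|k _]; first by rewrite lee_fin exprn_ge0// mulr_ge0// ltW.
by rewrite exprMn EFinM.
Qed.

Lemma hausdorff_lipT {R : realType} (T T' : Type) (d : T -> T -> \bar R)
    (d' : T' -> T' -> \bar R) (q : nat) (f : T -> T') (A : set T) (K : R) :
  0 < K -> (forall x y, A x -> A y -> (d' (f x) (f y) <= K%:E * d x y)%E) ->
  (hausdorff_measure d' q.+1 (f @` A) <= (K ^+ q.+1)%:E * hausdorff_measure d q.+1 A)%E.
Proof. by move=> K0 fK; apply: (@hausdorff_lip R T T' d d' q f A K 1) => // x y Ax Ay _; exact: fK. Qed.

(** * Hausdorff measure of the supremum distance, and of planes *)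

Definition sup_distance {R : realType} {m : nat} (u v : 'rV[R]_m) : \bar R := `|u - v|%:E.

Section SupHausdorff.
Context {R : realType} {m : nat} (q : nat).
Notation p := q.+1.
Notation H := (hausdorff_measure (@sup_distance R m) p).

Lemma pnull_hausdorff0 (A : set 'rV[R]_m) : pnull p A -> H A = 0%E.
Proof.
move=> A0; apply/eqP; rewrite eq_le hausdorff_ge0 andbT; apply: ge_ereal_sup => _ [dl dl0 <-].
apply/lee_addgt0Pr => e e0; rewrite add0e.
have vol0 := ball_volume_gt0 R p.
pose e' := Num.min ((dl / 2) ^+ p) (e / ball_volume p).
have e'0 : 0 < e' by rewrite lt_min exprn_gt0 ?divr_gt0.
have [c [r [r0 Ac re]]] := A0 _ e'0.
have rk k : r k <= dl / 2.
  rewrite -(@ler_pXn2r _ p) ?nnegrE ?(ltW (divr_gt0 dl0 _))//.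
  have : ((r k ^+ p)%:E <= e'%:E)%E.
    apply: le_trans re; rewrite (nneseriesD1 (n := k))//.
      by rewrite leeDl//; apply: nneseries_ge0 => j _ _; rewrite lee_fin exprn_ge0.
    by move=> j _; rewrite lee_fin exprn_ge0.
  by rewrite lee_fin le_min => /andP[].
apply: le_trans (@hausdorff_pre_le R _ _ q dl A (fun k => ball (c k) (r k)) (fun k => 2 * r k) Ac _ _) _.
- by move=> k; rewrite mulr_ge0//= mulrC -ler_pdivlMr.
- move=> k x y; rewrite -ball_normE /= => xk yk; rewrite /sup_distance lee_fin.
  rewrite -(subrKA (c k)) (le_trans (ler_normD _ _))// distrC; lra.
have -> : (\sum_(k <oo) ((2 * r k) ^+ p)%:E = (2 ^+ p)%:E * \sum_(k <oo) (r k ^+ p)%:E)%E.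
  rewrite -nneseriesZl; last by move=> k _; rewrite lee_fin exprn_ge0.
  by apply: eq_eseriesr => k _; rewrite exprMn EFinM.
rewrite muleA -EFinM divfK ?expf_neq0//.
apply: (@le_trans _ _ ((ball_volume p)%:E * e'%:E)%E).
  by apply: lee_wpmul2l re; rewrite lee_fin ltW.
rewrite -EFinM lee_fin mulrC -ler_pdivlMr//; by rewrite ge_min lexx orbT.
Qed.

(** A set of diameter [D] lies in a ball of radius larger than [D]; the radii
    are increased by summable amounts to be positive. *)
Lemma hausdorff0_pnull (A : set 'rV[R]_m) : H A = 0%E -> pnull p A.
Proof.
move=> A0 e e0; have vol0 := ball_volume_gt0 R p.
pose om : R := ball_volume p / 2 ^+ p.
have om0 : 0 < om by rewrite divr_gt0 ?exprn_gt0.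
pose e' := e / 2 / 2 ^+ p.
have e'0 : 0 < e' by rewrite !divr_gt0 ?exprn_gt0.
have : (hausdorff_pre (@sup_distance R m) p 1 A < (om * e')%:E)%E.
  apply: (@le_lt_trans _ _ 0%E); last by rewrite lte_fin mulr_gt0.
  by rewrite -A0; exact: hausdorff_pre_measure.
move=> /hausdorff_pre_lt[U [D [AU De UD]]].
rewrite [(om * e')%:E]EFinM -/om lte_pmul2l ?lte_fin// => De'.
have D0 k : 0 <= D k by have /andP[] := De k.
pose h k : R := Num.min 1 (e' / (2 ^ k.+1)%:R).
have ek k : 0 < e' / (2 ^ k.+1)%:R by rewrite divr_gt0// ltr0n expn_gt0.
have h0 k : 0 < h k by rewrite lt_min ltr01 ek.
exists (fun k => xget 0 (U k)), (fun k => D k + h k); split.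
- by move=> k; rewrite addr_ge0// ltW.
- move=> x Ax; have [k _ Ux] := AU x Ax; exists k => //.
  have Ug : U k (xget 0 (U k)) by apply: (xgetPex 0); exists x.
  rewrite -ball_normE /=; have := UD k _ _ Ug Ux; rewrite /sup_distance lee_fin.
  by move=> /le_lt_trans; apply; rewrite ltrDl.
apply: (@le_trans _ _ (\sum_(k <oo) ((2 ^+ p * D k ^+ p)%:E + (2 ^+ p * (e' / (2 ^ k.+1)%:R))%:E))%E).
  apply: lee_nneseries => [k _ _|k _].
    by rewrite lee_fin exprn_ge0// addr_ge0// ltW.
  rewrite -EFinD lee_fin -mulrDr.
  have hk : h k ^+ p <= e' / (2 ^ k.+1)%:R.
    apply: (@le_trans _ _ (h k)); last by rewrite ge_min lexx orbT.
    by rewrite exprS ler_piMr ?(ltW (h0 k))// exprn_ile1 ?(ltW (h0 k))//; by rewrite ge_min lexx.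
  apply: (@le_trans _ _ (2 ^+ p * (D k ^+ p + h k ^+ p))); last first.
    by rewrite ler_wpM2l ?exprn_ge0// lerD2l.
  have [Dh|hD] := leP (D k) (h k).
    apply: (@le_trans _ _ ((2 * h k) ^+ p)).
      by rewrite lerXn2r ?nnegrE ?addr_ge0 ?mulr_ge0 ?(ltW (h0 k))//; lra.
    by rewrite exprMn ler_wpM2l ?exprn_ge0// lerDr exprn_ge0.
  apply: (@le_trans _ _ ((2 * D k) ^+ p)).
    by rewrite lerXn2r ?nnegrE ?addr_ge0 ?mulr_ge0 ?(ltW (h0 k))//; lra.
  by rewrite exprMn ler_wpM2l ?exprn_ge0// lerDl exprn_ge0// ltW.
rewrite nneseriesD; [|by move=> k _ _; rewrite lee_fin mulr_ge0 ?exprn_ge0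
  |by move=> k _ _; rewrite lee_fin mulr_ge0 ?exprn_ge0// ltW].
have ee : e = 2 ^+ p * e' + 2 ^+ p * e'.
  by rewrite /e' mulrC divfK ?expf_neq0// -splitr.
rewrite ee EFinD; apply: leeD.
  under eq_eseriesr do rewrite EFinM.
  rewrite nneseriesZl; last by move=> k _; rewrite lee_fin exprn_ge0.
  by rewrite EFinM; apply: lee_wpmul2l; [rewrite lee_fin exprn_ge0|exact: ltW].
under eq_eseriesr do rewrite EFinM.
rewrite nneseriesZl; last by move=> k _; rewrite lee_fin ltW.
rewrite EFinM; apply: lee_wpmul2l; first by rewrite lee_fin exprn_ge0.
have := @epsilon_trick R (fun=> 0%E) e' xpredT (fun=> lexx _) (ltW e'0).
rewrite (_ : \sum_(i <oo) 0%R = 0)%E ?add0e; last by rewrite eseries0.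
apply: le_trans.
by apply: lee_nneseries => [k _ _|k _]; rewrite ?add0e// lee_fin ltW.
Qed.

End SupHausdorff.

Lemma pnull_lebn {R : realType} (q : nat) (A : set 'rV[R]_q.+1) :
  measurable (A : set (borel 'rV[R]_q.+1)) -> pnull q.+1 A ->
  lebn q.+1 (A : set (borel 'rV[R]_q.+1)) = 0%E.
Proof.
move=> mA A0; apply/eqP; rewrite eq_le measure_ge0 andbT; apply/lee_addgt0Pr => e e0.
rewrite add0e; have e20 : 0 < e / 2 ^+ q.+1 by rewrite divr_gt0 ?exprn_gt0.
have [c [r [r0 Ac re]]] := A0 _ e20.
apply: le_trans (measure_sigma_subadditive _ (fun k => ball_borel (c k) (r k)) mA Ac) _.
apply: (@le_trans _ _ (\sum_(k <oo) (2 ^+ q.+1)%:E * (r k ^+ q.+1)%:E)%E).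
  apply: lee_nneseries => // k _; rewrite -EFinM -exprMn.
  have [rk|rk] := ltP 0 (r k); first exact: lebn_ball.
  rewrite (_ : ball _ _ = set0) ?measure0 ?lee_fin ?exprn_ge0 ?mulr_ge0//.
  apply/seteqP; split => // x; rewrite -ball_normE /= => /(le_lt_trans (normr_ge0 _)).
  by rewrite ltNge rk.
rewrite nneseriesZl; last by move=> k _; rewrite lee_fin exprn_ge0.
apply: (@le_trans _ _ ((2 ^+ q.+1)%:E * (e / 2 ^+ q.+1)%:E)%E).
  by apply: lee_wpmul2l re; rewrite lee_fin exprn_ge0.
by rewrite -EFinM mulrC divfK ?expf_neq0.
Qed.

(** Subdivide a cube into equal cubes. *)
Lemma sup_hausdorff_fin {R : realType} (q : nat) (A : set 'rV[R]_q.+1) :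
  (forall x, A x -> `|x| <= 1) ->
  (hausdorff_measure (@sup_distance R q.+1) q.+1 A < +oo)%E.
Proof.
move=> A1; pose om : R := ball_volume q.+1 / 2 ^+ q.+1.
have om0 : 0 < om by rewrite divr_gt0 ?exprn_gt0// ball_volume_gt0.
apply: (@le_lt_trans _ _ (om * 5 ^+ q.+1)%:E); last exact: ltry.
apply: ge_ereal_sup => _ [dl dl0 <-].
pose N := (Num.truncn dl^-1).+1.
have N0 : 0 < N%:R :> R by rewrite ltr0n.
have Nd : N%:R^-1 <= dl.
  rewrite invf_ple ?posrE// ltW//.
  by have /andP[] := truncn_itv (ltW (eqbRL (invr_gt0 _) dl0)).
pose ctr (i : 'I_(4 * N).+1) : R := i%:R * (2^-1 / N%:R) - 2 * 2^-1.
pose I := {ffun 'I_q.+1 -> 'I_(4 * N).+1}.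
pose U (e : I) : set 'rV[R]_q.+1 := [set x | forall j, `|x 0 j - ctr (e j)| <= 2^-1 / N%:R].
have h20 : 0 < 2^-1 :> R by rewrite invr_gt0.
apply: le_trans (@hausdorff_pre_le_count R _ _ q I dl A U (fun=> N%:R^-1) (ltW dl0) _ _ _) _.
- move=> x Ax; have /choice[e he] : forall j, exists i : 'I_(4 * N).+1, `|x 0 j - ctr i| <= 2^-1 / N%:R.
    move=> j; apply: grid_close => //; rewrite mulfV ?pnatr_eq0//.
    exact: le_trans (le_coord_norm _ _) (A1 _ Ax).
  by exists [ffun j => e j] => // j; rewrite ffunE.
- by move=> e; rewrite invr_ge0 ler0n.
- move=> e x y Ux Uy; rewrite /sup_distance lee_fin; apply: norm_rV_le => [|j].
    by rewrite invr_ge0.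
  rewrite !mxE -(subrKA (ctr (e j))) (le_trans (ler_normD _ _))//.
  have -> : N%:R^-1 = 2^-1 / N%:R + 2^-1 / N%:R :> R by field; rewrite gt_eqF.
  by rewrite lerD// distrC.
rewrite [(om * _)%:E]EFinM; apply: lee_wpmul2l; first by rewrite lee_fin ltW.
rewrite esum_fset; [|exact: finite_finset|by move=> i _; rewrite lee_fin exprn_ge0// invr_ge0].
rewrite fsbig_finite; last exact: finite_finset.
rewrite (perm_big (index_enum I))/=; last first.
  apply: uniq_perm; [exact: finmap.fset_uniq|exact: index_enum_uniq|move=> i].
  by rewrite mem_index_enum in_fset_set ?in_setT//; exact: finite_finset.
rewrite sumEFin lee_fin sumr_const -[leLHS]mulr_natl card_ffun !card_ord natrX -exprMn.
rewrite lerXn2r ?nnegrE ?mulr_ge0 ?invr_ge0// ler_pdivrMr// -natrM ler_nat.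
by rewrite /N; lia.
Qed.

Section NormHausdorff.
Context {R : realType} (q : nat).
Notation p := q.+1.
Notation T1 := (borel 'rV[R]_p).
Notation L := (@lebn R p).
Variables (nrm : 'rV[R]_p -> R) (c1 c2 : R).
Hypothesis c10 : 0 < c1.
Hypothesis nrmZ : forall l z, 0 < l -> nrm (l *: z) = l * nrm z.
Hypothesis nrm1 : forall z, c1 * `|z| <= nrm z.
Hypothesis nrm2 : forall z, nrm z <= c2 * `|z|.

Notation H := (hausdorff_measure (fun u v : 'rV[R]_p => (nrm (u - v))%:E) p).

Let unit_cube : set 'rV[R]_p := dcube 0 0.
Let c := H unit_cube.

Let H_affine_le a l (A : set 'rV[R]_p) : 0 < l ->
  (H (affine_rV a l @` A) <= (l ^+ p)%:E * H A)%E.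
Proof.
move=> l0; apply: hausdorff_lipT => // x y _ _.
by rewrite /affine_rV opprD addrACA subrr add0r -scalerBr nrmZ// EFinM.
Qed.

Let affineK a l : 0 < l -> cancel (affine_rV a l) (affine_rV (- (l^-1 *: a)) l^-1 : 'rV[R]_p -> _).
Proof.
move=> l0 v; rewrite /affine_rV scalerDr addrA addNr add0r scalerA mulVf ?gt_eqF//.
by rewrite scale1r.
Qed.

Let H_affine a l (A : set 'rV[R]_p) : 0 < l ->
  H (affine_rV a l @` A) = ((l ^+ p)%:E * H A)%E.
Proof.
move=> l0; apply/eqP; rewrite eq_le H_affine_le//=.
have il : 0 < l^-1 by rewrite invr_gt0.
rewrite -lee_pdivlMl ?exprn_gt0// -exprVn.
apply: le_trans (H_affine_le (- (l^-1 *: a)) _ il).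
apply: le_hausdorff => x Ax; exists (affine_rV a l x); first by exists x.
exact: affineK.
Qed.

Let c_gt0 : (0 < c)%E.
Proof.
rewrite lt_neqAle hausdorff_ge0 andbT eq_sym; apply/eqP => c0.
have : lebn p (unit_cube : set T1) = 0%E.
  apply: pnull_lebn; first exact: measurable_dcube.
  apply: hausdorff0_pnull; apply/eqP; rewrite eq_le hausdorff_ge0 andbT.
  rewrite -(image_id unit_cube) -[leRHS](mule0 (c1^-1 ^+ p)%:E) -c0.
  apply: hausdorff_lipT => [|x y _ _]; first by rewrite invr_gt0.
  by rewrite /sup_distance -EFinM lee_fin ler_pdivlMl.
rewrite lebn_dcube expr0 invr1 expr1n => -[] /eqP; by rewrite oner_eq0.
Qed.

Let c_fin : (c < +oo)%E.
Proof.
have c20 : 0 < `|c2| + 1 by rewrite ltr_wpDl.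
rewrite /c -(image_id unit_cube).
apply: (@le_lt_trans _ _ (((`|c2| + 1) ^+ p)%:E * hausdorff_measure (@sup_distance R p) p unit_cube)%E).
  apply: hausdorff_lipT => // x y _ _; rewrite /sup_distance -EFinM lee_fin.
  apply: (le_trans (nrm2 _)); rewrite ler_wpM2r//.
  by apply: (le_trans (ler_norm _)); rewrite lerDl.
apply: lte_mul_pinfty; first by rewrite lee_fin exprn_ge0// ltW.
  by [].
apply: sup_hausdorff_fin => x hx; apply: norm_rV_le => // j.
have := floor_itv (2 ^+ 0 * x 0 j); rewrite hx mxE expr0 mul1r add0r.
by move=> /andP[h1 h2]; rewrite ger0_norm// ltW.
Qed.

Let cR := fine c.

Let cE : c = cR%:E.
Proof. by rewrite /cR fineK// ge0_fin_numE// hausdorff_ge0. Qed.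

Let cR0 : 0 < cR.
Proof. by rewrite -lte_fin -cE. Qed.

Let H_dcube k z : H (dcube k z) = (cR%:E * L (dcube k z : set T1))%E.
Proof.
have l0 : 0 < 2 ^- k :> R by rewrite invr_gt0 exprn_gt0.
have l0' : 0 < 2 ^+ k :> R by rewrite exprn_gt0.
rewrite lebn_dcube muleC -cE.
have -> : dcube k z = affine_rV (\row_j (2 ^- k * (z 0 j)%:~R)) (2 ^- k) @` unit_cube.
  apply/seteqP; split => [x hx|_ [x hx <-] j].
    exists (\row_j (2 ^+ k * x 0 j - (z 0 j)%:~R)).
      move=> j; rewrite !mxE expr0 mul1r -(hx j).
      apply: floor_def; have /andP[] := floor_itv (2 ^+ k * x 0 j).
      by rewrite add0r intrD => h1 h2; apply/andP; split; lra.
    apply/rowP => j; rewrite !mxE mulrBr addrC subrK mulrA mulVf ?mul1r//.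
  have /andP[] := floor_itv (2 ^+ 0 * x 0 j).
  rewrite (hx j) !mxE expr0 mul1r mulrDr !mulrA mulfV ?gt_eqF// !mul1r add0r => h1 h2.
  by apply: floor_def; rewrite intrD; apply/andP; split; lra.
by rewrite H_affine.
Qed.

Let H_open (V : set 'rV[R]_p) : open V -> (H V <= cR%:E * L (V : set T1))%E.
Proof.
move=> oV; pose P := [set i | (0 <= @dlevel p i)%N /\ (dcubes i : set 'rV[R]_p) `<=` V].
have VE : V = \bigcup_(i in P) dcubes i := open_dcubes 0 oV.
have [M [MP trivM coverM]] := @dcubes_select R p P.
pose D i : set T1 := if i \in M then dcubes i else set0.
have mD i : measurable (D i) by rewrite /D; case: ifP => // _; exact: measurable_dcubes.
have trivD : trivIset setT D.
  move=> i j _ _ [v]; rewrite /D; case: ifP => [/set_mem Mi|_ [] //].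
  by case: ifP => [/set_mem Mj [iv jv]|_ [] //]; apply: trivM => //; exists v.
have VD : V = \bigcup_i D i.
  apply/seteqP; split => [v|v [i _]].
    rewrite {1}VE => -[i Pi vi].
    have [j Mj [ij _]] := coverM i Pi (ex_intro _ v vi).
    by exists j => //; rewrite /D mem_set//; exact: ij.
  by rewrite /D; case: ifPn => // /set_mem /MP[_]; exact.
have mU : measurable (\bigcup_i D i) by exact: bigcup_measurable.
have /cvg_lim E := @measure_semi_sigma_additive _ _ _ L D mD trivD mU.
rewrite VD -E// -nneseriesZl//.
apply: le_trans (hausdorff_bigcup _ _ _) _.
apply: lee_nneseries => [i _ _|i _]; first exact: hausdorff_ge0.
rewrite /D; case: ifPn => _; last by rewrite hausdorff0 measure0 mule0.
rewrite /dcubes; case: unpickle => [[k z]|]; first by rewrite H_dcube.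
by rewrite hausdorff0 measure0 mule0.
Qed.

Let big n : set T1 := affine_rV (const_mx (- n.+1%:R)) (2 * n.+1%:R) @` unit_cube.

Let bigE n : big n = box (const_mx (- n.+1%:R)) (const_mx n.+1%:R).
Proof.
have n0 : 0 < n.+1%:R :> R by rewrite ltr0n.
have n20 : 0 < 2 * n.+1%:R :> R by rewrite mulr_gt0.
apply/seteqP; split => [_ [x hx <-] j|x hx].
  have := floor_itv (2 ^+ 0 * x 0 j); rewrite hx !mxE expr0 mul1r add0r => /andP[h1 h2].
  have h3 : 0 <= 2 * n.+1%:R * x 0 j by rewrite mulr_ge0// ltW.
  have h4 : 2 * n.+1%:R * x 0 j < 2 * n.+1%:R by rewrite gtr_pMr.
  by apply/andP; split; lra.
exists (\row_j ((x 0 j + n.+1%:R) / (2 * n.+1%:R))).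
  move=> j; rewrite !mxE expr0 mul1r; apply: floor_def; rewrite add0r.
  have := hx j; rewrite !mxE => /andP[h1 h2].
  rewrite ler_pdivlMr// ltr_pdivrMr// mul0r mul1r; apply/andP; split; lra.
apply/rowP => j; rewrite !mxE mulrC divfK ?gt_eqF//; lra.
Qed.

Let mbig n : measurable (big n).
Proof. by rewrite bigE; exact: measurable_box. Qed.

Let H_big n : H (big n) = (cR%:E * L (big n))%E.
Proof.
have n0 : 0 < 2 * n.+1%:R :> R by rewrite mulr_gt0.
rewrite H_affine// -/c cE muleC; congr (_ * _)%E.
rewrite bigE lebn_box; last by move=> j; rewrite !mxE; have := ltr0Sn R n; lra.
congr EFin; rewrite (eq_bigr (fun=> 2 * n.+1%:R)); first by rewrite prodr_const card_ord.
by move=> j _; rewrite !mxE; ring.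
Qed.

Let H_bounded_le n (A : set T1) : measurable A -> A `<=` big n ->
  (H A <= cR%:E * L A)%E.
Proof.
move=> mA An; pose W : set 'rV[R]_p := ball 0 n.+2%:R.
have W0 : 0 < n.+2%:R :> R by rewrite ltr0n.
have mW : measurable (W : set T1) by exact: ball_borel.
have AW : A `<=` W.
  move=> x /An; rewrite bigE => hx; apply/(ball_rVP _ _ W0) => j.
  have := hx j; rewrite !mxE -[n.+2%:R]natr1 => /andP[h1 h2].
  rewrite subr0 || rewrite ?sub0r; rewrite ltr_norml; apply/andP; split; lra.
have fin : (mrestr L mW setT < +oo)%E.
  by rewrite /mrestr setTI; apply: le_lt_trans (lebn_ball _ W0) (ltry _).
apply/lee_addgt0Pr => e e0.
have [V [F [oV cF FA AV VF]]] := @finite_regular R p (mrestr L mW) A fin mA (e / cR) (divr_gt0 e0 cR0).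
have oVW : open (V `&` W) by apply: openI => //; exact: ball_open.
apply: (@le_trans _ _ (H (V `&` W))).
  by apply: le_hausdorff => x Ax; split; [exact: AV|exact: AW].
apply: (le_trans (H_open oVW)).
apply: (@le_trans _ _ (cR%:E * (L A + (e / cR)%:E))%E); last first.
  rewrite muleDr ?fin_num_adde_defl//.
  by rewrite -EFinM mulrC divfK ?gt_eqF.
apply: lee_wpmul2l; first by rewrite lee_fin ltW.
have mVW : measurable (V `&` W : set T1) by exact: open_borel.
have mVF : measurable ((V `\` F) `&` W : set T1).
  by apply: measurableI => //; apply: measurableD; [exact: open_borel|exact: closed_borel].
apply: (@le_trans _ _ (L (A `|` ((V `\` F) `&` W)))).
  apply: le_measure; rewrite ?inE//; first exact: measurableU.
  move=> x [Vx Wx]; have [Fx|nFx] := pselect (F x); first by left; exact: FA.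
  by right.
by apply: le_trans (measureU2 _ mA mVF) _; exact: leeD2l.
Qed.

Let H_bounded n (A : set T1) : measurable A -> A `<=` big n ->
  H A = (cR%:E * L A)%E.
Proof.
move=> mA An; apply/eqP; rewrite eq_le (H_bounded_le mA An)/=.
have mD : measurable (big n `\` A) by exact: measurableD.
have Lfin : (L (big n) < +oo)%E by rewrite bigE; exact: lebn_box_fin.
have HB : (cR%:E * L (big n) <= H A + cR%:E * L (big n `\` A))%E.
  rewrite -H_big; apply: (@le_trans _ _ (H A + H (big n `\` A))%E).
    apply: le_trans (hausdorffU _ _ _ _); apply: le_hausdorff => x Bx.
    by have [Ax|nAx] := pselect (A x); [left|right].
  by apply: leeD2l; apply: H_bounded_le => // x [].
have LE : L (big n) = (L A + L (big n `\` A))%E.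
  rewrite -measureU//; last by apply/seteqP; split => // x [Ax [_ nAx]].
  congr (L _); apply/seteqP; split => [x Bx|x [/An//|[]//]].
  by have [Ax|nAx] := pselect (A x); [left|right].
have finA : L A \is a fin_num.
  rewrite ge0_fin_numE//; apply: le_lt_trans Lfin; apply: le_measure; rewrite ?inE//.
have finD : L (big n `\` A) \is a fin_num.
  rewrite ge0_fin_numE//; apply: le_lt_trans Lfin; apply: le_measure; rewrite ?inE//.
move: HB; rewrite LE muleDr ?ge0_adde_def ?inE// leeD2rE//.
by rewrite fin_numM.
Qed.

(** Both sides are translation invariant and homogeneous, so they agree on
    dyadic cubes up to a constant. Subadditivity gives the upper bound by
    covering with dyadic cubes, and the lower bound by taking complements in a
    large cube. *)
Lemma norm_hausdorff_lebn : exists2 k : R, 0 < k & forall A : set T1, measurable A ->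
  H A = (k%:E * L A)%E.
Proof.
exists cR => // A mA.
have ndB : nondecreasing_seq big.
  move=> i j ij; apply/subsetPset; rewrite !bigE => x hx l; have := hx l; rewrite !mxE.
  have : i.+1%:R <= j.+1%:R :> R by rewrite ler_nat.
  by move=> h /andP[h1 h2]; apply/andP; split; lra.
have cover x : exists n, big n x.
  exists (Num.truncn `|x|); rewrite bigE => j; rewrite !mxE.
  have /andP[_ h] := truncn_itv (normr_ge0 x).
  have := le_lt_trans (le_coord_norm x j) h.
  by rewrite ltr_norml => /andP[/ltW -> ->].
have mAB n : measurable (A `&` big n) by exact: measurableI.
apply/eqP; rewrite eq_le; apply/andP; split; last first.
  have ndAB : nondecreasing_seq (fun n => A `&` big n).
    by move=> i j /ndB /subsetPset ij; apply/subsetPset; exact: setIS.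
  have UE : \bigcup_n (A `&` big n) = A.
    apply/seteqP; split => [x [n _ []]//|x Ax].
    by have [n Bx] := cover x; exists n.
  have cv := @nondecreasing_cvg_mu _ _ _ L _ mAB _ ndAB.
  rewrite UE in cv; have {}cv := cv mA.
  rewrite -lee_pdivlMl//; apply: (cvge_to_le cv).
  near=> n; rewrite /= lee_pdivlMl// -(@H_bounded n)//.
  by apply: le_hausdorff => x [].
pose S := seqDU big.
have mS n : measurable (S n) by apply: measurableD => //; exact: bigsetU_measurable.
have trivS : trivIset setT S by exact: trivIset_seqDU.
have US : \bigcup_n S n = setT.
  by rewrite -seqDU_bigcup_eq; apply/seteqP; split => // x _; have [n Bx] := cover x; exists n.
have mAS n : measurable (A `&` S n) by exact: measurableI.
have trivAS : trivIset setT (fun n => A `&` S n).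
  by move=> i j _ _ [x [[_ xi] [_ xj]]]; apply: trivS => //; exists x.
have AE : A = \bigcup_n (A `&` S n) by rewrite -setI_bigcupr US setIT.
have mU : measurable (\bigcup_n (A `&` S n)) by rewrite -AE.
have /cvg_lim E := @measure_semi_sigma_additive _ _ _ L _ mAS trivAS mU.
rewrite {1 2}AE -E// -nneseriesZl//.
apply: le_trans (hausdorff_bigcup _ _ _) _.
apply: lee_nneseries => [i _ _|i _]; first exact: hausdorff_ge0.
rewrite (@H_bounded i)// => x [_]; exact: subset_seqDU.
Unshelve. all: by end_near. Qed.

End NormHausdorff.

Lemma sup_le_euclid {R : realType} (m : nat) (v : 'rV[R]_m) :
  `|v| <= Num.sqrt (\sum_k v 0 k ^+ 2).
Proof.
apply: norm_rV_le => // j; rewrite -sqrtr_sqr ler_sqrt; last first.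
  by apply: sumr_ge0 => k _; exact: sqr_ge0.
by rewrite (bigD1 j)//= lerDl; apply: sumr_ge0 => k _; exact: sqr_ge0.
Qed.

Lemma euclid_le_sup {R : realType} (m : nat) (v : 'rV[R]_m) :
  Num.sqrt (\sum_k v 0 k ^+ 2) <= m.+1%:R * `|v|.
Proof.
rewrite -[leRHS]ger0_norm ?mulr_ge0// -sqrtr_sqr ler_sqrt ?sqr_ge0//.
apply: (@le_trans _ _ (\sum_(k < m) `|v| ^+ 2)).
  by apply: ler_sum => k _; rewrite -real_normK ?num_real// lerXn2r ?nnegrE// le_coord_norm.
rewrite sumr_const card_ord -[leLHS]mulr_natl exprMn ler_wpM2r ?sqr_ge0//.
by rewrite -natrX ler_nat; nia.
Qed.

(** The parametrization is an isometry for the norm it pulls back, to which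
    [norm_hausdorff_lebn] applies. *)
Lemma plane_hausdorff {R : realType} (q m : nat) (T : 'M[R]_(q.+1, m)) (c : R) : 0 < c ->
  (forall z : 'rV[R]_q.+1, c * `|z| <= `|z *m T|) ->
  exists2 k : R, 0 < k & forall A : set (borel 'rV[R]_m), measurable A ->
    hausdorff_measure (@euclidean_distance R m) q.+1 (A `&` [set v | (v <= T)%MS]) =
    (k%:E * lebn q.+1 ((fun z : 'rV[R]_q.+1 => z *m T) @^-1` A : set (borel 'rV[R]_q.+1)))%E.
Proof.
move=> c0 Tc.
pose nrm (z : 'rV[R]_q.+1) := Num.sqrt (\sum_k (z *m T) 0 k ^+ 2).
pose M := \sum_i \sum_j `|T i j|.
have TM (z : 'rV[R]_q.+1) : `|z *m T| <= M * `|z|.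
  have M0 : 0 <= M by apply: sumr_ge0 => i _; apply: sumr_ge0.
  apply: norm_rV_le => [|j]; first by rewrite mulr_ge0.
  rewrite mxE; apply: (le_trans (ler_norm_sum _ _ _)).
  apply: (@le_trans _ _ (\sum_i `|T i j| * `|z|)).
    by apply: ler_sum => i _; rewrite normrM mulrC ler_wpM2l// le_coord_norm.
  rewrite -mulr_suml ler_wpM2r//.
  by apply: ler_sum => i _; rewrite (bigD1 j)//= lerDl; apply: sumr_ge0.
have nrmZ l z : 0 < l -> nrm (l *: z) = l * nrm z.
  move=> l0; rewrite /nrm -[l in RHS](ger0_norm (ltW l0)) -sqrtr_sqr -sqrtrM ?sqr_ge0//.
  congr Num.sqrt; rewrite mulr_sumr; apply: eq_bigr => k _.
  by rewrite -scalemxAl mxE exprMn.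
have [k k0 kP] : exists2 k : R, 0 < k & forall A : set (borel 'rV[R]_q.+1), measurable A ->
    hausdorff_measure (fun u v : 'rV[R]_q.+1 => (nrm (u - v))%:E) q.+1 A =
    (k%:E * lebn q.+1 A)%E.
  apply: (norm_hausdorff_lebn (c2 := m.+1%:R * M) c0 nrmZ).
  - by move=> z; exact: le_trans (Tc z) (sup_le_euclid _).
  - move=> z; apply: le_trans (euclid_le_sup _) _; rewrite -mulrA.
    by rewrite ler_wpM2l.
exists k => // A mA.
pose A' : set 'rV[R]_q.+1 := (fun z : 'rV[R]_q.+1 => z *m T) @^-1` A.
have mA' : measurable (A' : set (borel 'rV[R]_q.+1)).
  rewrite -[X in measurable X]setTI; apply: (continuous_borel (@mulmxr_continuous _ _ _ T)) => //.
rewrite -kP//.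
have AE : A `&` [set v | (v <= T)%MS] = (fun z : 'rV[R]_q.+1 => z *m T) @` A'.
  apply/seteqP; split => [v [Av /submxP[z vz]]|_ [z Az <-]].
    by exists z => //; rewrite /A' /= -vz.
  by split => //; exact: submxMl.
have dE x y : euclidean_distance (x *m T) (y *m T) = (nrm (x - y))%:E.
  congr (Num.sqrt _)%:E; apply: eq_bigr => j _.
  by rewrite mulmxBl !mxE.
rewrite AE; apply/eqP; rewrite eq_le; apply/andP; split.
  rewrite -[leRHS]mul1e -[in leRHS](expr1n R q.+1); apply: hausdorff_lipT => // x y _ _.
  by rewrite dE mul1e.
have TT : T *m pinvmx T = 1%:M.
  by apply: mulmxVp; rewrite /row_free (norm_ge_row_free c0 Tc).
have {1}-> : (fun z : 'rV[R]_q.+1 => z *m T) @^-1` A =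
    (fun v => v *m pinvmx T) @` ((fun z : 'rV[R]_q.+1 => z *m T) @` A').
  apply/seteqP; split => [z Az|_ [_ [z Az <-] <-]]; last by rewrite -mulmxA TT mulmx1.
  by exists (z *m T); [exists z|rewrite -mulmxA TT mulmx1].
rewrite -[leRHS]mul1e -[in leRHS](expr1n R q.+1); apply: hausdorff_lipT => // _ _ [x Ax <-] [y Ay <-].
by rewrite mul1e dE -!mulmxA TT !mulmx1.
Qed.

(** * Calculus of continuously differentiable functions of several variables *)

Section Calculus.
Context {R : realType}.

Lemma line_is_derive (p : nat) (f : 'rV[R]_p -> R) (w v : 'rV[R]_p) (s : R) :
  derivable f (w + s *: v) v ->
  is_derive s 1 (fun s => f (w + s *: v)) ('D_v f (w + s *: v)).
Proof.
move=> df.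
have E : (fun h : R => h^-1 *: ((fun s => f (w + s *: v)) (h *: 1 + s) - f (w + s *: v))) =
         (fun h => h^-1 *: (f (h *: v + (w + s *: v)) - f (w + s *: v))).
  apply/funext => h; congr (_ *: (f _ - _)).
  by rewrite [h *: 1]mulr1 scalerDl addrCA.
apply: DeriveDef.
  by rewrite /derivable E.
by rewrite /derive E.
Qed.

Lemma shift_is_derive (p : nat) (f : 'rV[R]_p -> R) (k x v : 'rV[R]_p) :
  derivable f (x + k) v -> is_derive x v (fun y => f (y + k)) ('D_v f (x + k)).
Proof.
move=> df.
have E : (fun h : R => h^-1 *: ((fun y => f (y + k)) (h *: v + x) - f (x + k))) =
         (fun h => h^-1 *: (f (h *: v + (x + k)) - f (x + k))).
  by apply/funext => h; rewrite addrA.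
by apply: DeriveDef; [rewrite /derivable E|rewrite /derive E].
Qed.

Lemma mvt_line (p : nat) (f : 'rV[R]_p -> R) (w v : 'rV[R]_p) (t : R) : 0 < t ->
  (forall s, 0 <= s <= t -> derivable f (w + s *: v) v) ->
  exists2 s, 0 < s < t & f (w + t *: v) - f w = t * 'D_v f (w + s *: v).
Proof.
move=> t0 df; pose phi s := f (w + s *: v).
have dphi s : 0 <= s <= t -> is_derive s 1 phi ('D_v f (w + s *: v)).
  by move=> st; apply: line_is_derive; exact: df.
have cphi : {within `[0, t], continuous phi}.
  apply: derivable_within_continuous => s; rewrite in_itv /= => st.
  by have [] := dphi s st.
have [s st E] : exists2 s, s \in `]0, t[%R & phi t - phi 0 = 'D_v f (w + s *: v) * (t - 0).
  apply: (MVT (df := fun s => 'D_v f (w + s *: v)) t0 _ cphi) => s; rewrite in_itv/= => /andP[s0 st].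
  by apply: dphi; rewrite !ltW.
exists s; first by move: st; rewrite in_itv.
by move: E; rewrite /phi scale0r addr0 subr0 mulrC.
Qed.

(** Decreasing increments reduce to increasing ones by reversing the
    direction. *)
Lemma mvt_partial (p : nat) (f : 'rV[R]_p -> R) (a : 'I_p) (w : 'rV[R]_p) (t : R) :
  (forall s, `|s| <= `|t| -> derivable f (w + s *: delta_mx 0 a) (delta_mx 0 a)) ->
  exists2 s, `|s| <= `|t| & f (w + t *: delta_mx 0 a) - f w = t * partial a f (w + s *: delta_mx 0 a).
Proof.
move=> df; have [t0|t0|->] := ltrgtP t 0.
- have t0' : 0 < - t by rewrite oppr_gt0.
  have df' s : 0 <= s <= - t ->
      derivable f (w + t *: delta_mx 0 a + s *: delta_mx 0 a) (delta_mx 0 a).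
    move=> /andP[s0 st]; rewrite -addrA -scalerDl; apply: df.
    by rewrite (ltr0_norm t0) ler_norml; apply/andP; split; lra.
  have [s /andP[s1 s2]] := mvt_line t0' df'.
  rewrite scaleNr addrK -[_ + _ + s *: _]addrA -scalerDl => E.
  exists (t + s); first by rewrite (ltr0_norm t0) ler_norml; apply/andP; split; lra.
  by rewrite -opprB E mulNr opprK.
- have df' s : 0 <= s <= t -> derivable f (w + s *: delta_mx 0 a) (delta_mx 0 a).
    move=> /andP[s0 st]; apply: df; rewrite (gtr0_norm t0) ler_norml.
    by apply/andP; split; lra.
  have [s /andP[s1 s2] E] := mvt_line t0 df'.
  by exists s => //; rewrite (gtr0_norm t0) ler_norml; apply/andP; split; lra.
- by exists 0 => //; rewrite scale0r addr0 subrr mul0r.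
Qed.

(** The corners of the path that changes one coordinate after the other. *)
Definition row_trunc (p k : nat) (z : 'rV[R]_p) : 'rV[R]_p :=
  \row_j if (j < k)%N then z 0 j else 0.

Lemma row_truncS (p : nat) (k : 'I_p) (z : 'rV[R]_p) :
  row_trunc k.+1 z = row_trunc k z + z 0 k *: delta_mx 0 k.
Proof.
apply/rowP => j; rewrite !mxE eqxx /= ltnS leq_eqVlt -[j == k]val_eqE /=.
have [jk|jk|jk] := ltngtP j k; rewrite /= ?mulr0 ?addr0//.
by rewrite add0r mulr1; congr (z 0 _); exact: val_inj.
Qed.

(** The increment telescopes along the path of [row_trunc], and the mean value
    theorem applies on each step. *)
Lemma Ck1_expand (p : nat) (W : set 'rV[R]_p) (f : 'rV[R]_p -> R) (u : 'rV[R]_p) :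
  open W -> Ck 1 W f -> W u ->
  forall e, 0 < e -> exists2 d, 0 < d & forall z : 'rV[R]_p, `|z| < d ->
    `|f (u + z) - f u - \sum_a z 0 a * partial a f u| <= e * `|z|.
Proof.
move=> oW [_ df] Wu e e0.
have e'0 : 0 < e / p.+1%:R by rewrite divr_gt0.
have hU : \forall v \near u, W v /\ forall a, `|partial a f v - partial a f u| <= e / p.+1%:R.
  apply: filterI; first exact: open_nbhs_nbhs.
  apply: (@filter_forall _ 'I_p (fun a x => `|partial a f x - partial a f u| <= e / p.+1%:R) (nbhs u)) => a.
  have [_ [cp _]] := df a.
  have := cp u Wu; move=> /(@cvgrPdist_le _ _ _ (nbhs u))/(_ _ e'0); apply: filterS => v.
  by rewrite distrC.
have /nbhs_ballP[d /= d0 dW] := hU.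
exists d => // z zd.
have inW k s : `|s| <= `|z 0 k| -> ball u d (u + (row_trunc k z + s *: delta_mx 0 k)).
  move=> sz; rewrite -ball_normE /= opprD addrA subrr add0r normrN.
  apply: le_lt_trans zd; apply: norm_rV_le => // j; rewrite !mxE eqxx /=.
  have [jk|jk|jk] := ltngtP j k.
  - have -> : (j == k) = false by apply/negP => /eqP jk'; move: jk; rewrite jk' ltnn.
    by rewrite mulr0 addr0 le_coord_norm.
  - have -> : (j == k) = false by apply/negP => /eqP jk'; move: jk; rewrite jk' ltnn.
    by rewrite mulr0 addr0 normr0.
  - have -> : j == k by apply/eqP/val_inj.
    by rewrite mulr1 add0r (le_trans sz)// le_coord_norm.
have step (k : 'I_p) : `|f (u + row_trunc k.+1 z) - f (u + row_trunc k z) -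
    z 0 k * partial k f u| <= e / p.+1%:R * `|z|.
  have dk s : `|s| <= `|z 0 k| -> derivable f (u + row_trunc k z + s *: delta_mx 0 k) (delta_mx 0 k).
    move=> sz; rewrite -addrA; have /dW[Wv _] := inW k s sz.
    by have [dfk _] := df k; exact: dfk.
  have [s sz E] := mvt_partial dk.
  rewrite row_truncS addrA E -addrA -mulrBr normrM mulrC.
  have /dW[_ h] := inW k s sz.
  by apply: ler_pM => //; rewrite ?le_coord_norm.
have tel : f (u + z) - f u = \sum_(k < p) (f (u + row_trunc k.+1 z) - f (u + row_trunc k z)).
  rewrite -(big_mkord xpredT (fun k => f (u + row_trunc k.+1 z) - f (u + row_trunc k z))).
  rewrite (@telescope_sumr _ _ _ (fun k => f (u + row_trunc k z)))//.
  congr (f _ - f _).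
    by congr (_ + _); apply/rowP => j; rewrite mxE ltn_ord.
  rewrite (_ : row_trunc 0 z = 0) ?addr0//.
  by apply/rowP => j; rewrite !mxE.
rewrite tel -sumrB; apply: (le_trans (ler_norm_sum _ _ _)).
apply: (@le_trans _ _ (\sum_(k < p) (e / p.+1%:R * `|z|))).
  by apply: ler_sum => k _; exact: step.
rewrite sumr_const card_ord -[leLHS]mulr_natl mulrA ler_wpM2r//.
rewrite mulrCA ler_piMr ?(ltW e0)// ler_pdivrMr// mul1r ler_nat.
exact: leqnSn.
Qed.

Lemma differentiable_expand (p m : nat) (f : 'rV[R]_p -> 'rV[R]_m) (a : 'rV[R]_p)
    (T : 'M[R]_(p, m)) :
  (forall e, 0 < e -> exists2 d, 0 < d & forall z : 'rV[R]_p, `|z| < d ->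
    `|f (a + z) - f a - z *m T| <= e * `|z|) ->
  differentiable f a /\ forall v, 'd f a v = v *m T.
Proof.
move=> fT.
have cT : continuous (mulmxr T : 'rV[R]_p -> 'rV[R]_m) by exact: mulmxr_continuous.
have E : f \o shift a = cst (f a) + mulmxr T +o_ (0 : 'rV[R]_p) id.
  apply/eqaddoP => e e0; have [d d0 dP] := fT e e0.
  apply/nbhs_ballP; exists d => // z; rewrite -ball_normE /= sub0r normrN => zd.
  by have := dP z zd; rewrite [a + z]addrC opprD addrA.
have dE : 'd f a = mulmxr T :> ('rV[R]_p -> 'rV[R]_m) by exact: diff_unique.
split; last by move=> v; rewrite dE.
by apply/diff_locallyP; split; rewrite dE.
Qed.

Definition partial_mx (p m : nat) (F : 'rV[R]_p -> 'rV[R]_m) (u : 'rV[R]_p) : 'M[R]_(p, m) :=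
  \matrix_(a, k) partial a (fun v => F v 0 k) u.

Lemma Ck1_map_differentiable (p m : nat) (W : set 'rV[R]_p) (F : 'rV[R]_p -> 'rV[R]_m)
    (u : 'rV[R]_p) : open W -> W u -> (forall k, Ck 1 W (fun v => F v 0 k)) ->
  differentiable F u /\ forall v, 'd F u v = v *m partial_mx F u.
Proof.
move=> oW Wu dF; apply: differentiable_expand => e e0.
have /choice[d dP] : forall k, exists d, 0 < d /\ forall z : 'rV[R]_p, `|z| < d ->
    `|F (u + z) 0 k - F u 0 k - \sum_a z 0 a * partial a (fun v => F v 0 k) u| <= e * `|z|.
  by move=> k; have [d d0 h] := Ck1_expand oW (dF k) Wu e0; exists d.
exists (\big[Num.min/1]_k d k).
  by apply: lt_bigmin => // k _; have [] := dP k.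
move=> z zd; apply: norm_rV_le => [|k]; first by rewrite mulr_ge0// ltW.
have [_ h] := dP k; have := h z; rewrite !mxE => hz.
rewrite (_ : \sum_j _ = \sum_a z 0 a * partial a (fun v => F v 0 k) u).
  by apply: hz; apply: (lt_le_trans zd); exact: bigmin_le.
by apply: eq_bigr => a _; rewrite mxE.
Qed.

Lemma Ck1_differentiable (p : nat) (W : set 'rV[R]_p) (f : 'rV[R]_p -> R) (u : 'rV[R]_p) :
  open W -> Ck 1 W f -> W u ->
  differentiable f u /\ forall v, 'd f u v = \sum_a v 0 a * partial a f u.
Proof.
move=> oW df Wu; pose F v : 'rV[R]_1 := \row_(_ < 1) f v.
have EF : f = (fun M : 'rV[R]_1 => M 0 0) \o F by apply/funext => v; rewrite /= mxE.
have [dF dFE] : differentiable F u /\ forall v, 'd F u v = v *m partial_mx F u.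
  apply: (Ck1_map_differentiable oW Wu) => k.
  by rewrite (_ : (fun v => F v 0 k) = f)//; apply/funext => v; rewrite mxE.
have dfu : differentiable f u.
  by rewrite EF; apply: differentiable_comp => //; exact: differentiable_coord.
split=> // v; rewrite -deriveE//.
have -> : 'D_v f u = 'D_v (fun v => F v 0 0) u.
  by congr ('D_v _ _); apply/funext => w; rewrite mxE.
have := @derive_mx R _ 1 1 F u v (diff_derivable dF).
rewrite deriveE// dFE => /matrixP/(_ 0 0); rewrite !mxE => <-.
apply: eq_bigr => a _; rewrite mxE; congr (_ * partial a _ _).
by apply/funext => w; rewrite mxE.
Qed.

(** The second difference of [f] over a small rectangle is computed by the
    mean value theorem in both orders. *)
Lemma schwarz (p : nat) (W : set 'rV[R]_p) (f : 'rV[R]_p -> R) (u : 'rV[R]_p) (a b : 'I_p) :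
  open W -> Ck 2 W f -> W u ->
  partial a (partial b f) u = partial b (partial a f) u.
Proof.
have half c d : open W -> Ck 2 W f -> W u -> forall e, 0 < e ->
    exists2 h0 : R, 0 < h0 & forall h, 0 < h < h0 ->
    `|(f (u + h *: delta_mx 0 c + h *: delta_mx 0 d) - f (u + h *: delta_mx 0 d)
      - (f (u + h *: delta_mx 0 c) - f u)) / h ^+ 2 - partial d (partial c f) u| <= e.
  move=> oW [_ df] Wu e e0.
  have [dfc [_ ddf]] := df c.
  have [dcd [cdd _]] := ddf d.
  have hU : \forall v \near u, W v /\ `|partial d (partial c f) v - partial d (partial c f) u| <= e.
    apply: filterI; first exact: open_nbhs_nbhs.
    have := cdd u Wu; move=> /(@cvgrPdist_le _ _ _ (nbhs u))/(_ _ e0); apply: filterS => v hv.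
    rewrite distrC; exact: hv.
  have /nbhs_ballP[r /= r0 rW] := hU.
  exists (r / 2); first by rewrite divr_gt0.
  move=> h /andP[h0 hr].
  have inb s t : 0 <= s <= h -> 0 <= t <= h -> ball u r (u + s *: delta_mx 0 c + t *: delta_mx 0 d).
    move=> /andP[s0 sh] /andP[t0 th]; rewrite -ball_normE /= -addrA opprD addrA subrr add0r normrN.
    apply: (le_lt_trans (ler_normD _ _)).
    have nd (k : 'I_p) : `|delta_mx 0 k : 'rV[R]_p| <= 1.
      apply: norm_rV_le => // j; rewrite mxE; case: (_ && _); rewrite ?normr1 ?normr0//.
    have n1 : `|s *: delta_mx 0 c : 'rV[R]_p| <= h.
      by rewrite normrZ ger0_norm// (le_trans _ sh)// ler_piMr.
    have n2 : `|t *: delta_mx 0 d : 'rV[R]_p| <= h.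
      by rewrite normrZ ger0_norm// (le_trans _ th)// ler_piMr.
    lra.
  have hh : 0 <= h <= h by rewrite lexx ltW.
  have h00 : 0 <= (0 : R) <= h by rewrite lexx ltW.
  pose g v := f (v + h *: delta_mx 0 d) - f v.
  have dg s : 0 <= s <= h -> is_derive (u + s *: delta_mx 0 c) (delta_mx 0 c) g
      (partial c f (u + s *: delta_mx 0 c + h *: delta_mx 0 d) - partial c f (u + s *: delta_mx 0 c)).
    move=> sh; have [W1 _] := rW _ (inb s h sh hh); have [W2 _] := rW _ (inb s 0 sh h00).
    rewrite scale0r addr0 in W2.
    apply: is_deriveB; last exact: derivableP (dfc _ W2).
    exact: shift_is_derive (dfc _ W1).
  have [s /andP[s0 sh] Es] : exists2 s, 0 < s < h & g (u + h *: delta_mx 0 c) - g u =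
      h * 'D_(delta_mx 0 c) g (u + s *: delta_mx 0 c).
    by apply: mvt_line => // s /dg[].
  have s01 : 0 <= s <= h by rewrite !ltW.
  have -> : f (u + h *: delta_mx 0 c + h *: delta_mx 0 d) - f (u + h *: delta_mx 0 d)
      - (f (u + h *: delta_mx 0 c) - f u) = g (u + h *: delta_mx 0 c) - g u.
    by rewrite /g; ring.
  rewrite Es (derive_val (is_derive := dg s s01)).
  have [t /andP[t0 th] Et] : exists2 t, 0 < t < h &
      partial c f (u + s *: delta_mx 0 c + h *: delta_mx 0 d) - partial c f (u + s *: delta_mx 0 c) =
      h * 'D_(delta_mx 0 d) (partial c f) (u + s *: delta_mx 0 c + t *: delta_mx 0 d).
    apply: mvt_line => // t th; apply: dcd.
    by have [] := rW _ (inb s t s01 th).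
  rewrite Et -/(partial d (partial c f) _).
  rewrite (_ : h * (h * _) / h ^+ 2 = partial d (partial c f) (u + s *: delta_mx 0 c + t *: delta_mx 0 d)).
    by have [|_ ] := rW _ (inb s t s01 _); first by rewrite !ltW.
  by field; rewrite gt_eqF.
move=> oW f2 Wu; apply/eqP; rewrite -subr_eq0 -normr_eq0 eq_le normr_ge0 andbT.
apply/ler_addgt0Pr => e e0; rewrite add0r.
have e20 : 0 < e / 2 by rewrite divr_gt0.
have [h1 h10 P1] := half b a oW f2 Wu _ e20.
have [h2 h20 P2] := half a b oW f2 Wu _ e20.
pose h := Num.min h1 h2 / 2.
have m0 : 0 < Num.min h1 h2 by rewrite lt_min h10.
have h0 : 0 < h by rewrite divr_gt0.
have hm : h < Num.min h1 h2 by rewrite /h; lra.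
move: (hm); rewrite lt_min => /andP[hh1 hh2].
have := P1 h; rewrite h0 hh1 => /(_ isT) Q1.
have := P2 h; rewrite h0 hh2 => /(_ isT); rewrite addrAC => Q2.
set D1 := (X in `|X / _ - _| <= _) in Q1; set D2 := (X in `|X / _ - _| <= _) in Q2.
have DE : D1 = D2 by rewrite /D1 /D2 (addrAC u); ring.
rewrite -DE in Q2; rewrite (splitr e) -(subrKA (D1 / h ^+ 2)).
apply: (le_trans (ler_normD _ _)); apply: lerD; last exact: Q2.
rewrite distrC; exact: Q1.
Qed.

End Calculus.

Section CkClosure.
Context {R : realType} {p : nat}.
Implicit Types (W : set 'rV[R]_p) (f g : 'rV[R]_p -> R).

Lemma open_near_eq W (U : Type) (f g : 'rV[R]_p -> U) u : open W -> W u -> (forall v, W v -> f v = g v) ->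
  \near u, f u = g u.
Proof.
move=> oW Wu fg; have : nbhs u W by exact: open_nbhs_nbhs.
by apply: filterS => v; exact: fg.
Qed.

Lemma partial_ext W f g u a : open W -> W u -> (forall v, W v -> f v = g v) ->
  partial a f u = partial a g u.
Proof. by move=> oW Wu fg; apply: near_eq_derive; exact: open_near_eq fg. Qed.

Lemma Ck_cont k W f u : Ck k W f -> W u -> {for u, continuous f}.
Proof. by case: k => [|k] [h _] Wu; exact: h. Qed.

Lemma cont_ext W (f g : 'rV[R]_p -> R) u : open W -> W u -> (forall v, W v -> f v = g v) ->
  {for u, continuous f} -> {for u, continuous g}.
Proof.
move=> oW Wu fg; rewrite /prop_for /continuous_at => cf; rewrite -(fg u Wu).
apply: cvg_trans cf; apply: (@near_eq_cvg _ _ (nbhs u) _ f g).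
have : nbhs u W by exact: open_nbhs_nbhs.
by apply: filterS => v; exact: fg.
Qed.

Lemma Ck_ext k W f g : open W -> (forall v, W v -> f v = g v) -> Ck k W f -> Ck k W g.
Proof.
move=> oW; elim: k f g => [|k IH] f g fg [cf df]; split => //.
- by move=> u Wu; exact: cont_ext fg (cf u Wu).
- by move=> u Wu; exact: cont_ext fg (cf u Wu).
- move=> a; have [d1 d2] := df a; split.
    by move=> u Wu; apply: near_eq_derivable (d1 u Wu); exact: open_near_eq fg.
  by apply: IH d2 => v Wv; exact: partial_ext fg.
Qed.

Lemma CkS k W W' f : W' `<=` W -> Ck k W f -> Ck k W' f.
Proof.
move=> WW; elim: k f => [|k IH] f [cf df]; split => //; try by move=> u /WW; exact: cf.
by move=> a; have [d1 d2] := df a; split; [move=> u /WW; exact: d1|exact: IH].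
Qed.

Lemma Ck_pred k W f : Ck k.+1 W f -> Ck k W f.
Proof.
elim: k f => [|k IH] f [cf df]; first by split.
by split => // a; have [d1 d2] := df a; split => //; exact: IH.
Qed.

Lemma Ck_cst k W (c : R) : open W -> Ck k W (fun=> c).
Proof.
move=> oW; elim: k c => [|k IH] c.
  by split => // u _; exact: cst_continuous.
split => [u _|a]; first exact: cst_continuous.
split; first by move=> u _; exact: derivable_cst.
apply: (Ck_ext oW _ (IH 0)) => v _; rewrite /partial.
by rewrite -[fun=> c]/(cst c) derive_cst.
Qed.

Lemma Ck_add k W f g : open W -> Ck k W f -> Ck k W g -> Ck k W (fun u => f u + g u).
Proof.
move=> oW; elim: k f g => [|k IH] f g.
  by move=> [cf _] [cg _]; split => // u Wu; apply: (continuousD (cf u Wu) (cg u Wu)).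
move=> [cf df] [cg dg]; split => [u Wu|a].
  by apply: (continuousD (cf u Wu) (cg u Wu)).
have [f1 f2] := df a; have [g1 g2] := dg a; split.
  by move=> u Wu; apply: derivableD; [exact: f1|exact: g1].
apply: (Ck_ext oW _ (IH _ _ f2 g2)) => v Wv.
by rewrite /partial -[in RHS]/(f \+ g) deriveD; [|exact: f1|exact: g1].
Qed.

Lemma Ck_mul k W f g : open W -> Ck k W f -> Ck k W g -> Ck k W (fun u => f u * g u).
Proof.
move=> oW; elim: k f g => [|k IH] f g.
  by move=> [cf _] [cg _]; split => // u Wu; apply: (continuousM (cf u Wu) (cg u Wu)).
move=> Cf Cg; have [cf df] := Cf; have [cg dg] := Cg; split => [u Wu|a].
  by apply: (continuousM (cf u Wu) (cg u Wu)).
have [f1 f2] := df a; have [g1 g2] := dg a; split.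
  by move=> u Wu; apply: derivableM; [exact: f1|exact: g1].
have h := Ck_add oW (IH _ _ (Ck_pred Cf) g2) (IH _ _ (Ck_pred Cg) f2).
apply: (Ck_ext oW _ h) => v Wv.
by rewrite /partial -[in RHS]/(f \* g) deriveM; [|exact: f1|exact: g1].
Qed.

Lemma Ck_scale k W (c : R) f : open W -> Ck k W f -> Ck k W (fun u => c * f u).
Proof. by move=> oW; apply: Ck_mul => //; exact: Ck_cst. Qed.

Lemma Ck_opp k W f : open W -> Ck k W f -> Ck k W (fun u => - f u).
Proof.
move=> oW Cf; apply: (Ck_ext oW _ (Ck_scale (-1) oW Cf)) => v _.
by rewrite mulN1r.
Qed.

Lemma Ck_sub k W f g : open W -> Ck k W f -> Ck k W g -> Ck k W (fun u => f u - g u).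
Proof. by move=> oW Cf Cg; apply: Ck_add => //; exact: Ck_opp. Qed.

Lemma Ck_sum k W (I : Type) (r : seq I) (P : pred I) (F : I -> 'rV[R]_p -> R) : open W ->
  (forall i, Ck k W (F i)) -> Ck k W (fun u => \sum_(i <- r | P i) F i u).
Proof.
move=> oW CF; elim: r => [|i r IH].
  by apply: (Ck_ext oW _ (Ck_cst k 0 oW)) => v _; rewrite big_nil.
case Pi : (P i).
  by apply: (Ck_ext oW _ (Ck_add oW (CF i) IH)) => v _; rewrite big_cons Pi.
by apply: (Ck_ext oW _ IH) => v _; rewrite big_cons Pi.
Qed.

Lemma Ck_prod k W (I : Type) (r : seq I) (P : pred I) (F : I -> 'rV[R]_p -> R) : open W ->
  (forall i, Ck k W (F i)) -> Ck k W (fun u => \prod_(i <- r | P i) F i u).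
Proof.
move=> oW CF; elim: r => [|i r IH].
  by apply: (Ck_ext oW _ (Ck_cst k 1 oW)) => v _; rewrite big_nil.
case Pi : (P i).
  by apply: (Ck_ext oW _ (Ck_mul oW (CF i) IH)) => v _; rewrite big_cons Pi.
by apply: (Ck_ext oW _ IH) => v _; rewrite big_cons Pi.
Qed.

Lemma Ck_det k W (q : nat) (M : 'rV[R]_p -> 'M[R]_q) : open W ->
  (forall i j, Ck k W (fun u => M u i j)) -> Ck k W (fun u => \det (M u)).
Proof.
move=> oW CM; apply: Ck_sum => // s; apply: Ck_mul => //; first exact: Ck_cst.
by apply: Ck_prod.
Qed.

Lemma Ck_adj k W (q : nat) (M : 'rV[R]_p -> 'M[R]_q) i j : open W ->
  (forall i j, Ck k W (fun u => M u i j)) -> Ck k W (fun u => (\adj (M u)) i j).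
Proof.
move=> oW CM.
have h : Ck k W (fun u => (-1) ^+ (j + i) * \det (row' j (col' i (M u)))).
  apply: Ck_scale => //; apply: Ck_det => // a b.
  by apply: (Ck_ext oW _ (CM (lift j a) (lift i b))) => v _; rewrite !mxE.
by apply: (Ck_ext oW _ h) => v _; rewrite mxE /cofactor.
Qed.

Lemma partial_coord (a j : 'I_p) u : partial a (fun v : 'rV[R]_p => v 0 j) u = (a == j)%:R.
Proof.
have := @derive_mx R _ 1 p id u (delta_mx 0 a) (@derivable_id _ _ _ _).
by rewrite derive_id => /matrixP/(_ 0 j); rewrite !mxE eqxx /= eq_sym => ->.
Qed.

Lemma Ck_coord k W j : open W -> Ck k W (fun u : 'rV[R]_p => u 0 j).
Proof.
move=> oW; have cc u : {for u, continuous (fun u : 'rV[R]_p => u 0 j)}.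
  exact: coord_continuous.
case: k => [|k]; split => // a; split.
  by move=> u _; apply: diff_derivable; exact: differentiable_coord.
by apply: (Ck_ext oW _ (Ck_cst k (a == j)%:R oW)) => v _; rewrite partial_coord.
Qed.

Lemma partialM W f g u a : Ck 1 W f -> Ck 1 W g -> W u ->
  partial a (fun v => f v * g v) u = f u * partial a g u + g u * partial a f u.
Proof.
move=> [_ df] [_ dg] Wu; have [f1 _] := df a; have [g1 _] := dg a.
by rewrite /partial -[in LHS]/(f \* g) deriveM; [|exact: f1|exact: g1].
Qed.

Lemma partialD W f g u a : Ck 1 W f -> Ck 1 W g -> W u ->
  partial a (fun v => f v + g v) u = partial a f u + partial a g u.
Proof.
move=> [_ df] [_ dg] Wu; have [f1 _] := df a; have [g1 _] := dg a.
by rewrite /partial -[in LHS]/(f \+ g) deriveD; [|exact: f1|exact: g1].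
Qed.

Lemma partial_sum W (I : Type) (r : seq I) (F : I -> 'rV[R]_p -> R) u a : open W -> W u ->
  (forall i, Ck 1 W (F i)) ->
  partial a (fun v => \sum_(i <- r) F i v) u = \sum_(i <- r) partial a (F i) u.
Proof.
move=> oW Wu CF; elim: r => [|i r IH].
  rewrite big_nil (_ : (fun _ => _) = fun=> 0) ?/partial -?[fun=> 0]/(cst 0) ?derive_cst//.
  by apply/funext => v; rewrite big_nil.
rewrite big_cons -IH -(partialD _ (CF i) _ Wu); last exact: Ck_sum.
by congr (partial a _ _); apply/funext => v; rewrite big_cons.
Qed.

Lemma partial_cst (c : R) (u : 'rV[R]_p) a : partial a (fun=> c : R) u = 0 :> R.
Proof. by rewrite /partial -[fun=> c]/(cst c) derive_cst. Qed.

Lemma Ck1_real_comp W f (phi dphi : R -> R) : open W -> Ck 1 W f ->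
  (forall x : R, is_derive x (1 : R) phi (dphi x)) -> continuous dphi ->
  Ck 1 W (fun u => phi (f u)) /\
  forall u a, W u -> partial a (fun u => phi (f u)) u = dphi (f u) * partial a f u.
Proof.
move=> oW Cf hphi cd; have [cf df] := Cf.
have dif u : W u -> differentiable (phi \o f) u.
  move=> Wu; apply: differentiable_comp; first by have [] := Ck1_differentiable oW Cf Wu.
  by apply/derivable1_diffP; have [] := hphi (f u).
have E u a : W u -> partial a (fun u => phi (f u)) u = dphi (f u) * partial a f u.
  move=> Wu; have [dfu _] := Ck1_differentiable oW Cf Wu.
  have dph : differentiable phi (f u) by apply/derivable1_diffP; have [] := hphi (f u).
  rewrite /partial -[fun u => _]/(phi \o f) deriveE; last exact: dif.
  rewrite diff_comp//= -(deriveE _ dfu).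
  have h1 : derivable phi (f u) 1 by have [] := hphi (f u).
  rewrite (deriv1E h1) derive1E (derive_val (is_derive := hphi (f u))).
  exact: mulrC.
split; last exact: E.
split => [u Wu|a].
  exact: differentiable_continuous (dif u Wu).
split; first by move=> u Wu; apply: diff_derivable; exact: dif.
have [f1 [f2 _]] := df a; split; last by [].
move=> u Wu.
apply: (@cont_ext W (fun u => dphi (f u) * partial a f u)) => // [v Wv|]; first by rewrite E.
apply: continuousM; last exact: f2.
by apply: continuous_comp; [exact: cf|exact: cd].
Qed.

End CkClosure.

Lemma Ck1_comp {R : realType} (p m : nat) (W : set 'rV[R]_p) (V : set 'rV[R]_m)
    (F : 'rV[R]_p -> 'rV[R]_m) (f : 'rV[R]_m -> R) : open W -> open V ->
  (forall k, Ck 1 W (fun v => F v 0 k)) -> (forall u, W u -> V (F u)) -> Ck 1 V f ->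
  Ck 1 W (fun u => f (F u)) /\
  forall u a, W u -> partial a (fun u => f (F u)) u =
    \sum_k partial a (fun v => F v 0 k) u * partial k f (F u).
Proof.
move=> oW oV CF FV Cf.
have dif u : W u -> differentiable (f \o F) u.
  move=> Wu; apply: differentiable_comp; first by have [] := Ck1_map_differentiable oW Wu CF.
  by have [] := Ck1_differentiable oV Cf (FV _ Wu).
have E u a : W u -> partial a (fun u => f (F u)) u =
    \sum_k partial a (fun v => F v 0 k) u * partial k f (F u).
  move=> Wu; have [dF dFE] := Ck1_map_differentiable oW Wu CF.
  have [df dfE] := Ck1_differentiable oV Cf (FV _ Wu).
  rewrite {1}/partial -[fun u => _]/(f \o F) deriveE; last exact: dif.
  rewrite diff_comp//= dfE dFE; apply: eq_bigr => k _; congr (_ * _).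
  rewrite mxE (bigD1 a)//= !mxE !eqxx mul1r big1 ?addr0// => b ba.
  by rewrite !mxE eqxx (negbTE ba) mul0r.
split; last exact: E.
split => [u Wu|a].
  exact: differentiable_continuous (dif u Wu).
split; first by move=> u Wu; apply: diff_derivable; exact: dif.
have [_ df] := Cf.
apply: (Ck_ext oW (f := fun u => \sum_k partial a (fun v => F v 0 k) u * partial k f (F u))).
  by move=> v Wv; rewrite E.
apply: Ck_sum => // k; apply: Ck_mul => //.
  by have [_ dF] := CF k; have [] := dF a.
split => // u Wu.
have [_ [h _]] := df k.
have cF : {for u, continuous F}.
  by apply: differentiable_continuous; have [] := Ck1_map_differentiable oW Wu CF.
by apply: continuous_comp cF _; apply: h; exact: FV.
Qed.

Lemma curve_is_derive {R : realType} (m : nat) (V : set 'rV[R]_m) (f : 'rV[R]_m -> R)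
    (c : R -> 'rV[R]_m) (t : R) : open V -> Ck 1 V f -> V (c t) -> derivable c t 1 ->
  is_derive t 1 (fun s => f (c s)) (\sum_a (derive1 c t) 0 a * partial a f (c t)).
Proof.
move=> oV Cf Vc dc.
have [df dfE] := Ck1_differentiable oV Cf Vc.
have dc' : differentiable c t by exact/derivable1_diffP.
have dfc : differentiable (f \o c) t by exact: differentiable_comp.
apply: DeriveDef; first exact/derivable1_diffP.
rewrite -[fun s => _]/(f \o c) deriveE// diff_comp//= dfE.
by rewrite -(deriveE _ dc') -derive1E.
Qed.

(** * Charts, the boundary and countable bases *)

Lemma open_nbhsP (T : topologicalType) (A : set T) : (forall x, A x -> nbhs x A) -> open A.
Proof. by move=> h; rewrite openE => x /h. Qed.

Section CkLocal.
Context {R : realType} {p : nat}.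
Implicit Types (W A : set 'rV[R]_p).

Lemma Ck_local k A (f : 'rV[R]_p -> R) : open A ->
  (forall u, A u -> exists W F, [/\ open W, W u, Ck k W F & forall v, W v -> A v -> F v = f v]) ->
  Ck k A f.
Proof.
move=> oA; elim: k f => [|k IH] f H.
  split=> // u Au; have [W [F [oW Wu CF Ff]]] := H u Au.
  have oWA : open (W `&` A) by exact: openI.
  apply: (@cont_ext R p (W `&` A) F f u oWA _ _ (Ck_cont CF Wu)) => //.
  by move=> v [Wv Av]; exact: Ff.
split=> [u Au|a].
  have [W [F [oW Wu CF Ff]]] := H u Au.
  have oWA : open (W `&` A) by exact: openI.
  apply: (@cont_ext R p (W `&` A) F f u oWA _ _ (Ck_cont CF Wu)) => //.
  by move=> v [Wv Av]; exact: Ff.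
split=> [u Au|].
  have [W [F [oW Wu [_ CF] Ff]]] := H u Au.
  have [dF _] := CF a; apply: near_eq_derivable (dF u Wu).
  apply: (@open_near_eq R p (W `&` A)); [exact: openI|by []|].
  by move=> v [Wv Av]; exact: Ff.
apply: IH => u Au; have [W [F [oW Wu [_ CF] Ff]]] := H u Au.
have [_ dF] := CF a; exists (W `&` A), (partial a F).
have oWA : open (W `&` A) by exact: openI.
split=> //; first by apply: CkS dF => v [].
move=> v [Wv Av] _; apply: (@partial_ext R p (W `&` A)) => //.
by move=> w [Ww Aw]; exact: Ff.
Qed.

Lemma smooth_on_Ck k A (f : 'rV[R]_p -> R) : open A -> smooth_on A f -> Ck k A f.
Proof.
move=> oA sf; apply: Ck_local => // u Au; have [W [F [oW Wu CF Ff]]] := sf u Au.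
by exists W, F; split.
Qed.

Lemma smooth_onS A B (f : 'rV[R]_p -> R) : A `<=` B -> smooth_on B f -> smooth_on A f.
Proof.
move=> AB sf u Au; have [W [F [oW Wu CF Ff]]] := sf u (AB u Au).
by exists W, F; split => // v Wv /AB; exact: Ff.
Qed.

(** The rule for functions of one variable applies along each coordinate line.
    *)
Lemma partial_at_min W (F : 'rV[R]_p -> R) u : open W -> W u -> Ck 1 W F ->
  (forall v, W v -> F u <= F v) -> forall a, partial a F u = 0.
Proof.
move=> oW Wu CF Fmin a.
have /nbhs_ballP[r /= r0 rW] : nbhs u W by exact: open_nbhs_nbhs.
pose phi t := F (u + t *: delta_mx 0 a).
have inW t : `|t| < r -> W (u + t *: delta_mx 0 a).
  move=> tr; apply: rW; rewrite -ball_normE /= opprD addrA subrr add0r normrN normrZ.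
  apply: le_lt_trans tr; rewrite ler_piMr//; apply: norm_rV_le => // j.
  by rewrite mxE; case: (_ && _); rewrite ?normr1 ?normr0.
have [_ dF] := CF; have [dFa _] := dF a.
have dphi (t : R) : `|t| < r -> is_derive t (1 : R) phi (partial a F (u + t *: delta_mx 0 a)).
  by move=> tr; apply: line_is_derive; apply: dFa; exact: inW.
have r20 : - (r / 2) < r / 2 by lra.
have tr t : t \in `](- (r / 2)), (r / 2)[%R -> `|t| < r.
  by rewrite in_itv/= => /andP[h1 h2]; rewrite ltr_norml; apply/andP; split; lra.
have : is_derive (0 : R) (1 : R) phi 0.
  apply: (derive1_at_min (ltW r20)) => [t /tr tr'||t /tr tr'].
  - by have [] := dphi t tr'.
  - by rewrite in_itv/=; apply/andP; split; lra.
  - by rewrite /phi scale0r addr0; apply: Fmin; exact: inW.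
have h0 : `|0 : R| < r by rewrite normr0.
move=> /(@derive_val) h; have := @derive_val _ _ _ _ _ _ _ (dphi 0 h0).
by rewrite h scale0r addr0.
Qed.

End CkLocal.

Section Charts.
Context {R : realType} {n : nat} (N : bmanifold R n).
Implicit Types (i j : Defs.index N) (x y : N).

Lemma chart_halfspace i x : dom i x -> 0 <= chart i x 0 0.
Proof.
move=> dx; have [W _ WE] := chart_image i.
have : (chart i @` dom i) (chart i x) by exists x.
by rewrite WE => -[].
Qed.

Lemma chart_near i x V : dom i x -> nbhs (chart i x) V -> nbhs x (chart i @^-1` V).
Proof. by move=> dx; exact: (chart_continuous dx). Qed.

Lemma chart_preim_open i (V : set 'rV[R]_n.+1) : open V -> open (dom i `&` chart i @^-1` V).
Proof.
move=> oV; apply: open_nbhsP => x [dx Vx]; apply: filterI.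
  by apply: open_nbhs_nbhs; split => //; exact: dom_open.
by apply: chart_near => //; exact: open_nbhs_nbhs.
Qed.

(** The image of the chart is open in the half-space. *)
Lemma chart_inv_near i x (U : set N) : dom i x -> nbhs x U ->
  exists2 e, 0 < e & forall v : 'rV[R]_n.+1, ball (chart i x) e v -> 0 <= v 0 0 ->
    [/\ dom i (chart_inv i v), U (chart_inv i v) & chart i (chart_inv i v) = v].
Proof.
move=> dx Ux; have [W oW WE] := chart_image i.
have ix : (chart i @` dom i) (chart i x) by exists x.
have /subspace_continuousP/(_ _ ix) cinv := @chart_inv_continuous R n N i.
have /cinv : nbhs (chart_inv i (chart i x)) U by rewrite chartK.
rewrite /within /= => hU.
have WWx : W (chart i x) by move: ix; rewrite WE => -[].
have : nbhs (chart i x) (W `&` [set v | (chart i @` dom i) v -> U (chart_inv i v)]).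
  by apply: filterI; [exact: open_nbhs_nbhs|exact: hU].
move=> /nbhs_ballP[e /= e0 eP]; exists e => // v ve v0.
have [Wv Uv] := eP v ve.
have iv : (chart i @` dom i) v by rewrite WE; split.
have [y dy yv] := iv; have yE : chart_inv i v = y by rewrite -yv chartK.
by split; [rewrite yE|exact: Uv|rewrite yE].
Qed.

Variables (rho : N -> R).
Hypothesis rho_def : defining_function rho.

Lemma rho_ge0 x : 0 <= rho x.
Proof.
have [_ r1 r2 _] := rho_def; have [bx|ix] := pselect (boundary x); first by rewrite r2.
by rewrite ltW// r1.
Qed.

(** Otherwise [rho] would have a minimum at an interior point of the chart
    domain, and its differential there would vanish. So boundary points are
    boundary points in every chart. *)
Lemma boundary_chart i x : boundary x -> dom i x -> chart i x 0 0 = 0.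
Proof.
move=> bx dx; apply/eqP; rewrite eq_le chart_halfspace// andbT leNgt; apply/negP => u0.
have [r1 _ r3 r4] := rho_def.
have [W [F [oW Wu CF Ff]]] := r1 i (chart i x) (ex_intro2 _ _ x dx erefl).
have [e e0 eP] := @chart_inv_near i x setT dx filterT.
pose B : set 'rV[R]_n.+1 := ball (chart i x) (Num.min e (chart i x 0 0)).
have m0 : 0 < Num.min e (chart i x 0 0) by rewrite lt_min e0.
have Bim v : B v -> (chart i @` dom i) v.
  move=> Bv; have ve : ball (chart i x) e v by apply: le_ball Bv; rewrite ge_min lexx.
  have v0 : 0 <= v 0 0.
    have := le_coord_norm (chart i x - v) 0; rewrite !mxE.
    move: Bv; rewrite /B -ball_normE /= lt_min => /andP[_ h1] h2.
    have := le_lt_trans h2 h1; rewrite ltr_norml => /andP[]; lra.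
  by have [d _ <-] := eP v ve v0; exists (chart_inv i v).
have oWB : open (W `&` B) by apply: openI => //; exact: ball_open.
have Fu : F (chart i x) = 0.
  by rewrite Ff; [rewrite /local chartK// r3|exact: Wu|exists x].
have dr : is_differential i rho x (\row_a partial a F (chart i x)).
  by exists W, F; split => //; exact: CF.
apply: (negP (r4 i x _ bx dx dr)); apply/eqP/rowP => a; rewrite !mxE.
apply: (@partial_at_min R n.+1 (W `&` B)) => //.
- by split => //; apply: ballxx.
- by apply: CkS (CF 1%N) => v [].
- by move=> v [Wv Bv]; rewrite Fu Ff//; [exact: rho_ge0|exact: Bim].
Qed.

Lemma inner_chart i x : dom i x -> inner x <-> 0 < chart i x 0 0.
Proof.
move=> dx; split=> [ix|u0 bx]; last by move: u0; rewrite boundary_chart// ltxx.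
rewrite lt_neqAle chart_halfspace// andbT eq_sym; apply/eqP => u0.
by apply: ix; exists i.
Qed.

Lemma inner_open : open (@inner R n N).
Proof.
apply: open_nbhsP => x ix; have [i dx] := dom_cover x.
have u0 := (inner_chart dx).1 ix.
have : nbhs x (dom i `&` chart i @^-1` [set v | 0 < v 0 0]).
  apply: open_nbhs_nbhs; split => //; apply: chart_preim_open.
  have := @open_comp _ _ (fun v : 'rV[R]_n.+1 => v 0 0) [set t | 0 < t].
  by apply; [move=> v _; exact: coord_continuous|exact: open_gt].
by apply: filterS => y [dy y0]; apply/(inner_chart dy).
Qed.

Definition ichart i : set 'rV[R]_n.+1 := chart i @` (dom i `&` @inner R n N).

Lemma ichart_near i x (U : set N) : dom i x -> inner x -> nbhs x U ->
  exists2 e, 0 < e & forall v : 'rV[R]_n.+1, ball (chart i x) e v ->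
    [/\ dom i (chart_inv i v), U (chart_inv i v), chart i (chart_inv i v) = v & 0 < v 0 0].
Proof.
move=> dx ix Ux; have u0 := (inner_chart dx).1 ix.
have [e e0 eP] := chart_inv_near dx Ux.
exists (Num.min e (chart i x 0 0)); first by rewrite lt_min e0.
move=> v Bv; have ve : ball (chart i x) e v by apply: le_ball Bv; rewrite ge_min lexx.
have v0 : 0 < v 0 0.
  have := le_coord_norm (chart i x - v) 0; rewrite !mxE.
  move: Bv; rewrite -ball_normE /= lt_min => /andP[_ h1] h2.
  have := le_lt_trans h2 h1; rewrite ltr_norml => /andP[]; lra.
by have [d Uv vE] := eP v ve (ltW v0).
Qed.

Lemma ichart_image_open i (U : set N) : open U -> open (chart i @` (dom i `&` @inner R n N `&` U)).
Proof.
move=> oU; apply: open_nbhsP => _ [x [[dx ix] Ux] <-].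
have [e e0 eP] := ichart_near dx ix (open_nbhs_nbhs (conj oU Ux)).
apply/nbhs_ballP; exists e => // v ve; have [dv Uv vE v0] := eP v ve.
by exists (chart_inv i v) => //; split => //; split => //; apply/(inner_chart dv); rewrite vE.
Qed.

Lemma ichart_open i : open (ichart i).
Proof.
rewrite /ichart -(setIT (dom i `&` _)); apply: ichart_image_open; exact: openT.
Qed.

Lemma ichartP i v : ichart i v -> [/\ dom i (chart_inv i v), inner (chart_inv i v) &
  chart i (chart_inv i v) = v].
Proof. by move=> [x [dx ix] <-]; rewrite chartK. Qed.

Lemma ichart_chart i x : dom i x -> inner x -> ichart i (chart i x).
Proof. by move=> dx ix; exists x. Qed.

Lemma inner_dense (U : set N) x : open U -> U x -> (U `&` @inner R n N) !=set0.
Proof.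
move=> oU Ux; have [i dx] := dom_cover x.
have [e e0 eP] := chart_inv_near dx (open_nbhs_nbhs (conj oU Ux)).
pose v : 'rV[R]_n.+1 := chart i x + (e / 2) *: delta_mx 0 0.
have ve : ball (chart i x) e v.
  rewrite -ball_normE /= /v opprD addrA subrr add0r normrN normrZ ger0_norm; last lra.
  apply: (@le_lt_trans _ _ (e / 2 * 1)); last lra.
  rewrite ler_wpM2l//; first lra.
  by apply: norm_rV_le => // j; rewrite mxE; case: (_ && _); rewrite ?normr1 ?normr0.
have v0 : 0 < v 0 0.
  by rewrite !mxE !eqxx mulr1; have := chart_halfspace dx; lra.
have [dv Uv vE] := eP v ve (ltW v0).
by exists (chart_inv i v); split => //; apply/(inner_chart dv); rewrite vE.
Qed.

(** Finitely many charts suffice by compactness, and in each chart the images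
    of balls with dyadic centres and radii form a base. *)
Lemma countable_base : exists U : nat -> set N, (forall k, open (U k)) /\
  forall x (V : set N), nbhs x V -> exists k, U k x /\ U k `<=` V.
Proof.
have /choice[ix ixP] := @dom_cover R n N.
have cN : cover_compact [set: N] by rewrite -compact_cover; exact: space_compact.
rewrite cover_compactE in cN.
have [D' _ D'P] : finite_subset_cover [set: N] (fun x => dom (ix x)) [set: N].
  apply: cN; first by exists (fun x => dom (ix x)) => [x|x] _; rewrite ?setTI//; exact: dom_open.
  by move=> x _; exists x.
pose s : seq N := finmap.enum_fset D'.
pose ctr m : 'rV[R]_n.+1 := xget 0 (dcubes m).
pose U k : set N := if (unpickle k : option (nat * nat)) is Some jm then
  dom (ix (nth point s jm.1)) `&` chart (ix (nth point s jm.1)) @^-1`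
    ball (ctr jm.2) (2 ^- @dlevel n.+1 jm.2) else set0.
exists U; split.
  move=> k; rewrite /U; case: unpickle => [jm|]; last exact: open0.
  by apply: chart_preim_open; exact: ball_open.
move=> x V xV; have [y yD dx] := D'P x Logic.I.
have ys : (index y s < size s)%N by rewrite index_mem.
set i := ix y in dx.
have [e e0 eP] := chart_inv_near dx xV.
have [l _ le] := @pow2_small R 0 _ (divr_gt0 e0 (ltr0n R 2)).
pose m := pickle (l, dindex l (chart i x)).
have h : dcubes m (chart i x) by rewrite dcubesE; exact: dcube_dindex.
have h' : dcubes m (ctr m) by apply: (xgetPex 0); exists (chart i x).
rewrite dcubesE in h h'; have close := dcube_close h' h.
have UE : U (pickle (index y s, m)) = dom i `&` chart i @^-1` ball (ctr m) (2 ^- l).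
  by rewrite /U pickleK /= nth_index// dlevelE.
exists (pickle (index y s, m)); rewrite UE; split.
  by split => //=; rewrite -ball_normE.
move=> z [dz]; rewrite /= -ball_normE /= => zl.
have ze : ball (chart i x) e (chart i z).
  rewrite -ball_normE /= -(subrKA (ctr m)) (le_lt_trans (ler_normD _ _))// distrC; lra.
by have [_ + _] := eP _ ze (chart_halfspace dz); rewrite chartK.
Qed.

(** Let [U k] be a countable base and [V k] the complement of the closures of
    those among the first [k] of them that are away from [S]. For every [U k]
    meeting [S], add an interior point of its intersection with [V k]: these
    points accumulate on all of [S], and nowhere else because the [V k] shrink
    to [S]. *)
Lemma accumulating_set (S : set N) : closed S -> S `<=` @boundary R n N ->
  exists C : set N, [/\ closed C, S `<=` C, C `&` @boundary R n N `<=` S &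
    S `<=` closure (C `&` @inner R n N)].
Proof.
move=> cS Sb; have [U [oU bU]] := countable_base.
pose P k := closure (U k) `&` S = set0.
pose V m : set N := [set y | forall k, (k < m)%N -> P k -> ~ closure (U k) y].
have nV s m : S s -> nbhs s (V m).
  move=> Ss; elim: m => [|m IH]; first by apply: filterS (filterT) => y _ k.
  have [Pm|nPm] := pselect (P m); last first.
    apply: filterS IH => y Vy k; rewrite ltnS leq_eqVlt => /orP[/eqP ->//|]; exact: Vy.
  have : nbhs s (~` closure (U m)).
    apply: open_nbhs_nbhs; split; first by apply: closed_openC; exact: closed_closure.
    by move=> h; have : (closure (U m) `&` S) s by []; rewrite Pm.
  move=> h; apply: filterS2 IH h => y Vy ny k.
  by rewrite ltnS leq_eqVlt => /orP[/eqP ->//|]; exact: Vy.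
have /choice[x xP] : forall l, exists x : N, (U l `&` S) !=set0 -> [/\ U l x, V l x & inner x].
  move=> l; have [[s [Us Ss]]|ne] := pselect ((U l `&` S) !=set0); last by exists point.
  have : nbhs s (U l `&` V l).
    by apply: filterI; [exact: open_nbhs_nbhs|exact: nV].
  rewrite nbhsE => -[Os_ [oO Os] OUV].
  have [y [Oy iy]] := inner_dense oO Os.
  by exists y => _; have [] := OUV y Oy.
pose C := S `|` [set x l | l in [set l | (U l `&` S) !=set0]].
exists C; split.
- rewrite -[X in closed X]setCK; apply: open_closedC; apply: open_nbhsP => z nCz.
  have nSz : ~ S z by move=> Sz; apply: nCz; left.
  have hz : nbhs z (~` S) by apply: open_nbhs_nbhs; split => //; exact: closed_openC.
  have zT : nbhs z setT by exact: filterT.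
  have reg := @compact_regular N z setT (@space_hausdorff R n N) (@space_compact R n N) zT.
  have [W zW WS] := reg _ hz.
  have [k [Ukz UkW]] := bU z W zW.
  have Pk : P k.
    apply/seteqP; split => // y [cy Sy].
    by apply: (WS y _ Sy); exact: closure_subset UkW _ cy.
  have hx m : nbhs z [set y | forall l, (l < m)%N -> (U l `&` S) !=set0 -> y <> x l].
    elim: m => [|m IH]; first by apply: filterS filterT => y _ l.
    have [Um|nUm] := pselect ((U m `&` S) !=set0); last first.
      apply: filterS IH => y Vy l; rewrite ltnS leq_eqVlt => /orP[/eqP ->//|]; exact: Vy.
    have : nbhs z (~` [set x m]).
      apply: open_nbhs_nbhs; split.
        apply: closed_openC; apply: accessible_closed_set1; apply: hausdorff_accessible.
        exact: space_hausdorff.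
      by move=> /= zx; apply: nCz; right; exists m.
    move=> h; apply: filterS2 IH h => y Vy ny l.
    by rewrite ltnS leq_eqVlt => /orP[/eqP -> _|]; [exact: ny|exact: Vy].
  have nUk : nbhs z (U k) by exact: open_nbhs_nbhs.
  apply: filterS3 hz nUk (hx k.+1) => y nSy Uky hy [//|[l Ul xl]].
  have [lk|kl] := ltnP l k.+1; first by apply: (hy l lk Ul).
  have [_ Vl _] := xP l Ul; apply: (Vl k kl Pk); rewrite xl; exact: subset_closure.
- by move=> y Sy; left.
- move=> y [[//|[l Ul <-]] bl]; have [_ _] := xP l Ul; by move/(_ bl).
- move=> s Ss B nB; have [k [Uks UkB]] := bU s B nB.
  have Uk : (U k `&` S) !=set0 by exists s.
  have [Ux _ Ix] := xP k Uk; exists (x k); split; last exact: UkB.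
  by split => //; right; exists k.
Qed.

End Charts.

(** * The Lie derivative of a metric *)

Section InnerProduct.
Context {R : realType} {n : nat}.
Notation p := n.+1.
Implicit Types (G : 'M[R]_p) (v w : 'rV[R]_p).

Lemma ipDl G v v' w : inner_product G (v + v') w = inner_product G v w + inner_product G v' w.
Proof. by rewrite /inner_product !mulmxDl mxE. Qed.

Lemma ipZl G (k : R) v w : inner_product G (k *: v) w = k * inner_product G v w.
Proof. by rewrite /inner_product -!scalemxAl mxE. Qed.

Lemma ipDm G G' v w : inner_product (G + G') v w = inner_product G v w + inner_product G' v w.
Proof. by rewrite /inner_product mulmxDr mulmxDl mxE. Qed.

Lemma ipZm (k : R) G v w : inner_product (k *: G) v w = k * inner_product G v w.
Proof. by rewrite /inner_product -scalemxAr -scalemxAl mxE. Qed.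

Lemma ip_tr G v w : inner_product G^T v w = inner_product G w v.
Proof.
rewrite /inner_product -[w *m G *m v^T]trmxK [RHS]mxE.
by rewrite !trmx_mul trmxK mulmxA.
Qed.

Lemma ip_mull (A B G : 'M[R]_p) v w :
  inner_product (A *m G *m B^T) v w = inner_product G (v *m A) (w *m B).
Proof. by rewrite /inner_product trmx_mul !mulmxA. Qed.

Lemma ipE G v w : inner_product G v w = \sum_a \sum_l v 0 a * G a l * w 0 l.
Proof.
rewrite /inner_product mxE exchange_big /=; apply: eq_bigr => l _.
by rewrite !mxE mulr_suml.
Qed.

End InnerProduct.

Section MatrixCalculus.
Context {R : realType} {n : nat}.
Notation p := n.+1.
Implicit Types (W : set 'rV[R]_p) (u v : 'rV[R]_p).

Definition ddir v (f : 'rV[R]_p -> R) u : R := \sum_a v 0 a * partial a f u.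

Definition mdir (r s : nat) v (M : 'rV[R]_p -> 'M[R]_(r, s)) u : 'M[R]_(r, s) :=
  \matrix_(i, j) ddir v (fun w => M w i j) u.

Definition Ckmx k W (r s : nat) (M : 'rV[R]_p -> 'M[R]_(r, s)) :=
  forall i j, Ck k W (fun w => M w i j).

Lemma ddir_ext W v f g u : open W -> W u -> (forall w, W w -> f w = g w) ->
  ddir v f u = ddir v g u.
Proof.
by move=> oW Wu fg; apply: eq_bigr => a _; congr (_ * _); exact: partial_ext fg.
Qed.

Lemma mdir_ext W (r s : nat) v (M Q : 'rV[R]_p -> 'M[R]_(r, s)) u : open W -> W u ->
  (forall w, W w -> M w = Q w) -> mdir v M u = mdir v Q u.
Proof.
move=> oW Wu MQ; apply/matrixP => i j; rewrite !mxE.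
by apply: (ddir_ext v oW Wu) => w Ww; rewrite MQ.
Qed.

Lemma ddirM W v f g u : Ck 1 W f -> Ck 1 W g -> W u ->
  ddir v (fun w => f w * g w) u = ddir v f u * g u + f u * ddir v g u.
Proof.
move=> Cf Cg Wu; rewrite /ddir mulr_suml mulr_sumr -big_split; apply: eq_bigr => a _ /=.
by rewrite (partialM _ Cf Cg Wu) mulrDr addrC; congr (_ + _); ring.
Qed.

Lemma ddir_sum W v (I : Type) (r : seq I) (F : I -> 'rV[R]_p -> R) u : open W -> W u ->
  (forall i, Ck 1 W (F i)) ->
  ddir v (fun w => \sum_(i <- r) F i w) u = \sum_(i <- r) ddir v (F i) u.
Proof.
move=> oW Wu CF; rewrite /ddir exchange_big /=; apply: eq_bigr => a _.
by rewrite (partial_sum _ _ oW Wu CF) mulr_sumr.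
Qed.

Lemma mdir_mul W (r s t : nat) v (M : 'rV[R]_p -> 'M[R]_(r, s)) (Q : 'rV[R]_p -> 'M[R]_(s, t)) u :
  open W -> W u -> Ckmx 1 W M -> Ckmx 1 W Q ->
  mdir v (fun w => M w *m Q w) u = mdir v M u *m Q u + M u *m mdir v Q u.
Proof.
move=> oW Wu CM CQ; apply/matrixP => i j; rewrite !mxE -big_split /=.
rewrite (_ : (fun w => (M w *m Q w) i j) = fun w => \sum_k M w i k * Q w k j); last first.
  by apply/funext => w; rewrite mxE.
rewrite (ddir_sum _ _ oW Wu); last by move=> k; exact: Ck_mul.
by apply: eq_bigr => k _; rewrite (ddirM _ (CM i k) (CQ k j) Wu) !mxE.
Qed.

Lemma mdir_tr (r s : nat) v (M : 'rV[R]_p -> 'M[R]_(r, s)) u :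
  mdir v (fun w => (M w)^T) u = (mdir v M u)^T.
Proof.
apply/matrixP => i j; rewrite !mxE; congr (ddir v _ u).
by apply/funext => w; rewrite mxE.
Qed.

Lemma mdir_scale W (r s : nat) v f (M : 'rV[R]_p -> 'M[R]_(r, s)) u :
  W u -> Ck 1 W f -> Ckmx 1 W M ->
  mdir v (fun w => f w *: M w) u = ddir v f u *: M u + f u *: mdir v M u.
Proof.
move=> Wu Cf CM; apply/matrixP => i j; rewrite !mxE -(ddirM _ Cf (CM i j) Wu).
by congr (ddir v _ u); apply/funext => w; rewrite mxE.
Qed.

Lemma mdirZ (r s : nat) (k : R) v (M : 'rV[R]_p -> 'M[R]_(r, s)) u :
  mdir (k *: v) M u = k *: mdir v M u.
Proof.
apply/matrixP => i j; rewrite !mxE /ddir mulr_sumr; apply: eq_bigr => a _.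
by rewrite mxE mulrA.
Qed.

Lemma ddirZ (k : R) v f u : ddir (k *: v) f u = k * ddir v f u.
Proof. by rewrite /ddir mulr_sumr; apply: eq_bigr => a _; rewrite mxE mulrA. Qed.

(** Half the Lie derivative of the metric [G] along [X], as a quadratic form
    in [e]. *)
Definition lie_form (G : 'rV[R]_p -> 'M[R]_p) (X : 'rV[R]_p -> 'rV[R]_p) u e : R :=
  2^-1 * inner_product (mdir (X u) G u) e e + inner_product (G u) (mdir e X u) e.

Lemma lie_form_ext W G G' X X' u e : open W -> W u -> (forall w, W w -> G w = G' w) ->
  (forall w, W w -> X w = X' w) -> lie_form G X u e = lie_form G' X' u e.
Proof.
move=> oW Wu GG XX; rewrite /lie_form (mdir_ext _ oW Wu XX) (mdir_ext _ oW Wu GG).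
by rewrite GG// XX.
Qed.

Lemma Ckmx_mul k W (r s t : nat) (M : 'rV[R]_p -> 'M[R]_(r, s)) (Q : 'rV[R]_p -> 'M[R]_(s, t)) :
  open W -> Ckmx k W M -> Ckmx k W Q -> Ckmx k W (fun w => M w *m Q w).
Proof.
move=> oW CM CQ i j; apply: (Ck_ext (f := fun w => \sum_l M w i l * Q w l j)) => //.
  by move=> w _; rewrite mxE.
by apply: Ck_sum => // l; exact: Ck_mul.
Qed.

Lemma Ckmx_scale k W (r s : nat) f (M : 'rV[R]_p -> 'M[R]_(r, s)) :
  open W -> Ck k W f -> Ckmx k W M -> Ckmx k W (fun w => f w *: M w).
Proof.
move=> oW Cf CM i j; apply: (Ck_ext (f := fun w => f w * M w i j)) => //.
  by move=> w _; rewrite mxE.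
exact: Ck_mul.
Qed.

Lemma lie_form_scale W (s f : 'rV[R]_p -> R) G X u e : open W -> W u ->
  Ck 1 W s -> Ck 1 W f -> Ckmx 1 W G -> Ckmx 1 W X ->
  lie_form (fun w => s w *: G w) (fun w => f w *: X w) u e =
  f u * (s u * lie_form G X u e + 2^-1 * ddir (X u) s u * inner_product (G u) e e) +
  ddir e f u * (s u * inner_product (G u) (X u) e).
Proof.
move=> oW Wu Cs Cf CG CX; rewrite /lie_form.
rewrite (mdir_scale _ Wu Cs CG) (mdir_scale _ Wu Cf CX) mdirZ ddirZ.
rewrite !(ipDl, ipZl, ipDm, ipZm); ring.
Qed.

End MatrixCalculus.

Section LieTransport.
Context {R : realType} {n : nat}.
Notation p := n.+1.

Lemma mdir_comp (W V : set 'rV[R]_p) (r s : nat) (v : 'rV[R]_p) (psi : 'rV[R]_p -> 'rV[R]_p)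
    (M : 'rV[R]_p -> 'M[R]_(r, s)) (u : 'rV[R]_p) : open W -> open V -> W u ->
  (forall w, W w -> V (psi w)) -> (forall k, Ck 1 W (fun w => psi w 0 k)) -> Ckmx 1 V M ->
  mdir v (fun w => M (psi w)) u = mdir (v *m partial_mx psi u) M (psi u).
Proof.
move=> oW oV Wu WV Cpsi CM; apply/matrixP => i j; rewrite !mxE /ddir.
have [_ E] := Ck1_comp oW oV Cpsi WV (CM i j).
under eq_bigr do rewrite (E _ _ Wu) mulr_sumr.
rewrite exchange_big /=; apply: eq_bigr => k _.
by rewrite !mxE mulr_suml; apply: eq_bigr => a _; rewrite mxE mulrA.
Qed.

(** The second derivatives of the change of coordinates, which enter through
    both terms, cancel by symmetry. *)
Lemma lie_form_transport (W V : set 'rV[R]_p) (psi : 'rV[R]_p -> 'rV[R]_p)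
    (G : 'rV[R]_p -> 'M[R]_p) (X : 'rV[R]_p -> 'rV[R]_p)
    (G' : 'rV[R]_p -> 'M[R]_p) (X' : 'rV[R]_p -> 'rV[R]_p) (u e : 'rV[R]_p) :
  open W -> open V -> W u -> (forall w, W w -> V (psi w)) ->
  (forall k, Ck 2 W (fun w => psi w 0 k)) -> Ckmx 1 V G' -> Ckmx 1 V X' -> Ckmx 1 W X ->
  (forall w, W w -> G w = partial_mx psi w *m G' (psi w) *m (partial_mx psi w)^T) ->
  (forall w, W w -> X' (psi w) = X w *m partial_mx psi w) ->
  (G' (psi u))^T = G' (psi u) ->
  lie_form G X u e = lie_form G' X' (psi u) (e *m partial_mx psi u).
Proof.
move=> oW oV Wu WV C2 CG' CX' CX GE XE symG.
have C1 k : Ck 1 W (fun w => psi w 0 k) by exact: Ck_pred.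
pose J := partial_mx psi.
have CJ : Ckmx 1 W J.
  move=> a k; have [_ h] := C2 k; have [_ h2] := h a.
  by apply: (@Ck_ext R n.+1 1 W (partial a (fun w => psi w 0 k))) => // w _; rewrite mxE.
have CGp : Ckmx 1 W (fun w => G' (psi w)).
  by move=> i j; have [] := Ck1_comp oW oV C1 WV (CG' i j).
have CJT : Ckmx 1 W (fun w => (J w)^T).
  move=> i j; apply: (Ck_ext oW _ (CJ j i)) => w _; by rewrite [RHS]mxE.
have DG : mdir (X u) G u = mdir (X u) J u *m G' (psi u) *m (J u)^T
    + J u *m mdir (X u *m J u) G' (psi u) *m (J u)^T
    + J u *m G' (psi u) *m (mdir (X u) J u)^T.
  rewrite (mdir_ext _ oW Wu GE).
  rewrite (mdir_mul _ oW Wu (Ckmx_mul oW CJ CGp) CJT) (mdir_mul _ oW Wu CJ CGp).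
  by rewrite (mdir_comp _ oW oV Wu WV C1 CG') mdir_tr mulmxDl.
have DX : mdir (e *m J u) X' (psi u) = mdir e X u *m J u + X u *m mdir e J u.
  rewrite -(mdir_comp _ oW oV Wu WV C1 CX').
  by rewrite (mdir_ext _ oW Wu XE) (mdir_mul _ oW Wu CX CJ).
have sym : e *m mdir (X u) J u = X u *m mdir e J u.
  apply/rowP => k; rewrite !mxE.
  under eq_bigr do rewrite mxE /ddir mulr_sumr.
  rewrite exchange_big /=; apply: eq_bigr => b _.
  rewrite mxE /ddir mulr_sumr; apply: eq_bigr => a _.
  rewrite mulrCA; congr (_ * (_ * _)).
  have -> : (fun w => J w a k) = partial a (fun w => psi w 0 k).
    by apply/funext => w; rewrite mxE.
  have -> : (fun w => J w b k) = partial b (fun w => psi w 0 k).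
    by apply/funext => w; rewrite mxE.
  exact: (schwarz _ _ oW (C2 k) Wu).
rewrite /lie_form DG DX GE// XE// !ipDm !ip_mull !ipDl sym -/J -/(J u).
have -> : inner_product (G' (psi u)) (e *m J u) (X u *m mdir e J u) =
    inner_product (G' (psi u)) (X u *m mdir e J u) (e *m J u) by rewrite -ip_tr symG.
set A := inner_product _ (X u *m mdir e J u) _; set B := inner_product (mdir _ _ _) _ _.
set D := inner_product _ (mdir _ _ _ *m _) _.
by field.
Qed.

End LieTransport.

(** * The Levi-Civita connection in a chart *)

Section LeviCivita.
Context {R : realType} {n : nat}.
Notation p := n.+1.
Variables (W : set 'rV[R]_p) (G : 'rV[R]_p -> 'M[R]_p) (u : 'rV[R]_p).
Hypotheses (oW : open W) (Wu : W u).
Hypothesis Gsym : forall w, W w -> (G w)^T = G w.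
Hypothesis Gunit : G u \in unitmx.

Let d c a b : R := partial c (fun w => G w a b) u.

Definition christoffel_mx k a b : R :=
  2^-1 * \sum_l invmx (G u) k l * (d a b l + d b a l - d l a b).

(** Lowering the index removes the inverse of the metric. *)
Lemma christoffel_contract (e f h : 'rV[R]_p) :
  inner_product (G u) (\row_k \sum_a \sum_b christoffel_mx k a b * (e 0 a * f 0 b)) h =
  2^-1 * (inner_product (mdir e G u) f h + inner_product (mdir f G u) e h
          - inner_product (mdir h G u) e f).
Proof.
pose z : 'rV[R]_p := \row_l \sum_a \sum_b (d a b l + d b a l - d l a b) * (e 0 a * f 0 b).
have wE : \row_k \sum_a \sum_b christoffel_mx k a b * (e 0 a * f 0 b) = 2^-1 *: (z *m invmx (G u)).
  apply/rowP => k; rewrite !mxE.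
  have isym l : invmx (G u) l k = invmx (G u) k l.
    by rewrite -[in LHS](Gsym Wu) -trmx_inv mxE.
  rewrite mulr_sumr.
  under eq_bigr do under eq_bigr do rewrite /christoffel_mx -mulrA mulr_suml mulr_sumr.
  under eq_bigr do rewrite exchange_big /=.
  rewrite exchange_big /=; apply: eq_bigr => l _.
  rewrite !mxE !mulr_suml mulr_sumr; apply: eq_bigr => a _.
  rewrite !mulr_suml mulr_sumr; apply: eq_bigr => b _.
  by rewrite isym; ring.
rewrite wE ipZl; congr (_ * _).
have -> : inner_product (G u) (z *m invmx (G u)) h = \sum_l z 0 l * h 0 l.
  rewrite /inner_product -[z *m _ *m _]mulmxA mulVmx// mulmx1 mxE.
  by apply: eq_bigr => l _; rewrite [h^T _ _]mxE.
rewrite !ipE.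
under [in X in _ = X + _ - _]eq_bigr do under eq_bigr do rewrite mxE /ddir mulr_sumr mulr_suml.
under [in X in _ = _ + X - _]eq_bigr do under eq_bigr do rewrite mxE /ddir mulr_sumr mulr_suml.
under [in X in _ = _ + _ - X]eq_bigr do under eq_bigr do rewrite mxE /ddir mulr_sumr mulr_suml.
under [LHS]eq_bigr do rewrite mxE mulr_suml.
under [LHS]eq_bigr do under eq_bigr do rewrite mulr_suml.
have -> : \sum_l \sum_a \sum_b (d a b l + d b a l - d l a b) * (e 0 a * f 0 b) * h 0 l =
    \sum_l \sum_a \sum_b d a b l * (e 0 a * f 0 b) * h 0 l +
    \sum_l \sum_a \sum_b d b a l * (e 0 a * f 0 b) * h 0 l -
    \sum_l \sum_a \sum_b d l a b * (e 0 a * f 0 b) * h 0 l.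
  rewrite -big_split -sumrB /=; apply: eq_bigr => l _.
  rewrite -big_split -sumrB /=; apply: eq_bigr => a _.
  rewrite -big_split -sumrB /=; apply: eq_bigr => b _; ring.
congr (_ + _ - _).
- under [LHS]eq_bigr do rewrite exchange_big /=.
  rewrite [LHS]exchange_big /=; apply: eq_bigr => b _; apply: eq_bigr => l _.
  by apply: eq_bigr => a _; rewrite /d; ring.
- rewrite [LHS]exchange_big /=; apply: eq_bigr => a _; apply: eq_bigr => l _.
  by apply: eq_bigr => b _; rewrite /d; ring.
- under [RHS]eq_bigr do rewrite exchange_big /=.
  rewrite [RHS]exchange_big /=; apply: eq_bigr => l _; apply: eq_bigr => a _.
  by apply: eq_bigr => b _; rewrite /d; ring.
Qed.

Let ip_sym (M : 'M[R]_p) v w : M^T = M -> inner_product M v w = inner_product M w v.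
Proof. by move=> h; rewrite -[in LHS]h ip_tr. Qed.

Let mdir_sym v : (mdir v G u)^T = mdir v G u.
Proof. by rewrite -mdir_tr; exact: (mdir_ext _ oW Wu). Qed.

(** In [christoffel_contract] with equal last arguments only the derivative of
    the metric along [X] survives. *)
Lemma covariant_lie_form (X : 'rV[R]_p -> 'rV[R]_p) (e : 'rV[R]_p) :
  inner_product (G u) (mdir e X u +
    \row_k \sum_a \sum_b christoffel_mx k a b * (e 0 a * X u 0 b)) e = lie_form G X u e.
Proof.
rewrite ipDl christoffel_contract /lie_form (ip_sym (X u) e (mdir_sym e)).
by rewrite addrAC subrr add0r addrC.
Qed.

End LeviCivita.

(** The Christoffel terms from the geodesic equation are those of
    [covariant_lie_form]. *)
Lemma geodesic_product_derive {R : realType} {n : nat} (W : set 'rV[R]_n.+1)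
    (G : 'rV[R]_n.+1 -> 'M[R]_n.+1) (Y : 'rV[R]_n.+1 -> 'rV[R]_n.+1)
    (c : R -> 'rV[R]_n.+1) (t : R) : open W -> W (c t) ->
  (forall w, W w -> (G w)^T = G w) -> G (c t) \in unitmx ->
  Ckmx 1 W G -> Ckmx 1 W Y -> derivable c t 1 -> derivable (derive1 c) t 1 ->
  (forall k, derive1 (derive1 c) t 0 k + \sum_a \sum_b christoffel_mx G (c t) k a b *
     (derive1 c t 0 a * derive1 c t 0 b) = 0) ->
  is_derive t 1 (fun s => inner_product (G (c s)) (Y (c s)) (derive1 c s))
    (lie_form G Y (c t) (derive1 c t)).
Proof.
move=> oW Wc Gsym Gu CG CY dc ddc geo.
pose c' := derive1 c t; pose c2 := derive1 (derive1 c) t.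
have dcl l : is_derive t 1 (fun s => derive1 c s 0 l) (c2 0 l).
  have h := (derivable_mxP (derive1 c) t 1).1 ddc 0 l.
  apply: DeriveDef; first exact: h.
  have := derive_mx ddc; rewrite /c2 derive1E => /matrixP/(_ 0 l).
  by rewrite mxE => ->.
have df a l : is_derive t 1 (fun s => Y (c s) 0 a * G (c s) a l * derive1 c s 0 l)
    (Y (c t) 0 a * G (c t) a l * c2 0 l + c' 0 l * ddir c' (fun w => Y w 0 a * G w a l) (c t)).
  have h1 := curve_is_derive oW (Ck_mul oW (CY 0 a) (CG a l)) Wc dc.
  by have := @is_deriveM R R _ _ t 1 _ _ h1 (dcl l).
have E : (fun s => inner_product (G (c s)) (Y (c s)) (derive1 c s)) =
    \sum_a \sum_l (fun s => Y (c s) 0 a * G (c s) a l * derive1 c s 0 l).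
  apply/funext => s; rewrite ipE fct_sumE; apply: eq_bigr => a _.
  by rewrite fct_sumE.
rewrite E.
have h : is_derive t 1 (\sum_a \sum_l (fun s => Y (c s) 0 a * G (c s) a l * derive1 c s 0 l))
    (\sum_a \sum_l (Y (c t) 0 a * G (c t) a l * c2 0 l +
       c' 0 l * ddir c' (fun w => Y w 0 a * G w a l) (c t))).
  by apply: is_derive_sum => a; apply: is_derive_sum => l; exact: df.
apply: is_derive_eq h _.
have -> : \sum_a \sum_l (Y (c t) 0 a * G (c t) a l * c2 0 l +
       c' 0 l * ddir c' (fun w => Y w 0 a * G w a l) (c t)) =
    inner_product (G (c t)) (Y (c t)) c2 + inner_product (G (c t)) (mdir c' Y (c t)) c' +
    inner_product (mdir c' G (c t)) (Y (c t)) c'.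
  rewrite !ipE -!big_split /=; apply: eq_bigr => a _.
  rewrite -!big_split /=; apply: eq_bigr => l _.
  by rewrite (ddirM _ (CY 0 a) (CG a l) Wc) !mxE; ring.
have c2E : c2 = - 1 *: \row_k \sum_a \sum_b christoffel_mx G (c t) k a b * (c' 0 a * c' 0 b).
  apply/rowP => k; rewrite !mxE mulN1r; apply/eqP; rewrite -addr_eq0; apply/eqP; exact: geo.
rewrite -{1}(Gsym _ Wc) ip_tr c2E ipZl.
rewrite (christoffel_contract Wc Gsym Gu).
have msym : (mdir c' G (c t))^T = mdir c' G (c t).
  by rewrite -mdir_tr; exact: (mdir_ext _ oW Wc).
rewrite -[in X in _ + X]msym ip_tr /lie_form -/c'.
set A := inner_product _ c' (Y (c t)); set B := inner_product _ c' c'; set C := inner_product _ _ c'.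
by field.
Qed.

(** * Tensor fields in charts *)

Lemma is_derive_near {R : realType} (f g : R -> R) (t d : R) :
  (\forall s \near t, f s = g s) -> is_derive t (1 : R) f d -> is_derive t (1 : R) g d.
Proof.
by move=> fg; apply: near_eq_is_derive; rewrite ?oner_eq0.
Qed.

Section ChartTensors.
Context {R : realType} {n : nat} (N : bmanifold R n).
Notation p := n.+1.
Implicit Types (i j : Defs.index N) (x y : N).
Variables (rho : N -> R) (g : metric_components N).
Hypothesis rho_def : defining_function rho.
Hypothesis g_metric : riemannian_metric g.

Notation gl i := (fun u => g i (chart_inv i u)).

Definition transition i j (u : 'rV[R]_p) : 'rV[R]_p := chart j (chart_inv i u).

Definition overlap i j : set 'rV[R]_p := chart i @` (dom i `&` @inner R n N `&` dom j).

Lemma overlap_open i j : open (overlap i j).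
Proof. by apply: (ichart_image_open rho_def); exact: dom_open. Qed.

Arguments overlap_open : clear implicits.

Lemma overlapP i j u : overlap i j u ->
  [/\ dom i (chart_inv i u), inner (chart_inv i u), dom j (chart_inv i u) &
      chart i (chart_inv i u) = u].
Proof. by move=> [x [[dx ix] jx] <-]; rewrite chartK. Qed.

Lemma overlap_chart i j x : dom i x -> inner x -> dom j x -> overlap i j (chart i x).
Proof. by move=> dx ix jx; exists x. Qed.

Lemma overlap_ichart i j : overlap i j `<=` ichart (N := N) i.
Proof. by move=> u [x [[dx ix] jx] <-]; exists x. Qed.

Lemma transition_overlap i j u : overlap i j u -> overlap j i (transition i j u).
Proof. by move=> [x [[dx ix] jx] <-]; rewrite /transition chartK//; exists x. Qed.

Lemma transition_ichart i j u : overlap i j u -> ichart (N := N) j (transition i j u).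
Proof. by move=> /transition_overlap/overlap_ichart. Qed.

Lemma transitionK i j u : overlap i j u -> chart_inv j (transition i j u) = chart_inv i u.
Proof. by move=> [x [[dx ix] jx] <-]; rewrite /transition !chartK. Qed.

Lemma transition_chart i j x : dom i x -> transition i j (chart i x) = chart j x.
Proof. by move=> dx; rewrite /transition chartK. Qed.

Lemma transition_Ck k i j l : Ck k (overlap i j) (fun u => transition i j u 0 l).
Proof.
apply: smooth_on_Ck; first exact: overlap_open.
apply: (smooth_onS _ (transition_smooth (b := N) (i := i) (j := j) l)).
by move=> u [x [[dx ix] jx] <-]; exists x.
Qed.

Arguments transition_Ck : clear implicits.

Lemma metric_Ck k i : Ckmx k (ichart (N := N) i) (gl i).
Proof.
have [_ _ sm] := g_metric.
by move=> a b; apply: smooth_on_Ck (sm i a b); exact: (ichart_open rho_def).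
Qed.

Lemma metric_pos i x : inner x -> dom i x -> positive_definite (g i x).
Proof. by have [pd _ _] := g_metric; exact: pd. Qed.

Lemma pos_unitmx (G : 'M[R]_p) : positive_definite G -> G \in unitmx.
Proof.
move=> [_ pd]; rewrite -row_free_unit; apply/row_freeP.
have : kermx G = 0.
  apply/row_matrixP => a; rewrite row0; apply/eqP; apply: contraT => h.
  have := pd _ h; rewrite /inner_product.
  by rewrite -row_mul mulmx_ker row0 mul0mx mxE ltxx.
move=> /eqP; rewrite kermx_eq0 => /row_freeP[B GB]; by exists B.
Qed.

Lemma transition_jacobianE i j x : inner x -> dom i x -> dom j x ->
  transition_jacobian i j x = partial_mx (transition i j) (chart i x).
Proof.
move=> ix dx jx.
have [_ E] := Ck1_map_differentiable (overlap_open i j) (overlap_chart dx ix jx)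
  (fun k => transition_Ck 1 i j k).
rewrite /transition_jacobian /jacobian /local.
apply/matrixP => a k; rewrite [LHS]mxE.
rewrite (_ : 'd _ _ _ = delta_mx 0 a *m partial_mx (transition i j) (chart i x)); last exact: E.
by rewrite -rowE mxE.
Qed.

Lemma jacobian_comp i j l x : inner x -> dom i x -> dom j x -> dom l x ->
  transition_jacobian i l x = transition_jacobian i j x *m transition_jacobian j l x.
Proof.
move=> ix di dj dl; rewrite !transition_jacobianE//.
set W := overlap i j `&` overlap i l.
have oW : open W by apply: openI; exact: overlap_open.
have Wx : W (chart i x) by split; exact: overlap_chart.
have WV w : W w -> overlap j l (transition i j w).
  move=> [/overlapP[a b c _] /overlapP[_ _ e _]]; rewrite /transition.
  exact: overlap_chart.
apply/matrixP => a k; rewrite !mxE.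
have [_ E] := Ck1_comp (f := fun u => transition j l u 0 k) oW (overlap_open j l)
  (fun k' => CkS (@subIsetl _ _ _) (transition_Ck 1 i j k')) WV (transition_Ck 1 j l k).
rewrite (partial_ext (g := fun u => transition j l (transition i j u) 0 k) a oW Wx).
  by rewrite E//; apply: eq_bigr => b _; rewrite !mxE transition_chart.
by move=> w [h _]; rewrite [in RHS]/transition transitionK.
Qed.

Lemma metric_transport i j w : overlap i j w ->
  gl i w = partial_mx (transition i j) w *m gl j (transition i j w) *m
    (partial_mx (transition i j) w)^T.
Proof.
move=> h; have [di ii dj ci] := overlapP h; have [_ tr _] := g_metric.
by rewrite /= (tr i j)// transitionK// transition_jacobianE// ci.
Qed.

Lemma velocity_transport i j (gamma : R -> N) t : {for t, continuous gamma} -> inner (gamma t) ->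
  dom i (gamma t) -> dom j (gamma t) -> derivable (chart i \o gamma) t 1 ->
  derive1 (chart j \o gamma) t =
  derive1 (chart i \o gamma) t *m transition_jacobian i j (gamma t).
Proof.
move=> cg ig di dj dc; rewrite transition_jacobianE//.
pose c := chart i \o gamma.
have h l : is_derive t 1 (fun s => (chart j \o gamma) s 0 l)
    ((derive1 c t *m partial_mx (transition i j) (c t)) 0 l).
  have := curve_is_derive (overlap_open i j) (transition_Ck 1 i j l) (overlap_chart di ig dj) dc.
  rewrite mxE; under [X in _ -> is_derive _ _ _ X]eq_bigr do rewrite mxE.
  apply: is_derive_near.
  have : \forall s \near t, dom i (gamma s).
    exact: (cg _ (open_nbhs_nbhs (conj (dom_open i) di))).
  by apply: filterS => s /= ds; rewrite transition_chart.
have dj1 : derivable (chart j \o gamma) t 1.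
  by apply/derivable_mxP => a l; rewrite (ord1 a); have [] := h l.
apply/rowP => l; rewrite derive1E derive_mx// mxE.
by have [_ ->] := h l.
Qed.

Lemma inner_product_transport i j x v w : inner x -> dom i x -> dom j x ->
  inner_product (g i x) v w =
  inner_product (g j x) (v *m transition_jacobian i j x) (w *m transition_jacobian i j x).
Proof. by move=> ix di dj; have [_ tr _] := g_metric; rewrite (tr i j)// ip_mull. Qed.

Lemma speedE i (gamma : R -> N) t : {for t, continuous gamma} -> inner (gamma t) ->
  (forall j, dom j (gamma t) -> derivable (chart j \o gamma) t 1) -> dom i (gamma t) ->
  let v := derive1 (chart i \o gamma) t in
  speed g gamma t = Num.sqrt (inner_product (g i (gamma t)) v v).
Proof.
move=> cg ig dg di v; rewrite /speed; case: xgetP => [s _ [j dj ->]|/(_ _ (ex_intro2 _ _ i di erefl))//].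
by rewrite (@velocity_transport i j)// -?inner_product_transport//; exact: dg.
Qed.

Section Field.
Variable X : vector_components N.
Hypothesis X_C1 : C1_vector_field X.
Notation xl i := (fun u => X i (chart_inv i u)).

Lemma field_Ck i : Ckmx 1 (ichart (N := N) i) (xl i).
Proof.
move=> a k; rewrite (ord1 a); apply: Ck_local; first exact: (ichart_open rho_def).
exact: X_C1.2.
Qed.

Lemma lie_form_chart i j x e : inner x -> dom i x -> dom j x ->
  lie_form (gl i) (xl i) (chart i x) e =
  lie_form (gl j) (xl j) (chart j x) (e *m transition_jacobian i j x).
Proof.
move=> ix di dj.
rewrite (lie_form_transport (V := ichart j) (psi := transition i j) (G' := gl j) (X' := xl j)
  e (overlap_open i j)).
- by rewrite transition_chart// transition_jacobianE.
- exact: (ichart_open rho_def).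
- exact: overlap_chart.
- by move=> w; exact: transition_ichart.
- by move=> k; exact: transition_Ck.
- exact: metric_Ck.
- exact: field_Ck.
- move=> a k; exact: (CkS (@overlap_ichart i j) (@field_Ck i a k)).
- by move=> w; exact: metric_transport.
- move=> w h; have [di' ii dj' ci] := overlapP h.
  by rewrite /= transitionK// (X_C1.1 i j)// transition_jacobianE// ci.
- by rewrite transition_chart// chartK//; have [] := metric_pos ix dj.
Qed.

Lemma covariant_lie i x e : inner x -> dom i x ->
  inner_product (g i x) (covariant_derivative g X i x e) e =
  lie_form (gl i) (xl i) (chart i x) e.
Proof.
move=> ix di; have xK : chart_inv i (chart i x) = x by exact: chartK.
have cx : ichart (N := N) i (chart i x) by exact: ichart_chart.
rewrite -(covariant_lie_form (ichart_open rho_def (i := i)) cx); last 2 first.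
- by move=> w /ichartP[dw iw _]; have [] := metric_pos iw dw.
- by rewrite xK; apply: pos_unitmx; exact: metric_pos.
rewrite /= xK; congr (inner_product _ _ e); apply/rowP => k.
rewrite !mxE /ddir -big_split /=; apply: eq_bigr => a _.
rewrite mulrDr; congr (_ + _); rewrite mulr_sumr; apply: eq_bigr => b _.
by rewrite /christoffel /christoffel_mx /local xK; ring.
Qed.

End Field.

End ChartTensors.

(** * Quadratic forms and cutoff functions *)

Section QuadraticForms.
Context {R : realType} {n : nat}.
Notation p := n.+1.
Implicit Types (W : set 'rV[R]_p) (Q : 'rV[R]_p -> 'M[R]_p) (u v e q : 'rV[R]_p).

Lemma ip_le (M : 'M[R]_p) (d : R) v w : (forall a l, `|M a l| <= d) ->
  `|inner_product M v w| <= p%:R ^+ 2 * d * (`|v| * `|w|).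
Proof.
move=> Md; rewrite ipE; apply: le_trans (ler_norm_sum _ _ _) _.
have -> : p%:R ^+ 2 * d * (`|v| * `|w|) = \sum_(a < p) \sum_(l < p) d * (`|v| * `|w|).
  by rewrite !sumr_const !card_ord -[RHS]mulrnA -[RHS]mulr_natl natrM expr2 !mulrA.
apply: ler_sum => a _; apply: le_trans (ler_norm_sum _ _ _) _; apply: ler_sum => l _.
rewrite !normrM mulrAC mulrC; apply: ler_pM => //.
by rewrite ler_pM// le_coord_norm.
Qed.

Lemma Ckmx_near W Q q (d : R) : Ckmx 0 W Q -> W q -> 0 < d ->
  \forall u \near q, forall a l, `|Q u a l - Q q a l| <= d.
Proof.
move=> CQ Wq d0.
apply: (@filter_forall _ 'I_p (fun a u => forall l, `|Q u a l - Q q a l| <= d) (nbhs q)) => a.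
apply: (@filter_forall _ 'I_p (fun l u => `|Q u a l - Q q a l| <= d) (nbhs q)) => l.
have [/(_ _ Wq) cQ _] := CQ a l.
have /cvgrPdist_le/(_ _ d0) := cQ.
by apply: filterS => u; rewrite distrC.
Qed.

Lemma ip_bounded W Q q : Ckmx 0 W Q -> W q -> exists2 M : R, 0 < M &
  \forall u \near q, forall e, `|inner_product (Q u) e e| <= M * `|e| ^+ 2.
Proof.
move=> CQ Wq; pose D := \sum_a \sum_l `|Q q a l| + 1.
have D0 : 0 < D by rewrite ltr_wpDl// sumr_ge0// => a _; rewrite sumr_ge0.
exists (p%:R ^+ 2 * D); first by rewrite mulr_gt0// exprn_gt0.
have := Ckmx_near CQ Wq (@ltr01 R); apply: filterS => u h e.
rewrite expr2; apply: ip_le => a l.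
rewrite -[Q u a l](subrK (Q q a l)) (le_trans (ler_normD _ _))// addrC lerD//.
rewrite (bigD1 a)//= (bigD1 l)//= -addrA lerDl.
by rewrite addr_ge0// ?sumr_ge0// => a' _; rewrite sumr_ge0.
Qed.

(** Minimum over the unit sphere. *)
Lemma posdef_ge (M : 'M[R]_p) : positive_definite M ->
  exists2 c : R, 0 < c & forall e, c * `|e| ^+ 2 <= inner_product M e e.
Proof.
move=> [_ pd].
pose S := [set e : 'rV[R]_p | `|e| = 1].
have cM : continuous (fun e : 'rV[R]_p => inner_product M e e).
  rewrite (_ : (fun e => _) = fun e : 'rV[R]_p => \sum_a \sum_l e 0 a * M a l * e 0 l); last first.
    by apply/funext => e; rewrite ipE.
  have h : Ck 0 setT (fun e : 'rV[R]_p => \sum_a \sum_l e 0 a * M a l * e 0 l).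
    apply: Ck_sum openT _ => a; apply: Ck_sum openT _ => l.
    apply: Ck_mul openT _ (Ck_coord _ _ openT); apply: Ck_mul openT (Ck_coord _ _ openT) _.
    exact: Ck_cst openT.
  by move=> e; exact: (h.1 e I).
have cS : compact S.
  apply: bounded_closed_compact.
    by exists 1; split => // y y1 z /= ->; exact: ltW.
  apply: (@preimage_closed 'rV[R]_p R (fun e => `|e|) [set x | x = 1]); last exact: closed_eq.
  by move=> x _; exact: norm_continuous.
have S0 : S !=set0.
  have d0 : delta_mx 0 0 != 0 :> 'rV[R]_p.
    by apply/eqP => /matrixP/(_ 0 0)/eqP; rewrite !mxE eqxx oner_eq0.
  exists (`|delta_mx 0 0 : 'rV[R]_p|^-1 *: delta_mx 0 0).
  by rewrite /S /= normrZ ger0_norm ?invr_ge0// mulVf// normr_eq0.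
have [c Sc cmin] := compact_EVT_min S0 cS (continuous_subspaceT cM).
exists (inner_product M c c).
  by apply: pd; rewrite -normr_eq0; move: Sc; rewrite inE /S /= => ->; exact: oner_neq0.
move=> e; have [->|e0] := eqVneq e 0.
  by rewrite normr0 expr0n mulr0 /inner_product mul0mx mul0mx mxE.
have ne : 0 < `|e| by rewrite normr_gt0.
have := cmin (`|e|^-1 *: e); rewrite inE /S /= normrZ normfV normr_id mulVf ?gt_eqF//.
move=> h; have {h} := h erefl; rewrite ipZl -[X in _ * X]ip_tr ipZl ip_tr mulrA -expr2 exprVn.
by rewrite ler_pdivlMl ?exprn_gt0// mulrC.
Qed.

Lemma posdef_near W Q q : Ckmx 0 W Q -> W q -> positive_definite (Q q) -> exists2 c : R, 0 < c &
  \forall u \near q, forall e, c * `|e| ^+ 2 <= inner_product (Q u) e e.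
Proof.
move=> CQ Wq /posdef_ge[c c0 hc]; exists (c / 2); first by rewrite divr_gt0.
have d0 : 0 < c / (2 * p%:R ^+ 2) by rewrite divr_gt0// mulr_gt0// exprn_gt0.
have := Ckmx_near CQ Wq d0; apply: filterS => u h e.
have := @ip_le (Q u - Q q) _ e e; move=> /(_ (c / (2 * p%:R ^+ 2))).
have -> : inner_product (Q u - Q q) e e = inner_product (Q u) e e - inner_product (Q q) e e.
  by rewrite ipDm -[- Q q]scaleN1r ipZm mulN1r.
have -> : p%:R ^+ 2 * (c / (2 * p%:R ^+ 2)) = c / 2 :> R.
  have P0 : (p%:R : R) ^+ 2 != 0 by rewrite expf_neq0// pnatr_eq0.
  by rewrite invfM mulrCA [p%:R ^+ 2 * _]mulrC mulfVK.
move=> /(_ _)/wrap[]; first by move=> a l; rewrite !mxE.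
rewrite ler_norml -expr2 => /andP[h1 _]; have := hc e; lra.
Qed.

End QuadraticForms.

Section Cutoff.
Context {R : realType}.

Definition relu (s : R) : R := Num.max s 0.

Lemma relu_ge0 s : 0 <= relu s.
Proof. by rewrite /relu le_max lexx orbT. Qed.

Lemma relu_pos s : 0 <= s -> relu s = s.
Proof. by move=> s0; rewrite /relu max_l. Qed.

Lemma relu_neg s : s <= 0 -> relu s = 0.
Proof. by move=> s0; rewrite /relu max_r. Qed.

Lemma relu_gt0 s : (0 < relu s) = (0 < s).
Proof. by rewrite /relu lt_max ltxx orbF. Qed.

Lemma relu_continuous : continuous relu.
Proof. by move=> s; apply: continuous_max; [exact: cvg_id|exact: cst_continuous]. Qed.

(** At zero this shows that the square is differentiable. *)
Lemma relu_mul s : relu s ^+ 2 = s * relu s.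
Proof.
have [s0|s0] := leP 0 s; first by rewrite relu_pos.
by rewrite relu_neg ?ltW// mulr0 expr0n.
Qed.

Lemma relu2_derive (s : R) : is_derive s (1 : R) (fun t => relu t ^+ 2) (2 * relu s).
Proof.
have [s0|s0|s0] := ltgtP s 0.
- rewrite relu_neg ?ltW// mulr0.
  apply: (is_derive_near (f := fun=> 0)).
  by apply: filterS (lt_nbhsl s0) => t t0; rewrite relu_neg ?expr0n// ltW.
- rewrite relu_pos ?ltW//.
  apply: (is_derive_near (f := fun t => t ^+ 2)).
    by apply: filterS (lt_nbhsr s0) => t t0; rewrite relu_pos// ltW.
  have h := @is_deriveM R R id id s 1 _ _ (is_derive_id s 1) (is_derive_id s 1).
  have h2 : is_derive s (1 : R) (id * id : R -> R) (2 * s).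
    by apply: is_derive_eq h _; rewrite /GRing.scale /= mulr1 -mulr2n mulr_natl.
  exact: h2.
- rewrite s0 relu_neg// mulr0.
  have h : h^-1 *: (((fun t => relu t ^+ 2) \o shift 0) (h *: (1 : R)) - relu 0 ^+ 2) @[h --> (0:R)^'] --> (0 : R).
    have h1 : relu h @[h --> (0:R)^'] --> (0 : R).
      have h : relu x @[x --> (0 : R)] --> relu 0 by exact: relu_continuous.
      by rewrite (relu_neg (lexx 0)) in h; exact: cvg_within_filter h.
    apply: cvg_trans h1; apply: near_eq_cvg.
    near=> h; rewrite /= addr0 [h *: _]mulr1 (relu_neg (lexx 0)) expr0n subr0 relu_mul.
    by rewrite [RHS]mulrA mulVf ?mul1r//; near: h; exact: nbhs_dnbhs_neq.
  by apply: DeriveDef; [apply/cvg_ex; exists 0; exact: h | exact: cvg_lim h].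
Unshelve. all: by end_near. Qed.

Lemma relu3_derive (s : R) : is_derive s (1 : R) (fun t => t * relu t ^+ 2) (3 * relu s ^+ 2).
Proof.
have h := @is_deriveM R R id (fun t => relu t ^+ 2) s 1 1 _ (is_derive_id s 1) (relu2_derive s).
by apply: is_derive_eq h _; rewrite /GRing.scale /= mulr1 mulrCA -relu_mul; ring.
Qed.

(** A continuously differentiable transition from 0 to 1 on the unit interval;
    the denominator never vanishes. *)
Definition step (t : R) : R := relu t ^+ 2 / (relu t ^+ 2 + relu (1 - t) ^+ 2).

Definition dstep (t : R) : R :=
  (2 * relu t * relu (1 - t) ^+ 2 + relu t ^+ 2 * (2 * relu (1 - t))) /
    (relu t ^+ 2 + relu (1 - t) ^+ 2) ^+ 2.

Lemma step_den t : 0 < relu t ^+ 2 + relu (1 - t) ^+ 2.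
Proof.
have [t0|t0] := ltP 0 t.
  by rewrite ltr_pwDl ?exprn_gt0 ?relu_gt0// exprn_ge0 ?relu_ge0.
by rewrite ltr_wpDl ?exprn_gt0 ?relu_gt0 ?exprn_ge0 ?relu_ge0//; lra.
Qed.

Lemma step0 t : t <= 0 -> step t = 0.
Proof. by move=> t0; rewrite /step relu_neg// expr0n mul0r. Qed.

Lemma step1 t : 1 <= t -> step t = 1.
Proof.
move=> t1; rewrite /step [relu (1 - t)]relu_neg ?subr_le0// expr0n addr0 divff//.
by rewrite gt_eqF// exprn_gt0// relu_gt0; lra.
Qed.

Lemma step_ge0 t : 0 <= step t.
Proof. by rewrite divr_ge0 ?exprn_ge0 ?relu_ge0// ltW// step_den. Qed.

Lemma step_le1 t : step t <= 1.
Proof. by rewrite ler_pdivrMr ?step_den// mul1r lerDl exprn_ge0// relu_ge0. Qed.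

Lemma step_derive (t : R) : is_derive t (1 : R) step (dstep t).
Proof.
have h1 := relu2_derive t.
have h2 : is_derive t (1 : R) (fun t => relu (1 - t) ^+ 2) (- (2 * relu (1 - t))).
  have h3 : is_derive t (1 : R) (fun t => 1 - t) (- 1).
    have h0 : is_derive t (1 : R) (cst (1 : R)) 0.
      by apply: DeriveDef; [exact: derivable_cst|exact: derive_cst].
    have := @is_deriveB R R R _ _ t 1 _ _ h0 (is_derive_id t 1).
    by rewrite sub0r => h; exact: h.
  have := @is_derive1_comp R (fun t => relu t ^+ 2) (fun t => 1 - t) t _ _ (relu2_derive (1 - t)) h3.
  by rewrite mulrN1 => h; exact: h.
have hd := @is_deriveD R R R _ _ t 1 _ _ h1 h2.
have d0 := step_den t.
have hV := @is_deriveV R _ t _ 1 (lt0r_neq0 d0) hd.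
have hM := @is_deriveM R R _ _ t 1 _ _ h1 hV.
apply: is_derive_eq hM _; rewrite /GRing.scale /= /dstep !fctE.
by field; rewrite gt_eqF.
Qed.

Lemma dstep_continuous : continuous dstep.
Proof.
have c1 : continuous (fun t : R => relu t) by exact: relu_continuous.
have c2 : continuous (fun t : R => relu (1 - t)).
  move=> t; have h : {for t, continuous (fun t : R => 1 - t)}.
    by apply: continuousB; [exact: cst_continuous|exact: cvg_id].
  exact: (continuous_comp h (@relu_continuous (1 - t))).
have cM (f h : R -> R) : continuous f -> continuous h -> continuous (fun t => f t * h t).
  by move=> cf ch t; apply: continuousM; [exact: cf|exact: ch].
have sq (f : R -> R) : continuous f -> continuous (fun t => f t ^+ 2).
  by move=> cf; exact: (cM f f cf cf).
have cD (f h : R -> R) : continuous f -> continuous h -> continuous (fun t => f t + h t).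
  by move=> cf ch t; apply: continuousD; [exact: cf|exact: ch].
have c0 : continuous (fun _ : R => 2 : R) by move=> t; exact: cst_continuous.
apply: (cM (fun t => 2 * relu t * relu (1 - t) ^+ 2 + relu t ^+ 2 * (2 * relu (1 - t)))).
  apply: cD; last exact: (cM _ _ (sq _ c1) (cM _ _ c0 c2)).
  exact: (cM _ _ (cM _ _ c0 c1) (sq _ c2)).
have cden : continuous (fun t : R => (relu t ^+ 2 + relu (1 - t) ^+ 2) ^+ 2).
  exact: (sq _ (cD _ _ (sq _ c1) (sq _ c2))).
move=> t; have ct := cden t; apply: cvgV ct.
by rewrite gt_eqF// exprn_gt0// step_den.
Qed.

Lemma dstep_bounded : exists2 B : R, 0 < B & forall t, `|dstep t| <= B.
Proof.
have [c _ hc] := @EVT_max R dstep 0 1 ler01 (continuous_subspaceT dstep_continuous).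
have d0 t : 0 <= dstep t.
  by rewrite divr_ge0 ?exprn_ge0 ?(ltW (step_den t))// addr_ge0// !mulr_ge0// ?exprn_ge0 ?relu_ge0.
exists (dstep c + 1); first by rewrite ltr_wpDl.
move=> t; rewrite ger0_norm//; have [t0|t0] := leP t 0.
  have -> : dstep t = 0 by rewrite /dstep (relu_neg t0) expr0n /= !(mul0r, mulr0, addr0).
  exact: addr_ge0.
have [t1|t1] := leP 1 t.
  have h : 1 - t <= 0 by rewrite subr_le0.
  have -> : dstep t = 0 by rewrite /dstep (relu_neg h) expr0n /= !(mul0r, mulr0, addr0).
  exact: addr_ge0.
by rewrite ler_wpDr// hc// in_itv /= !ltW.
Qed.

End Cutoff.

(** * Barriers at the boundary *)

Section Barrier.
Context {R : realType} {n : nat} (N : bmanifold R n).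
Notation p := n.+1.
Implicit Types (i j : Defs.index N) (x y : N).
Variables (rho : N -> R) (g h : metric_components N).
Hypothesis g_metric : riemannian_metric g.
Hypothesis cc : C2_compactification g rho h.

Let rho_def : defining_function rho. Proof. by have [] := cc. Qed.

Notation gl i := (fun u => g i (chart_inv i u)).
Notation hl i := (fun u => h i (chart_inv i u)).
Notation rl i := (fun u => rho (chart_inv i u)).

Lemma rho_continuous : continuous rho.
Proof.
move=> x; have [i dx] := dom_cover x; have [sm _ _ _] := rho_def.
have [W [F [oW Wx CF FE]]] := sm i _ (ex_intro2 _ _ x dx erefl).
have cF : {for x, continuous (F \o chart i)}.
  by apply: continuous_comp; [exact: chart_continuous|exact: (Ck_cont (CF 0%N))].
have xE : rho x = (F \o chart i) x.
  by rewrite /= FE /local ?chartK//; exists x.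
have nb : nbhs x (dom i `&` chart i @^-1` W).
  by apply: open_nbhs_nbhs; split => //; exact: chart_preim_open.
have FR : \forall y \near x, (F \o chart i) y = rho y.
  apply: filterS nb => y [dy Wy] /=.
  have cy : (chart i @` dom i) (chart i y) by exists y.
  by rewrite FE// /local chartK.
rewrite /continuous_at xE; apply: cvg_trans cF.
by apply: (@near_eq_cvg _ _ (nbhs x) _ (F \o chart i) rho).
Qed.

(** The chart image contains the part of a small box in the half-space. *)
Lemma chart_box_compact i x (O : set N) : dom i x -> nbhs x O ->
  exists2 e : R, 0 < e & forall r, 0 < r < e ->
    exists K : set N, [/\ compact K, K `<=` dom i `&` O &
      forall y, dom i y -> (forall k, `|chart i y 0 k - chart i x 0 k| <= r) -> K y].
Proof.
move=> dx Ox; have [e e0 he] := chart_inv_near dx Ox.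
exists e => // r /andP[r0 re]; set q := chart i x.
pose A (k : 'I_p) : set R := [set` `[q 0 k - r, q 0 k + r]].
pose B : set 'rV[R]_p := [set v | forall k, A k (v 0 k)] `&` [set v | 0 <= v 0 0].
have ballB v : B v -> ball q e v.
  move=> [hv _]; apply/ball_rVP => // k; have := hv k; rewrite /A /= in_itv /= => /andP[a b].
  by rewrite ltr_norml; apply/andP; split; lra.
have cB : compact B.
  apply: compact_closedI; first by apply: rV_compact => k; exact: segment_compact.
  apply: (@preimage_closed 'rV[R]_p R (fun v => v 0 0) [set s | 0 <= s]); last exact: closed_ge.
  by move=> v _; exact: coord_continuous.
exists (chart_inv i @` B); split.
- apply: continuous_compact cB; apply: continuous_subspaceW (@chart_inv_continuous _ _ N i).
  move=> v Bv; have [dv _ cv] := he v (ballB v Bv) Bv.2.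
  by exists (chart_inv i v).
- by move=> _ [v Bv <-]; have [] := he v (ballB v Bv) Bv.2.
- move=> y dy hy; exists (chart i y); last exact: chartK.
  split; last exact: chart_halfspace.
  move=> k; rewrite /A /= in_itv /=; have := hy k; rewrite ler_norml => /andP[a b].
  by apply/andP; split; lra.
Qed.

(** The region [0 < eta] of the chart stays in the compact [K], and the field
    [Y] is a positive multiple of the gradient of [eta] whose flow, weighted
    by [relu eta ^ 2], expands all lengths there. In terms of [g] the rate of
    expansion has the order of [1 / rho]. *)
Record barrier i (K : set N) (eta : 'rV[R]_p -> R) (Y : 'rV[R]_p -> 'rV[R]_p) (kappa : R) : Prop :=
  Barrier {
  bar_compact : compact K;
  bar_dom : K `<=` dom i;
  bar_eta : Ck 1 (ichart (N := N) i) eta;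
  bar_field : Ckmx 1 (ichart (N := N) i) Y;
  bar_supp : forall u, ichart (N := N) i u -> 0 < eta u -> K (chart_inv i u);
  bar_grad : forall u, ichart (N := N) i u -> exists2 w, 0 < w &
    forall e, inner_product (gl i u) (Y u) e = w * ddir e eta u;
  bar_pos : 0 < kappa;
  bar_lie : forall u e, ichart (N := N) i u ->
    kappa * (relu (eta u) ^+ 2 / rl i u) * inner_product (gl i u) e e <=
    lie_form (gl i) (fun w => relu (eta w) ^+ 2 *: Y w) u e }.

Section Existence.
Variables (i : Defs.index N) (x : N).
Hypotheses (bx : boundary x) (dx : dom i x).
Let q := chart i x.

(* The barrier function is [depth] shifted by a constant. *)
Let depth (u : 'rV[R]_p) : R := - (\sum_k (u 0 k - q 0 k) ^+ 2) - rl i u.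
Let grad (u : 'rV[R]_p) : 'rV[R]_p := \row_a partial a depth u.
(* The gradient of [depth] for [h], scaled by the square of the determinant
   so as to avoid inverses. *)
Let Y (u : 'rV[R]_p) : 'rV[R]_p := \det (hl i u) *: (grad u *m \adj (hl i u)).

Let iO : open (ichart (N := N) i). Proof. exact: (ichart_open rho_def). Qed.

Let sq_Ck k W : open W -> Ck k W (fun u : 'rV[R]_p => - (\sum_k (u 0 k - q 0 k) ^+ 2)).
Proof.
move=> oW; apply: (Ck_opp oW _); apply: Ck_sum => // a.
rewrite (_ : (fun u => _) = fun u : 'rV[R]_p => (u 0 a - q 0 a) * (u 0 a - q 0 a))//.
by apply: (Ck_mul oW _ _); apply: (Ck_sub oW (Ck_coord _ _ oW) (Ck_cst _ _ oW)).
Qed.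

Let rl_Ck k : Ck k (ichart (N := N) i) (rl i).
Proof.
have [sm _ _ _] := rho_def; apply: smooth_on_Ck; first exact: iO.
apply: (smooth_onS _ (sm i)).
by move=> u [y [dy iy] <-]; exists y.
Qed.

Let depth_Ck k : Ck k (ichart (N := N) i) depth.
Proof. by apply: (Ck_sub (@iO) (sq_Ck k (@iO)) (rl_Ck k)). Qed.

Let hlE u : ichart (N := N) i u -> hl i u = rl i u ^+ 2 *: gl i u.
Proof. by move=> /ichartP[du iu _]; have [_ hE _ _] := cc; exact: hE. Qed.

Let hl_Ck k : Ckmx k (ichart (N := N) i) (hl i).
Proof.
move=> a b; apply: (Ck_ext (f := fun u => (rl i u * rl i u) * gl i u a b)) => //.
  by move=> u iu; rewrite hlE// mxE expr2.
apply: (Ck_mul (@iO) (Ck_mul (@iO) (rl_Ck k) (rl_Ck k)) _).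
exact: (metric_Ck rho_def g_metric).
Qed.

Let mk_field_Ck k W (H : 'rV[R]_p -> 'M[R]_p) (E : 'rV[R]_p -> R) : open W ->
  Ckmx k W H -> Ck k.+1 W E ->
  Ckmx k W (fun u => \det (H u) *: (\row_a partial a E u *m \adj (H u))).
Proof.
move=> oW CH CE; apply: (Ckmx_scale oW (Ck_det oW CH) _).
apply: (Ckmx_mul oW _ _); last by move=> a b; exact: Ck_adj.
move=> a b; have [_ hE] := CE; have [_ hb] := hE b.
by apply: (Ck_ext oW _ hb) => u _; rewrite mxE.
Qed.

Let Y_Ck : Ckmx 1 (ichart (N := N) i) Y.
Proof. exact: (mk_field_Ck (@iO) (hl_Ck 1) (depth_Ck 2)). Qed.

(** The fields extend continuously across the boundary, where [Y] points out of
    the manifold because the differential of [depth] at [q] is that of [- rho]. *)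
Let estimates : exists (M c k : R), [/\ 0 < M, 0 < c, 0 < k &
  \forall u \near q, ichart (N := N) i u ->
    [/\ forall e, - (M * `|e| ^+ 2) <= lie_form (hl i) Y u e,
        forall e, c * `|e| ^+ 2 <= inner_product (hl i u) e e &
        ddir (Y u) (rl i) u <= - k]].
Proof.
have [sm _ rho0 drho] := rho_def; have [_ _ hpos hCk] := cc.
have cq : (chart i @` dom i) q by exists x.
have [W0 [F [oW0 W0q CF FE]]] := sm i _ cq.
have /choice[WH hWH] : forall ab : 'I_p * 'I_p, exists WH : set 'rV[R]_p * ('rV[R]_p -> R),
    [/\ open WH.1, WH.1 q, Ck 2 WH.1 WH.2 &
        forall v, WH.1 v -> (chart i @` dom i) v -> WH.2 v = h i (chart_inv i v) ab.1 ab.2].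
  by move=> [a b]; have [W [H [? ? ? ?]]] := hCk i a b _ cq; exists (W, H).
pose W := (W0 `&` [set u | forall ab, (WH ab).1 u])^°.
have oW : open W by exact: open_interior.
have Wsub : W `<=` W0 `&` [set u | forall ab, (WH ab).1 u] by exact: interior_subset.
have Wq : W q.
  apply: filterI; first exact: open_nbhs_nbhs.
  apply: (@filter_forall _ _ (fun ab u => (WH ab).1 u) (nbhs q)) => ab.
  by have [oWH WHq _ _] := hWH ab; exact: open_nbhs_nbhs.
pose H (u : 'rV[R]_p) : 'M[R]_p := \matrix_(a, b) (WH (a, b)).2 u.
have HC : Ckmx 2 W H.
  move=> a b; have [_ _ C _] := hWH (a, b).
  apply: (Ck_ext (f := (WH (a, b)).2) oW); first by move=> u _; rewrite mxE.
  by apply: CkS C => u /Wsub[_ hu]; exact: hu.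
have FC k : Ck k W F by apply: CkS (CF k) => u /Wsub[].
have HE u : W u -> (chart i @` dom i) u -> H u = hl i u.
  move=> /Wsub[_ Wu] cu; apply/matrixP => a b; rewrite mxE.
  by have [_ _ _ ->] := hWH (a, b).
have FEq u : W u -> (chart i @` dom i) u -> F u = rl i u.
  by move=> /Wsub[Wu _] cu; rewrite FE.
pose E (u : 'rV[R]_p) : R := - (\sum_k (u 0 k - q 0 k) ^+ 2) - F u.
have EC k : Ck k W E by exact: (Ck_sub oW (sq_Ck k oW) (FC k)).
pose Z (u : 'rV[R]_p) : 'rV[R]_p := \det (H u) *: (\row_a partial a E u *m \adj (H u)).
have H1 : Ckmx 1 W H by move=> a b; exact: Ck_pred.
have ZC : Ckmx 1 W Z by exact: (mk_field_Ck oW H1 (EC 2)).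
(* The Lie derivative as a continuous family of quadratic forms. *)
pose Q (u : 'rV[R]_p) : 'M[R]_p := 2^-1 *: mdir (Z u) H u + partial_mx Z u *m H u.
have QE u e : lie_form H Z u e = inner_product (Q u) e e.
  rewrite /lie_form /Q ipDm ipZm; congr (_ + _).
  rewrite /inner_product mulmxA; congr ((_ *m _ *m _) 0 0).
  apply/rowP => k; rewrite !mxE /ddir; apply: eq_bigr => a _.
  by rewrite mxE.
have QC : Ckmx 0 W Q.
  move=> a b; apply: (Ck_ext (f := fun u => 2^-1 * (\sum_c Z u 0 c * partial c (fun w => H w a b) u)
    + \sum_c partial a (fun v => Z v 0 c) u * H u c b) oW).
    move=> u _; rewrite [RHS]mxE; congr (_ + _).
      by rewrite [RHS]mxE [X in _ = _ * X]mxE.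
    by rewrite [RHS]mxE; apply: eq_bigr => c _; rewrite [partial_mx _ _ _ _]mxE.
  have ZC0 c : Ck 0 W (fun u => Z u 0 c) by exact: Ck_pred (ZC 0 c).
  have HC0 c : Ck 0 W (fun u => H u c b) by exact: Ck_pred (H1 c b).
  have dH c : Ck 0 W (partial c (fun w => H w a b)) by have [_ /(_ c)[_]] := H1 a b.
  have dZ c : Ck 0 W (partial a (fun v => Z v 0 c)) by have [_ /(_ a)[_]] := ZC 0 c.
  have s1 : Ck 0 W (fun u => \sum_c Z u 0 c * partial c (fun w => H w a b) u).
    by apply: Ck_sum => // c; apply: (Ck_mul (k := 0) oW) (ZC0 c) (dH c).
  have s2 : Ck 0 W (fun u => \sum_c partial a (fun v => Z v 0 c) u * H u c b).
    by apply: Ck_sum => // c; apply: (Ck_mul (k := 0) oW) (dZ c) (HC0 c).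
  by apply: (Ck_add (k := 0) oW) s2; apply: (Ck_scale (k := 0) _ oW).
have [M M0 hM] := ip_bounded QC Wq.
have Hq : H q = h i x by rewrite HE// /q chartK.
have [c c0 hc] : exists2 c : R, 0 < c & \forall u \near q,
    forall e, c * `|e| ^+ 2 <= inner_product (H u) e e.
  apply: (posdef_near (W := W)) => //; last by rewrite Hq; exact: hpos.
  by move=> a b; apply: Ck_pred; exact: H1.
pose D (u : 'rV[R]_p) : R := ddir (Z u) F u.
have DC : Ck 0 W D.
  have ZC0 a : Ck 0 W (fun u => Z u 0 a) by exact: Ck_pred (ZC 0 a).
  have dF a : Ck 0 W (partial a F) by have [_ /(_ a)[_]] := FC 1%N.
  by apply: Ck_sum => // a; apply: (Ck_mul (k := 0) oW) (ZC0 a) (dF a).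
have Dq : D q < 0.
  pose w : 'rV[R]_p := \row_a partial a F q; pose z := w *m \adj (H q).
  have w0 : w != 0.
    apply: (drho i x) bx dx _; exists W, F; split => // u Wu cu; exact: FEq.
  have [Hsym Hpos] : positive_definite (H q) by rewrite Hq; exact: hpos.
  have zH : z *m H q = \det (H q) *: w by rewrite /z -mulmxA mul_adj_mx mul_mx_scalar.
  have d0 : \det (H q) != 0.
    by rewrite -unitfE -unitmxE; apply: pos_unitmx; split.
  have z0 : z != 0.
    apply: contraNneq w0 => z0; move: zH; rewrite z0 mul0mx => /esym/eqP.
    by rewrite scaler_eq0 (negbTE d0).
  have Eq a : partial a E q = - w 0 a.
    pose sq := fun u : 'rV[R]_p => - (\sum_k (u 0 k - q 0 k) ^+ 2).
    have FN : Ck 1 W (fun u => - F u) by exact: Ck_opp.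
    rewrite /E (partialD (f := sq) a (sq_Ck 1 oW) FN Wq).
    have -> : partial a sq q = 0.
      apply: oppr_inj; rewrite oppr0.
      have -> : - partial a sq q = partial a (fun u => \sum_k (u 0 k - q 0 k) ^+ 2) q.
        rewrite /sq (_ : (fun u => - _) = fun u : 'rV[R]_p => \sum_k -1 * ((u 0 k - q 0 k) ^+ 2)); last first.
          by apply/funext => u; rewrite -sumrN; apply: eq_bigr => k _; rewrite mulN1r.
        have C k : Ck 1 W (fun u : 'rV[R]_p => (u 0 k - q 0 k) ^+ 2).
          by apply: (Ck_mul oW); apply: (Ck_sub oW (Ck_coord _ _ oW) (Ck_cst _ _ oW)).
        rewrite !(partial_sum _ _ oW Wq)//; last by move=> k; exact: Ck_scale.
        rewrite -sumrN; apply: eq_bigr => k _.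
        by rewrite (partialM _ (Ck_cst 1 _ oW) (C k) Wq) partial_cst mulr0 addr0 mulN1r opprK.
      apply: (partial_at_min oW Wq).
        apply: Ck_sum => // k.
        by apply: (Ck_mul oW); apply: (Ck_sub oW (Ck_coord _ _ oW) (Ck_cst _ _ oW)).
      move=> v _; rewrite [leLHS]big1; last by move=> k _; rewrite subrr expr0n.
      by apply: sumr_ge0 => k _; exact: sqr_ge0.
    rewrite add0r mxE; apply/eqP; rewrite -addr_eq0 -(partialD a FN (FC 1%N) Wq).
    by rewrite (_ : (fun v => _) = fun=> 0) ?partial_cst//; apply/funext => u; rewrite addNr.
  have -> : D q = - inner_product (H q) z z.
    rewrite /D /ddir /inner_product zH -scalemxAl mxE mxE mulr_sumr -sumrN.
    apply: eq_bigr => a _; rewrite /Z.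
    have -> : \row_b partial b E q = - w by apply/rowP => b; rewrite [LHS]mxE Eq [RHS]mxE.
    by rewrite mulNmx -/z !mxE; ring.
  by rewrite oppr_lt0; exact: Hpos.
exists M, c, (- D q / 2); split => //; first by rewrite divr_gt0// oppr_gt0.
have hD : \forall u \near q, D u <= D q / 2.
  have cD : D u @[u --> q] --> D q by exact: (DC.1 q Wq).
  by apply: (cvgr_le _ cD); lra.
have WqN : nbhs q W by exact: open_nbhs_nbhs.
apply: filterS (filterI WqN (filterI hM (filterI hc hD))) => u [Wu [hMu [hcu hDu]]] iu.
pose V := W `&` ichart (N := N) i.
have oV : open V by exact: openI.
have Vu : V u by [].
have Vc v : V v -> (chart i @` dom i) v by move=> [_ [y [dy _] <-]]; exists y.
have EV v : V v -> E v = depth v by move=> Vv; rewrite /E /depth FEq//; [case: Vv|exact: Vc].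
have HV v : V v -> H v = hl i v by move=> Vv; apply: HE; [case: Vv|exact: Vc].
have ZV v : V v -> Z v = Y v.
  move=> Vv; rewrite /Z /Y HV//; congr (_ *: (_ *m _)); apply/rowP => a; rewrite !mxE.
  exact: (partial_ext _ oV Vv).
split.
- move=> e; rewrite -(lie_form_ext e oV Vu HV ZV) QE.
  by have := hMu e; rewrite ler_norml => /andP[].
- by move=> e; rewrite -HV.
- rewrite -ZV// -(ddir_ext (f := F) _ oV Vu); first by rewrite mulNr opprK.
  by move=> v Vv; rewrite FEq//; [case: Vv|exact: Vc].
Qed.

(** On the region [0 < eta] both [rho] and the distance to [q] are small, so
    that the bounded part [M] of the Lie derivative of [h], multiplied by
    [rho], is dominated by the derivative of [rho]. *)
Lemma barrier_exists (O : set N) : nbhs x O ->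
  exists (K : set N) (eta : 'rV[R]_p -> R) (Z : 'rV[R]_p -> 'rV[R]_p) (kappa : R),
    [/\ barrier i K eta Z kappa, K `<=` O &
      \forall y \near x, inner y -> dom i y /\ 0 < eta (chart i y)].
Proof.
move=> Ox; have [M [c [k [M0 c0 k0 near_q]]]] := estimates.
have [e e0 hK] := chart_box_compact dx Ox.
have /nbhs_ballP[d /= d0 hd] := near_q.
(* [r] is small enough for the estimates on the region [rho < r ^ 2]. *)
have Mc0 : 0 < M / c by rewrite divr_gt0.
have [s s0 hs] := small_factor (ltW Mc0) (divr_gt0 k0 (ltr0n R 2)).
pose r := Num.min 1 (Num.min s (Num.min (e / 2) (d / 2))).
have r0 : 0 < r by rewrite !lt_min ltr01 s0 !divr_gt0.
have [r1 rs re rd] : [/\ r <= 1, r <= s, r < e & r < d].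
  have [a1 [a2 [a3 a4]]] : r <= 1 /\ r <= s /\ r <= e / 2 /\ r <= d / 2.
    by rewrite /r !ge_min !lexx !orbT.
  by split => //; lra.
clearbody r; have r01 : 0 < r < e by rewrite r0.
have [K [cK Kdom Kbox]] := hK r r01.
pose eta u := r ^+ 2 + depth u.
have eta_rho u : ichart (N := N) i u -> 0 < eta u -> rl i u < r ^+ 2 /\ forall a, `|u 0 a - q 0 a| < r.
  move=> iu; rewrite /eta /depth => eu.
  have rl0 : 0 <= rl i u by exact: (rho_ge0 rho_def).
  have sq0 : 0 <= \sum_a (u 0 a - q 0 a) ^+ 2 by apply: sumr_ge0 => a _; exact: sqr_ge0.
  split; first lra.
  move=> a; rewrite -(@ltr_pXn2r _ 2)// ?nnegrE ?(ltW r0)// real_normK ?num_real//.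
  rewrite (@le_lt_trans _ _ (\sum_a (u 0 a - q 0 a) ^+ 2))//; last lra.
  rewrite (bigD1 a)//= lerDl; apply: sumr_ge0 => b _; exact: sqr_ge0.
have etaC k' : Ck k' (ichart (N := N) i) eta by exact: (Ck_add iO (Ck_cst _ _ iO) (depth_Ck k')).
have deta v u : ichart (N := N) i u -> ddir v eta u = ddir v depth u.
  move=> iu; apply: eq_bigr => a _; congr (_ * _).
  by rewrite /eta (partialD (f := fun=> r ^+ 2) a (Ck_cst 1 _ iO) (depth_Ck 1) iu) partial_cst add0r.
have rl_gt0 u : ichart (N := N) i u -> 0 < rl i u.
  by move=> /ichartP[_ iu _]; have [_ h0 _ _] := rho_def; exact: h0.
have gY u e' : ichart (N := N) i u ->
    inner_product (gl i u) (Y u) e' = (rl i u ^- 2 * \det (hl i u) ^+ 2) * ddir e' depth u.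
  move=> iu; have rl0 := rl_gt0 _ iu.
  have -> : gl i u = rl i u ^- 2 *: hl i u.
    by rewrite hlE// scalerA mulVf ?scale1r// gt_eqF// exprn_gt0.
  rewrite ipZm -mulrA; congr (_ * _).
  rewrite /Y ipZl /inner_product -[grad u *m _ *m _]mulmxA mul_adj_mx mul_mx_scalar -scalemxAl mxE mulrA -expr2.
  congr (_ * _); rewrite mxE; apply: eq_bigr => a _.
  by rewrite !mxE mulrC.
have w0 u : ichart (N := N) i u -> 0 < rl i u ^- 2 * \det (hl i u) ^+ 2.
  move=> iu; have rl0 := rl_gt0 _ iu.
  apply: mulr_gt0; first by rewrite invr_gt0 exprn_gt0.
  rewrite lt_def sqr_ge0 sqrf_eq0 andbT.
  have [du _ _] := ichartP iu; have [_ _ hpos _] := cc.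
  by rewrite -unitfE -unitmxE; apply: pos_unitmx; exact: hpos.
have reluC : Ck 1 (ichart (N := N) i) (fun u => relu (eta u) ^+ 2) /\ forall u a,
    ichart (N := N) i u -> partial a (fun u => relu (eta u) ^+ 2) u = (2 * relu (eta u)) * partial a eta u.
  apply: (Ck1_real_comp (phi := fun t => relu t ^+ 2) (dphi := fun t => 2 * relu t) iO (etaC 1%N)).
    by move=> t; exact: relu2_derive.
  move=> t; have h2 : {for t, continuous (fun _ : R => 2 : R)} by exact: cst_continuous.
  exact: (continuousM h2 (@relu_continuous R t)).
exists K, eta, Y, (k / 2); split; last 2 first.
- by move=> y /Kdom[].
- have [_ _ rho0 _] := rho_def.
  have cdepth : \forall y \near x, - r ^+ 2 / 2 < - (\sum_k (chart i y 0 k - q 0 k) ^+ 2).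
    have h1 : {for x, continuous ((fun u : 'rV[R]_p => - (\sum_k (u 0 k - q 0 k) ^+ 2)) \o chart i)}.
      apply: continuous_comp; first exact: chart_continuous.
      exact: (Ck_cont (sq_Ck 0 openT)).
    apply: (cvgr_gt _ h1); rewrite /= big1; last by move=> a _; rewrite subrr expr0n.
    by rewrite oppr0 mulNr oppr_lt0 divr_gt0// exprn_gt0.
  have crho : \forall y \near x, rho y < r ^+ 2 / 2.
    by apply: (cvgr_lt _ (@rho_continuous x)); rewrite rho0// divr_gt0// exprn_gt0.
  have cdom : nbhs x (dom i) by apply: open_nbhs_nbhs; split => //; exact: dom_open.
  apply: filterS (filterI cdom (filterI cdepth crho)) => y [dy [h1 h2]] iy; split => //.
  by rewrite /eta /depth chartK//; lra.
split => //.
- by move=> y /Kdom[].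
- by move=> u iu eu; have [du _ cu] := ichartP iu; apply: Kbox => // a; rewrite cu ltW//; exact: (eta_rho _ iu eu).2.
- by move=> u iu; exists (rl i u ^- 2 * \det (hl i u) ^+ 2) => [|e']; [exact: w0|rewrite gY// deta].
- by rewrite divr_gt0.
move=> u e' iu; have rl0 := rl_gt0 _ iu.
have rl2 : 0 < rl i u ^+ 2 by rewrite exprn_gt0.
have gC := metric_Ck rho_def g_metric.
have s1 := Ck_cst 1 (1 : R) iO.
(* The constant field 1 as a weight: [lie_form_scale] then compares the Lie
   derivatives of [g] and [h] along the same field, without dividing. *)
have LgY : lie_form (hl i) Y u e' = rl i u ^+ 2 * lie_form (gl i) Y u e' +
    rl i u * ddir (Y u) (rl i) u * inner_product (gl i u) e' e'.
  rewrite (lie_form_ext (G' := fun w => (rl i w * rl i w) *: gl i w) (X' := fun w => (1 : R) *: Y w) e' iO iu).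
  - rewrite (lie_form_scale (s := fun w => rl i w * rl i w) (f := fun=> 1) e' iO iu (Ck_mul iO (rl_Ck 1) (rl_Ck 1)) s1 (gC 1%N i) Y_Ck).
    have -> : ddir e' (fun=> 1 : R) u = 0.
      by apply: big1 => a _; rewrite partial_cst mulr0.
    by rewrite (ddirM _ (rl_Ck 1) (rl_Ck 1) iu); field.
  - by move=> w iw; rewrite hlE// expr2.
  - by move=> w _; rewrite scale1r.
have LfY : lie_form (gl i) (fun w => relu (eta w) ^+ 2 *: Y w) u e' =
    relu (eta u) ^+ 2 * lie_form (gl i) Y u e' +
    2 * relu (eta u) * (rl i u ^- 2 * \det (hl i u) ^+ 2) * ddir e' depth u ^+ 2.
  rewrite (lie_form_ext (G' := fun w => (1 : R) *: gl i w) (X' := fun w => relu (eta w) ^+ 2 *: Y w) e' iO iu)//; last first.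
    by move=> w _; rewrite scale1r.
  rewrite (lie_form_scale (s := fun=> 1) (f := fun w => relu (eta w) ^+ 2) e' iO iu s1 reluC.1 (gC 1%N i) Y_Ck).
  have -> : ddir (Y u) (fun=> 1 : R) u = 0.
    by apply: big1 => a _; rewrite partial_cst mulr0.
  have -> : ddir e' (fun w => relu (eta w) ^+ 2) u = 2 * relu (eta u) * ddir e' depth u.
    rewrite -deta// /ddir mulr_sumr; apply: eq_bigr => a _.
    by rewrite reluC.2// mulrCA.
  by rewrite gY//; ring.
rewrite LfY; have [eu|eu] := leP (eta u) 0.
  by rewrite relu_neg// expr0n /= !(mul0r, mulr0) addr0.
have [rlr box] := eta_rho u iu eu.
have dball : ball q d u by apply/ball_rVP => // a; rewrite distrC; apply: lt_trans (box a) rd.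
have [hlie hpos hdir] := hd u dball iu.
have g0 : 0 <= inner_product (gl i u) e' e'.
  have -> : gl i u = rl i u ^- 2 *: hl i u.
    by rewrite hlE// scalerA mulVf ?scale1r// gt_eqF// exprn_gt0.
  rewrite ipZm mulr_ge0 ?invr_ge0 ?(ltW rl2)//.
  by apply: le_trans (hpos e'); rewrite mulr_ge0 ?(ltW c0)// exprn_ge0.
have gh : inner_product (hl i u) e' e' = rl i u ^+ 2 * inner_product (gl i u) e' e'.
  by rewrite hlE// ipZm.
have t2 : 0 <= 2 * relu (eta u) * (rl i u ^- 2 * \det (hl i u) ^+ 2) * ddir e' depth u ^+ 2.
  by rewrite mulr_ge0 ?sqr_ge0// mulr_ge0 ?(ltW (w0 _ iu))// mulr_ge0// relu_ge0.
rewrite -[leLHS]addr0; apply: lerD => //.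
rewrite [k / 2 * _]mulrCA -mulrA; apply: ler_wpM2l; first by rewrite exprn_ge0// relu_ge0.
set gee := inner_product (gl i u) e' e' in g0 gh LgY *; set L := lie_form (gl i) Y u e' in LgY *.
set t := rl i u in rl0 rl2 rlr gh LgY *.
have b1 : M * `|e'| ^+ 2 <= M / c * (t ^+ 2 * gee).
  rewrite -gh -mulrA; apply: ler_wpM2l; first exact: ltW.
  by rewrite ler_pdivlMl//; exact: hpos.
have tr : t <= r.
  by apply: le_trans (ltW rlr) _; rewrite expr2 ler_piMl// ltW.
have b2 : M / c * t <= k / 2.
  apply: le_trans hs; apply: ler_wpM2l; first exact: ltW.
  exact: le_trans tr rs.
have b3 : k * (t * gee) <= - (ddir (Y u) (rl i) u) * (t * gee).
  by apply: ler_wpM2r; [rewrite mulr_ge0// ltW|rewrite lerNr].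
have b4 : M / c * t * (t * gee) <= k / 2 * (t * gee).
  by apply: ler_wpM2r => //; rewrite mulr_ge0// ltW.
have key : k / 2 * (t * gee) <= t ^+ 2 * L.
  have := hlie e'; rewrite LgY => b5.
  have e1 : M / c * (t ^+ 2 * gee) = M / c * t * (t * gee) by rewrite expr2; ring.
  have e2 : - (ddir (Y u) (rl i) u) * (t * gee) = - (t * ddir (Y u) (rl i) u * gee) by ring.
  rewrite e1 in b1; rewrite e2 in b3; lra.
rewrite -(ler_pM2l rl2); apply: le_trans key.
by rewrite le_eqVlt; apply/orP; left; apply/eqP; field; rewrite gt_eqF.
Qed.

End Existence.
End Barrier.

(** * The hull of a set at infinity *)

Lemma derive_ge0_le {R : realType} (f df : R -> R) (a b s t : R) : a <= s -> s <= t -> t <= b ->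
  (forall r, a <= r <= b -> is_derive r (1 : R) f (df r)) ->
  (forall r, a <= r <= b -> 0 <= df r) -> f s <= f t.
Proof.
move=> sa st tb fd df0; have [->//|st'] := eqVneq s t.
have slt : s < t by rewrite lt_neqAle st'.
have fI r : r \in `]s, t[ -> is_derive r (1 : R) f (df r).
  by rewrite in_itv /= => /andP[h1 h2]; apply: fd; apply/andP; split; lra.
have fc : {within `[s, t], continuous f}.
  apply: derivable_within_continuous => r; rewrite in_itv /= => /andP[h1 h2].
  by have [] := fd r _ => //; apply/andP; split; lra.
have [r rI E] := MVT slt fI fc.
rewrite -subr_ge0 E mulr_ge0 ?subr_ge0//; apply: df0.
by move: rI; rewrite in_itv /= => /andP[h1 h2]; apply/andP; split; lra.
Qed.

Section Hull.
Context {R : realType} {n : nat} (N : bmanifold R n).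
Notation p := n.+1.
Implicit Types (i j : Defs.index N) (x y : N).
Variables (rho : N -> R) (g h : metric_components N).
Hypothesis g_metric : riemannian_metric g.
Hypothesis cc : C2_compactification g rho h.

Let rho_def : defining_function rho. Proof. by have [] := cc. Qed.

Notation gl i := (fun u => g i (chart_inv i u)).

Section Geodesics.
Variables (i : Defs.index N) (K : set N) (eta : 'rV[R]_p -> R) (Y : 'rV[R]_p -> 'rV[R]_p) (kappa : R).
Hypothesis bar : barrier rho g i K eta Y kappa.
Variables (gamma : R -> N) (a b e : R).
Hypothesis e0 : 0 < e.
Hypothesis geo : forall t, a - e < t < b + e -> geodesic_at g gamma t.
Let c := chart i \o gamma.

Let iO : open (ichart (N := N) i). Proof. exact: (ichart_open rho_def). Qed.

(* Extension by zero of a function defined while the curve is in the chart. *)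
Let glue (f : R -> R) t := if `[< dom i (gamma t) >] then f t else 0.

Let glue_derive (f : R -> R) t d : a - e < t < b + e -> dom i (gamma t) ->
  is_derive t (1 : R) f d -> is_derive t (1 : R) (glue f) d.
Proof.
move=> /geo[_ ct _] di; apply: is_derive_near.
have : \forall s \near t, dom i (gamma s).
  exact: (ct _ (open_nbhs_nbhs (conj (dom_open i) di))).
by apply: filterS => s ds; rewrite /glue asboolT.
Qed.

Let glue_derive0 (f : R -> R) t : a - e < t < b + e -> ~ dom i (gamma t) ->
  (forall s, a - e < s < b + e -> dom i (gamma s) -> eta (c s) <= 0 -> f s = 0) ->
  is_derive t (1 : R) (glue f) 0.
Proof.
move=> tab ndi f0; have [_ ct _] := geo tab.
apply: (is_derive_near (f := fun=> 0)).
have oK : open (~` K).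
  by apply: closed_openC; apply: compact_closed (bar_compact bar); exact: (@space_hausdorff _ _ N).
have nK : (~` K) (gamma t) by move=> /(bar_dom bar).
have h1 : \forall s \near t, ~ K (gamma s).
  exact: (ct _ (open_nbhs_nbhs (conj oK nK))).
have h2 : \forall s \near t, a - e < s < b + e.
  move/andP: tab => [t1 t2].
  by apply: filterS2 (lt_nbhsr t1) (lt_nbhsl t2) => s -> ->.
apply: filterS2 h1 h2 => s nKs sab; rewrite /glue; case: asboolP => // ds.
rewrite f0// leNgt; apply/negP => es; apply: nKs.
have [is_ _ _] := geo sab.
rewrite -(chartK ds); apply: (bar_supp bar) => //; exact: ichart_chart.
Qed.

Let F t := inner_product (gl i (c t)) (relu (eta (c t)) ^+ 2 *: Y (c t)) (derive1 c t).

Let field_Ck1 : Ckmx 1 (ichart (N := N) i) (fun w => relu (eta w) ^+ 2 *: Y w).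
Proof.
apply: Ckmx_scale; [exact: iO| |exact: (bar_field bar)].
apply: (Ck1_real_comp (phi := fun t => relu t ^+ 2) (dphi := fun t => 2 * relu t) (@iO) (bar_eta bar) _ _).1.
  by move=> t; exact: relu2_derive.
move=> t; have h2 : {for t, continuous (fun _ : R => 2 : R)} by exact: cst_continuous.
exact: (continuousM h2 (@relu_continuous R t)).
Qed.

Let dF t : R := if `[< dom i (gamma t) >] then
  lie_form (gl i) (fun w => relu (eta w) ^+ 2 *: Y w) (c t) (derive1 c t) else 0.

Let FE t : relu (eta (c t)) = 0 -> F t = 0.
Proof. by move=> e1; rewrite /F e1 expr0n /= ipZl mul0r. Qed.

Let F_derive t : a - e < t < b + e -> is_derive t (1 : R) (glue F) (dF t).
Proof.
move=> tab; rewrite /dF; case: asboolP => di; last first.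
  by apply: glue_derive0 => // s _ _ es; apply: FE; exact: relu_neg.
apply: glue_derive => //.
have [iga _ hgeo] := geo tab; have [dc ddc eqn] := hgeo i di.
have ci : ichart (N := N) i (c t) by exact: ichart_chart.
apply: (geodesic_product_derive iO ci).
- by move=> w /ichartP[dw iw _]; have [] := metric_pos g_metric iw dw.
- by rewrite chartK//; apply: pos_unitmx; exact: (metric_pos g_metric).
- exact: (metric_Ck rho_def g_metric).
- exact: field_Ck1.
- exact: nbhs_singleton dc.
- exact: ddc.
- move=> k; rewrite -[RHS](eqn k); congr (_ + _); apply: eq_bigr => l _; apply: eq_bigr => m _.
  by rewrite /christoffel /christoffel_mx /local /c /= chartK.
Qed.

Let dF_ge0 t : a - e < t < b + e -> 0 <= dF t.
Proof.
move=> tab; rewrite /dF; case: asboolP => // di.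
have [iga _ _] := geo tab.
have ci : ichart (N := N) i (c t) by exact: ichart_chart.
apply: le_trans (bar_lie bar (derive1 c t) ci); apply: mulr_ge0.
  rewrite mulr_ge0 ?(ltW (bar_pos bar))// divr_ge0 ?exprn_ge0 ?relu_ge0//.
  exact: (rho_ge0 rho_def).
rewrite chartK//; have [_ pd] := metric_pos g_metric iga di.
have [->|/pd/ltW//] := eqVneq (derive1 c t) 0.
by rewrite /inner_product mul0mx mul0mx mxE.
Qed.

Let P t := eta (c t) * relu (eta (c t)) ^+ 2.
Let dP t : R := if `[< dom i (gamma t) >] then 3 * relu (eta (c t)) ^+ 2 * ddir (derive1 c t) eta (c t) else 0.

Let P_derive t : a - e < t < b + e -> is_derive t (1 : R) (glue P) (dP t).
Proof.
move=> tab; rewrite /dP; case: asboolP => di; last first.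
  by apply: glue_derive0 => // s _ _ es; rewrite /P relu_neg// expr0n mulr0.
apply: glue_derive => //.
have [iga _ hgeo] := geo tab; have [dc _ _] := hgeo i di.
have ci : ichart (N := N) i (c t) by exact: ichart_chart.
have c3 : continuous (fun t : R => 3 * relu t ^+ 2).
  move=> s; have h3 : {for s, continuous (fun _ : R => 3 : R)} by exact: cst_continuous.
  have h1 := @relu_continuous R s.
  exact: (continuousM h3 (continuousM h1 h1)).
have [CP hP] := Ck1_real_comp (phi := fun t => t * relu t ^+ 2) (dphi := fun t => 3 * relu t ^+ 2)
  (@iO) (bar_eta bar) (@relu3_derive R) c3.
have der := curve_is_derive (@iO) CP ci (nbhs_singleton dc).
apply: is_derive_eq der _; rewrite /ddir mulr_sumr; apply: eq_bigr => l _.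
by rewrite (hP _ _ ci) mulrCA.
Qed.

(** The product of the velocity with the expanding field is nondecreasing and
    zero at both ends, hence zero; so the cube of the positive part of [eta]
    has zero derivative. *)
Lemma barrier_geodesic :
  ~ (dom i (gamma a) /\ 0 < eta (c a)) -> ~ (dom i (gamma b) /\ 0 < eta (c b)) ->
  forall t, a <= t <= b -> ~ (dom i (gamma t) /\ 0 < eta (c t)).
Proof.
move=> na nb t /andP[at_ tb].
have endF s : ~ (dom i (gamma s) /\ 0 < eta (c s)) -> glue F s = 0 /\ glue P s = 0.
  move=> ns; rewrite /glue; case: asboolP => // ds.
  have es : eta (c s) <= 0 by rewrite leNgt; apply/negP => es; apply: ns.
  by split; [apply: FE; exact: relu_neg|rewrite /P relu_neg// expr0n mulr0].
have [Fa Pa] := endF a na; have [Fb Pb] := endF b nb.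
have wide s : a <= s <= b -> a - e < s < b + e.
  move=> /andP[h1 h2].
  by rewrite ltrBlDr (le_lt_trans h1) ?ltrDl// (le_lt_trans h2) ?ltrDl.
have F0 s : a <= s <= b -> glue F s = 0.
  move=> sab; move/andP: (sab) => [as_ sb]; apply/eqP; rewrite eq_le; apply/andP; split.
    rewrite -Fb; apply: (derive_ge0_le (df := dF) as_ sb (lexx b)) => r /wide rab.
      exact: F_derive.
    exact: dF_ge0.
  rewrite -[in leLHS]Fa; apply: (derive_ge0_le (df := dF) (lexx a) as_ sb) => r /wide rab.
    exact: F_derive.
  exact: dF_ge0.
have dP0 s : a <= s <= b -> dP s = 0.
  move=> sab; have := F0 s sab; rewrite /glue /dP; case: asboolP => // ds.
  have [iga _ _] := geo (wide s sab).
  have ci : ichart (N := N) i (c s) by exact: ichart_chart.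
  have [w w0 gE] := bar_grad bar ci.
  rewrite /F ipZl gE => /eqP; rewrite mulrCA mulf_eq0 (gt_eqF w0) /= => /eqP h0.
  by rewrite -mulrA h0 mulr0.
have Pt : glue P t = 0.
  apply/eqP; rewrite eq_le; apply/andP; split.
    rewrite -Pb; apply: (derive_ge0_le (df := dP) at_ tb (lexx b)) => r rab.
      by apply: P_derive; exact: wide.
    by rewrite dP0.
  rewrite -[in leLHS]Pa; apply: (derive_ge0_le (df := dP) (lexx a) at_ tb) => r rab.
    by apply: P_derive; exact: wide.
  by rewrite dP0.
move=> [dt et]; move: Pt; rewrite /glue asboolT// /P relu_pos ?(ltW et)// => /eqP.
by rewrite mulf_eq0 expf_eq0 /= orbb gt_eqF.
Qed.

End Geodesics.

(** The points that no barrier avoiding [C] cuts off. *)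
Definition hull (C : set N) : set N := [set x | inner x /\
  forall i K eta Y kappa, barrier rho g i K eta Y kappa -> K `&` C = set0 ->
    ~ (dom i x /\ 0 < eta (chart i x))].

Lemma hull_convex C : totally_convex g (hull C).
Proof.
move=> gamma a b [ab [e e0 geo]] [ia Ha] [ib Hb] _ [t tab <-].
move: tab; rewrite /= in_itv /= => tab; split.
  have [] := geo t _ => //; by move/andP: tab => [h1 h2]; apply/andP; split; lra.
move=> i K eta Y kappa bar KC.
apply: (barrier_geodesic bar e0 geo) tab; [exact: Ha bar KC|exact: Hb bar KC].
Qed.

Lemma barrier_open i K eta Y kappa : barrier rho g i K eta Y kappa ->
  open [set x | inner x /\ (dom i x /\ 0 < eta (chart i x))].
Proof.
move=> bar; apply: open_nbhsP => x [ix [dx ex]].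
have h1 : nbhs x (@inner R n N) by apply: open_nbhs_nbhs; split => //; exact: (inner_open rho_def).
have h2 : nbhs x (dom i) by apply: open_nbhs_nbhs; split => //; exact: dom_open.
have h3 : \forall y \near x, 0 < eta (chart i y).
  have cx : {for x, continuous (eta \o chart i)}.
    apply: continuous_comp; first exact: chart_continuous.
    by apply: (Ck_cont (bar_eta bar)); exact: ichart_chart.
  by apply: (cvgr_gt _ cx).
exact: filterS (filterI h1 (filterI h2 h3)).
Qed.

Lemma hull_closed C : closed_in_inner (hull C).
Proof.
split=> [x []//|x [cx ix]]; split=> // i K eta Y kappa bar KC [dx ex].
have D : nbhs x [set x | inner x /\ (dom i x /\ 0 < eta (chart i x))].
  by apply: open_nbhs_nbhs; split => //; exact: barrier_open bar.
by have [y [[_ Hy] [_ hy]]] := cx _ D; exact: Hy bar KC hy.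
Qed.

(** Barriers avoid [C], which keeps its interior points in the hull; at a
    boundary point outside [C] there is a barrier, and it covers a
    neighbourhood of that point. *)
Lemma hull_boundary (C S : set N) : closed C -> S `<=` C -> C `&` @boundary R n N `<=` S ->
  S `<=` closure (C `&` @inner R n N) -> S `<=` @boundary R n N ->
  asymptotic_boundary (hull C) = S.
Proof.
move=> clC SC CS Scl Sb; apply/seteqP; split=> x; last first.
  move=> Sx; split; last exact: Sb.
  apply: closure_subset (Scl x Sx) => y [Cy iy]; split=> // i K eta Y kappa bar KC [dy ey].
  have : (K `&` C) y.
    split=> //; rewrite -(chartK dy); apply: (bar_supp bar) => //; exact: ichart_chart.
  by rewrite KC.
move=> [cx bx]; apply: contrapT => nS.
have nC : (~` C) x by move=> Cx; apply: nS; exact: CS.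
have [i dx] := dom_cover x.
have OC : nbhs x (~` C) by apply: open_nbhs_nbhs; split => //; exact: closed_openC.
have [K [eta [Z [kappa [bar KO near_x]]]]] := barrier_exists g_metric cc bx dx OC.
have KC : K `&` C = set0 by apply/seteqP; split=> // y [/KO].
have [y [[iy Hy] hy]] := cx _ near_x.
exact: Hy bar KC (hy iy).
Qed.

End Hull.

(** * Riemannian distance in a chart *)

(** The integral of a nonnegative function is a supremum over the simple
    functions below it, measurable or not. *)
Lemma integral_le_ge0 {R : realType} d (T : measurableType d) (mu : {measure set T -> \bar R})
    (D : set T) (f1 f2 : T -> \bar R) : (forall x, D x -> (0 <= f1 x)%E) ->
  (forall x, D x -> (f1 x <= f2 x)%E) ->
  (\int[mu]_(x in D) f1 x <= \int[mu]_(x in D) f2 x)%E.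
Proof.
move=> f10 f12.
have f20 x : D x -> (0 <= f2 x)%E by move=> Dx; apply: le_trans (f10 x Dx) (f12 x Dx).
rewrite !ge0_integralE//; apply: ereal_sup_le => _ [h hf <-].
exists h => // x; apply: le_trans (hf x) _.
rewrite /patch; case: ifPn => // xD; apply: f12; exact: set_mem.
Qed.

Lemma increment_le_integral {R : realType} (F D : R -> R) :
  (forall t : R, is_derive t (1 : R) F (D t)) -> continuous D ->
  (`|F 1 - F 0|%:E <= \int[lebesgue_measure]_(t in `[0%R, 1%R]) `|D t|%:E)%E.
Proof.
move=> FD cD.
have cF : continuous F.
  by move=> t; apply: differentiable_continuous; apply/derivable1_diffP; have [] := FD t.
have cDi : {within `[0, 1], continuous D} by exact: continuous_subspaceT.
rewrite -[(`|F 1 - F 0|)%:E]/(`|(F 1 - F 0)%:E|)%E.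
have <- : (\int[lebesgue_measure]_(t in `[0%R, 1%R]) (D t)%:E)%E = (F 1 - F 0)%:E.
  rewrite (continuous_FTC2 (F := F) ltr01 cDi)//.
    split.
    - by move=> t _; have [] := FD t.
    - exact: cvg_at_right_filter (cF 0).
    - exact: cvg_at_left_filter (cF 1).
  by move=> t _; rewrite derive1E; have [_ ->] := FD t.
apply: le_trans (le_abse_integral _ _ _) _ => //.
by apply/measurable_EFinP; apply: subspace_continuous_measurable_fun.
Qed.

Lemma row_continuous {R : realType} (T : topologicalType) (m : nat) (F : T -> 'rV[R]_m) (t : T) :
  (forall l, {for t, continuous (fun s => F s 0 l)}) -> {for t, continuous F}.
Proof.
move=> hF; apply/cvgrPdist_lt => e e0.
have : \forall s \near t, forall l, `|F t 0 l - F s 0 l| < e.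
  apply: (@filter_forall _ 'I_m (fun l s => `|F t 0 l - F s 0 l| < e) (nbhs t)) => l.
  by have /cvgrPdist_lt/(_ _ e0) := hF l.
by apply: filterS => s hs; apply: norm_rV_lt => // l; rewrite !mxE; exact: hs.
Qed.

Lemma near_continuous (T U : topologicalType) (f g : T -> U) (t : T) :
  (\forall s \near t, f s = g s) -> {for t, continuous f} -> {for t, continuous g}.
Proof.
move=> fg cf; have e : f t = g t := nbhs_singleton fg.
change (g s @[s --> t] --> g t); rewrite -e; apply: cvg_trans cf.
by apply: (@near_eq_cvg _ _ (nbhs t) _ f g).
Qed.

Lemma sum_continuous {R : realType} (T : topologicalType) (I : Type) (r : seq I) (f : I -> T -> R) (t : T) :
  (forall a, {for t, continuous (f a)}) -> {for t, continuous (fun s => \sum_(a <- r) f a s)}.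
Proof.
move=> cf; elim: r => [|a r IH].
  rewrite (_ : (fun s => _) = fun=> 0); first exact: cst_continuous.
  by apply/funext => s; rewrite big_nil.
rewrite (_ : (fun s => _) = fun s => f a s + \sum_(b <- r) f b s); last first.
  by apply/funext => s; rewrite big_cons.
exact: (continuousD (cf a) IH).
Qed.

Section ChartDistance.
Context {R : realType} {n : nat} (N : bmanifold R n).
Notation p := n.+1.
Implicit Types (i j : Defs.index N) (x y : N).
Variables (rho : N -> R) (g : metric_components N).
Hypothesis rho_def : defining_function rho.
Hypothesis g_metric : riemannian_metric g.
Variables (i : Defs.index N) (x0 : N).
Hypotheses (dx0 : dom i x0) (ix0 : inner x0).
Let u0 := chart i x0.

Notation gl i := (fun u => g i (chart_inv i u)).
Let iO : open (ichart (N := N) i). Proof. exact: (ichart_open rho_def). Qed.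

Lemma metric_comparison : exists (r c M : R), [/\ 0 < r, 0 < c, 0 < M &
  forall u, ball u0 r u -> ichart (N := N) i u /\ forall e,
    c * `|e| ^+ 2 <= inner_product (gl i u) e e <= M * `|e| ^+ 2].
Proof.
have cu : ichart (N := N) i u0 by exact: ichart_chart.
have CG := metric_Ck rho_def g_metric 0 i.
have [M M0 hM] := ip_bounded CG cu.
have [c c0 hc] : exists2 c : R, 0 < c & \forall u \near u0,
    forall e, c * `|e| ^+ 2 <= inner_product (gl i u) e e.
  by apply: (posdef_near CG cu); rewrite chartK//; exact: (metric_pos g_metric).
have iN : nbhs u0 (ichart (N := N) i) by exact: open_nbhs_nbhs.
have [r /= r0 hr] := (nbhs_ballP _ _).1 (filterI iN (filterI hM hc)).
exists r, c, M; split => // u /hr[iu [h1 h2]]; split => // e.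
by rewrite h2 /= (le_trans (ler_norm _) (h1 e)).
Qed.

Section Bounds.
Variables (r c M : R).
Hypotheses (r0 : 0 < r) (c0 : 0 < c) (M0 : 0 < M).
Hypothesis cmp : forall u, ball u0 r u -> ichart (N := N) i u /\ forall e,
    c * `|e| ^+ 2 <= inner_product (gl i u) e e <= M * `|e| ^+ 2.

Let curve_speed gamma t : C1_curve gamma -> dom i (gamma t) ->
  speed g gamma t = Num.sqrt (inner_product (gl i (chart i (gamma t)))
    (derive1 (chart i \o gamma) t) (derive1 (chart i \o gamma) t)).
Proof.
move=> /(_ t)[it ct dt] di; rewrite (speedE rho_def g_metric ct it _ di) ?chartK//.
by move=> j dj; have [h _] := dt j dj; exact: nbhs_singleton h.
Qed.

(** The segment in the chart, run through at the pace of [step] so as to be a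
    curve defined for all times, has bounded speed. *)
Lemma distance_le : exists2 C : R, 0 < C & forall u v, ball u0 r u -> ball u0 r v ->
  (riemannian_distance g (chart_inv i u) (chart_inv i v) <= (C * `|u - v|)%:E)%E.
Proof.
have [B B0 hB] := @dstep_bounded R.
have sM0 : 0 < Num.sqrt M by rewrite sqrtr_gt0.
exists (Num.sqrt M * B); first exact: mulr_gt0.
move=> u v bu bv; pose cc (t : R) := u + step t *: (v - u).
have bcc t : ball u0 r (cc t).
  apply/ball_rVP => // k; rewrite !mxE.
  move: bu bv => /(ball_rVP _ _ r0)/(_ k) h1 /(ball_rVP _ _ r0)/(_ k) h2.
  have s0 := step_ge0 t; have s1 := step_le1 t; rewrite ltr_norml.
  move: h1 h2; rewrite !ltr_norml => /andP[a1 a2] /andP[b1 b2].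
  have -> : u0 0 k - (u 0 k + step t * (v 0 k - u 0 k)) =
    (1 - step t) * (u0 0 k - u 0 k) + step t * (u0 0 k - v 0 k) by ring.
  have [s1e|s1e] := eqVneq (step t) 1.
    by rewrite s1e subrr mul0r mul1r add0r b1.
  have s1' : 0 < 1 - step t by rewrite subr_gt0 lt_neqAle s1e.
  have e1 : (1 - step t) * - r < (1 - step t) * (u0 0 k - u 0 k) by rewrite ltr_pM2l.
  have e2 : (1 - step t) * (u0 0 k - u 0 k) < (1 - step t) * r by rewrite ltr_pM2l.
  have e3 : step t * - r <= step t * (u0 0 k - v 0 k) by rewrite ler_wpM2l// ltW.
  have e4 : step t * (u0 0 k - v 0 k) <= step t * r by rewrite ler_wpM2l// ltW.
  by apply/andP; split; lra.
have icc t : ichart (N := N) i (cc t) by have [] := cmp (bcc t).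
pose gamma t := chart_inv i (cc t).
have dcc (t : R) l : is_derive t (1 : R) (fun s => cc s 0 l) (dstep t * (v - u) 0 l).
  have h0 : is_derive t (1 : R) (cst (u 0 l)) 0.
    by apply: DeriveDef; [exact: derivable_cst|exact: derive_cst].
  have h1 : is_derive t (1 : R) (cst ((v - u) 0 l)) 0.
    by apply: DeriveDef; [exact: derivable_cst|exact: derive_cst].
  have h2 := @is_deriveD R R R _ _ t 1 _ _ h0 (@is_deriveM R R _ _ t 1 _ _ (step_derive t) h1).
  have -> : (fun s => cc s 0 l) = cst (u 0 l) + step * cst ((v - u) 0 l).
    by apply/funext => s; rewrite /cc !mxE.
  by apply: is_derive_eq h2 _; rewrite /GRing.scale /= mulr0 !add0r mulrC.
have dccv (t : R) : derivable cc t 1.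
  by apply/derivable_mxP => a l; rewrite (ord1 a); have [] := dcc t l.
have cc' (t : R) : derive1 cc t = dstep t *: (v - u).
  apply/rowP => l; rewrite derive1E derive_mx// mxE [RHS]mxE.
  by have [_ ->] := dcc t l.
have ccc : continuous cc.
  by move=> t; apply: differentiable_continuous; apply/derivable1_diffP.
have cgamma : continuous gamma.
  move=> t.
  have cinv : {for cc t, continuous (chart_inv i)}.
    have := @chart_inv_continuous _ _ N i.
    move=> /(continuous_subspaceW (A := ichart i)) hh.
    have sub : ichart (N := N) i `<=` chart i @` dom i by move=> _ [y [dy _] <-]; exists y.
    have := hh sub; rewrite continuous_open_subspace; last exact: iO.
    by apply; rewrite inE.
  exact: (continuous_comp (@ccc t) cinv).
have inn t : inner (gamma t) /\ dom i (gamma t) /\ chart i (gamma t) = cc t.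
  by have [? ? ?] := ichartP (icc t).
have dtr j (t : R) l : dom j (gamma t) ->
    is_derive t (1 : R) (fun s => (chart j \o gamma) s 0 l)
      (\sum_a (dstep t * (v - u) 0 a) * partial a (fun w => transition i j w 0 l) (cc t)).
  move=> dj; have [it [di ct]] := inn t.
  have ov : overlap i j (cc t) by rewrite -ct; exact: overlap_chart.
  have := curve_is_derive (@overlap_open R n N rho rho_def i j) (@transition_Ck R n N rho rho_def 1 i j l) ov (dccv t).
  by under eq_bigr do rewrite cc' mxE.
have near_dom j t : dom j (gamma t) -> \forall s \near t, dom j (gamma s).
  by move=> dj; exact: (cgamma t _ (open_nbhs_nbhs (conj (dom_open j) dj))).
have Cg : C1_curve gamma.
  move=> t; have [it [di ct]] := inn t; split => //; first exact: cgamma.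
  move=> j dj.
  have der s : dom j (gamma s) -> derivable (chart j \o gamma) s 1.
    by move=> ds; apply/derivable_mxP => a l; rewrite (ord1 a); have [] := dtr j s l ds.
  split; first by apply: filterS (near_dom j t dj) => s /der.
  have E s : dom j (gamma s) -> derive1 (chart j \o gamma) s = \row_l
      \sum_a (dstep s * (v - u) 0 a) * partial a (fun w => transition i j w 0 l) (cc s).
    move=> ds; apply/rowP => l; rewrite derive1E derive_mx; last exact: der.
    by rewrite mxE [RHS]mxE; have [_ ->] := dtr j s l ds.
  have cE : {for t, continuous (fun s => \row_l
      \sum_a (dstep s * (v - u) 0 a) * partial a (fun w => transition i j w 0 l) (cc s))}.
    apply: row_continuous => l.
    rewrite (_ : (fun s => _) = fun s => \sum_a (dstep s * (v - u) 0 a) *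
      partial a (fun w => transition i j w 0 l) (cc s)); last by apply/funext => s; rewrite mxE.
    apply: sum_continuous => a.
    have ov : overlap i j (cc t) by rewrite -ct; exact: overlap_chart.
    have [_ /(_ a)[_ hC]] := @transition_Ck R n N rho rho_def 1 i j l.
    have h1 := continuous_comp (@ccc t) (hC.1 _ ov).
    have h2 : {for t, continuous (fun _ : R => (v - u) 0 a)} by exact: cst_continuous.
    exact: (continuousM (continuousM (@dstep_continuous R t) h2) h1).
  apply: near_continuous cE.
  by apply: filterS (near_dom j t dj) => s ds; rewrite E.
have ends : gamma 0 = chart_inv i u /\ gamma 1 = chart_inv i v.
  by rewrite /gamma /cc step0// step1// scale0r addr0 scale1r addrC subrK.
have spd t : ((speed g gamma t)%:E <= (Num.sqrt M * B * `|u - v|)%:E)%E.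
  have [it [di ct]] := inn t.
  rewrite lee_fin curve_speed// ct.
  have -> : derive1 (chart i \o gamma) t = dstep t *: (v - u).
    rewrite -cc'; congr (derive1 _ t); apply/funext => s /=.
    by have [_ [_ ->]] := inn s.
  have [_ /(_ (dstep t *: (v - u)))/andP[_ h]] := cmp (bcc t).
  apply: le_trans (ler_wsqrtr h) _.
  rewrite sqrtrM ?(ltW M0)// sqrtr_sqr normr_id normrZ -mulrA ler_pM2l// distrC.
  by rewrite ler_wpM2r.
apply: (@le_trans _ _ (curve_length g gamma)).
  by apply: ereal_inf_lbound; exists gamma => //; split; case: ends.
apply: (@le_trans _ _ (\int[lebesgue_measure]_(t in `[0%R, 1%R]) (Num.sqrt M * B * `|u - v|)%:E)%E).
  apply: integral_le_ge0 => t _; last exact: spd.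
  by have [it [di ct]] := inn t; rewrite lee_fin curve_speed// sqrtr_ge0.
by rewrite integral_cst//= lebesgue_measure_itv/= lte_fin ltr01 EFinN sube0 mule1.
Qed.

Let sq (u : 'rV[R]_p) : R := \sum_a (u 0 a - u0 0 a) ^+ 2.

Let sq_Ck k W : open W -> Ck k W sq.
Proof.
move=> oW; apply: Ck_sum => // a.
by apply: (Ck_mul oW); apply: (Ck_sub oW (Ck_coord _ _ oW) (Ck_cst _ _ oW)).
Qed.

Lemma speed_ge0 (gamma : R -> N) t : 0 <= speed g gamma t.
Proof. by rewrite /speed; case: xgetP => // s _ [j dj ->]; exact: sqrtr_ge0. Qed.

(** The coordinates, cut off outside a compact part of the chart, have a
    bounded differential on the whole interior, so a curve cannot escape and
    come back at no cost. *)
Lemma distance_ge : exists2 s : R, 0 < s & exists2 C : R, 0 < C & forall x y,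
  dom i x -> ball u0 s (chart i x) -> dom i y -> ball u0 s (chart i y) ->
  (`|chart i x - chart i y|%:E <= C%:E * riemannian_distance g x y)%E.
Proof.
have [e e0 hK] := chart_box_compact dx0 (@filterT _ (nbhs x0) _).
pose s := Num.min (r / 2) (e / 2).
have s0 : 0 < s by rewrite lt_min !divr_gt0.
have [sr se] : s < r /\ s < e.
  have [a1 a2] : s <= r / 2 /\ s <= e / 2 by rewrite /s !ge_min !lexx !orbT.
  by split; lra.
clearbody s; have s0e : 0 < s < e by rewrite s0.
have [K [cK Kdom Kbox]] := hK s s0e.
pose box : set 'rV[R]_p := [set u | forall a, `|u 0 a - u0 0 a| <= s].
pose r1 := s / 2; have r10 : 0 < r1 by rewrite divr_gt0.
have r1s : 2 * r1 ^+ 2 <= s ^+ 2.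
  by rewrite /r1 expr_div_n; have := sqr_ge0 s; lra.
clearbody r1.
have boxP u : sq u <= 2 * r1 ^+ 2 -> box u.
  move=> hu a; rewrite -(@ler_pXn2r _ 2)// ?nnegrE ?(ltW s0)// real_normK ?num_real//.
  apply: le_trans r1s; apply: le_trans hu; rewrite /sq (bigD1 a)//= lerDl.
  by apply: sumr_ge0 => b _; exact: sqr_ge0.
have box_ball u : box u -> ball u0 r u.
  by move=> hu; apply/ball_rVP => // a; rewrite distrC; exact: le_lt_trans (hu a) sr.
pose chi (u : 'rV[R]_p) : R := step (2 - r1 ^- 2 * sq u).
pose kap k (u : 'rV[R]_p) : R := chi u * (u 0 k - u0 0 k).
have argC W : open W -> Ck 1 W (fun u : 'rV[R]_p => 2 - r1 ^- 2 * sq u).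
  by move=> oW; apply: (Ck_sub oW (Ck_cst _ _ oW) (Ck_scale _ oW (sq_Ck 1 oW))).
have kapC k W : open W -> Ck 1 W (kap k).
  move=> oW; apply: (Ck_mul oW); last by apply: (Ck_sub oW (Ck_coord _ _ oW) (Ck_cst _ _ oW)).
  exact: (Ck1_real_comp oW (argC W oW) (@step_derive R) (@dstep_continuous R)).1.
have kap0 k u : 2 * r1 ^+ 2 < sq u -> kap k u = 0.
  move=> hu; rewrite /kap /chi step0 ?mul0r// subr_le0 -ler_pdivrMl ?invr_gt0 ?exprn_gt0//.
  by rewrite invrK mulrC ltW.
have oFar : open [set u | 2 * r1 ^+ 2 < sq u].
  have cs : continuous sq by move=> u; exact: (Ck_cont (sq_Ck 0 openT)).
  by apply: (open_comp (f := sq) (D := [set t | 2 * r1 ^+ 2 < t])) => [u _|]; [exact: cs|exact: open_gt].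
have dkap0 k a u : ~ box u -> kap k u = 0 /\ partial a (kap k) u = 0.
  move=> nb; have hu : 2 * r1 ^+ 2 < sq u by rewrite ltNge; apply/negP => /boxP.
  split; first exact: kap0.
  rewrite (partial_ext (g := fun=> 0) a oFar hu) ?partial_cst// => w.
  exact: kap0.
have box_compact : compact box.
  have : compact [set v : 'rV[R]_p | forall k, [set` `[u0 0 k - s, u0 0 k + s]] (v 0 k)].
    pose A (k : 'I_p) : set R := [set` `[u0 0 k - s, u0 0 k + s]].
    by apply: (@rV_compact R p A) => k; exact: segment_compact.
  congr compact; apply/seteqP; split => v hv k; have := hv k; rewrite /= in_itv /= ler_norml.
    by move=> /andP[h1 h2]; apply/andP; split; lra.
  by move=> /andP[h1 h2]; apply/andP; split; lra.
have bu0 : box u0 by move=> a; rewrite subrr normr0 ltW.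
have /choice[Bd hBd] : forall ka : 'I_p * 'I_p, exists Bd : R, forall u, box u -> `|partial ka.2 (kap ka.1) u| <= Bd.
  move=> [k a].
  have cpart : continuous (fun u => `|partial a (kap k) u|).
    move=> u; have [_ /(_ a)[_ hC]] := kapC k setT openT.
    have hc2 : {for u, continuous (partial a (kap k))} := hC.1 _ I.
    exact: (cvg_norm hc2).
  have [v _ hv] := compact_EVT_max (ex_intro _ u0 bu0) box_compact (continuous_subspaceT cpart).
  by exists (`|partial a (kap k) v|) => u bu; apply: hv; rewrite inE.
pose Bs := \sum_ka `|Bd ka|.
have Bs0 : 0 <= Bs by apply: sumr_ge0.
have hBs k a u : box u -> `|partial a (kap k) u| <= Bs.
  move=> bu; apply: le_trans (hBd (k, a) u bu) _; apply: le_trans (ler_norm _) _.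
  by rewrite /Bs (bigD1 (k, a))//= lerDl; apply: sumr_ge0.
have sc0 : 0 < Num.sqrt c by rewrite sqrtr_gt0.
pose C := p%:R * Bs / Num.sqrt c + 1.
have C0 : 0 < C by rewrite ltr_wpDl// divr_ge0 ?(ltW sc0)// mulr_ge0.
exists (r1 / p%:R); first by rewrite divr_gt0.
exists C => // x y dx bx dy by_.
have kapE z : ball u0 (r1 / p%:R) z -> forall k, kap k z = z 0 k - u0 0 k.
  move=> bz k; rewrite /kap /chi step1 ?mul1r//.
  have : r1 ^- 2 * sq z <= 1.
    rewrite ler_pdivrMl ?exprn_gt0// mulr1.
    apply: (@le_trans _ _ (\sum_(a < p) (r1 / p%:R) ^+ 2)).
      apply: ler_sum => a _; rewrite -real_normK ?num_real//.
      have q0 : 0 < r1 / p%:R by rewrite divr_gt0.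
      have h := (ball_rVP _ _ q0).1 bz a.
      by rewrite ler_pXn2r ?nnegrE ?(ltW q0)// distrC ltW.
    rewrite sumr_const card_ord -[leLHS]mulr_natl expr_div_n.
    rewrite mulrCA ler_piMr ?sqr_ge0// expr2 invfM mulrA divff ?pnatr_eq0// mul1r.
    by rewrite invf_le1// ler1n.
  lra.
rewrite -lee_pdivrMl//; apply: le_ereal_inf_tmp => _ [gamma [Cg g0 g1] <-].
pose cv := chart i \o gamma.
pose glue (f : R -> R) t := if `[< dom i (gamma t) >] then f t else 0.
pose Dk k t := glue (fun t => \sum_a derive1 cv t 0 a * partial a (kap k) (cv t)) t.
have near_dom t : dom i (gamma t) -> \forall s \near t, dom i (gamma s).
  move=> dt; have [_ ct _] := Cg t.
  exact: (ct _ (open_nbhs_nbhs (conj (dom_open i) dt))).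
have near_nK t : ~ dom i (gamma t) -> \forall s \near t, dom i (gamma s) -> ~ box (cv s).
  move=> ndt; have [_ ct _] := Cg t.
  have oK : open (~` K).
    by apply: closed_openC; apply: compact_closed cK; exact: (@space_hausdorff _ _ N).
  have nK : (~` K) (gamma t) by move=> /Kdom[].
  have : \forall s \near t, ~ K (gamma s) by exact: (ct _ (open_nbhs_nbhs (conj oK nK))).
  by apply: filterS => w nKw dw bw; apply: nKw; apply: Kbox.
have Fder k (t : R) : is_derive t (1 : R) (glue (fun t => kap k (cv t))) (Dk k t).
  rewrite /Dk {2}/glue; case: asboolP => dt.
    have [it _ /(_ i dt)[dc _]] := Cg t.
    have := curve_is_derive openT (kapC k setT openT) I (nbhs_singleton dc).
    apply: is_derive_near; apply: filterS (near_dom t dt) => w dw.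
    by rewrite /glue asboolT.
  apply: (is_derive_near (f := fun=> 0)).
  apply: filterS (near_nK t dt) => w nb; rewrite /glue; case: asboolP => // dw.
  by rewrite (dkap0 k 0 _ (nb dw)).1.
have Dcont k : continuous (Dk k).
  move=> t; suff : {for t, continuous (Dk k)} by [].
  have [dt|dt] := pselect (dom i (gamma t)).
    have [it ct /(_ i dt)[dc c'c]] := Cg t.
    have cc : {for t, continuous cv}.
      by apply: differentiable_continuous; apply/derivable1_diffP; exact: nbhs_singleton dc.
    have h : {for t, continuous (fun w => \sum_a derive1 cv w 0 a * partial a (kap k) (cv w))}.
      apply: (@sum_continuous R R _ _ (fun a w => derive1 cv w 0 a * partial a (kap k) (cv w))) => a.
      have [_ /(_ a)[_ hC]] := kapC k setT openT.
      have h1 : {for t, continuous (fun w => derive1 cv w 0 a)}.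
        exact: (continuous_comp c'c (@coord_continuous _ _ _ _ _ _)).
      have h2 := continuous_comp cc (hC.1 _ I).
      exact: (continuousM h1 h2).
    apply: near_continuous h.
    by apply: filterS (near_dom t dt) => w dw; rewrite /Dk /glue asboolT.
  have h : {for t, continuous (fun _ : R => 0 : R)} by exact: cst_continuous.
  apply: near_continuous h.
  apply: filterS (near_nK t dt) => w nb; rewrite /Dk /glue; case: asboolP => // dw.
  by rewrite big1// => a _; rewrite (dkap0 k a _ (nb dw)).2 mulr0.
have Dle k t : `|Dk k t| <= C * speed g gamma t.
  have sp0 := speed_ge0 gamma t.
  rewrite /Dk /glue; case: asboolP => dt; last by rewrite normr0 mulr_ge0// ltW.
  have [bt|bt] := pselect (box (cv t)); last first.
    rewrite big1 ?normr0 ?mulr_ge0 ?(ltW C0)// => a _.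
    by rewrite (dkap0 k a _ bt).2 mulr0.
  have cs : Num.sqrt c * `|derive1 cv t| <= speed g gamma t.
    rewrite (curve_speed Cg dt); have [_ /(_ (derive1 cv t))/andP[h _]] := cmp (box_ball _ bt).
    apply: le_trans (ler_wsqrtr h).
    by rewrite sqrtrM ?(ltW c0)// sqrtr_sqr normr_id.
  apply: le_trans (ler_norm_sum _ _ _) _.
  apply: (@le_trans _ _ (\sum_(a < p) `|derive1 cv t| * Bs)).
    by apply: ler_sum => a _; rewrite normrM ler_pM// ?le_coord_norm// hBs.
  rewrite sumr_const card_ord -[leLHS]mulr_natl /C mulrDl mul1r.
  apply: (@le_trans _ _ (p%:R * Bs / Num.sqrt c * speed g gamma t)); last by rewrite lerDl.
  rewrite [`|_| * Bs]mulrC mulrA -[leRHS]mulrA; apply: ler_wpM2l; first by rewrite mulr_ge0.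
  by rewrite ler_pdivlMl.
have len_ge k : ((C^-1 * `|chart i x 0 k - chart i y 0 k|)%:E <= curve_length g gamma)%E.
  pose F t := C^-1 * glue (fun t => kap k (cv t)) t.
  have Fd (t : R) : is_derive t (1 : R) F (C^-1 * Dk k t).
    have := @is_deriveZ R R R _ C^-1 t 1 _ (Fder k t).
    exact.
  have Dc : continuous (fun t => C^-1 * Dk k t).
    move=> t; have h2 : {for t, continuous (fun _ : R => C^-1 : R)} by exact: cst_continuous.
    exact: (continuousM h2 (Dcont k t)).
  have := increment_le_integral Fd Dc.
  have -> : `|F 1 - F 0| = C^-1 * `|chart i x 0 k - chart i y 0 k|.
    rewrite /F /glue !asboolT ?g0 ?g1// -mulrBr normrM gtr0_norm ?invr_gt0//.
    rewrite /cv /= g0 g1 !kapE//; congr (_ * _); rewrite distrC; congr (`|_|); ring.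
  move=> h; apply: le_trans h _; apply: integral_le_ge0 => t _; first by rewrite lee_fin.
  by rewrite lee_fin normrM gtr0_norm ?invr_gt0// ler_pdivrMl.
rewrite -EFinM.
move: len_ge; case: (curve_length g gamma) => [L||] len_ge.
- rewrite lee_fin ler_pdivrMl//; apply: norm_rV_le.
    have := len_ge 0; rewrite lee_fin; apply: contraTT; rewrite -ltNge => h.
    rewrite -ltNge (@lt_le_trans _ _ 0)//; last by rewrite mulr_ge0 ?invr_ge0// ltW.
    by rewrite -(pmulr_rlt0 _ C0).
  by move=> k; rewrite !mxE -ler_pdivrMl// -lee_fin; exact: len_ge.
- by rewrite leey.
- by have := len_ge 0; rewrite leeNy_eq.
Qed.

End Bounds.

Lemma chart_bilipschitz : exists (r C : R), [/\ 0 < r, 0 < C,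
  (forall u, ball u0 r u -> ichart (N := N) i u) &
  forall x y, dom i x -> ball u0 r (chart i x) -> dom i y -> ball u0 r (chart i y) ->
    (`|chart i x - chart i y|%:E <= C%:E * riemannian_distance g x y)%E /\
    (riemannian_distance g x y <= C%:E * `|chart i x - chart i y|%:E)%E].
Proof.
have [r [c [M [r0 c0 M0 cmp]]]] := metric_comparison.
have [C1 C10 h1] := distance_le r0 M0 cmp.
have [s s0 [C2 C20 h2]] := distance_ge r0 c0 cmp.
have d0 x y : (0 <= riemannian_distance g x y)%E.
  apply: le_ereal_inf_tmp => _ [gamma _ <-]; apply: integral_ge0 => t _.
  by rewrite lee_fin speed_ge0.
exists (Num.min r s), (C1 + C2); split => [|||x y dx bx dy by_].
- by rewrite lt_min r0 s0.
- by rewrite addr_gt0.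
- move=> u bu; have bur : ball u0 r u by apply: le_ball bu; rewrite ge_min lexx.
  by have [] := cmp _ bur.
have [bxr byr] : ball u0 r (chart i x) /\ ball u0 r (chart i y).
  by split; [apply: le_ball bx|apply: le_ball by_]; rewrite ge_min lexx.
have [bxs bys] : ball u0 s (chart i x) /\ ball u0 s (chart i y).
  by split; [apply: le_ball bx|apply: le_ball by_]; rewrite ge_min lexx orbT.
split.
  apply: le_trans (h2 x y dx bxs dy bys) _; apply: lee_wpmul2r => //.
  by rewrite lee_fin lerDr ltW.
have := h1 _ _ bxr byr; rewrite !chartK// => h; apply: le_trans h _.
by rewrite -EFinM lee_fin ler_wpM2r// lerDl ltW.
Qed.

(** The chart is Lipschitz in both directions, and for the supremum distance
    the sets of zero Hausdorff measure are those without content. *)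
Lemma chart_hausdorff0 (q : nat) (r C : R) (A : set N) : 0 < C ->
  (forall x y, dom i x -> ball u0 r (chart i x) -> dom i y -> ball u0 r (chart i y) ->
    (`|chart i x - chart i y|%:E <= C%:E * riemannian_distance g x y)%E /\
    (riemannian_distance g x y <= C%:E * `|chart i x - chart i y|%:E)%E) ->
  (forall x, A x -> dom i x /\ ball u0 r (chart i x)) ->
  hausdorff_measure (riemannian_distance g) q.+1 A = 0%E <-> pnull q.+1 (chart i @` A).
Proof.
move=> C0 bil AD; split=> [HA|cA].
  apply: hausdorff0_pnull; apply/eqP; rewrite eq_le hausdorff_ge0 andbT.
  have := @hausdorff_lipT R _ _ (riemannian_distance g) sup_distance q (chart i) A C C0.
  rewrite HA mule0; apply => x y /AD[dx bx] /AD[dy by_].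
  by have [] := bil x y dx bx dy by_.
have AE : chart_inv i @` (chart i @` A) = A.
  apply/seteqP; split => [_ [_ [x Ax <-] <-]|x Ax]; first by rewrite chartK//; case: (AD x Ax).
  by exists (chart i x); [exists x|rewrite chartK//; case: (AD x Ax)].
apply/eqP; rewrite eq_le hausdorff_ge0 andbT.
have := @hausdorff_lipT R _ _ sup_distance (riemannian_distance g) q (chart_inv i) (chart i @` A) C C0.
rewrite AE (pnull_hausdorff0 cA) mule0; apply => _ _ [x Ax <-] [y Ay <-].
have [dx bx] := AD x Ax; have [dy by_] := AD y Ay.
by rewrite !chartK//; have [] := bil x y dx bx dy by_.
Qed.

End ChartDistance.

(** * The expanding field of a barrier *)

Section CutField.
Context {R : realType} {n : nat} (N : bmanifold R n).
Notation p := n.+1.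
Implicit Types (i j : Defs.index N) (x y : N).
Variables (rho : N -> R) (g h : metric_components N).
Hypothesis g_metric : riemannian_metric g.
Hypothesis cc : C2_compactification g rho h.

Let rho_def : defining_function rho. Proof. by have [] := cc. Qed.

Notation gl i := (fun u => g i (chart_inv i u)).
Notation rl i := (fun u => rho (chart_inv i u)).

Lemma jacobian_id i x : inner x -> dom i x -> transition_jacobian i i x = 1%:M.
Proof.
move=> ix dx; rewrite (transition_jacobianE rho_def)//; apply/matrixP => a k.
rewrite !mxE -(partial_coord a k (chart i x)).
apply: (partial_ext _ (ichart_open rho_def (i := i)) (ichart_chart dx ix)) => w iw.
by rewrite /transition; have [_ _ ->] := ichartP iw.
Qed.

Variables (i : Defs.index N) (K : set N) (eta : 'rV[R]_p -> R) (Y : 'rV[R]_p -> 'rV[R]_p) (kappa : R).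
Hypothesis bar : barrier rho g i K eta Y kappa.
Variable eps : R.
Hypothesis eps0 : 0 < eps.

Let iO : open (ichart (N := N) i). Proof. exact: (ichart_open rho_def). Qed.

(* Zero for [t <= eps / 4] and one for [eps / 2 <= t]. *)
Let chi (t : R) : R := step (4 / eps * t - 1).
Let weight (u : 'rV[R]_p) : R := chi (rl i u).
Let Z (u : 'rV[R]_p) : 'rV[R]_p := relu (eta u) ^+ 2 *: Y u.
Let X (u : 'rV[R]_p) : 'rV[R]_p := weight u *: Z u.

Definition cut_field : vector_components N := fun j x =>
  if `[< dom i x >] then X (chart i x) *m transition_jacobian i j x else 0.

Let ZC : Ckmx 1 (ichart (N := N) i) Z.
Proof.
apply: Ckmx_scale; [exact: iO| |exact: (bar_field bar)].
apply: (Ck1_real_comp (phi := fun t => relu t ^+ 2) (dphi := fun t => 2 * relu t) (@iO) (bar_eta bar) _ _).1.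
  by move=> t; exact: relu2_derive.
move=> t; have h2 : {for t, continuous (fun _ : R => 2 : R)} by exact: cst_continuous.
exact: (continuousM h2 (@relu_continuous R t)).
Qed.

Let argC : Ck 1 (ichart (N := N) i) (fun u => 4 / eps * rl i u - 1).
Proof.
have [sm _ _ _] := rho_def.
have rlC : Ck 1 (ichart (N := N) i) (rl i).
  apply: smooth_on_Ck; first exact: iO.
  by apply: (smooth_onS _ (sm i)) => u [y [dy iy] <-]; exists y.
exact: (Ck_sub (@iO) (Ck_scale _ (@iO) rlC) (Ck_cst _ _ (@iO))).
Qed.

Let weightC : Ck 1 (ichart (N := N) i) weight /\ forall u a, ichart (N := N) i u ->
  partial a weight u = dstep (4 / eps * rl i u - 1) * partial a (fun u => 4 / eps * rl i u - 1) u.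
Proof. exact: (Ck1_real_comp (@iO) argC (@step_derive R) (@dstep_continuous R)). Qed.

Let XC : Ckmx 1 (ichart (N := N) i) X.
Proof. by apply: Ckmx_scale; [exact: iO|exact: weightC.1|exact: ZC]. Qed.

Let X_off y : inner y -> dom i y -> ~ K y -> X (chart i y) = 0.
Proof.
move=> iy dy nK; rewrite /X /Z relu_neg ?expr0n ?scale0r ?scaler0// leNgt; apply/negP => ey.
by apply: nK; rewrite -(chartK dy); apply: (bar_supp bar) => //; exact: ichart_chart.
Qed.

Let K_closed : closed K.
Proof. apply: compact_closed (bar_compact bar); exact: (@space_hausdorff _ _ N). Qed.

Let zero_near j x : inner x -> dom j x -> ~ dom i x ->
  exists2 W, open W & W (chart j x) /\ forall w, W w -> cut_field j (chart_inv j w) = 0.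
Proof.
move=> ix dj ndi; have nK : ~ K x by move=> /(bar_dom bar).
exists (chart j @` (dom j `&` @inner R n N `&` ~` K)).
  by apply: (ichart_image_open rho_def); exact: closed_openC.
split; first by exists x.
move=> _ [y [[dy iy] nKy] <-]; rewrite chartK// /cut_field; case: asboolP => // diy.
by rewrite X_off// mul0mx.
Qed.

Lemma cut_field_C1 : C1_vector_field cut_field.
Proof.
split=> [j j' x ix dj dj'|j l _ [x [dj ix] <-]].
  rewrite /cut_field; case: asboolP => di; last by rewrite mul0mx.
  by rewrite -mulmxA -(jacobian_comp rho_def).
have [di|ndi] := pselect (dom i x); last first.
  have [W oW [Wx W0]] := zero_near ix dj ndi.
  exists W, (fun=> 0); split => //; first exact: Ck_cst.
  by move=> w Ww _; rewrite /local W0// mxE.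
pose G v : R := (X v *m partial_mx (transition i j) v) 0 l.
have GC : Ck 1 (overlap i j) G.
  have oO := @overlap_open R n N rho rho_def i j.
  apply: (Ckmx_mul oO _ _ 0 l).
    by move=> a k; apply: CkS (XC a k); exact: overlap_ichart.
  move=> a k; have [_ /(_ a)[_ hC]] := @transition_Ck R n N rho rho_def 2 i j k.
  apply: (Ck_ext (k := 1) (f := partial a (fun w => transition i j w 0 k)) oO); last exact: hC.
  by move=> w _; rewrite mxE.
have oW := @overlap_open R n N rho rho_def j i.
exists (overlap j i), (fun w => G (transition j i w)); split => //.
- exact: overlap_chart.
- apply: (Ck1_comp oW (@overlap_open R n N rho rho_def i j) _ _ GC).1.
    by move=> k; exact: (@transition_Ck R n N rho rho_def 1 j i k).
  by move=> w; exact: transition_overlap.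
- move=> w Ww _; have [dw iw diw _] := overlapP Ww.
  by rewrite /local /cut_field asboolT// /G (transition_jacobianE rho_def).
Qed.

Lemma cut_field_compact : compactly_supported (@inner R n N) cut_field.
Proof.
exists (K `&` [set x | eps / 4 <= rho x]); first split.
- apply: compact_closedI; first exact: bar_compact bar.
  apply: (@preimage_closed N R rho [set s | eps / 4 <= s]); last exact: closed_ge.
  by move=> v _; exact: (rho_continuous cc).
- move=> x [_ hx] bx; have [_ _ r0 _] := rho_def; move: hx; rewrite /= r0//.
  by rewrite leNgt divr_gt0.
- move=> j x ix dj nKx; rewrite /cut_field; case: asboolP => // di.
  have [Kx|nK] := pselect (K x); last by rewrite X_off// mul0mx.
  have hr : rho x < eps / 4 by rewrite ltNge; apply/negP => hr; apply: nKx.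
  rewrite /X /weight /chi step0 ?scale0r ?mul0mx// chartK// subr_le0.
  rewrite -ler_pdivlMl ?divr_gt0// mulr1 invf_div; exact: ltW.
Qed.

Let field_lie j x e : inner x -> dom j x -> dom i x ->
  lie_form (gl j) (fun u => cut_field j (chart_inv j u)) (chart j x) e =
  lie_form (gl i) X (chart i x) (e *m transition_jacobian j i x).
Proof.
move=> ix dj di; rewrite (lie_form_chart rho_def g_metric cut_field_C1 e ix dj di).
apply: (lie_form_ext _ (@iO) (ichart_chart di ix)) => // w iw.
have [dw iw' cw] := ichartP iw.
by rewrite /cut_field asboolT// jacobian_id// mulmx1 cw.
Qed.

Let lieX u e : ichart (N := N) i u -> lie_form (gl i) X u e =
  weight u * lie_form (gl i) Z u e + ddir e weight u * inner_product (gl i u) (Z u) e.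
Proof.
move=> iu.
rewrite (lie_form_ext (G' := fun w => (1 : R) *: gl i w) (X' := X) e (@iO) iu)//; last first.
  by move=> w _; rewrite scale1r.
rewrite (lie_form_scale (s := fun=> 1) (f := weight) e (@iO) iu (Ck_cst 1 (1 : R) (@iO)) weightC.1
  (metric_Ck rho_def g_metric 1 i) ZC).
have -> : ddir (Z u) (fun=> 1 : R) u = 0 by apply: big1 => a _; rewrite partial_cst mulr0.
ring.
Qed.

(** At points with [eps <= rho] the cutoff is locally constant; where [eta <=
    0] it multiplies a field that vanishes there, so that its derivative does
    not contribute. *)
Lemma cut_field_lie_ge j x e : inner x -> dom j x ->
  (dom i x -> 0 < eta (chart i x) -> eps <= rho x) ->
  (if `[< dom i x >] then kappa * (relu (eta (chart i x)) ^+ 2 / rho x) else 0) *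
    inner_product (g j x) e e <=
  inner_product (g j x) (covariant_derivative g cut_field j x e) e.
Proof.
move=> ix dj hrho; rewrite (covariant_lie rho_def g_metric)//.
case: asboolP => di; last first.
  have [W oW [Wx W0]] := zero_near ix dj di.
  rewrite (lie_form_ext (G' := gl j) (X' := fun=> 0) e oW Wx)//.
  have -> : lie_form (gl j) (fun=> 0) (chart j x) e = 0; last by rewrite mul0r.
  rewrite /lie_form; have -> : mdir e (fun=> 0 : 'rV[R]_p) (chart j x) = 0.
    apply/matrixP => a b; rewrite !mxE; apply: big1 => k _.
    by rewrite partial_cst mulr0.
  have -> : mdir 0 (gl j) (chart j x) = 0.
    by apply/matrixP => a b; rewrite !mxE; apply: big1 => k _; rewrite mxE mul0r.
  by rewrite /inner_product mulmx0 !mul0mx mxE mulr0 addr0.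
rewrite field_lie// (inner_product_transport g_metric e e ix dj di).
set e' := e *m _; have iu : ichart (N := N) i (chart i x) by exact: ichart_chart.
have := bar_lie bar e' iu; rewrite -/Z chartK// => hZ.
rewrite lieX//; have [eu|eu] := leP (eta (chart i x)) 0.
  move: hZ; rewrite relu_neg// expr0n /= mul0r mulr0 mul0r => hZ.
  rewrite [Z _]/Z relu_neg// expr0n /= scale0r /inner_product mul0mx mul0mx mxE mulr0 addr0.
  by rewrite mulr_ge0// step_ge0.
have rx := hrho di eu.
have arg1 : 1 <= 4 / eps * rho x - 1.
  have h4 : 4 <= 4 / eps * rho x by rewrite mulrAC ler_pdivlMr// ler_pM2l.
  lra.
have -> : weight (chart i x) = 1 by rewrite /weight /chi chartK// step1.
have -> : ddir e' weight (chart i x) = 0.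
  apply: big1 => a _; rewrite weightC.2// chartK// /dstep [relu (1 - _)]relu_neg ?subr_le0//.
  by rewrite expr0n /= !(mulr0, mul0r, addr0).
by rewrite mul1r mul0r addr0.
Qed.

(** The divergence is a sum over an orthonormal basis, whatever chart and
    basis the tangent plane is described in. *)
Lemma cut_field_divergence (q : nat) (mu : {measure set (borel N) -> \bar R}) x : inner x ->
  (dom i x -> 0 < eta (chart i x) -> eps <= rho x) ->
  0 <= tangential_divergence g q mu cut_field x /\
  (dom i x -> (exists j (e : 'M[R]_(q, p)), [/\ dom j x, approximate_tangent mu j x e &
      forall a b, inner_product (g j x) (row a e) (row b e) = (a == b)%:R]) ->
    q%:R * (kappa * (relu (eta (chart i x)) ^+ 2 / rho x)) <=
      tangential_divergence g q mu cut_field x).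
Proof.
move=> ix hrho.
set c := if `[< dom i x >] then kappa * (relu (eta (chart i x)) ^+ 2 / rho x) else 0.
have c0 : 0 <= c.
  rewrite /c; case: asboolP => // di; rewrite mulr_ge0 ?(ltW (bar_pos bar))//.
  by rewrite divr_ge0 ?exprn_ge0 ?relu_ge0// (rho_ge0 rho_def).
have step1 j (e : 'M[R]_(q, p)) : dom j x ->
    (forall a b, inner_product (g j x) (row a e) (row b e) = (a == b)%:R) ->
    q%:R * c <= \sum_a inner_product (g j x) (covariant_derivative g cut_field j x (row a e)) (row a e).
  move=> dj orth; have -> : q%:R * c = \sum_(a < q) c by rewrite sumr_const card_ord mulr_natl.
  apply: ler_sum => a _; have := cut_field_lie_ge (row a e) ix dj hrho.
  by rewrite orth eqxx mulr1.
rewrite /tangential_divergence; case: xgetP => [s _ [j [e [dj _ orth ->]]]|no].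
  have hs := step1 j e dj orth; split; first by apply: le_trans hs; rewrite mulr_ge0.
  by move=> di _; move: hs; rewrite /c asboolT.
split => // di [j [e [dj ap orth]]]; exfalso.
by apply: (no (\sum_a inner_product (g j x) (covariant_derivative g cut_field j x (row a e)) (row a e))); exists j, e.
Qed.

End CutField.

(** * Orthonormal bases of planes *)

(** The Gram-Schmidt process. *)
Lemma orthonormal_rows {R : realType} (n k : nat) (G : 'M[R]_n.+1) (T : 'M[R]_(k, n.+1)) :
  positive_definite G -> \rank T = k ->
  exists e : 'M[R]_(k, n.+1), e *m G *m e^T = 1%:M /\ (e :=: T)%MS.
Proof.
move=> [Gsym Gpos].
have main : forall k (T : 'M[R]_(k, n.+1)), \rank T = k ->
    exists e : 'M[R]_(k, n.+1), e *m G *m e^T = 1%:M /\ (T <= e)%MS.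
  elim=> [M _|l IH]; first by exists M; split; [apply/matrixP => -[]|exact: submx_refl].
  rewrite -[l.+1]add1n => M rM.
  pose t : 'rV[R]_n.+1 := usubmx M.
  pose M' : 'M[R]_(l, n.+1) := dsubmx M.
  have ME : M = col_mx t M' by rewrite vsubmxK.
  have rt : (\rank t <= 1)%N by exact: rank_leq_row.
  have rM' : \rank M' = l.
    apply/eqP; rewrite eqn_leq rank_leq_row /= -(leq_add2l 1) -[X in (X <= _)%N]rM.
    rewrite ME -addsmxE; apply: leq_trans (mxrank_adds_leqif _ _) _.
    by rewrite leq_add2r.
  have [e' [orth Me']] := IH M' rM'.
  pose w := t - t *m G *m e'^T *m e'.
  have tE : t = w + t *m G *m e'^T *m e' by rewrite subrK.
  have we : w *m G *m e'^T = 0.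
    by rewrite /w !mulmxBl -!(mulmxA _ _ e'^T) -!(mulmxA _ e') !mulmxA -(mulmxA _ e' G)
      -(mulmxA _ (e' *m G)) orth mulmx1 subrr.
  have w0 : w != 0.
    apply/eqP => w0; move: tE; rewrite w0 add0r => tE.
    have te' : (t <= e')%MS by rewrite tE submxMl.
    have : (M <= e')%MS by rewrite ME -addsmxE addsmx_sub te'.
    by move/mxrankS; rewrite rM => /leq_trans/(_ (rank_leq_row e')); rewrite ltnn.
  have ww := Gpos w w0.
  pose c := Num.sqrt (inner_product G w w).
  have c0 : 0 < c by rewrite sqrtr_gt0.
  exists (col_mx (c^-1 *: w) e'); split.
    rewrite (mul_col_mx (c^-1 *: w)) tr_col_mx mul_col_row orth.
    have e1 : c^-1 *: w *m G *m e'^T = 0 by rewrite -!scalemxAl we scaler0.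
    have e2 : e' *m G *m (c^-1 *: w)^T = 0.
      apply: trmx_inj; rewrite !trmx_mul trmxK Gsym trmx0 mulmxA.
      by rewrite -[(c^-1 *: w) *m G *m e'^T]/(_) e1.
    have e3 : c^-1 *: w *m G *m (c^-1 *: w)^T = 1%:M.
      rewrite linearZ /= -!scalemxAl -scalemxAr scalerA.
      apply/matrixP => a b; rewrite (ord1 a) (ord1 b) [LHS]mxE [RHS]mxE eqxx.
      have -> : (w *m G *m w^T) 0 0 = c ^+ 2 by rewrite sqr_sqrtr// ltW.
      by rewrite -expr2 -exprMn mulVf ?expr1n// gt_eqF.
    rewrite e1 e2 e3; apply: (etrans _ (esym (@scalar_mx_block _ 1 l 1))).
    by [].
  rewrite ME -addsmxE addsmx_sub; apply/andP; split.
    rewrite {1}tE addmx_sub//.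
      rewrite -addsmxE; apply: (submx_trans _ (addsmxSl _ _)).
      by rewrite (eqmx_scale _ (invr_neq0 (lt0r_neq0 c0))).
    by rewrite -addsmxE; apply: (submx_trans _ (addsmxSr _ _)); exact: submxMl.
  by rewrite -addsmxE; apply: (submx_trans Me' (addsmxSr _ _)).
move=> rT; have [e [orth Te]] := main k T rT; exists e; split=> //.
apply/eqmxP; rewrite Te andbT.
have := mxrank_leqif_sup Te; rewrite rT => -[_ <-].
by rewrite eqn_leq rank_leq_row andbT -{1}rT mxrankS.
Qed.

(** * Integrals of nonmeasurable functions and images of measures *)

(** The integral is the difference of those of the positive and negative
    parts, and monotonicity holds without measurability: the negative part is
    dominated by a function vanishing outside a null set, the positive part
    dominates a multiple of an indicator. *)
Lemma integral_pos_neq0 {R : realType} d (T : measurableType d) (mu : {measure set T -> \bar R})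
    (D Z B : set T) (f : T -> R) (c : R) : measurable D -> measurable Z -> mu Z = 0%E ->
  (forall x, D x -> ~ Z x -> 0 <= f x) -> measurable B -> B `<=` D -> (0 < mu B)%E -> 0 < c ->
  (forall x, B x -> c <= f x) -> (\int[mu]_(x in D) (f x)%:E)%E <> 0%E.
Proof.
move=> mD mZ muZ fpos mB BD muB c0 fc.
have neg0 : (\int[mu]_(x in D) ((fun x => (f x)%:E)^\- x) = 0)%E.
  apply/eqP; rewrite eq_le; apply/andP; split; last first.
    by apply: integral_ge0 => x _; exact: funeneg_ge0.
  apply: (@le_trans _ _ (\int[mu]_(x in D) ((cst +oo%E \_ Z) x))%E).
    apply: integral_le_ge0 => x Dx; first exact: funeneg_ge0.
    rewrite /patch; case: ifPn => [_|/negP nZ]; first by rewrite leey.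
    change ((fun x0 : T => (f x0)%:E)^\- x <= 0)%E.
    rewrite funenegE -EFinN -EFin_max lee_fin ge_max lexx andbT oppr_le0.
    by apply: fpos => // Zx; apply: nZ; rewrite inE.
  rewrite -integral_mkcondr integral_cst; last exact: measurableI.
  have -> : mu (D `&` Z) = 0%E.
    apply/eqP; rewrite eq_le measure_ge0 andbT -muZ; apply: le_measure; rewrite ?inE//.
    exact: measurableI.
  by rewrite mule0.
have pos : (0 < \int[mu]_(x in D) ((fun x => (f x)%:E)^\+ x))%E.
  apply: (@lt_le_trans _ _ (\int[mu]_(x in D) ((cst c%:E \_ B) x))%E).
    rewrite -integral_mkcondr integral_cst; last exact: measurableI.
    by rewrite (setIidr BD) mule_gt0// lte_fin.
  apply: integral_le_ge0 => x Dx; rewrite /patch; case: ifPn => // xB.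
  - by rewrite lee_fin ltW.
  - rewrite funeposE -EFin_max lee_fin le_max fc//; exact: set_mem.
  - exact: funepos_ge0.
by rewrite integralE neg0 sube0 => h; rewrite h ltxx in pos.
Qed.

(** The positive and negative parts may be treated separately. *)
Lemma integral_image {R : realType} d d' (T : measurableType d) (U : measurableType d')
    (mu : {measure set T -> \bar R}) (nu : {measure set U -> \bar R}) (E : set T) (s : T -> U) :
  (forall f : U -> \bar R, measurable_fun setT f -> (forall x, 0 <= f x)%E ->
      (\int[nu]_x f x = \int[mu]_(y in E) f (s y))%E) ->
  forall f : U -> \bar R, measurable_fun setT f ->
    (\int[nu]_x f x = \int[mu]_(y in E) f (s y))%E.
Proof.
move=> nuE f mf; rewrite integralE [RHS]integralE; congr (_ - _)%E.
  rewrite (nuE f^\+%E (measurable_funepos mf) (funepos_ge0 f)).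
  by apply: eq_integral => x _; rewrite !funeposE.
rewrite (nuE f^\-%E (measurable_funeneg mf) (funeneg_ge0 f)).
by apply: eq_integral => x _; rewrite !funenegE.
Qed.

(** Lebesgue measure is carried to the plane and rescaled by the constant of
    [plane_hausdorff]. *)
Lemma plane_measure {R : realType} (q m : nat) (T : 'M[R]_(q.+1, m.+1)) : \rank T = q.+1 ->
  exists2 k : R, 0 < k & exists nu : {measure set (borel 'rV[R]_m.+1) -> \bar R},
    (forall A, measurable A -> nu A = hausdorff_measure (@euclidean_distance R m.+1) q.+1
      (A `&` [set v | (v <= T)%MS])) /\
    forall phi : 'rV[R]_m.+1 -> R, continuous phi ->
      Rintegral nu setT phi = k * Rintegral (lebn q.+1) setT (fun z => phi (z *m T)).
Proof.
move=> rT.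
have inj (v : 'rV[R]_q.+1) : v *m T = 0 -> v = 0.
  move=> vT; have /row_freeP[T' TT'] : row_free T by rewrite /row_free rT.
  by rewrite -[v]mulmx1 -TT' mulmxA vT mul0mx.
have [c c0 hc] := inj_norm_ge inj.
have [k k0 hk] := plane_hausdorff c0 hc.
have mT : measurable_fun setT ((fun z : 'rV[R]_q.+1 => z *m T) : borel 'rV[R]_q.+1 -> borel 'rV[R]_m.+1).
  by apply: continuous_borel; exact: mulmxr_continuous.
have [nu [nuE nuI]] := restricted_pushforward (lebn q.+1) (@measurableT _ (borel 'rV[R]_q.+1)) mT.
pose kn : {nonneg R} := NngNum (ltW k0).
exists k => //; exists (mscale kn nu); split.
  by move=> A mA; rewrite hk//= /mscale /= nuE setIT.
move=> phi cphi.
have mphi : measurable_fun setT (fun v : borel 'rV[R]_m.+1 => (phi v)%:E).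
  by apply/measurable_EFinP; exact: continuous_borel_real.
have E : (\int[mscale kn nu]_x (phi x)%:E = k%:E * \int[lebn q.+1]_z (phi (z *m T))%:E)%E.
  rewrite -(integral_image nuI mphi) [LHS]integralE [X in (k%:E * X)%E]integralE.
  rewrite !ge0_integral_mscale//=; last 2 first.
    exact: measurable_funeneg.
    exact: measurable_funepos.
  have distr (a b : \bar R) : (k%:E * (a - b) = k%:E * a - k%:E * b)%E.
    have kp : (k%:E * +oo = +oo)%E by rewrite gt0_muley// lte_fin.
    have km : (k%:E * -oo = -oo)%E by rewrite gt0_muleNy// lte_fin.
    case: a => [a||]; case: b => [b||] //=; rewrite ?kp ?km//= ?kp ?km//.
    by rewrite -[LHS]/((k * (a - b))%:E) mulrBr.
  by rewrite [RHS]distr.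
rewrite /Rintegral E; case: (\int[lebn q.+1]_z _)%E => [r||] //=.
  by rewrite gt0_muley ?lte_fin//= mulr0.
by rewrite gt0_muleNy ?lte_fin//= mulr0.
Qed.

(** * Tangent planes of rectifiable varifolds *)

Lemma chart_measurable {R : realType} {n : nat} (N : bmanifold R n) (i : Defs.index N) (D : set N) :
  open D -> D `<=` dom i ->
  measurable_fun setT ((fun y => if `[< D y >] then chart i y else 0) : borel N -> borel 'rV[R]_n.+1).
Proof.
move=> oD Di; apply: measurability => // _ [V oV <-]; rewrite setTI.
have -> : (fun y => if `[< D y >] then chart i y else 0) @^-1` V =
    (D `&` (dom i `&` chart i @^-1` V)) `|` (if `[< V 0 >] then ~` D else set0).
  apply/seteqP; split => y /=.
    case: asboolP => Dy; first by left; split => //; split => //; exact: Di.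
    by move=> V0; right; rewrite asboolT.
  move=> [[Dy [_ Vy]]|]; first by rewrite asboolT.
  by case: asboolP => // V0 nDy; rewrite asboolF.
apply: measurableU.
  by apply: open_borel; apply: openI => //; exact: chart_preim_open.
case: asboolP => _; last exact: measurable0.
by apply: measurableC; exact: open_borel.
Qed.

(** Balls are compact, so the range is a countable union of compact sets. *)
Lemma lip_range_borel {R : realType} (p m : nat) (f : 'rV[R]_p -> 'rV[R]_m) (K : R) :
  (forall x y, `|f x - f y| <= K * `|x - y|) -> measurable (range f : set (borel 'rV[R]_m)).
Proof.
move=> fK.
pose A (k : nat) (j : 'I_p) : set R := [set` `[- k%:R, k%:R]].
pose cube (k : nat) : set 'rV[R]_p := [set a | forall j, A k j (a 0 j)].
have -> : range f = \bigcup_k (f @` cube k).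
  apply/seteqP; split => [_ [a _ <-]|_ [k _ [a _ <-]]]; last by exists a.
  exists (Num.bound `|a|) => //; exists a => // j; rewrite /A /= in_itv /= -ler_norml.
  by apply: le_trans (le_coord_norm _ _) _; apply: ltW; exact: archi_boundP.
apply: bigcup_measurable => k _; apply: closed_borel; apply: compact_closed.
  exact: norm_hausdorff.
apply: continuous_compact; first by apply: continuous_subspaceT; exact: lip_continuous fK.
by apply: (@rV_compact R p (A k)) => j; exact: segment_compact.
Qed.

Section VarifoldTangents.
Context {R : realType} {n : nat} (N : bmanifold R n).
Notation p := n.+1.
Variables (rho : N -> R) (g : metric_components N).
Hypothesis rho_def : defining_function rho.
Hypothesis g_metric : riemannian_metric g.
Variables (q : nat) (mu : {measure set (borel N) -> \bar R}).

(** A countable base suffices to cover the complement of the support by null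
    open sets. *)
Lemma support_null : exists Z : set (borel N), [/\ measurable Z, mu Z = 0%E &
  forall x, @inner _ _ N x -> ~ Z x -> spt mu x].
Proof.
have [U [oU hU]] := countable_base N.
pose V k : set (borel N) := if `[< mu (U k) = 0%E >] then U k else set0.
have mV k : measurable (V k).
  by rewrite /V; case: asboolP => _; [exact: open_borel|exact: measurable0].
have V0 k : mu (V k) = 0%E by rewrite /V; case: asboolP => // _; exact: measure0.
exists (\bigcup_k V k); split; first by apply: bigcup_measurable => k _.
  apply/(negligibleP mu (bigcup_measurable (fun k _ => mV k))).
  by apply: negligible_bigcup => k; exists (V k); split.
move=> x ix nZ; split=> // W oW Wx; rewrite lt_def measure_ge0 andbT; apply/eqP => W0.
have [k [Ukx UkW]] := hU x W (open_nbhs_nbhs (conj oW Wx)).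
apply: nZ; exists k => //; rewrite /V asboolT//.
apply/eqP; rewrite eq_le measure_ge0 andbT -W0; apply: le_measure => //; rewrite inE; exact: open_borel.
Qed.

Hypothesis rect : rectifiable_varifold g q.+1 mu.

(** In a small chart ball the mass becomes a measure to which [tangent_planes]
    applies: the parametrizations of the rectifiable set, followed by the
    chart, extend to Lipschitz maps, and the mass does not charge sets of zero
    Hausdorff measure. At small scales the dilations only see the ball, and
    Gram-Schmidt turns the plane found in the chart into an orthonormal basis
    for [g]. *)
Lemma varifold_tangents x0 (U : set N) : spt mu x0 -> open U -> U x0 ->
  exists B : set (borel N), [/\ measurable B, B `<=` U `&` @inner _ _ N, (0 < mu B)%E &
    forall x, B x -> exists j (e : 'M[R]_(q.+1, p)), [/\ dom j x, approximate_tangent mu j x e &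
      forall a b, inner_product (g j x) (row a e) (row b e) = (a == b)%:R]].
Proof.
move: rect => [mufin [E [theta [nuE [[mE Ein rectE] [mth th0 nuH muE]]]]]] [ix0 sx0] oU Ux0.
have [i dx0] := dom_cover x0.
have [r [C [r0 C0 rin bil]]] := chart_bilipschitz rho_def g_metric dx0 ix0.
set u0 := chart i x0 in rin bil.
have innN : nbhs x0 (@inner _ _ N) by apply: open_nbhs_nbhs; split => //; exact: (inner_open rho_def).
have [e0 e00 hK] := chart_box_compact dx0 innN.
pose s0 := Num.min r (e0 / 2).
have s00 : 0 < s0 by rewrite lt_min r0 divr_gt0.
have [s0r s0e] : s0 <= r /\ s0 < e0.
  have [a1 a2] : s0 <= r /\ s0 <= e0 / 2 by rewrite /s0 !ge_min !lexx !orbT.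
  by split; lra.
clearbody s0; have s01 : 0 < s0 < e0 by rewrite s00.
have [K [cK Kdom Kbox]] := hK s0 s01.
pose D0 := U `&` (dom i `&` chart i @^-1` (ball u0 s0)) `&` @inner _ _ N.
have oD0 : open D0.
  apply: openI; last exact: (inner_open rho_def).
  by apply: openI => //; apply: chart_preim_open; exact: ball_open.
have D0x0 : D0 x0 by split=> //; split => //; split => //; exact: ballxx.
have D0P y : D0 y -> [/\ dom i y, ball u0 r (chart i y) & inner y].
  by move=> [[_ [dy by_]] iy]; split => //; apply: le_ball by_.
have D0K : D0 `<=` K.
  move=> y [[_ [dy by_]] iy]; apply: Kbox => // k.
  by rewrite distrC ltW//; exact: (ball_rVP _ _ s00).1 by_ k.
have mD0 : measurable (D0 : set (borel N)) by exact: open_borel.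
have muD0 : (mu D0 < +oo)%E.
  apply: le_lt_trans (mufin K cK _); last by move=> y /Kdom[].
  apply: le_measure; rewrite ?inE//; apply: closed_borel; apply: compact_closed => //.
  exact: (@space_hausdorff _ _ N).
have muD0pos : (0 < mu D0)%E by exact: sx0.
have [Z [A [F [L [HZ FL EZ]]]]] := rectE.
pose s : borel N -> borel 'rV[R]_p := fun y => if `[< D0 y >] then chart i y else 0.
have sE y : D0 y -> s y = chart i y by move=> Dy; rewrite /s asboolT.
have ms : measurable_fun setT s by apply: chart_measurable => // y /D0P[].
have [nu [nuD nuI]] := restricted_pushforward mu mD0 ms.
(* The charted pieces of the rectifiable set, extended to Lipschitz maps. *)
have /choice[f /choice[Kf hf]] : forall k, exists f : 'rV[R]_q.+1 -> 'rV[R]_p, exists Kf : R,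
    (forall x y, `|f x - f y| <= Kf * `|x - y|) /\
    forall a, A k a -> D0 (F k a) -> f a = chart i (F k a).
  move=> k; pose A' := A k `&` [set a | D0 (F k a)].
  have [[a0 A'a0]|A'0] := pselect (A' !=set0); last first.
    exists (fun=> 0), 0; split => [x y|a Aa Da]; first by rewrite subrr normr0 mul0r.
    by exfalso; apply: A'0; exists a.
  pose Kf := C * (`|L k| * q.+2%:R).
  have Kf0 : 0 <= Kf by rewrite !mulr_ge0// ltW.
  have uK x y : A' x -> A' y -> `|chart i (F k x) - chart i (F k y)| <= Kf * `|x - y|.
    move=> [Ax Dx] [Ay Dy]; have [dx bx _] := D0P _ Dx; have [dy by_ _] := D0P _ Dy.
    have [h1 _] := bil _ _ dx bx dy by_.
    rewrite -lee_fin; apply: le_trans h1 _.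
    apply: (@le_trans _ _ (C%:E * ((L k)%:E * euclidean_distance x y))%E).
      by apply: lee_wpmul2l; [rewrite lee_fin ltW|exact: FL].
    rewrite /euclidean_distance -!EFinM lee_fin /Kf -mulrA ler_pM2l//.
    apply: le_trans (ler_wpM2r (sqrtr_ge0 _) (ler_norm _)) _; rewrite -mulrA ler_wpM2l//.
    have := euclid_le_sup (x - y); congr (Num.sqrt _ <= _).
    by apply: eq_bigr => k' _; rewrite !mxE.
  have [f [fK fE]] := mcshane Kf0 (ex_intro _ a0 A'a0) uK.
  by exists f, Kf; split=> // a Aa Da; exact: fE.
have mur (B1 : set (borel N)) : measurable B1 -> mu (B1 `&` E) = mu B1.
  move=> mB1; rewrite muE; last exact: measurableI.
  by rewrite -setIA setIid muE.
have nu_pnull (B1 : set (borel 'rV[R]_p)) : measurable B1 -> pnull q.+1 B1 -> nu B1 = 0%E.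
  move=> mB1 cB1; rewrite nuD.
  have mA1 : measurable (s @^-1` B1 `&` D0).
    by apply: measurableI => //; rewrite -[_ @^-1` _]setTI; exact: ms.
  pose A1 : set N := s @^-1` B1 `&` D0.
  rewrite -[s @^-1` B1 `&` D0]/A1 in mA1 *.
  have HA1 : hausdorff_measure (riemannian_distance g) q.+1 A1 = 0%E.
    have AD (y : N) : A1 y -> dom i y /\ ball u0 r (chart i y) by move=> [_ /D0P[]].
    have [_ h] := @chart_hausdorff0 R n N g i x0 q r C A1 C0 bil AD.
    apply: h.
    apply: pnullS cB1 => _ [y [By Dy] <-]; by rewrite -(sE y Dy).
  have n1 : nuE (A1 `&` E) = 0%E.
    rewrite nuH; last exact: measurableI.
    apply/eqP; rewrite eq_le hausdorff_ge0 andbT -HA1; apply: le_hausdorff.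
    by move=> y [[]].
  rewrite muE//; apply: null_set_integral n1; first exact: measurableI.
  apply/measurable_EFinP; apply: measurable_funS mth => //; exact: subIsetr.
have nu_range : nu.-negligible ((~` \bigcup_k range (f k)) : set (borel 'rV[R]_p)).
  have mH : measurable ((~` \bigcup_k range (f k)) : set (borel 'rV[R]_p)).
    apply: measurableC; apply: bigcup_measurable => k _.
    exact: lip_range_borel (hf k).1.
  set H := ~` _ in mH *.
  have cZ : pnull q.+1 (chart i @` (Z `&` D0)).
    have AD (y : N) : (Z `&` D0) y -> dom i y /\ ball u0 r (chart i y) by move=> [_ /D0P[]].
    have [h _] := @chart_hausdorff0 R n N g i x0 q r C (Z `&` D0) C0 bil AD.
    apply: h.
    apply/eqP; rewrite eq_le hausdorff_ge0 andbT -HZ; apply: le_hausdorff.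
    by move=> y [].
  have [G [mG nG ZG]] := pnull_negligible nu_pnull cZ.
  exists H; split => //; rewrite nuD.
  have mHD : measurable (s @^-1` H `&` D0).
    by apply: measurableI => //; rewrite -[_ @^-1` _]setTI; exact: ms.
  have mGD : measurable (s @^-1` G `&` D0).
    by apply: measurableI => //; rewrite -[_ @^-1` _]setTI; exact: ms.
  rewrite -mur//; apply/eqP; rewrite eq_le measure_ge0 andbT -nG nuD.
  apply: le_measure; rewrite ?inE//; first exact: measurableI.
  move=> y [[Hy Dy] Ey]; split => //; apply: ZG; rewrite sE//.
  exists y => //; split => //; have [//|[k _ [a Aa Fa]]] := EZ y Ey.
  exfalso; apply: Hy; exists k => //; exists a => //.
  by rewrite sE// (hf k).2// Fa.
have nuT : nu setT = mu D0 by rewrite nuD preimage_setT setTI.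
have nuTfin : (nu setT < +oo)%E by rewrite nuT.
have nuTpos : (0 < nu setT)%E by rewrite nuT.
have [B [mB nuB tanB]] := tangent_planes nuTfin (fun k => (hf k).1) nu_pnull nu_range nuTpos.
exists (s @^-1` B `&` D0); split.
- by apply: measurableI => //; rewrite -[_ @^-1` _]setTI; exact: ms.
- by move=> y [_ [[Uy _] iy]].
- by rewrite -nuD.
move=> x [Bx D0x]; have [dx bx ix] := D0P x D0x.
rewrite /= sE// in Bx; have [T [th1 [rT th10 blow]]] := tanB _ Bx.
have gpos := metric_pos g_metric ix dx.
have [e [orth eT]] := orthonormal_rows gpos rT.
exists i, e; split => //; last first.
  move=> a b; transitivity ((e *m g i x *m e^T) a b); last by rewrite orth mxE.
  rewrite /inner_product -row_mul [LHS]mxE [RHS]mxE; apply: eq_bigr => l _.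
  by rewrite [row a _ _ _]mxE [(row b e)^T _ _]mxE [row b e _ _]mxE [e^T _ _]mxE.
split; first by rewrite eT.
have [k k0 [nup [nupH nupI]]] := plane_measure rT.
exists (th1 / k), nup; split; first exact: divr_gt0.
  move=> A1 mA1; rewrite nupH//; congr (hausdorff_measure _ _ (_ `&` _)).
  by apply/seteqP; split => v /=; rewrite eT.
move=> phi cphi Kphi; rewrite nupI// mulrA divfK ?gt_eqF//.
apply: cvg_trans (blow phi cphi Kphi); apply: near_eq_cvg.
have [M [_ [M0 _ phiM _ _]]] := compact_support_bounds cphi Kphi.
have [d d0 hd] : exists2 d : R, 0 < d & forall y, dom i y -> ball (chart i x) d (chart i y) -> D0 y.
  have oV := ichart_image_open rho_def (i := i) oD0.
  have Vx : (chart i @` (dom i `&` @inner R n N `&` D0)) (chart i x) by exists x.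
  have [d /= d0 hd] := (nbhs_ballP _ _).1 (open_nbhs_nbhs (conj oV Vx)).
  exists d => // y dy /hd[z [[dz _] Dz] zy].
  by rewrite -(chartK dy) -zy chartK.
near=> l.
have l0 : 0 < l by near: l; exact: nbhs_right_gt.
have ld : l < d / M by near: l; apply: nbhs_right_lt; exact: divr_gt0.
congr (_ * _); rewrite /Rintegral; congr fine.
have mphi : measurable_fun setT (fun y : borel 'rV[R]_p => (phi (l^-1 *: ((y : 'rV[R]_p) - chart i x)))%:E).
  apply/measurable_EFinP; apply: (measurable_comp_rV (f := fun y : 'rV[R]_p => l^-1 *: (y - chart i x))) => //.
  exact: rescale_continuous.
rewrite (integral_image nuI mphi) integral_mkcond [RHS]integral_mkcond.
apply: eq_integral => y _; rewrite /patch.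
have [Dy|nDy] := pselect (D0 y).
  by rewrite !mem_set//; [rewrite sE|case: (D0P y Dy)].
rewrite [in LHS]memNset//; case: ifPn => // /set_mem dy.
rewrite phiM// normrZ gtr0_norm ?invr_gt0// ler_pdivlMl//.
rewrite leNgt; apply/negP => h; apply: nDy; apply: hd => //.
rewrite -ball_normE /= distrC; apply: lt_trans h _.
by rewrite -ltr_pdivlMr.
Unshelve. all: by end_near. Qed.

End VarifoldTangents.

Theorem theorem1p1 (R : realType) (n : nat) (N : bmanifold R n)
    (g : metric_components N)
    (g_metric : riemannian_metric g)
    (g_cc : C2_conformally_compact g)
    (g_alh : asymptotically_locally_hyperbolic g)
    (S : set N) (S_closed : closed S) (S_bd : S `<=` @boundary R n N) :
  exists H : set N,
    [/\ closed_in_inner H,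
        totally_convex g H,
        asymptotic_boundary H = S
      & forall (p : nat) (V : {measure set (borel N) -> \bar R}),
          (1 <= p <= n)%N ->
          rectifiable_varifold g p V ->
          stationary g p V ->
          asymptotic_boundary (spt V) `<=` S ->
          spt V `<=` H].
Proof.
have [rho [h cc]] := g_cc; have [rho_def _ _ _] := cc.
have [C [clC SC CS Scl]] := accumulating_set rho_def S_closed S_bd.
exists (hull rho g C); split.
- exact: (hull_closed cc).
- exact: (hull_convex g_metric cc).
- exact: (hull_boundary g_metric cc).
move=> [|q] V // _ rect stat asym x0 sx0; have ix0 := sx0.1; split=> //.
move=> i K eta Y kappa bar KC [dx0 ex0].
have inK x : inner x -> dom i x -> 0 < eta (chart i x) -> K x.
  by move=> ix dx ex; rewrite -(chartK dx); apply: (bar_supp bar) => //; exact: ichart_chart.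
(* The support stays at a positive distance of the boundary inside [K]. *)
pose K' := K `&` closure (spt V).
have cK' : compact K' by apply: compact_closedI (bar_compact bar) _; exact: closed_closure.
have K'x0 : K' x0 by split; [exact: inK|exact: subset_closure].
have [c Kc cmin] := compact_EVT_min (ex_intro _ x0 K'x0) cK' (continuous_subspaceT (rho_continuous cc)).
have eps0 : 0 < rho c.
  have [_ rpos _ _] := rho_def; apply: rpos => bc.
  move: Kc; rewrite inE => -[Kc cc'].
  have : (K `&` C) c by split=> //; apply: SC; apply: asym.
  by rewrite KC.
have hrho x : spt V x -> dom i x -> 0 < eta (chart i x) -> rho c <= rho x.
  move=> sx dx ex; apply: cmin; rewrite inE; split; last exact: subset_closure.
  by apply: inK => //; case: sx.
have fv := stat _ (cut_field_C1 cc bar (rho c)) (cut_field_compact cc bar eps0).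
have [Z [mZ VZ hZ]] := support_null V.
pose eta0 := eta (chart i x0); rewrite -/eta0 in ex0; pose r0 := rho x0 + 1.
have r00 : 0 < r0 by rewrite ltr_wpDl// (rho_ge0 rho_def).
pose P : set N := [set x | dom i x /\ (eta0 / 2 < eta (chart i x) /\ rho x < r0)].
have Px0 : nbhs x0 P.
  have n1 : nbhs x0 (dom i) by apply: open_nbhs_nbhs; split => //; exact: dom_open.
  have n2 : \forall y \near x0, eta0 / 2 < eta (chart i y).
    have cx : {for x0, continuous (eta \o chart i)}.
      apply: continuous_comp; first exact: chart_continuous.
      by apply: (Ck_cont (bar_eta bar)); exact: ichart_chart.
    by apply: (cvgr_gt _ cx); rewrite /= -/eta0; lra.
  have n3 : \forall y \near x0, rho y < r0.
    by apply: (cvgr_lt _ (@rho_continuous R n N rho g h cc x0)); rewrite /r0 ltrDl.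
  exact: filterS (filterI n1 (filterI n2 n3)).
have [B [mB BP VB tanB]] := varifold_tangents rho_def g_metric rect sx0 (open_interior P) Px0.
pose c1 := q.+1%:R * (kappa * ((eta0 / 2) ^+ 2 / r0)).
have c10 : 0 < c1 by rewrite !mulr_gt0 ?invr_gt0 ?exprn_gt0 ?divr_gt0 ?(bar_pos bar).
apply: (@integral_pos_neq0 _ _ _ V (@inner R n N) Z (B `\` Z)
  (tangential_divergence g q.+1 V (cut_field rho i eta Y (rho c))) c1) fv => //.
- by apply: open_borel; exact: (inner_open rho_def).
- move=> x ix nZ; have sx := hZ x ix nZ.
  by have [] := cut_field_divergence g_metric cc bar eps0 q.+1 V ix (hrho x sx).
- exact: measurableD.
- by move=> x [/BP[]].
- have := measureDI V mB mZ => VBE.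
  have VBZ : V (B `&` Z) = 0%E.
    apply/eqP; rewrite eq_le measure_ge0 andbT -VZ; apply: le_measure; rewrite ?inE//.
    exact: measurableI.
  have e0 : V B = V (B `\` Z) by rewrite VBE [X in (_ + X)%E]VBZ adde0.
  by rewrite -e0.
move=> x [Bx nZ]; have [Ux ix] := BP x Bx; have sx := hZ x ix nZ.
have [dx [ex rx]] := interior_subset Ux.
have [_ /(_ dx (tanB x Bx))] := cut_field_divergence g_metric cc bar eps0 q.+1 V ix (hrho x sx).
apply: le_trans; rewrite /c1 ler_wpM2l// ler_wpM2l ?(ltW (bar_pos bar))//.
have [_ rpos _ _] := rho_def; have rx0 := rpos x ix.
have e20 : 0 < eta0 / 2 by rewrite divr_gt0.
rewrite relu_pos ?(ltW (lt_trans e20 ex))//; apply: ler_pM.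
- by rewrite exprn_ge0// ltW.
- by rewrite invr_ge0 ltW.
- by rewrite ler_pXn2r ?nnegrE ?(ltW e20) ?(ltW (lt_trans e20 ex))// ltW.
- by rewrite lef_pV2 ?posrE// ltW.
Qed.
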